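(* Let $d\ge1$, $T>0$, and let $K:\mathbb R^d\to\mathbb R$ be such that $D^2K\in C_b(\mathbb R^d)$, $D^2K$ is even and positive semi-definite, and $D^2K$ is Lipschitz. Let $\rho_0\in\mathcal P(\mathbb R^d)$ with $\int|x|^2d\rho_0<\infty$ and $u_0\in L^2(\mathbb R^d;d\rho_0)$. Suppose that there exists a strong solution $(r,v)\in C([0,T];\mathcal P(\mathbb R^d))\times L^\infty(0,T;W^{1,\infty}(\mathbb R^d))$, $r>0$ on $[0,T]\times\mathbb R^d$, with initial data $(\rho_0,u_0)$, of $$\partial_tr+\mathrm{div}_x(rv)=0,\qquad \partial_tv+(v\cdot\nabla_x)v+\int_{\mathbb R^d}D^2K(x-y)(v(x)-v(y))\,dr(y)=0\quad\text{in }(0,T)\times\mathbb R^d.$$ Then the measure solution $(\rho,u,\mu)$ (in the sense of the context) of the Euler-alignment system arising from the initial data $(\rho_0,u_0)$ coincides with the strong solution, in the sense that $$d\rho_t(x)=dr_t(x)\text{ for all }t\in[0,T],\qquad u(t,x)=v(t,x)\text{ a.e. in }[0,T]\times\mathbb R^d,\qquad \mu\equiv0.$$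
   Context: Notation. $\mathcal M$, $\mathcal M^+$, $\mathcal P$ denote Radon measures, positive Radon measures, probability measures. The measure $r_t$ is identified with its density $r(t,x)>0$. $A:B=\mathrm{tr}(A^TB)$. The flat metric is $d_f(\mu,\nu)=\sup\{\int\varphi\,d(\mu-\nu):\varphi\in C^1(\mathbb R^d),\|\varphi\|_\infty\le1,\|\nabla_x\varphi\|_\infty\le1\}$. $\mathcal M^+(\mathbb R^d;\mathbb R^{d\times d}_{\rm sym})$ is the set of symmetric-matrix-valued measures $\mu$ with $\int\phi\,\xi\otimes\xi:d\mu\ge0$ for all $\xi\in\mathbb R^d$ and $0\le\phi\in C_c(\mathbb R^d)$. Suprema in time of quantities defined for a.e. $t$ are essential suprema. The Euler-alignment system is $\partial_t\rho+\mathrm{div}_x(\rho u)=0$, $\partial_t(\rho u)+\mathrm{div}_x(\rho u\otimes u)+\rho\int D^2K(x-y)(u(x)-u(y))\rho(y)dy=0$. A triple $(\rho,u,\mu)$ is a measure solution with data $(\rho_0,u_0)$ iff (for $K$ with $D^2K\in C_b$, even and positive semi-definite): (1) $\rho\in C([0,T];(\mathcal P(\mathbb R^d),d_f))$, $u\in L^\infty(0,T;L^2(d\rho_t))$, $\mu\in L^\infty(0,T;\mathcal M^+(\mathbb R^d;\mathbb R^{d\times d}_{\rm sym}))$, $\sup_{t}\int|x|^2d\rho_t<\infty$, $\sup_{t}\int|x||u(t,x)|d\rho_t<\infty$. (2) For every $t\in[0,T]$ and $\phi\in C^1([0,T]\times\mathbb R^d)$ with $|\phi|,|\partial_t\phi|\le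 C(1+|x|^2)$, $|\nabla_x\phi|\le C(1+|x|)$: $\int\phi(t,x)d\rho_t-\int\phi(0,x)d\rho_0=\int_0^t\int\partial_t\phi+\nabla_x\phi\cdot u\,d\rho_\tau d\tau$. (3) For a.e. $t\in(0,T)$ and $\phi\in C^1([0,T)\times\mathbb R^d;\mathbb R^d)$ with $|\phi|,|\partial_t\phi|\le C(1+|x|)$, $|\nabla_x\phi|\le C$: $$\int\phi(t,x)\cdot u(t,x)d\rho_t-\int\phi(0,x)\cdot u_0d\rho_0=\int_0^t\int\partial_t\phi\cdot u+u\otimes u:\nabla_x\phi\,d\rho_\tau d\tau+\int_0^t\int\nabla_x\phi:d\mu_\tau d\tau$$ $$+\int_0^t\int_{\mathbb R^{2d}}\phi(\tau,x)\cdot D^2K(x-y)(u(\tau,y)-u(\tau,x))\,d\rho_\tau(y)d\rho_\tau(x)d\tau.$$ (4) For a.e. $t\in(0,T)$: $\frac12\int|u(t,x)|^2d\rho_t+\frac12\mathrm{tr}(\mu_t(\mathbb R^d))\le e^{4t\|D^2K\|_\infty}\frac12\int|u_0|^2d\rho_0$, and $$\tfrac12\int|u(t,x)|^2d\rho_t+\tfrac12\mathrm{tr}(\mu_t(\mathbb R^d))+\tfrac12\int_0^t\int_{\mathbb R^{2d}}(u(s,x)-u(s,y))\cdot D^2K(x-y)(u(s,x)-u(s,y))\,d\rho_s(x)d\rho_s(y)ds\le\tfrac12\int|u_0|^2d\rho_0.$$ *)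

(* Defs.v *)
From HB Require Import structures.
From mathcomp Require Import all_boot all_order all_algebra.
From mathcomp Require Import all_classical all_reals all_analysis.
From mathcomp Require Import ess_sup_inf.

Set Implicit Arguments.
Unset Strict Implicit.
Unset Printing Implicit Defensive.

Import Order.TTheory GRing.Theory Num.Theory.
Import numFieldNormedType.Exports.

Local Open Scope classical_set_scope.
Local Open Scope ring_scope.

HB.instance Definition _ (R : realType) (m n : nat) :=
  @isMeasurable.Build (sigma_display (@open 'M[R]_(m, n))) 'M[R]_(m, n)
    <<s @open 'M[R]_(m, n) >>
    (@sigma_algebra0 _ setT _) (@sigma_algebraC _ _)
    (@sigma_algebra_bigcup _ setT _).

Section measurable_matrix.
Context {R : realType}.

Lemma measurable_coord m n i j :
  measurable_fun setT (fun M : 'M[R]_(m, n) => M i j).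
Proof.
apply: (measurability _ (measurable_realfun.RGenOpens.measurableE R)).
move=> _ [_ [a [b ->]] <-]; rewrite setTI.
apply: sub_sigma_algebra; apply: open_comp.
  by move=> x _; exact: coord_continuous.
exact: interval_open.
Qed.

Lemma measurable_fun_matrix d (T : measurableType d) m n (D : set T)
    (f : T -> 'M[R]_(m, n)) :
  (forall i j, measurable_fun D (fun x => f x i j)) -> measurable_fun D f.
Proof.
move=> mf mD.
apply: (@measurability _ _ _ _ _ _ (@open 'M[R]_(m, n))) => //.
move=> _ [V oV <- ].
pose B (k : 'M[rat]_(m, n) * nat) := if pselect
    (ball (map_mx ratr k.1 : 'M[R]_(m, n)) k.2.+1%:R^-1 `<=` V)
  then ball (map_mx ratr k.1 : 'M[R]_(m, n)) k.2.+1%:R^-1 else set0.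
have -> : V = \bigcup_k B k.
  apply/seteqP; split=> [M VM | M [k _] ]; last first.
    by rewrite /B; case: pselect => // kV; exact: kV.
  move: oV; rewrite openE => oV; have /nbhs_ballP[e /= e0 MV] := oV _ VM.
  have [N N2] : exists N : nat, N.+1%:R^-1 < e / 2.
    have := near_infty_natSinv_lt (PosNum (divr_gt0 e0 (ltr0Sn R 1))).
    by move=> [N _ /(_ N (leqnn _))] /=; exists N.
  have /choice[q qP] : forall ij : 'I_m * 'I_n, exists q : rat,
      ball (M ij.1 ij.2) N.+1%:R^-1 (ratr q : R).
    move=> [i j] /=.
    have /rat_in_itvoo[q] : M i j - N.+1%:R^-1 < M i j + N.+1%:R^-1.
      by rewrite ltrD2l gtrN.
    by rewrite in_itv /= => qP; exists q; rewrite ball_itv /= in_itv.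
  have bq : ball (map_mx ratr (\matrix_(i, j) q (i, j)) : 'M[R]_(m, n))
      N.+1%:R^-1 M.
    split => [|i j]; first by [].
    by rewrite !mxE; apply: ball_sym; exact: (qP (i, j)).
  exists (\matrix_(i, j) q (i, j), N) => //; rewrite /B /=.
  case: pselect => // -[] M' bM'; apply: MV.
  apply: (@le_ball _ _ _ (N.+1%:R^-1 + N.+1%:R^-1)).
    by rewrite (splitr e) lerD// ltW.
  by apply: ball_triangle bM'; exact: ball_sym.
rewrite preimage_bigcup setI_bigcupr.
apply: countable_bigcupT_measurable => [|k]; first exact: countableP.
rewrite /B; case: pselect => // kV; last by rewrite preimage_set0 setI0.
have -> : D `&` f @^-1` ball (map_mx ratr k.1 : 'M[R]_(m, n)) k.2.+1%:R^-1 =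
    D `&` \bigcap_(ij in [set: 'I_m * 'I_n]) (D `&`
      (fun x => f x ij.1 ij.2) @^-1`
        ball (ratr (k.1 ij.1 ij.2) : R) k.2.+1%:R^-1).
  apply/seteqP; split=> x [Dx].
    move=> [_ H]; split => // ij _; split => //=.
    by have := H ij.1 ij.2; rewrite mxE.
  move=> H; split => //; split => [|i j]; first by [].
  by rewrite mxE; have [//] := H (i, j) I.
apply: measurableI => //; apply: fin_bigcap_measurable; first exact: finite_finset.
move=> ij _; apply: mf => //.
by rewrite ball_itv; exact: measurable_itv.
Qed.

End measurable_matrix.

(* Lebesgue measure on R^n, by recursion on n: the image of
   lebesgue_measure \x (Lebesgue measure on R^n) by (t, x) |-> (t, x_0, .., x_(n-1)) *)
Section lebesgue_rV.
Context {R : realType}.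

Definition rV_cons n (z : R * 'rV[R]_n) : 'rV[R]_n.+1 :=
  \row_i oapp (z.2 0) z.1 (unlift ord0 i).

Definition rV_uncons n (x : 'rV[R]_n.+1) : R * 'rV[R]_n :=
  (x 0 ord0, \row_i x 0 (lift ord0 i)).

Lemma rV_consK n : cancel (@rV_cons n) (@rV_uncons n).
Proof.
move=> [t x]; congr pair; first by rewrite mxE unlift_none.
by apply/rowP => i; rewrite !mxE liftK.
Qed.

Lemma rV_unconsK n : cancel (@rV_uncons n) (@rV_cons n).
Proof.
by move=> x; apply/rowP => i; rewrite mxE; case: unliftP => [j|] -> /=; rewrite ?mxE.
Qed.

Lemma measurable_rV_cons n : measurable_fun setT (@rV_cons n).
Proof.
apply: measurable_fun_matrix => i j.
under eq_fun do rewrite mxE.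
case: unliftP => [k|] _ /=; last exact: measurable_fst.
exact: measurableT_comp (measurable_coord _ _) measurable_snd.
Qed.

Lemma measurable_rV_uncons n : measurable_fun setT (@rV_uncons n).
Proof.
apply: measurable_fun_pair; first exact: measurable_coord.
apply: measurable_fun_matrix => i j.
by under eq_fun do rewrite mxE; exact: measurable_coord.
Qed.

Section cons_measure.
Variables (n : nat) (m : {sigma_finite_measure set 'rV[R]_n -> \bar R}).

Definition cons_measure : set 'rV[R]_n.+1 -> \bar R :=
  pushforward (lebesgue_measure \x m)%E (@rV_cons n).

Let cons_measure0 : cons_measure set0 = 0%E.
Proof. by rewrite /cons_measure /pushforward preimage_set0 measure0. Qed.

Let cons_measure_ge0 A : (0 <= cons_measure A)%E.
Proof. by rewrite /cons_measure /pushforward; exact: measure_ge0. Qed.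

Let cons_measure_sigma_additive : semi_sigma_additive cons_measure.
Proof.
apply: measure_semi_sigma_additive; exact: measurable_rV_cons.
Qed.

HB.instance Definition _ := isMeasure.Build _ _ _ cons_measure
  cons_measure0 cons_measure_ge0 cons_measure_sigma_additive.

Let cons_measure_sigma_finite : sigma_finite setT cons_measure.
Proof.
have /sigma_finiteP[F [TF ndF Foo]] := sigma_finiteT (@lebesgue_measure R).
have /sigma_finiteP[G [TG ndG Goo]] := sigma_finiteT m.
exists (fun k => @rV_uncons n @^-1` (F k `*` G k)).
  rewrite -preimage_bigcup (_ : \bigcup_k _ = setT) ?preimage_setT//.
  rewrite -subTset => -[t x] _.
  have [k _ Fkt] : (\bigcup_k F k) t by rewrite -TF.
  have [l _ Glx] : (\bigcup_k G k) x by rewrite -TG.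
  exists (maxn k l) => //; split => /=.
    by move: t Fkt; exact/subsetPset/ndF/leq_maxl.
  by move: x Glx; exact/subsetPset/ndG/leq_maxr.
move=> k; have [mF Fk] := Foo k; have [mG Gk] := Goo k; split.
  rewrite -[X in measurable X]setTI; apply: measurable_rV_uncons => //.
  exact: measurableX.
rewrite /cons_measure /pushforward -comp_preimage.
rewrite (_ : _ \o _ = id) ?preimage_id; last exact/funext/rV_consK.
by rewrite product_measure1E// lte_mul_pinfty// ge0_fin_numE.
Qed.

HB.instance Definition _ := @Measure_isSigmaFinite.Build _ _ _ cons_measure
  cons_measure_sigma_finite.

End cons_measure.

Fixpoint lebesgue_rV n : {sigma_finite_measure set 'rV[R]_n -> \bar R} :=
  if n is n'.+1 then cons_measure (lebesgue_rV n') else \d_(0 : 'rV[R]_0).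

End lebesgue_rV.

Section euler_alignment.
Context {R : realType} {d : nat}.
Local Notation V := 'rV[R]_d.
Local Notation M := 'M[R]_d.
Local Notation leb1 := (@lebesgue_measure R).
Local Notation lebd := (@lebesgue_rV R d).
Local Notation evec := (fun i : 'I_d => delta_mx 0 i : V).

(* The library norms on V and M are sup norms; these are the Euclidean ones. *)
Definition dotv (x y : V) : R := \sum_i x 0 i * y 0 i.
Definition normv (x : V) : R := Num.sqrt (dotv x x).
Definition ddot (A B : M) : R := \tr (A^T *m B).
Definition normm (A : M) : R := Num.sqrt (ddot A A).

(* vectors are stored as rows: [mxv A w] is the vector A w *)
Definition mxv (A : M) (w : V) : V := w *m A^T.
Definition tensor (x y : V) : M := x^T *m y.

Definition grad (f : V -> R) (x : V) : V := \row_i 'D_(evec i) f x.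
Definition hess (f : V -> R) (x : V) : M :=
  \matrix_(i, j) 'D_(evec i) (fun y => 'D_(evec j) f y) x.

Definition twice_differentiable (f : V -> R) : Prop :=
  (forall x, differentiable f x) /\
  (forall i x, differentiable (fun y => 'D_(evec i) f y) x).

Definition hess_sup (f : V -> R) : R := sup [set normm (hess f x) | x in setT].

Definition pos_semidef (A : M) : Prop := forall xi, 0 <= dotv xi (mxv A xi).

Definition C1 (f : V -> R) : Prop :=
  (forall x, differentiable f x) /\ continuous (grad f).

Definition Cc (f : V -> R) : Prop :=
  continuous f /\ compact (closure [set x | f x != 0]).

(* [phi] is of class C^1 on I x R^d, for an interval I with nonempty interior,
   with time derivative [phit] and spatial partial derivatives [phix i]; at an
   endpoint of I, [phit] is the continuous extension of the time derivative. *)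
Definition C1_on (W : normedModType R) (I : set R)
    (phi phit : R -> V -> W) (phix : 'I_d -> R -> V -> W) : Prop :=
  [/\ {within I `*` setT, continuous (fun z : R * V => phi z.1 z.2)},
      {within I `*` setT, continuous (fun z : R * V => phit z.1 z.2)},
      (forall i,
        {within I `*` setT, continuous (fun z : R * V => phix i z.1 z.2)}),
      (forall t x, I° t -> is_derive t (1 : R) (phi^~ x) (phit t x)) &
      (forall i t x, I t -> is_derive x (evec i) (phi t) (phix i t x))].

Definition gradx (phix : 'I_d -> R -> V -> R) (t : R) (x : V) : V :=
  \row_i phix i t x.
Definition jacx (phix : 'I_d -> R -> V -> V) (t : R) (x : V) : M :=
  \matrix_(i, j) phix j t x 0 i.

Definition C1c_cylinder (T : R) (psi psit : R -> V -> R)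
    (psix : 'I_d -> R -> V -> R) : Prop :=
  [/\ C1_on setT psi psit psix,
      compact (closure [set z : R * V | psi z.1 z.2 != 0]) &
      closure [set z : R * V | psi z.1 z.2 != 0] `<=` `]0, T[ `*` setT].

Definition flat_dist (m1 m2 : probability V R) : \bar R :=
  ereal_sup [set (\int[m1]_x phi x - \int[m2]_x phi x)%:E | phi in
    [set phi : V -> R | [/\ C1 phi, (forall x, `|phi x| <= 1) &
                           (forall x, normv (grad phi x) <= 1)]]].

Definition flat_continuous (T : R) (m : R -> probability V R) : Prop :=
  forall t, t \in `[0, T] ->
    flat_dist (m s) (m t) @[s --> within `[0, T] (nbhs t)] --> 0%E.

Definition ess_sup_time (T : R) (f : R -> \bar R) : \bar R :=
  ess_sup (mrestr leb1 (measurable_itv `]0, T[)) f.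

Section charge_integral.
Variable nu : {charge set V -> \bar R}.

Definition hahn_pos : set V := projT1 (cid (Hahn_decomposition nu)).
Definition hahn_neg : set V :=
  projT1 (cid (projT2 (cid (Hahn_decomposition nu)))).
Definition hahnP : hahn_decomposition nu hahn_pos hahn_neg :=
  projT2 (cid (projT2 (cid (Hahn_decomposition nu)))).

Definition charge_integral (f : V -> R) : R :=
  \int[jordan_pos hahnP]_x f x - \int[jordan_neg hahnP]_x f x.

Definition total_variation_norm : \bar R := charge_variation hahnP setT.

End charge_integral.

Definition mx_charge := 'I_d -> 'I_d -> {charge set V -> \bar R}.

Definition mx_integral (m : mx_charge) (F : V -> M) : R :=
  \sum_i \sum_j charge_integral (m i j) (fun x => F x i j).

Definition mx_mass (m : mx_charge) : \bar R :=
  (\sum_i \sum_j total_variation_norm (m i j))%E.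

Definition mx_trace (m : mx_charge) : \bar R := (\sum_i m i i setT)%E.

Definition mx_pos_sym (m : mx_charge) : Prop :=
  (forall i j A, measurable A -> m i j A = m j i A) /\
  (forall (xi : V) (phi : V -> R), Cc phi -> (forall x, 0 <= phi x) ->
     0 <= mx_integral m (fun x => phi x *: tensor xi xi)).

(* L^oo(0, T; M^+(R^d; R^(d x d)_sym)), with weak-* measurability in time *)
Definition Linfty_mx_pos_sym (T : R) (mu : R -> mx_charge) : Prop :=
  [/\ (forall i j phi, Cc phi ->
        measurable_fun `]0, T[ (fun t => charge_integral (mu t i j) phi)),
      {ae leb1, forall t, t \in `]0, T[ -> mx_pos_sym (mu t)} &
      (ess_sup_time T (fun t => mx_mass (mu t)) < +oo)%E].

Definition kinetic (m : probability V R) (w : V -> V) : \bar R :=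
  (2^-1%:E * \int[m]_x (normv (w x) ^+ 2)%:E)%E.

Definition measure_solution_space (T : R) (rho : R -> probability V R)
    (u : R -> V -> V) (mu : R -> mx_charge) : Prop :=
  [/\ flat_continuous T rho,
      measurable_fun (`[0, T] `*` setT) (fun z : R * V => u z.1 z.2) /\
      (ess_sup_time T (fun t => \int[rho t]_x (normv (u t x) ^+ 2)%:E) < +oo)%E,
      Linfty_mx_pos_sym T mu,
      (ereal_sup [set \int[rho t]_x (normv x ^+ 2)%:E | t in `[0%R, T]] < +oo)%E &
      (ess_sup_time T (fun t => \int[rho t]_x (normv x * normv (u t x))%:E)
        < +oo)%E].

Definition weak_continuity (T : R) (rho0 : probability V R)
    (rho : R -> probability V R) (u : R -> V -> V) : Prop :=
  forall t, t \in `[0, T] -> forall phi phit phix,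
  @C1_on R `[0, T] phi phit phix ->
  (exists C : R, forall s x, s \in `[0, T] ->
    [/\ `|phi s x| <= C * (1 + normv x ^+ 2),
        `|phit s x| <= C * (1 + normv x ^+ 2) &
        normv (gradx phix s x) <= C * (1 + normv x)]) ->
  \int[rho t]_x phi t x - \int[rho0]_x phi 0 x =
  \int[leb1]_(tau in `[0, t])
    \int[rho tau]_x (phit tau x + dotv (gradx phix tau x) (u tau x)).

Definition weak_momentum (T : R) (K : V -> R) (rho0 : probability V R)
    (u0 : V -> V) (rho : R -> probability V R) (u : R -> V -> V)
    (mu : R -> mx_charge) : Prop :=
  {ae leb1, forall t, t \in `]0, T[ -> forall phi phit phix,
  @C1_on V `[0, T[ phi phit phix ->
  (exists C : R, forall s x, s \in `[0, T[ ->
    [/\ normv (phi s x) <= C * (1 + normv x),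
        normv (phit s x) <= C * (1 + normv x) &
        normm (jacx phix s x) <= C]) ->
  \int[rho t]_x dotv (phi t x) (u t x) - \int[rho0]_x dotv (phi 0 x) (u0 x) =
  \int[leb1]_(tau in `[0, t])
    \int[rho tau]_x (dotv (phit tau x) (u tau x) +
                     ddot (tensor (u tau x) (u tau x)) (jacx phix tau x)) +
  \int[leb1]_(tau in `[0, t]) mx_integral (mu tau) (jacx phix tau) +
  \int[leb1]_(tau in `[0, t])
    \int[(rho tau \x rho tau)%E]_z
      dotv (phi tau z.1)
           (mxv (hess K (z.1 - z.2)) (u tau z.2 - u tau z.1))}.

Definition energy_inequalities (T : R) (K : V -> R) (rho0 : probability V R)
    (u0 : V -> V) (rho : R -> probability V R) (u : R -> V -> V)
    (mu : R -> mx_charge) : Prop :=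
  {ae leb1, forall t, t \in `]0, T[ ->
    (kinetic (rho t) (u t) + 2^-1%:E * mx_trace (mu t) <=
       (expR (4 * t * hess_sup K))%:E * kinetic rho0 u0)%E /\
    (kinetic (rho t) (u t) + 2^-1%:E * mx_trace (mu t) +
       2^-1%:E * \int[leb1]_(s in `[0%R, t]) \int[(rho s \x rho s)%E]_z
         (dotv (u s z.1 - u s z.2)
            (mxv (hess K (z.1 - z.2)) (u s z.1 - u s z.2)))%:E <=
       kinetic rho0 u0)%E}.

Definition measure_solution (T : R) (K : V -> R) (rho0 : probability V R)
    (u0 : V -> V) (rho : R -> probability V R) (u : R -> V -> V)
    (mu : R -> mx_charge) : Prop :=
  [/\ measure_solution_space T rho u mu,
      weak_continuity T rho0 rho u,
      weak_momentum T K rho0 u0 rho u mu &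
      energy_inequalities T K rho0 u0 rho u mu].

Definition weak_partial (i : 'I_d) (f g : V -> R) : Prop :=
  forall psi, C1 psi -> Cc psi ->
  \int[lebd]_x (f x * 'D_(evec i) psi x) = - \int[lebd]_x (g x * psi x).

(* v is in L^oo(0, T; W^(1,oo)(R^d)) with weak Jacobian [Dv],
   (Dv t x) i j being the j-th partial derivative of the i-th component *)
Definition Linfty_W1infty (T : R) (v : R -> V -> V) (Dv : R -> V -> M) : Prop :=
  [/\ measurable_fun (`]0, T[ `*` setT) (fun z : R * V => v z.1 z.2),
      measurable_fun (`]0, T[ `*` setT) (fun z : R * V => Dv z.1 z.2),
      {ae leb1, forall t, t \in `]0, T[ -> forall i j,
        weak_partial j (fun x => v t x 0 i) (fun x => Dv t x i j)} &
      (ess_sup_time T (fun t =>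
         ess_sup lebd (fun x => (normv (v t x))%:E) +
         ess_sup lebd (fun x => (normm (Dv t x))%:E)) < +oo)%E].

Definition weak_time_derivative (T : R) (v vt : R -> V -> V) : Prop :=
  measurable_fun (`]0, T[ `*` setT) (fun z : R * V => vt z.1 z.2) /\
  forall psi psit psix, C1c_cylinder T psi psit psix -> forall i,
  \int[(leb1 \x lebd)%E]_(z in `]0, T[ `*` setT)
     (v z.1 z.2 0 i * psit z.1 z.2) =
  - \int[(leb1 \x lebd)%E]_(z in `]0, T[ `*` setT)
     (vt z.1 z.2 0 i * psi z.1 z.2).

Definition has_positive_density (m : probability V R) : Prop :=
  exists f : V -> R,
    [/\ measurable_fun setT f, (forall x, 0 < f x) &
        forall A, measurable A -> m A = (\int[lebd]_(x in A) (f x)%:E)%E].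

Definition alignment (K : V -> R) (m : probability V R) (w : V -> V)
    (x : V) : V :=
  \row_i \int[m]_y (mxv (hess K (x - y)) (w x - w y)) 0 i.

(* A velocity in L^oo(0, T; W^(1,oo)) with bounded time derivative has a
   representative that is continuous on [0, T] x R^d: the initial datum u0 is
   the value at time 0 of that representative. *)
Definition strong_solution (T : R) (K : V -> R) (rho0 : probability V R)
    (u0 : V -> V) (r : R -> probability V R) (v : R -> V -> V) : Prop :=
  [/\ flat_continuous T r,
      (forall t, t \in `[0, T] -> has_positive_density (r t)),
      (forall A, measurable A -> r 0 A = rho0 A),
      (forall psi psit psix, C1c_cylinder T psi psit psix ->
        \int[leb1]_(t in `]0, T[)
          \int[r t]_x (psit t x + dotv (gradx psix t x) (v t x)) = 0) &
      exists Dv vt vbar,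
      [/\ Linfty_W1infty T v Dv,
          weak_time_derivative T v vt,
          {ae (leb1 \x lebd)%E, forall z : R * V, z.1 \in `]0, T[ ->
            vt z.1 z.2 + mxv (Dv z.1 z.2) (v z.1 z.2)
              + alignment K (r z.1) (v z.1) z.2 = 0},
          {within `[0, T] `*` setT,
            continuous (fun z : R * V => vbar z.1 z.2)} /\
          {ae (leb1 \x lebd)%E, forall z : R * V, z.1 \in `]0, T[ ->
            v z.1 z.2 = vbar z.1 z.2} &
          {ae rho0, forall x, vbar 0 x = u0 x}]].

End euler_alignment.

(* Main.v *)
Require Import Defs.
From HB Require Import structures.
From mathcomp Require Import all_boot all_order all_algebra.
From mathcomp Require Import all_classical all_reals all_analysis.
From mathcomp Require Import measurable_realfun ess_sup_inf ring lra.

(** Weak-strong uniqueness by relative energy. Were the strong velocity v of class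
    C^1, it could be used as a test field: the energy inequality, minus the momentum
    balance tested with v, plus the continuity equation tested with |v|^2 / 2, bounds
    E(t) = 1/2 \int |u - v|^2 d rho_t + 1/2 tr mu_t(R^d) by a time integral. In the
    integrand, the terms of transport and the pairing of mu with the gradient of v are
    at most C E because v is Lipschitz. The alignment terms, taken over pairs of
    particles and symmetrized, leave minus a nonnegative quadratic form in (u - v)(x)
    - (u - v)(y), since the Hessian of K is even and positive semidefinite
    ([interaction_symmetric]). One term is left over: v is aligned with its own
    density r, and not with rho. Hence a bound of the distance between rho and r by
    the gap of velocities, which closes the Gronwall argument ([relative_energy],
    [gronwall_steps]).

    Two difficulties shape the proof. First, v is only Lipschitz, so that it is no
    test field. Its continuous representative b is mollified in space and time; the
    weak derivatives of v pass through the convolution, and the mollified field f is a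
    C^1 field which is e-close to b and solves the equation of b up to an error of
    order e ([phi_equation], [approx_field_exists]). That error is small because the
    alignment force of r is Lipschitz in time and space, which in turn holds because r
    moves at bounded speed ([transport_lipschitz], [alignment_diff]). All estimates
    are carried out with f, and e tends to 0 at the end.

    Second, the distance between rho and r, measured by bounded Lipschitz test
    functions, is propagated over a short time step h by a test function that is
    constant to first order along the flow of f: the given function at the foot of a
    straight characteristic run backward in time ([smooth_chart], [chart_flux]). Over
    one step the distance grows by a factor 1 + O(h), plus the gap of velocities
    accumulated during the step, plus O(h^2) ([lipdist_step]); the sum over the steps
    and h -> 0 give [lipdist_gap].

    Consequently the gap of velocities and the trace of mu vanish for almost every
    time. Then rho = r by [lipdist_gap], so u = b holds almost everywhere for r_t,
    hence for Lebesgue measure as the density of r_t is positive, and a positive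
    matrix-valued measure without trace is zero ([trace0_null]). *)

Set Implicit Arguments.
Unset Strict Implicit.
Unset Printing Implicit Defensive.

Import Order.TTheory GRing.Theory Num.Theory.
Import numFieldNormedType.Exports.

Local Open Scope classical_set_scope.
Local Open Scope ring_scope.

(** * Row vectors *)

Section row_vectors.
Context {R : realType}.
Implicit Types n : nat.

Lemma coord_le_norm n (x : 'rV[R]_n) i : `|x 0 i| <= `|x|.
Proof.
by rewrite [leRHS]/Num.norm/= mx_normrE; exact: (le_bigmax _ (fun ij : 'I_1 * 'I_n => `|x ij.1 ij.2|) (0, i)).
Qed.

Lemma norm_le_coord n (x : 'rV[R]_n) c :
  0 <= c -> (forall i, `|x 0 i| <= c) -> `|x| <= c.
Proof.
move=> c0 xc; rewrite [leLHS]/Num.norm/= mx_normrE; apply/bigmax_leP; split => // -[i j] _ /=.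
by rewrite ord1.
Qed.

(** The Borel sets of the space of rows are generated by its open sets, hence
    preimages of open intervals suffice. *)
Lemma measurable_continuous_rV n (f : 'rV[R]_n -> R) :
  continuous f -> measurable_fun setT f.
Proof.
move=> cf; apply: (measurability _ (measurable_realfun.RGenOpens.measurableE R)).
move=> _ [_ [a [b ->]] <-]; rewrite setTI.
apply: sub_sigma_algebra; apply: open_comp; last exact: interval_open.
by move=> x _; exact: cf.
Qed.

Lemma rV_cons_coord0 n (z : R * 'rV[R]_n) : rV_cons z 0 ord0 = z.1.
Proof. by rewrite mxE unlift_none. Qed.

Lemma rV_cons_coordS n (z : R * 'rV[R]_n) i : rV_cons z 0 (lift ord0 i) = z.2 0 i.
Proof. by rewrite mxE liftK. Qed.

Lemma continuous_rV n (T : topologicalType) (f : T -> 'rV[R]_n) :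
  (forall i, continuous (fun x => f x 0 i)) -> continuous f.
Proof.
move=> cf x; apply/cvgrPdist_le => e e0.
have H (i : 'I_n) : \forall y \near x, `|f x 0 i - f y 0 i| <= e.
  by have /cvgrPdist_le/(_ _ e0) := cf i x.
have : \forall y \near x, forall i, `|f x 0 i - f y 0 i| <= e.
  exact: filter_forall.
apply: filterS => y Hy; apply: norm_le_coord; first exact: ltW.
by move=> i; rewrite !mxE.
Qed.

Lemma continuous_coord n (T : topologicalType) (f : T -> 'rV[R]_n) i :
  continuous f -> continuous (fun x => f x 0 i).
Proof.
move=> cf x; apply: (@continuous_comp _ _ _ f (fun v : 'rV[R]_n => v 0 i)); first exact: cf.
exact: coord_continuous.
Qed.

Lemma continuous_rV_uncons n : continuous (@rV_uncons R n).
Proof.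
move=> x; apply: (@cvg_pair _ _ _ _ (nbhs _) (nbhs _)) => /=.
  exact: nbhs_filter.
  exact: coord_continuous.
move: x; apply: (@continuous_rV n 'rV[R]_n.+1 (fun x => \row_i x 0 (lift ord0 i))) => i x.
under eq_fun do rewrite mxE; exact: coord_continuous.
Qed.

Lemma continuous_rV_cons n : continuous (@rV_cons R n).
Proof.
apply: continuous_rV => i; case: (unliftP ord0 i) => [j|] ->.
  under eq_fun do rewrite rV_cons_coordS.
  by apply: continuous_coord => x; exact: cvg_snd.
by under eq_fun do rewrite rV_cons_coord0; move=> x; exact: cvg_fst.
Qed.

(** R * 'rV_n carries the product sigma-algebra and 'rV_(n+1) the Borel one; the
    measurable bijection [rV_cons] transports the result from the latter. *)
Lemma measurable_continuous_prod n (f : R * 'rV[R]_n -> R) :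
  continuous f -> measurable_fun setT f.
Proof.
move=> cf; have -> : f = (f \o @rV_uncons R n) \o @rV_cons R n.
  by apply/funext => x /=; rewrite rV_consK.
apply: measurableT_comp; last exact: measurable_rV_cons.
apply: measurable_continuous_rV => x; apply: continuous_comp; last exact: cf.
exact: continuous_rV_uncons.
Qed.

Lemma measurable_rV n d (T : measurableType d) (D : set T) (f : T -> 'rV[R]_n) :
  (forall i, measurable_fun D (fun x => f x 0 i)) -> measurable_fun D f.
Proof. by move=> mf; apply: measurable_fun_matrix => i j; rewrite ord1. Qed.

Lemma measurable_rV_coord n d (T : measurableType d) (D : set T) (f : T -> 'rV[R]_n) i :
  measurable_fun D f -> measurable_fun D (fun x => f x 0 i).
Proof.
by move=> mf; apply: (measurableT_comp (f := fun x : 'rV[R]_n => x 0 i)) => //; exact: measurable_coord.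
Qed.

Lemma measurable_rVB n d (T : measurableType d) (D : set T) (f g : T -> 'rV[R]_n) :
  measurable_fun D f -> measurable_fun D g -> measurable_fun D (fun x => f x - g x).
Proof.
move=> mf mg; apply: measurable_rV => i; under eq_fun do rewrite !mxE.
by apply: measurable_funB; exact: measurable_rV_coord.
Qed.

End row_vectors.

(** * Real-valued integrals *)

Section real_integrals.
Context {R : realType} d (T : measurableType d) (mu : {measure set T -> \bar R}).
Variable D : set T.
Hypothesis mD : measurable D.
Implicit Types f g : T -> R.

Lemma ae_bounded_integrable f C : (mu D < +oo)%E -> measurable_fun D f ->
  {ae mu, forall x, D x -> `|f x| <= C} -> mu.-integrable D (EFin \o f).
Proof.
move=> muD mf fC; apply/integrableP; split; first exact/measurable_EFinP.
have C0 : (0 <= `|C|%:E)%E by rewrite lee_fin.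
apply: (@le_lt_trans _ _ (\int[mu]_(x in D) `|C|%:E)%E).
  apply: ae_ge0_le_integral => //.
  - exact/measurable_EFinP/measurableT_comp.
  - apply: filterS fC => x fC Dx; rewrite lee_fin.
    by apply: le_trans (fC Dx) _; exact: ler_norm.
by rewrite integral_cst// lte_mul_pinfty.
Qed.

Lemma bounded_integrable f C : (mu D < +oo)%E -> measurable_fun D f ->
  (forall x, D x -> `|f x| <= C) -> mu.-integrable D (EFin \o f).
Proof. by move=> *; apply: (@ae_bounded_integrable _ C) => //; exact/aeW. Qed.

Lemma ae_le_Rintegral f g :
  mu.-integrable D (EFin \o f) -> mu.-integrable D (EFin \o g) ->
  {ae mu, forall x, D x -> f x <= g x} ->
  \int[mu]_(x in D) f x <= \int[mu]_(x in D) g x.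
Proof.
move=> fi gi fg; rewrite -subr_ge0 -RintegralB// /Rintegral fine_ge0//.
have /integrableP[mf _] := integrableB mD gi fi.
rewrite (@ae_eq_integral _ _ _ mu D (fun x => (Num.max 0 (g x - f x))%:E))//.
- by apply: integral_ge0 => x Dx; rewrite lee_fin le_max lexx.
- apply/measurable_EFinP/measurable_maxr => //.
  exact/measurable_EFinP.
- apply: filterS fg => x fg /fg fgx /=.
  by rewrite EFinB max_r// subr_ge0.
Qed.

Lemma ae_eq_Rintegral f g : measurable_fun D f -> measurable_fun D g ->
  {ae mu, forall x, D x -> f x = g x} ->
  \int[mu]_(x in D) f x = \int[mu]_(x in D) g x.
Proof.
move=> mf mg fg; congr fine; apply: ae_eq_integral => //; try exact/measurable_EFinP.
by apply: filterS fg => x /= fg Dx; rewrite fg.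
Qed.

Lemma ae_normr_Rintegral_le f g :
  mu.-integrable D (EFin \o f) -> mu.-integrable D (EFin \o g) ->
  {ae mu, forall x, D x -> `|f x| <= g x} ->
  `|\int[mu]_(x in D) f x| <= \int[mu]_(x in D) g x.
Proof.
move=> fi gi fg; apply: le_trans (le_normr_Rintegral mD fi) _.
apply: ae_le_Rintegral => //.
exact: integrable_norm.
Qed.

Lemma integrableDr f g : mu.-integrable D (EFin \o f) ->
  mu.-integrable D (EFin \o g) -> mu.-integrable D (EFin \o (fun x => f x + g x)).
Proof. by move=> fi gi; rewrite (_ : _ \o _ = (EFin \o f) \+ (EFin \o g))//; exact: integrableD. Qed.

Lemma integrableBr f g : mu.-integrable D (EFin \o f) ->
  mu.-integrable D (EFin \o g) -> mu.-integrable D (EFin \o (fun x => f x - g x)).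
Proof. by move=> fi gi; rewrite (_ : _ \o _ = ((EFin \o f) \- (EFin \o g))%E)//; exact: integrableB. Qed.

Lemma integrableZr k f : mu.-integrable D (EFin \o f) ->
  mu.-integrable D (EFin \o (fun x => k * f x)).
Proof. by move=> fi; rewrite (_ : _ \o _ = (fun x => k%:E * (EFin \o f) x)%E)//; exact: integrableZl. Qed.

Lemma integrable_sumr (I : Type) (s : seq I) (f : I -> T -> R) :
  (forall i, mu.-integrable D (EFin \o f i)) ->
  mu.-integrable D (EFin \o (fun x => \sum_(i <- s) f i x)).
Proof.
move=> fi; rewrite (_ : _ \o _ = (fun x => \sum_(i <- s) (EFin \o f i) x)%E).
  exact: integrable_sum.
by apply/funext => x /=; rewrite sumEFin.
Qed.

Lemma Rintegral_sumr (I : Type) (s : seq I) (f : I -> T -> R) :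
  (forall i, mu.-integrable D (EFin \o f i)) ->
  \int[mu]_(x in D) (\sum_(i <- s) f i x) = \sum_(i <- s) \int[mu]_(x in D) f i x.
Proof.
move=> fi; elim: s => [|i s IH].
  by under eq_Rintegral do rewrite big_nil; rewrite big_nil /Rintegral integral0.
under eq_Rintegral do rewrite big_cons.
by rewrite big_cons RintegralD// ?IH//; exact: integrable_sumr.
Qed.

Lemma le_integrabler f g : measurable_fun D f ->
  (forall x, D x -> `|f x| <= g x) -> mu.-integrable D (EFin \o g) ->
  mu.-integrable D (EFin \o f).
Proof.
move=> mf fg; apply: le_integrable => //; first exact/measurable_EFinP.
move=> x Dx; rewrite /= lee_fin; apply: le_trans (fg x Dx) _; exact: ler_norm.
Qed.

(** Changing the majorant to +oo on a null measurable set makes the inequality hold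
    everywhere, and the integral of a nonnegative function, a supremum over simple
    functions below it, is monotone for arbitrary functions. *)
Lemma ae_le_integral_nonmeas (f g : T -> \bar R) :
  (forall x, (0 <= f x)%E) -> (forall x, (0 <= g x)%E) ->
  measurable_fun D g ->
  {ae mu, forall x, D x -> (f x <= g x)%E} ->
  (\int[mu]_(x in D) f x <= \int[mu]_(x in D) g x)%E.
Proof.
move=> f0 g0 mg [N [mN N0 fgN]].
pose h x := (g x + if pselect (N x) then +oo else 0)%E.
have mh : measurable_fun D h.
  apply: emeasurable_funD => //.
  rewrite (_ : (fun x => _) = (fun x => +oo * (\1_N x)%:E)%E); last first.
    by apply/funext => x; rewrite indicE; case: pselect => /= Nx;
      [rewrite mem_set// mule1|rewrite memNset// mule0].
  apply: emeasurable_funM => //; apply/measurable_EFinP.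
  exact: measurable_indic.
have h0 x : (0 <= h x)%E by rewrite adde_ge0//; case: pselect.
have -> : (\int[mu]_(x in D) g x = \int[mu]_(x in D) h x)%E.
  apply: ge0_ae_eq_integral => //.
  exists N; split => // x; apply: contra_notP => Nx Dx.
  by rewrite /h; case: pselect => [/Nx//|?]; rewrite adde0.
have fh x : D x -> (f x <= h x)%E.
  move=> Dx; rewrite /h; case: pselect => Nx.
    by rewrite addey ?leey// gt_eqF// (lt_le_trans _ (g0 x)).
  by rewrite adde0; apply: contrapT => fg; apply: Nx; apply: fgN => /(_ Dx).
rewrite !ge0_integralE//; apply: le_ereal_sup => _ [k /= kf <-].
exists k => // x; apply: le_trans (kf x) _; rewrite /patch; case: ifP => //.
by rewrite inE => Dx; exact: fh.
Qed.

End real_integrals.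

(** * Differential calculus through partial derivatives *)

Section calculus.
Context {R : realType}.

Lemma cvg_sumr (I : Type) (r : seq I) (T : Type) (F : set_system T) (f : I -> T -> R) (l : I -> R) :
  Filter F -> (forall i, f i x @[x --> F] --> l i) ->
  (\sum_(i <- r) f i x) @[x --> F] --> \sum_(i <- r) l i.
Proof.
move=> FF fl; elim: r => [|i r IH].
  by under eq_fun do rewrite big_nil; rewrite big_nil; exact: cvg_cst.
by under eq_fun do rewrite big_cons; rewrite big_cons; apply: cvgD.
Qed.

Lemma is_derive_line (V W : normedModType R) (f : V -> W) (p v : V) (c : R) (df : W) :
  is_derive (p + c *: v) v f df -> is_derive c (1 : R) (fun c => f (p + c *: v)) df.
Proof.
have E : (fun h : R => h^-1 *: ((fun c : R => f (p + c *: v)) (h *: (1 : R) + c) - f (p + c *: v))) =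
    (fun h : R => h^-1 *: (f (h *: v + (p + c *: v)) - f (p + c *: v))).
  by apply/funext => h /=; rewrite scalerDl addrCA -[h *: 1]/(h * 1) mulr1.
by move=> -[dv dE]; split; rewrite /derivable /derive/= E.
Qed.

Lemma is_derive_line0 (V W : normedModType R) (f : V -> W) (p v : V) (df : W) :
  is_derive (0 : R) (1 : R) (fun c => f (p + c *: v)) df -> is_derive p v f df.
Proof.
have E : (fun h : R => h^-1 *: ((fun c : R => f (p + c *: v)) (h *: (1 : R) + 0) - f (p + 0 *: v))) =
    (fun h : R => h^-1 *: (f (h *: v + p) - f p)).
  by apply/funext => h /=; rewrite scale0r !addr0 (_ : h%:A = h) ?[p + _]addrC//; exact: mulr1.
by move=> -[dv dE]; split; move: dv dE; rewrite /derivable /derive/= E.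
Qed.

(** The mean value theorem is applied on each edge of the staircase path from x to y
    that changes one coordinate at a time, so that it involves one partial derivative
    at a time. *)
Lemma rV_MVT n (f : 'rV[R]_n -> R) (g : 'I_n -> 'rV[R]_n -> R) :
  (forall i x, is_derive x (delta_mx 0 i : 'rV[R]_n) f (g i x)) ->
  forall x y : 'rV[R]_n, exists xi : 'I_n -> 'rV[R]_n,
    (forall i j, exists2 c, 0 <= c <= 1 & xi i 0 j = x 0 j + c * (y 0 j - x 0 j)) /\
    f y - f x = \sum_i (y 0 i - x 0 i) * g i (xi i).
Proof.
move=> dfg x y.
(* p k agrees with y in its first k coordinates and with x in the others *)
pose p k : 'rV[R]_n := \row_j (if (j < k)%N then y 0 j else x 0 j).
have H (i : 'I_n) : exists xi : 'rV[R]_n,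
    (forall j, exists2 c, 0 <= c <= 1 & xi 0 j = x 0 j + c * (y 0 j - x 0 j)) /\
    f (p i.+1) - f (p i) = (y 0 i - x 0 i) * g i xi.
  pose q c : 'rV[R]_n := p i + (c * (y 0 i - x 0 i)) *: delta_mx 0 i.
  have dq (c : R) : is_derive c 1 (f \o q) ((y 0 i - x 0 i) * g i (q c)).
    have d1 : is_derive (c * (y 0 i - x 0 i)) (1 : R)
        (fun c => f (p i + c *: delta_mx 0 i)) (g i (q c)).
      by apply: is_derive_line; exact: dfg.
    have d2 : is_derive c (1 : R) (fun c => c * (y 0 i - x 0 i)) (y 0 i - x 0 i).
      by apply: is_derive_eq; rewrite scaler0 add0r -[_ *: _]/(_ * _) mulr1.
    have := is_derive1_comp (g := fun c => c * (y 0 i - x 0 i)) d1 d2.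
    by rewrite mulrC.
  have [] := @MVT_segment R (f \o q) (fun c => (y 0 i - x 0 i) * g i (q c)) 0 1.
  - by [].
  - apply: continuous_subspaceT => c.
    by apply/differentiable_continuous/derivable1_diffP; exact: ex_derive.
  move=> c; rewrite in_itv/= subr0 mulr1 => c01 E.
  exists (q c); split.
    move=> j; rewrite !mxE eqxx/=; have [->|ji] := eqVneq j i.
      by exists c => //; rewrite ltnn mulr1.
    rewrite mulr0 addr0; case: ifP => _.
      by exists 1; rewrite ?ler01 ?lexx// mul1r addrC subrK.
    by exists 0; rewrite ?ler01 ?lexx// mul0r addr0.
  rewrite -E /= /q mul0r scale0r addr0 mul1r; congr (f _ - _).
  apply/rowP => j; rewrite !mxE eqxx/= ltnS leq_eqVlt.
  have [ji|ji] := eqVneq j i; first by rewrite ji eqxx/= ltnn mulr1 addrC subrK.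
  by rewrite -val_eqE in ji; rewrite (negbTE ji)/= mulr0 addr0.
move/choice : H => [xi xiP]; exists xi; split => [i|]; first by have [] := xiP i.
rewrite -(eq_bigr _ (fun i _ => (xiP i).2)).
rewrite -(big_mkord xpredT (fun i => f (p i.+1) - f (p i))) telescope_sumr//.
congr (f _ - f _); apply/rowP => j; rewrite !mxE ?ltn_ord//.
Qed.

Lemma rV_Lipschitz n (f : 'rV[R]_n -> R) (g : 'I_n -> 'rV[R]_n -> R) (L : R) (x y : 'rV[R]_n) :
  (forall i x, is_derive x (delta_mx 0 i : 'rV[R]_n) f (g i x)) ->
  (forall i (z : 'rV[R]_n), (forall j, exists2 c, 0 <= c <= 1 & z 0 j = x 0 j + c * (y 0 j - x 0 j)) ->
     `|g i z| <= L) ->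
  `|f y - f x| <= n%:R * L * `|y - x|.
Proof.
move=> dfg gL; have [xi [xiP ->]] := rV_MVT dfg x y.
apply: le_trans (ler_norm_sum _ _ _) _.
apply: (@le_trans _ _ (\sum_(i < n) L * `|y - x|)).
  apply: ler_sum => i _; rewrite normrM mulrC ler_pM//.
    by apply: gL => j; exact: xiP.
  by have := coord_le_norm (y - x) i; rewrite !mxE.
by rewrite sumr_const card_ord -(mulr_natl (L * _)) mulrA.
Qed.

(** By [rV_MVT] the difference quotient is a sum of difference quotients of the
    coordinates of [c], times partial derivatives at points tending to [c s], where
    they are continuous. *)
Lemma rV_chain n (f : 'rV[R]_n -> R) (g : 'I_n -> 'rV[R]_n -> R)
   (c : R -> 'rV[R]_n) (dc : 'I_n -> R) (s : R) :
  (forall i x, is_derive x (delta_mx 0 i : 'rV[R]_n) f (g i x)) ->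
  (forall i, {for c s, continuous (g i)}) ->
  (forall i, is_derive s (1 : R) (fun s => c s 0 i) (dc i)) ->
  is_derive s (1 : R) (f \o c) (\sum_i dc i * g i (c s)).
Proof.
move=> dfg cg dcs.
have /choice[xi xiP] := fun h : R => rV_MVT dfg (c s) (c (h *: (1 : R) + s)).
have cc i : {for s, continuous (fun s => c s 0 i)}.
  by apply/differentiable_continuous/derivable1_diffP; exact: ex_derive.
have cs1 : h *: (1:R) + s @[h --> (0:R)^'] --> s.
  apply/cvgrPdist_le => d d0; near=> h.
  rewrite opprD addrCA subrr addr0 normrN (_ : h%:A = h); last exact: mulr1.
  by near: h; exact: dnbhs0_le.
have xic i : xi h i @[h --> (0 : R)^'] --> c s.
  apply/cvgrPdist_le => e e0.
  have H (j : 'I_n) : \forall h \near (0:R)^', `|c s 0 j - c (h *: (1:R) + s) 0 j| <= e.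
    have : c (h *: (1:R) + s) 0 j @[h --> (0:R)^'] --> c s 0 j.
      exact: (cvg_comp (fun h : R => h *: (1:R) + s) (fun s => c s 0 j) cs1 (cc j)).
    by move/cvgrPdist_le => /(_ _ e0).
  have : \forall h \near (0:R)^', forall j, `|c s 0 j - c (h *: (1:R) + s) 0 j| <= e.
    exact: filter_forall.
  apply: filterS => h Hh; apply: norm_le_coord; first exact: ltW.
  move=> j; rewrite !mxE; have [_] := xiP h; have [+ _] := xiP h.
  move=> /(_ i j)[t /andP[t0 t1] ->] _.
  rewrite opprD addNKr normrN normrM; apply: le_trans (Hh j).
  by rewrite distrC ler_piMl// ger0_norm.
have dE : h^-1 *: ((f \o c) (h *: (1 : R) + s) - (f \o c) s) @[h --> (0:R)^'] -->
    \sum_i dc i * g i (c s).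
  have -> : (fun h : R => h^-1 *: ((f \o c) (h *: (1 : R) + s) - (f \o c) s)) =
      (fun h => \sum_i (h^-1 *: (c (h *: (1:R) + s) 0 i - c s 0 i)) * g i (xi h i)).
    apply/funext => h; have [_ /= ->] := xiP h; rewrite scaler_sumr; apply: eq_bigr => i _.
    by rewrite -[_ *: _]/(_ * _) -[_ *: _]/(_ * _) mulrA.
  apply: cvg_sumr => i; apply: cvgM.
    by have [d1 <-] := dcs i; exact: d1.
  by apply: continuous_cvg (xic i); exact: cg.
split; first by apply/cvg_ex; eexists; exact: dE.
exact: cvg_lim dE.
Unshelve. all: by end_near. Qed.

End calculus.

(** * A bump of class C^1 and mass one *)

Section bump.
Context {R : realType}.

(** A remainder of second order, which is how the derivative of the piecewise
    polynomial below is found at the points where its formula changes. *)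
Lemma is_derive_quad (f : R -> R) (x df C : R) :
  (forall h, `|f (x + h) - f x - df * h| <= C * h ^+ 2) -> is_derive x (1 : R) f df.
Proof.
move=> fC.
have dE : h^-1 *: (f (h *: (1 : R) + x) - f x) @[h --> (0:R)^'] --> df.
  have C1 : 0 < `|C| + 1 by rewrite ltr_wpDl.
  apply/cvgrPdist_le => e e0; near=> h.
  have h0 : h != 0 by near: h; exact: nbhs_dnbhs_neq.
  rewrite (_ : h%:A = h); last exact: mulr1.
  rewrite distrC (_ : _ - df = h^-1 * (f (x + h) - f x - df * h)); last first.
    by rewrite [h + x]addrC [RHS]mulrBr [df * h]mulrC mulKf//.
  rewrite normrM normfV ler_pdivrMl ?normr_gt0//.
  apply: le_trans (fC h) _; rewrite -(real_normK (num_real h)) expr2 mulrA mulrC ler_wpM2l//.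
  apply: (@le_trans _ _ ((`|C| + 1) * `|h|)).
    by rewrite ler_wpM2r// ler_wpDr// ler_norm.
  rewrite mulrC -ler_pdivlMr//; near: h.
  by apply: dnbhs0_le; rewrite divr_gt0.
split; first by apply/cvg_ex; eexists; exact: dE.
exact: cvg_lim dE.
Unshelve. all: by end_near. Qed.

Lemma is_derive_pow (f : R -> R) (x df : R) n : is_derive x (1 : R) f df ->
  is_derive x (1 : R) (fun y => f y ^+ n) (n%:R * f x ^+ n.-1 * df).
Proof.
move=> d; elim: n => [|n IH].
  by rewrite !mul0r (_ : (fun _ => _) = cst 1)//; exact: is_derive_cst.
rewrite (_ : (fun y => f y ^+ n.+1) = f * (fun y => f y ^+ n)); last first.
  by apply/funext => y; rewrite exprS.
have := is_deriveM d IH; congr is_derive; rewrite /GRing.scale/=.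
by case: n {IH} => [|n] /=; rewrite ?expr0 ?exprS -?natr1; ring.
Qed.

Lemma is_derive_maxsq (y : R) :
  is_derive y (1 : R) (fun y => (Num.max 0 y) ^+ 2) (2 * Num.max 0 y).
Proof.
apply: (@is_derive_quad _ _ _ 1) => h.
rewrite mul1r ler_norml; case: (leP 0 y) => y0; case: (leP 0 (y + h)) => yh;
  apply/andP; split; nra.
Qed.

(** The square makes the truncated parabola of class C^1, and 15 / (16 e^5) is the
    inverse of the integral of (e^2 - s^2)^2 over [-e, e]. *)
Definition bump (e s : R) : R := 15 / (16 * e ^+ 5) * (Num.max 0 (e ^+ 2 - s ^+ 2)) ^+ 2.
Definition dbump (e s : R) : R := - (15 / (4 * e ^+ 5)) * (s * Num.max 0 (e ^+ 2 - s ^+ 2)).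

Lemma is_derive_bump (e s : R) : 0 < e -> is_derive s (1 : R) (bump e) (dbump e s).
Proof.
move=> e0.
have d1 : is_derive s (1 : R) (fun s => e ^+ 2 - s ^+ 2) (- (2 * s)).
  apply: (@is_derive_quad _ _ _ 1) => h.
  by rewrite (_ : _ - _ = - h ^+ 2) ?normrN ?normrX ?real_normK ?num_real ?mul1r//; ring.
have d2 := is_derive1_comp (g := fun s => e ^+ 2 - s ^+ 2) (is_derive_maxsq (e ^+ 2 - s ^+ 2)) d1.
have := is_deriveZ (15 / (16 * e ^+ 5)) d2.
congr is_derive; rewrite /dbump /GRing.scale/=; field.
by rewrite gt_eqF.
Qed.

Lemma bump_ge0 e s : 0 < e -> 0 <= bump e s.
Proof. by move=> e0; rewrite mulr_ge0// ?sqr_ge0// divr_ge0// mulr_ge0// exprn_ge0// ltW. Qed.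

Lemma max_out (e s : R) : 0 < e -> e <= `|s| -> Num.max 0 (e ^+ 2 - s ^+ 2) = 0.
Proof.
move=> e0 es; apply/max_idPl; rewrite subr_le0 -(real_normK (num_real s)).
by rewrite lerXn2r// ?nnegrE ltW.
Qed.

Lemma bump_out e s : 0 < e -> e <= `|s| -> bump e s = 0.
Proof. by move=> e0 es; rewrite /bump max_out// expr0n mulr0. Qed.

Lemma dbump_out e s : 0 < e -> e <= `|s| -> dbump e s = 0.
Proof. by move=> e0 es; rewrite /dbump max_out// !mulr0. Qed.

Lemma bump_gt0 e s : 0 < e -> `|s| < e -> 0 < bump e s.
Proof.
move=> e0 es; have H : 0 < e ^+ 2 - s ^+ 2.
  by rewrite subr_gt0 -(real_normK (num_real s)) ltrXn2r.
rewrite /bump (max_r (ltW H)) mulr_gt0//; last exact: exprn_gt0.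
by rewrite divr_gt0// mulr_gt0// exprn_gt0.
Qed.

Lemma max_lip (e s t : R) : 0 < e ->
  `|s * Num.max 0 (e ^+ 2 - s ^+ 2) - t * Num.max 0 (e ^+ 2 - t ^+ 2)| <= 2 * e ^+ 2 * `|s - t|.
Proof.
move=> e0.
wlog st : s t / `|s| <= `|t|.
  move=> H; have [|/ltW] := leP `|s| `|t|; first exact: H.
  by rewrite distrC [`|s - t|]distrC; exact: H.
have [te|te] := leP e `|t|.
  rewrite [in t * _]max_out// mulr0 subr0.
  have [se|se] := leP e `|s|; first by rewrite max_out// mulr0 normr0 mulr_ge0// mulr_ge0// exprn_ge0// ltW.
  apply: (@le_trans _ _ (2 * e ^+ 2 * (`|t| - `|s|))); last first.
    rewrite ler_wpM2l ?mulr_ge0 ?exprn_ge0 ?(ltW e0)// distrC; exact: lerB_normD || exact: lerB_dist.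
  have H : 0 < e ^+ 2 - s ^+ 2.
    by rewrite subr_gt0 -(real_normK (num_real s)) ltrXn2r.
  rewrite max_r ?(ltW H)// normrM (gtr0_norm H) -(real_normK (num_real s)).
  have := normr_ge0 s; move: (`|s|) (`|t|) se te => x y se te x0.
  rewrite (_ : x * _ = x * (e + x) * (e - x)); last by ring.
  apply: ler_pM; [by nra|by lra|by nra|by lra].
have H : 0 < e ^+ 2 - s ^+ 2.
  by rewrite subr_gt0 -(real_normK (num_real s)) ltrXn2r// (le_lt_trans st).
have H2 : 0 < e ^+ 2 - t ^+ 2.
  by rewrite subr_gt0 -(real_normK (num_real t)) ltrXn2r.
rewrite (max_r (ltW H)) (max_r (ltW H2)).
rewrite (_ : _ - _ = (s - t) * (e ^+ 2 - s ^+ 2 - s * t - t ^+ 2)); last by ring.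
rewrite normrM mulrC ler_wpM2r// ler_norml; apply/andP; split; nra.
Qed.

(** The kernels of one variable used for mollification: products over the coordinates
    of such functions are again bounded, Lipschitz and supported in a cube, and the
    derivative [dbump] of the bump stays in the class. *)
Definition nice1 (e : R) (k : R -> R) : Prop := exists C, [/\ 0 <= C,
  forall s, `|k s| <= C, forall s t, `|k s - k t| <= C * `|s - t| &
  forall s, e <= `|s| -> k s = 0].

Lemma dbump_cst_gt0 (e : R) : 0 < e -> 0 < 15 / (4 * e ^+ 5).
Proof. by move=> e0; rewrite divr_gt0// mulr_gt0// exprn_gt0. Qed.

Lemma dbump_le e s : 0 < e -> `|dbump e s| <= 15 / (4 * e ^+ 2).
Proof.
move=> e0; have [es|es] := leP e `|s|.
  by rewrite dbump_out// normr0 divr_ge0// mulr_ge0// exprn_ge0// ltW.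
rewrite /dbump normrM normrN (gtr0_norm (dbump_cst_gt0 e0)).
rewrite (_ : 15 / (4 * e ^+ 2) = 15 / (4 * e ^+ 5) * e ^+ 3); last first.
  by field; rewrite gt_eqF.
rewrite ler_wpM2l ?(ltW (dbump_cst_gt0 e0))//.
rewrite normrM exprS ler_pM// ?(ltW es)// ger0_norm ?le_max ?lexx//.
by rewrite ge_max sqr_ge0/= gerBl sqr_ge0.
Qed.

Lemma nice_dbump e : 0 < e -> nice1 e (dbump e).
Proof.
move=> e0; exists (Num.max (15 / (4 * e ^+ 2)) (15 / (4 * e ^+ 5) * (2 * e ^+ 2))).
have h0 : 0 <= 15 / (4 * e ^+ 2) by rewrite divr_ge0// mulr_ge0// exprn_ge0// ltW.
split; first by rewrite le_max h0.
- by move=> s; rewrite le_max dbump_le.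
- move=> s t; rewrite /dbump -mulrBr normrM normrN (gtr0_norm (dbump_cst_gt0 e0)).
  apply: (@le_trans _ _ (15 / (4 * e ^+ 5) * (2 * e ^+ 2) * `|s - t|)).
    by rewrite -[in leRHS]mulrA ler_wpM2l ?max_lip// (ltW (dbump_cst_gt0 e0)).
  by rewrite ler_wpM2r// le_max lexx orbT.
- by move=> s; exact: dbump_out.
Qed.

Lemma bump_le e s : 0 < e -> `|bump e s| <= 15 / (16 * e).
Proof.
move=> e0; rewrite ger0_norm ?bump_ge0//.
rewrite (_ : 15 / (16 * e) = 15 / (16 * e ^+ 5) * (e ^+ 2) ^+ 2); last first.
  by field; rewrite gt_eqF.
rewrite ler_wpM2l// ?divr_ge0 ?mulr_ge0 ?exprn_ge0 ?(ltW e0)//.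
rewrite lerXn2r// ?nnegrE ?le_max ?lexx// ?sqr_ge0//.
by rewrite ge_max sqr_ge0/= gerBl sqr_ge0.
Qed.

Lemma derive_lip (k dk : R -> R) C : (forall s, is_derive s (1 : R) k (dk s)) ->
  (forall s, `|dk s| <= C) -> forall s t, `|k s - k t| <= C * `|s - t|.
Proof.
move=> dkk dkC s t; wlog st : s t / t <= s.
  move=> H; have [|/ltW] := leP t s; first exact: H.
  by rewrite distrC [`|s - t|]distrC; exact: H.
have [] := @MVT_segment R k dk t s st.
- apply: continuous_subspaceT => c.
  by apply/differentiable_continuous/derivable1_diffP; exact: ex_derive.
- by move=> c _ ->; rewrite normrM ler_wpM2r.
Qed.

Lemma nice_bump e : 0 < e -> nice1 e (bump e).
Proof.
move=> e0; exists (Num.max (15 / (16 * e)) (15 / (4 * e ^+ 2))).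
have h0 : 0 <= 15 / (16 * e) by rewrite divr_ge0// mulr_ge0// ltW.
split; first by rewrite le_max h0.
- by move=> s; rewrite le_max bump_le.
- move=> s t.
  apply: (@le_trans _ _ (15 / (4 * e ^+ 2) * `|s - t|)).
    exact: (derive_lip (fun u => is_derive_bump u e0) (fun u => dbump_le u e0)).
  by rewrite ler_wpM2r// le_max lexx orbT.
- by move=> s; exact: bump_out.
Qed.

Lemma nice_continuous e k : nice1 e k -> continuous k.
Proof.
move=> [C [C0 _ kC _]] x; have C1 : 0 < C + 1 by rewrite ltr_wpDl.
apply/cvgrPdist_le => d d0; near=> t.
apply: le_trans (kC x t) _.
apply: (@le_trans _ _ ((C + 1) * `|x - t|)); first by rewrite ler_wpM2r// lerDl.
rewrite mulrC -ler_pdivlMr//; near: t.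
by exists (d / (C + 1)) => /=; [rewrite divr_gt0//|move=> z /= /ltW].
Unshelve. all: by end_near. Qed.

(** The square of the parabola is a polynomial on the support, with the explicit
    primitive [F]. *)
Lemma integral_bump e a : 0 < e -> (\int[lebesgue_measure]_s (bump e (a - s))%:E = 1)%E.
Proof.
move=> e0.
pose F s : R := - (15 / (16 * e ^+ 5)) * (e ^+ 4 * (a - s) - 2 / 3 * e ^+ 2 * (a - s) ^+ 3 + (a - s) ^+ 5 / 5).
have cb : continuous (fun s => bump e (a - s)).
  move=> s; apply: (@continuous_comp _ _ _ (fun s => a - s) (bump e)).
    by apply: cvgB; [exact: cvg_cst|exact: cvg_id].
  exact: (nice_continuous (nice_bump e0)).
have dF s : is_derive s (1 : R) F (15 / (16 * e ^+ 5) * (e ^+ 2 - (a - s) ^+ 2) ^+ 2).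
  have d1 : is_derive s (1 : R) (fun s => a - s) (- 1).
    by apply: (@is_derive_quad _ _ _ 0) => h; rewrite (_ : _ - _ = 0) ?normr0 ?mul0r//; ring.
  have d3 := is_derive_pow 3 d1; have d5 := is_derive_pow 5 d1.
  have := is_deriveZ (- (15 / (16 * e ^+ 5))) (is_deriveD (is_deriveB (is_deriveZ (e ^+ 4) d1)
    (is_deriveZ (2 / 3 * e ^+ 2) d3)) (is_deriveZ (5^-1) d5)).
  rewrite (_ : _ \*: _ = F); last first.
    apply/funext => z; rewrite -[LHS]/(- (15 / (16 * e ^+ 5)) * (e ^+ 4 * (a - z) -
      2 / 3 * e ^+ 2 * (a - z) ^+ 3 + 5^-1 * (a - z) ^+ 5)) /F; ring.
  by congr is_derive; rewrite /GRing.scale /=; field; rewrite gt_eqF.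
rewrite (_ : (\int[_]_s _)%E = (\int[lebesgue_measure]_(s in `[(a - e)%R, (a + e)%R]) (bump e (a - s))%:E)%E); last first.
  rewrite [RHS]integral_mkcond; apply: eq_integral => s _; rewrite patchE.
  case: ifPn => //; rewrite notin_setE/= in_itv/= => /negP; rewrite negb_and -!ltNge => H.
  rewrite bump_out//; case/orP: H => H.
    by rewrite ler_normr lerBrDr addrC -lerBrDr ltW.
  by rewrite ler_normr; apply/orP; right; rewrite opprB lerBrDl ltW.
rewrite (@continuous_FTC2 _ _ F); first last.
- move=> s; rewrite in_itv/= => /andP[s1 s2]; rewrite derive1E; have [_ ->] := dF s.
  rewrite /bump max_r// subr_ge0 -(real_normK (num_real (a - s))).
  rewrite lerXn2r// ?nnegrE ?(ltW e0)// ler_norml; apply/andP; split; lra.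
- split.
  + by move=> s _; exact: ex_derive.
  + apply: cvg_at_right_filter; apply/differentiable_continuous/derivable1_diffP; exact: ex_derive.
  + apply: cvg_at_left_filter; apply/differentiable_continuous/derivable1_diffP; exact: ex_derive.
- exact: continuous_subspaceT.
- by lra.
rewrite -EFinB; congr EFin; rewrite /F; field.
by rewrite gt_eqF.
Qed.

End bump.

(** * Products of functions of one coordinate *)

Section products.
Context {R : realType}.
Local Notation leb := (@lebesgue_measure R).
Local Notation lebn n := (@lebesgue_rV R n).

Definition prodf n (k : 'I_n -> R -> R) (x : 'rV[R]_n) : R := \prod_i k i (x 0 i).

Lemma prodf_cons n (k : 'I_n.+1 -> R -> R) (z : R * 'rV[R]_n) :
  prodf k (rV_cons z) = k ord0 z.1 * prodf (fun i => k (lift ord0 i)) z.2.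
Proof.
rewrite /prodf big_ord_recl rV_cons_coord0; congr (_ * _).
by apply: eq_bigr => i _; rewrite rV_cons_coordS.
Qed.

Lemma prodf_ge0 n (k : 'I_n -> R -> R) x : (forall i s, 0 <= k i s) -> 0 <= prodf k x.
Proof. by move=> k0; apply: prodr_ge0. Qed.

Lemma measurable_prodf n (k : 'I_n -> R -> R) :
  (forall i, measurable_fun setT (k i)) -> measurable_fun setT (prodf k).
Proof.
move=> mk; rewrite /prodf; elim: (index_enum _) => [|i s IH].
  by under eq_fun do rewrite big_nil; exact: measurable_cst.
under eq_fun do rewrite big_cons; apply: measurable_funM => //.
by apply: (measurableT_comp (f := k i)) => //; exact: measurable_coord.
Qed.

(** Lebesgue measure on 'rV_n is built one coordinate at a time, so the integral
    factors by induction on n. *)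
Lemma integral_prodf n (k : 'I_n -> R -> R) (c : 'I_n -> R) :
  (forall i s, 0 <= k i s) -> (forall i, measurable_fun setT (k i)) ->
  (forall i, (\int[leb]_s (k i s)%:E = (c i)%:E)%E) ->
  (\int[lebn n]_x (prodf k x)%:E = (\prod_i c i)%:E)%E.
Proof.
elim: n => [|n IH] in k c *.
  move=> k0 mk kc; rewrite integral_dirac//; last first.
    by apply/measurable_EFinP; exact: measurable_prodf.
  by rewrite diracT mul1e /prodf !big_ord0.
move=> k0 mk kc; rewrite ge0_integral_pushforward//; first last.
- by move=> x _; rewrite lee_fin prodf_ge0.
- by apply/measurable_EFinP; exact: measurable_prodf.
- exact: measurable_rV_cons.
rewrite preimage_setT fubini_tonelli1//=; first last.
- by move=> x; rewrite lee_fin prodf_ge0.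
- apply/measurable_EFinP; apply: measurableT_comp; last exact: measurable_rV_cons.
  exact: measurable_prodf.
rewrite /fubini_F /=.
under eq_integral => t _.
  under eq_integral do rewrite prodf_cons EFinM /=.
  rewrite ge0_integralZl_EFin//; last 2 first.
  - by move=> x _; rewrite lee_fin prodf_ge0.
  - by apply/measurable_EFinP; exact: measurable_prodf.
  rewrite (IH _ (fun i => c (lift ord0 i)))//.
  rewrite muleC; over.
rewrite ge0_integralZl_EFin//; last first.
- by apply: prodr_ge0 => i _; rewrite -lee_fin -kc; apply: integral_ge0 => s _; rewrite lee_fin.
- by apply/measurable_EFinP; exact: mk.
- by move=> s _; rewrite lee_fin.
by rewrite kc -EFinM big_ord_recl mulrC.
Qed.

Lemma prodf_out n (e : R) (k : 'I_n -> R -> R) x :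
  (forall i, nice1 e (k i)) -> e <= `|x| -> 0 < e -> prodf k x = 0.
Proof.
move=> ke ex e0.
have [i ix] : exists i, e <= `|x 0 i|.
  apply: contrapT => /forallNP H.
  have [c c0 xc] : exists2 c, 0 <= c < e & forall i, `|x 0 i| <= c.
    exists (\big[Num.max/0]_i `|x 0 i|); last by move=> i; exact: le_bigmax.
    apply/andP; split; first exact: bigmax_ge_id.
    by apply/bigmax_ltP; split => // i _; rewrite ltNge; apply/negP/H.
  by have := norm_le_coord (proj1 (andP c0)) xc; case/andP: c0 => _ ce; rewrite leNgt (lt_le_trans ce).
have [C [_ _ _ kC]] := ke i.
by rewrite /prodf (bigD1 i)//= kC// mul0r.
Qed.

Lemma prodf_nice n (e : R) (k : 'I_n -> R -> R) : (forall i, nice1 e (k i)) ->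
  exists C, [/\ 0 <= C, (forall x, `|prodf k x| <= C) &
    (forall x y, `|prodf k x - prodf k y| <= C * `|x - y|)].
Proof.
move=> ke; rewrite /prodf; elim: (index_enum _) => [|i s [C [C0 kC kL]]].
  exists 1; split => // [x|x y]; rewrite !big_nil ?normr1// subrr normr0 mul1r//.
have [B [B0 kB kBL _]] := ke i; exists (B * C + B * C + B * C); split.
- by rewrite !addr_ge0// mulr_ge0.
- by move=> x; rewrite big_cons normrM; apply: (@le_trans _ _ (B * C));
   [exact: ler_pM|rewrite lerDr addr_ge0// mulr_ge0].
- move=> x y; rewrite !big_cons.
  set a := k i _; set b := k i _; set P := \prod_(_ <- s) _; set Q := \prod_(_ <- s) _.
  rewrite (_ : _ - _ = a * (P - Q) + (a - b) * Q); last by ring.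
  apply: (@le_trans _ _ (B * (C * `|x - y|) + (B * `|x - y|) * C)).
    apply: le_trans (ler_normD _ _) _; rewrite !normrM.
    have xy : `|x 0 i - y 0 i| <= `|x - y| by have := coord_le_norm (x - y) i; rewrite !mxE.
    apply: lerD; apply: ler_pM => //; [exact: kB|exact: kL| |exact: kC].
    by apply: le_trans (kBL _ _) _; rewrite ler_wpM2l.
  have : 0 <= B * C * `|x - y| by rewrite !mulr_ge0.
  by set w := _ * _ * _ => w0; rewrite [leLHS](_ : _ = w + w) 1?[leRHS](_ : _ = w + w + w) ?lerDl// /w; ring.
Qed.

Definition upd n (k : 'I_n -> R -> R) i (f : R -> R) : 'I_n -> R -> R :=
  fun j => if j == i then f else k j.

Lemma is_derive_prodf n (k : 'I_n -> R -> R) i dk x :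
  (forall s, is_derive s (1 : R) (k i) (dk s)) ->
  is_derive x (delta_mx 0 i : 'rV[R]_n) (prodf k) (prodf (upd k i dk) x).
Proof.
move=> dki; apply: is_derive_line0.
pose P := \prod_(j < n | j != i) k j (x 0 j).
have -> : (fun c : R => prodf k (x + c *: delta_mx 0 i)) = (fun c => P * k i (x 0 i + c)).
  apply/funext => c; rewrite /prodf (bigD1 i)//= mulrC; congr (_ * k i _).
    by apply: eq_bigr => j ji; rewrite !mxE eqxx/= (negbTE ji) mulr0 addr0.
  by rewrite !mxE !eqxx mulr1.
have -> : prodf (upd k i dk) x = P *: dk (x 0 i + 0).
  rewrite /prodf (bigD1 i)//= mulrC /upd eqxx addr0; congr (_ * _).
  by apply: eq_bigr => j ji; rewrite (negbTE ji).
apply: (@is_deriveZ _ _ _ (fun c => k i (x 0 i + c))).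
have d1 : is_derive (0 : R) (1 : R) (fun c => x 0 i + c) 1.
  by apply: (@is_derive_quad _ _ _ _ 0) => h; rewrite mul0r (_ : _ - _ = 0) ?normr0//; ring.
by have := is_derive1_comp (g := fun c => x 0 i + c) (dki (x 0 i + 0)) d1; rewrite mulr1.
Qed.

(** Indicator functions of cubes in product form, so that [integral_prodf] computes
    their integrals. *)
Definition box1 (a r s : R) : R := if `|a - s| <= r then 1 else 0.

Definition boxf n (r : R) (w q : 'rV[R]_n) : R :=
  prodf (fun i => box1 (w 0 i) r) q.

Lemma boxf_ge0 n r (w q : 'rV[R]_n) : 0 <= boxf r w q.
Proof. by apply: prodf_ge0 => i s; rewrite /box1; case: ifP. Qed.

Lemma boxf1 n r (w q : 'rV[R]_n) : `|w - q| <= r -> boxf r w q = 1.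
Proof.
move=> wq; apply: big1 => i _; rewrite /box1 ifT// (le_trans _ wq)//.
by have := coord_le_norm (w - q) i; rewrite !mxE.
Qed.

Lemma box1E (a r : R) : box1 a r = \1_(`[(a - r)%R, (a + r)%R]%classic).
Proof.
apply/funext => s; rewrite indicE /box1 ler_norml.
rewrite (_ : (s \in _) = (- r <= a - s <= r)); first by case: ifP.
by apply/idP/idP; rewrite inE /= in_itv /= => /andP[? ?]; apply/andP; split; lra.
Qed.

Lemma measurable_boxf1 (a r : R) : measurable_fun setT (box1 a r).
Proof.
rewrite (_ : box1 a r = \1_(`[(a - r)%R, (a + r)%R]%classic)); last exact: box1E.
exact: measurable_indic.
Qed.

Lemma integral_box1 (a r : R) : 0 <= r -> (\int[leb]_s (box1 a r s)%:E = (2 * r)%:E)%E.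
Proof.
move=> r0; rewrite box1E.
transitivity (leb `[(a - r)%R, (a + r)%R]%classic).
  by rewrite integral_indic// setIT.
rewrite lebesgue_measure_itv/= lte_fin.
case: ifPn => [_|]; first by rewrite -EFinB; congr EFin; ring.
by rewrite -leNgt => H; congr EFin; lra.
Qed.

Lemma integral_boxf n r (w : 'rV[R]_n) : 0 <= r ->
  (\int[lebn n]_q (boxf r w q)%:E = ((2 * r) ^+ n)%:E)%E.
Proof.
move=> r0; rewrite (@integral_prodf _ _ (fun=> 2 * r))//.
- by rewrite prodr_const card_ord.
- by move=> i s; rewrite /box1; case: ifP.
- by move=> i; exact: measurable_boxf1.
- by move=> i; exact: integral_box1.
Qed.

Lemma measurable_boxf n r (w : 'rV[R]_n) : measurable_fun setT (boxf r w).
Proof. by apply: measurable_prodf => i; exact: measurable_boxf1. Qed.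

Lemma integrable_boxf n r (w : 'rV[R]_n) : 0 <= r ->
  (lebn n).-integrable setT (EFin \o boxf r w).
Proof.
move=> r0; apply/integrableP; split; first by apply/measurable_EFinP; exact: measurable_boxf.
rewrite (eq_integral (fun q => (boxf r w q)%:E)); first by rewrite integral_boxf// ltry.
by move=> q _ /=; rewrite ger0_norm// boxf_ge0.
Qed.

End products.

(** * Mollification *)

Lemma local_lip_continuous (R : realType) (V : normedModType R) (f : V -> R) (C : R) : 0 <= C ->
  (forall w w', `|w - w'| <= 1 -> `|f w - f w'| <= C * `|w - w'|) -> continuous f.
Proof.
move=> C0 CL; have C1 : 0 < C + 1 by rewrite ltr_wpDl.
move=> w; apply/cvgrPdist_le => d d0; near=> w'.
have ww : `|w - w'| <= Num.min 1 (d / (C + 1)).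
  near: w'; apply: (@cvgr_dist_le _ _ _ (nbhs w) _ id w) => //.
  by rewrite lt_min ltr01 divr_gt0.
apply: le_trans (CL _ _ _) _; first by move: ww; rewrite le_min => /andP[].
apply: (@le_trans _ _ ((C + 1) * `|w - w'|)); first by rewrite ler_wpM2r// lerDl.
by move: ww; rewrite le_min => /andP[_]; rewrite ler_pdivlMr// mulrC.
Unshelve. all: by end_near. Qed.

Section mollification.
Context {R : realType} (n : nat).
Local Notation lebn := (@lebesgue_rV R n).
Implicit Types (k : 'I_n -> R -> R) (g : 'rV[R]_n -> R) (w q : 'rV[R]_n).

(** Convolution with a product kernel; the factors may differ, which covers both the
    mollification and its partial derivatives. *)
Definition moll k g w : R := \int[lebn]_q (prodf k (w - q) * g q).

Lemma prodf_shift k w q : prodf k (w - q) = prodf (fun i s => k i (w 0 i - s)) q.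
Proof. by apply: eq_bigr => i _; rewrite !mxE. Qed.

Lemma continuous_prodf k : (forall i, continuous (k i)) -> continuous (prodf k).
Proof.
move=> ck x; rewrite /prodf; elim: (index_enum _) => [|i s IH].
  by rewrite (_ : (fun _ => _) = cst 1); [exact: cst_continuous|apply/funext => y; rewrite big_nil].
rewrite (_ : (fun _ => _) = (fun x : 'rV[R]_n => k i (x 0 i) * \prod_(j <- s) k j (x 0 j))); last first.
  by apply/funext => y; rewrite big_cons.
apply: continuousM => //.
by apply: (@continuous_comp _ _ _ (fun x : 'rV[R]_n => x 0 i) (k i)); [exact: coord_continuous|exact: ck].
Qed.

Lemma measurable_prodf_shift k w e : (forall i, nice1 e (k i)) ->
  measurable_fun setT (fun q => prodf k (w - q)).
Proof.
move=> ke; under eq_fun do rewrite prodf_shift.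
apply: measurable_prodf => i; apply: continuous_measurable_fun => s.
apply: (@continuous_comp _ _ _ (fun s => w 0 i - s) (k i)); last exact: nice_continuous (ke i) _.
by apply: cvgB; [exact: cvg_cst|exact: cvg_id].
Qed.

(** A majorant of the translated kernel that serves for all centers at distance at
    most one: the source of the uniform constants below. *)
Lemma prodf_le_boxf k e C w w' q : 0 < e -> (forall i, nice1 e (k i)) -> 0 <= C ->
  (forall x, `|prodf k x| <= C) -> `|w - w'| <= 1 ->
  `|prodf k (w' - q)| <= C * boxf (e + 1) w q.
Proof.
move=> e0 ke C0 kC ww; have [ew|ew] := leP e `|w' - q|.
  by rewrite (prodf_out ke)// normr0 mulr_ge0// boxf_ge0.
rewrite boxf1 ?mulr1//; apply: le_trans (ler_distD w' _ _) _.
by rewrite addrC lerD// ltW.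
Qed.

Lemma moll_integrable k g w e M : 0 < e -> (forall i, nice1 e (k i)) ->
  measurable_fun setT g -> (forall q, `|g q| <= M) ->
  lebn.-integrable setT (EFin \o (fun q => prodf k (w - q) * g q)).
Proof.
move=> e0 ke mg gM; have [C [C0 kC _]] := prodf_nice ke.
apply: (@le_integrabler _ _ _ _ _ _ _ (fun q => (M * C) * boxf (e + 1) w q)) => //.
- by apply: measurable_funM => //; exact: measurable_prodf_shift ke.
- move=> q _; rewrite normrM mulrC -mulrA; apply: ler_pM => //.
  by apply: prodf_le_boxf; rewrite // subrr normr0.
- by apply: integrableZr => //; apply: integrable_boxf; rewrite addr_ge0// ltW.
Qed.

(** The kernel is Lipschitz and both translates are supported in one common cube, so
    the difference of the integrals is bounded by the Lipschitz constant times the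
    volume of that cube. *)
Lemma moll_local_lip k g e M : 0 < e -> (forall i, nice1 e (k i)) ->
  measurable_fun setT g -> (forall q, `|g q| <= M) ->
  exists2 C, 0 <= C & forall w w', `|w - w'| <= 1 ->
    `|moll k g w - moll k g w'| <= C * `|w - w'|.
Proof.
move=> e0 ke mg gM; have [C [C0 kC kL]] := prodf_nice ke.
have M0 : 0 <= M by apply: le_trans (gM 0).
have e1 : 0 <= e + 1 by rewrite addr_ge0// ltW.
exists (M * C * (2 * (e + 1)) ^+ n); first by rewrite !mulr_ge0// exprn_ge0// mulr_ge0.
move=> w w' ww.
have H w0 := moll_integrable w0 e0 ke mg gM.
rewrite /moll -RintegralB//.
apply: (@le_trans _ _ (\int[lebn]_q ((M * C * `|w - w'|) * boxf (e + 1) w q))).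
  apply: ae_normr_Rintegral_le => //.
  - exact: integrableBr.
  - by apply: integrableZr => //; exact: integrable_boxf.
  apply/aeW => q _; rewrite -mulrBl normrM mulrC -!mulrA; apply: ler_pM => //.
  have [H1|H1] := leP `|w - q| (e + 1).
    rewrite boxf1// mulr1; apply: le_trans (kL _ _) _.
    by rewrite opprB addrA subrK.
  rewrite !(prodf_out ke)// ?subrr ?normr0 ?mulr_ge0// ?boxf_ge0//.
    have H2 : `|w - q| <= `|w - w'| + `|w' - q| by exact: ler_distD.
    by rewrite -(lerD2l 1) addrC (le_trans (ltW H1))// (le_trans H2)// lerD2r.
  by apply: ltW; apply: lt_trans H1; rewrite ltrDl.
rewrite RintegralZl//; last exact: integrable_boxf.
rewrite [X in _ * X](_ : _ = (2 * (e + 1)) ^+ n); last by rewrite /Rintegral integral_boxf.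
by rewrite -!mulrA ler_wpM2l// ler_wpM2l// mulrC.
Qed.

Lemma moll_continuous k g e M : 0 < e -> (forall i, nice1 e (k i)) ->
  measurable_fun setT g -> (forall q, `|g q| <= M) -> continuous (moll k g).
Proof.
move=> e0 ke mg gM; have [C C0 CL] := moll_local_lip e0 ke mg gM.
exact: local_lip_continuous CL.
Qed.

Lemma moll_le k g w e M : 0 < e -> (forall i, nice1 e (k i)) ->
  measurable_fun setT g -> (forall q, `|g q| <= M) ->
  forall C, (forall x, `|prodf k x| <= C) -> `|moll k g w| <= M * C * (2 * (e + 1)) ^+ n.
Proof.
move=> e0 ke mg gM C kC; have C0 : 0 <= C by apply: le_trans (kC 0).
have e1 : 0 <= e + 1 by rewrite addr_ge0// ltW.
apply: (@le_trans _ _ (\int[lebn]_q (M * C * boxf (e + 1) w q))).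
  apply: ae_normr_Rintegral_le => //.
  - exact: moll_integrable e0 ke mg gM.
  - by apply: integrableZr => //; exact: integrable_boxf.
  apply/aeW => q _; rewrite normrM mulrC -mulrA; apply: ler_pM => //.
  by apply: prodf_le_boxf; rewrite // subrr normr0.
rewrite RintegralZl//; last exact: integrable_boxf.
by rewrite [X in _ * X](_ : _ = (2 * (e + 1)) ^+ n)// /Rintegral integral_boxf.
Qed.

(** Differentiation under the integral sign, by dominated convergence: the difference
    quotients of the kernel are bounded by a multiple of [boxf]. *)
Lemma moll_derive k g i dk e M w : 0 < e -> (forall i, nice1 e (k i)) -> nice1 e dk ->
  measurable_fun setT g -> (forall q, `|g q| <= M) ->
  (forall s, is_derive s (1 : R) (k i) (dk s)) ->
  is_derive w (delta_mx 0 i : 'rV[R]_n) (moll k g) (moll (upd k i dk) g w).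
Proof.
move=> e0 ke dke mg gM dki; apply: is_derive_line0.
have uke j : nice1 e (upd k i dk j) by rewrite /upd; case: ifP.
have [C [C0 kC _]] := prodf_nice uke.
pose f (c : R) q := prodf k (w + c *: delta_mx 0 i - q) * g q.
have df c q : is_derive c (1 : R) (f^~ q) (prodf (upd k i dk) (w + c *: delta_mx 0 i - q) * g q).
  have := is_derive_line (is_derive_prodf ((w - q) + c *: delta_mx 0 i) dki).
  move=> /(is_deriveZ (g q)); rewrite (_ : g q \*: _ = f^~ q).
    by congr is_derive; rewrite /GRing.scale/= mulrC addrAC.
  by apply/funext => z; rewrite /f mulrC addrAC.
have M0 : 0 <= M by apply: le_trans (gM 0).
have e1 : 0 <= e + 1 by rewrite addr_ge0// ltW.
have := @cvg_differentiation_under_integral R _ _ lebn f setT measurableT 0 (- 1) 1 _ _ _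
  (fun q => M * C * boxf (e + 1) w q) _ _ _.
have dE c q : partial1of2 f c q = prodf (upd k i dk) (w + c *: delta_mx 0 i - q) * g q.
  by rewrite partial1of2E; have [_ ->] := df c q.
have -> : (\int[lebn]_(y in setT) (partial1of2 f) 0 y) = moll (upd k i dk) g w.
  by apply: eq_Rintegral => q _; rewrite dE scale0r addr0.
move=> H.
have {}H : h^-1 *: (moll k g (w + (h *: (1 : R) + 0) *: delta_mx 0 i) - moll k g (w + 0 *: delta_mx 0 i))
   @[h --> (0:R)^'] --> moll (upd k i dk) g w.
  rewrite (_ : (fun _ => _) = (fun h => h^-1 *: (\int[lebn]_(y in setT) f (h + 0) y - \int[lebn]_(y in setT) f 0 y))).
    apply: H.
    - by rewrite /= in_itv/= ltrN10 ltr01.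
    - by move=> c _; exact: moll_integrable e0 ke mg gM.
    - by move=> c q _ _; have [] := df c q.
    - by move=> q; rewrite mulr_ge0// ?mulr_ge0// boxf_ge0.
    - by apply: integrableZr => //; exact: integrable_boxf.
    - move=> c q; rewrite /= in_itv/= => /andP[c1 c2] _; rewrite dE.
      rewrite normrM mulrC -mulrA; apply: ler_pM => //.
      apply: prodf_le_boxf => //; rewrite opprD addrA subrr sub0r normrN.
      apply: norm_le_coord => // j; rewrite !mxE eqxx/=; case: eqP => _; rewrite ?mulr0 ?normr0// mulr1.
      by rewrite ler_norml; apply/andP; split; lra.
  by apply/funext => h; rewrite (_ : h%:A = h)//; exact: mulr1.
split; first by apply/cvg_ex; eexists; exact: H.
exact: cvg_lim H.
Qed.

(** The kernel is nonnegative of mass one and supported in the e-cube, so the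
    mollification is a mean of values of g that lie within dl of c. *)
Lemma moll_bump_close g w e M c dl : 0 < e ->
  measurable_fun setT g -> (forall q, `|g q| <= M) ->
  {ae lebn, forall q, `|w - q| < e -> `|g q - c| <= dl} ->
  `|moll (fun=> bump e) g w - c| <= dl.
Proof.
move=> e0 mg gM gc; have ke (i : 'I_n) := nice_bump e0.
have I1 : \int[lebn]_q prodf (fun=> bump e) (w - q) = 1.
  rewrite /Rintegral; under eq_integral do rewrite prodf_shift.
  rewrite (@integral_prodf _ _ _ (fun=> 1))//.
  - by rewrite big1.
  - by move=> i s; exact: bump_ge0.
  - move=> i; apply: continuous_measurable_fun => s.
    apply: (@continuous_comp _ _ _ (fun s => w 0 i - s) (bump e)).
      by apply: cvgB; [exact: cvg_cst|exact: cvg_id].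
    exact: (nice_continuous (nice_bump e0)).
  - by move=> i; exact: integral_bump.
have ik cc : lebn.-integrable setT (EFin \o (fun q => prodf (fun=> bump e) (w - q) * cc)).
  exact: (moll_integrable w e0 ke (@measurable_cst _ _ _ _ setT cc) (fun=> lexx `|cc|)).
have ik1 : lebn.-integrable setT (EFin \o (fun q => prodf (fun=> bump e) (w - q))).
  by have := ik 1; congr (_.-integrable _ (_ \o _)); apply/funext => q; rewrite mulr1.
have -> : c = \int[lebn]_q (prodf (fun=> bump e) (w - q) * c).
  by rewrite RintegralZr// I1 mul1r.
have -> : dl = \int[lebn]_q (prodf (fun=> bump e) (w - q) * dl).
  by rewrite RintegralZr// I1 mul1r.
rewrite /moll -RintegralB//; last exact: moll_integrable e0 ke mg gM.
apply: ae_normr_Rintegral_le => //.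
  by apply: integrableBr => //; exact: moll_integrable e0 ke mg gM.
apply: filterS gc => q gc _.
have k0 : 0 <= prodf (fun=> bump e) (w - q) by apply: prodf_ge0 => *; exact: bump_ge0.
rewrite -mulrBr normrM ger0_norm//; have [ew|ew] := leP e `|w - q|.
  by rewrite (prodf_out ke)// !mul0r.
by rewrite ler_wpM2l// gc.
Qed.

End mollification.

(** * Measures determined by smooth test functions *)

Lemma cvg_prodr (R : realType) (I : Type) (r : seq I) (T : Type) (F : set_system T)
    (f : I -> T -> R) (l : I -> R) :
  Filter F -> (forall i, f i x @[x --> F] --> l i) ->
  (\prod_(i <- r) f i x) @[x --> F] --> \prod_(i <- r) l i.
Proof.
move=> FF fl; elim: r => [|i r IH].
  by under eq_fun do rewrite big_nil; rewrite big_nil; exact: cvg_cst.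
by under eq_fun do rewrite big_cons; rewrite big_cons; apply: cvgM.
Qed.

Section dominated.
Context {R : realType} d (T : measurableType d) (mu : {measure set T -> \bar R}).
Variable D : set T.
Hypothesis mD : measurable D.

Lemma Rintegral_dominated_cvg (f : nat -> T -> R) (g h : T -> R) :
  (forall k, measurable_fun D (f k)) -> measurable_fun D g ->
  {ae mu, forall x, D x -> f k x @[k --> \oo] --> g x} ->
  mu.-integrable D (EFin \o h) ->
  {ae mu, forall x, forall k, D x -> `|f k x| <= h x} ->
  \int[mu]_(x in D) f k x @[k --> \oo] --> \int[mu]_(x in D) g x.
Proof.
move=> mf mg fg hi fh.
have fg' : {ae mu, forall x, D x -> (f k x)%:E @[k --> \oo] --> (EFin \o g) x}.
  by apply: filterS fg => x fgx Dx; apply: cvg_EFin; [exact: nearW|exact: fgx].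
have fh' : {ae mu, forall x, forall k, D x -> (`|(f k x)%:E| <= (EFin \o h) x)%E}.
  by apply: filterS fh => x fhx k Dx; rewrite /= lee_fin; exact: fhx.
have [gi _ H] := @dominated_convergence _ _ _ mu D mD (fun k x => (f k x)%:E)
  (EFin \o g) (EFin \o h) (fun k => iffRL (measurable_EFinP _ _) (mf k))
  (iffRL (measurable_EFinP _ _) mg) fg' hi fh'.
apply: fine_cvg; rewrite /Rintegral fineK//.
exact: integrable_fin_num.
Qed.

Lemma Rintegral_bounded_cvg (f : nat -> T -> R) (g : T -> R) C : (mu D < +oo)%E ->
  (forall k, measurable_fun D (f k)) -> measurable_fun D g ->
  (forall x, D x -> f k x @[k --> \oo] --> g x) ->
  (forall k x, D x -> `|f k x| <= C) ->
  \int[mu]_(x in D) f k x @[k --> \oo] --> \int[mu]_(x in D) g x.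
Proof.
move=> muD mf mg fg fC; apply: (@Rintegral_dominated_cvg _ _ (cst C)) => //.
- exact: aeW.
- by apply: (@bounded_integrable _ _ _ _ _ _ _ `|C|) => //; exact: measurable_cst.
- by apply: aeW => x k Dx; exact: fC.
Qed.

End dominated.

Section box_tests.
Context {R : realType} {n : nat}.
Local Notation V := 'rV[R]_n.

Lemma differentiable_prodf (k : 'I_n -> R -> R) (x : V) :
  (forall i s, derivable (k i) s 1) -> differentiable (prodf k) x.
Proof.
move=> dk; rewrite /prodf; elim: (index_enum _) => [|i s IH].
  rewrite (_ : (fun _ => _) = cst 1); first exact: differentiable_cst.
  by apply/funext => y; rewrite big_nil.
rewrite (_ : (fun _ => _) = (fun x : V => k i (x 0 i)) * (fun x : V => \prod_(j <- s) k j (x 0 j))); last first.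
  by apply/funext => y; rewrite big_cons.
apply: differentiableM => //.
apply: (@differentiable_comp _ _ _ _ (fun x : V => x 0 i) (k i)).
  exact: differentiable_coord.
exact/derivable1_diffP.
Qed.

Lemma C1_prodf (k dk : 'I_n -> R -> R) :
  (forall i s, is_derive s (1 : R) (k i) (dk i s)) -> (forall i, continuous (dk i)) ->
  C1 (prodf k) /\ forall x, grad (prodf k) x = \row_i prodf (upd k i (dk i)) x.
Proof.
move=> dkk cdk.
have ck i : continuous (k i).
  move=> s; apply/differentiable_continuous/derivable1_diffP.
  by have [] := dkk i s.
have gE x : grad (prodf k) x = \row_i prodf (upd k i (dk i)) x.
  apply/rowP => i; rewrite !mxE.
  by have [_ ->] := is_derive_prodf x (dkk i).
split => //; split.
  by move=> x; apply: differentiable_prodf => i s; have [] := dkk i s.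
rewrite (_ : grad _ = (fun x => \row_i prodf (upd k i (dk i)) x)); last exact/funext.
apply: continuous_rV => i; under eq_fun do rewrite mxE.
by apply: continuous_prodf => j; rewrite /upd; case: ifP.
Qed.

Lemma Cc_prodf e (k : 'I_n -> R -> R) : 0 < e -> (forall i, nice1 e (k i)) -> Cc (prodf k).
Proof.
move=> e0 ke; split; first by apply: continuous_prodf => i; exact: nice_continuous (ke i).
apply: bounded_closed_compact; last exact: closed_closure.
have H : closure [set x : V | prodf k x != 0] `<=` [set x | `|x| <= e].
  have cl : closed [set x : V | `|x| <= e].
    apply: (@closed_comp _ _ (fun x : V => `|x|) [set y : R | y <= e]); last exact: closed_le.
    by move=> x _; exact: norm_continuous.
  rewrite (proj1 (closure_id _) cl); apply: closure_subset => x /= kx.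
  by rewrite leNgt; apply: contra kx => /ltW ex; rewrite (prodf_out ke).
exists e; split; first by rewrite num_real.
by move=> M eM x /H /= xe; apply: le_trans xe _; exact: ltW.
Qed.

(** The test functions common to all the weak formulations: they may be used in the
    flat distance, against charges and in Lipschitz tests. *)
Definition test_fun (f : V -> R) : Prop :=
  [/\ C1 f, Cc f, (exists2 C, 0 <= C & forall x y, `|f x - f y| <= C * `|x - y|),
   (exists2 C, 0 <= C & forall x i, `|grad f x 0 i| <= C) &
   forall x, 0 <= f x <= 1].

Definition box (a b : V) : set V := [set x | forall i, a 0 i < x 0 i < b 0 i].

(** For a bump h supported by one side of the box, h / (h + 1 / (m + 1)) is of class
    C^1, stays in [0, 1] and increases to 1 where h > 0; the approximation is the
    product of these functions over the coordinates. *)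
Lemma box_approx (a b : V) : exists f : nat -> V -> R,
  (forall m, test_fun (f m)) /\
  forall x, f m x @[m --> \oo] --> (\1_(box a b) x : R).
Proof.
(* a degenerate box is empty and its indicator is approximated by 0 *)
have [[i ab]|/forallNP ab] := pselect (exists i, b 0 i <= a 0 i).
  exists (fun _ _ => 0); split.
    move=> _; split.
    - split => [x|]; first exact: differentiable_cst.
      rewrite (_ : grad _ = cst 0); first exact: cst_continuous.
      by apply/funext => x; apply/rowP => j; rewrite !mxE derive_cst.
    - split; first exact: cst_continuous.
      rewrite (_ : [set _ | _] = set0) ?closure0; first exact: compact0.
      by apply/seteqP; split => // x /=; rewrite eqxx.
    - by exists 0 => // x y; rewrite subrr normr0 mul0r.
    - by exists 0 => // x j; rewrite mxE derive_cst normr0.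
    - by move=> x; rewrite lexx ler01.
  move=> x; rewrite indicE memNset; first exact: cvg_cst.
  by move=> /(_ i) /andP[]/lt_trans/[apply]; rewrite ltNge ab.
have {}ab i : a 0 i < b 0 i by rewrite ltNge; apply/negP/ab.
pose rh i := (b 0 i - a 0 i) / 2; pose mi i := (a 0 i + b 0 i) / 2.
have rh0 i : 0 < rh i by rewrite divr_gt0// subr_gt0.
pose h i s := bump (rh i) (s - mi i).
pose dh i s := dbump (rh i) (s - mi i).
have h_ge0 i s : 0 <= h i s by exact: bump_ge0.
have dhh i s : is_derive s (1 : R) (h i) (dh i s).
  have d1 : is_derive s (1 : R) (fun s => s - mi i) 1.
    by apply: (@is_derive_quad _ _ _ _ 0) => h'; rewrite mul0r (_ : _ - _ = 0) ?normr0//; ring.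
  by have := is_derive1_comp (g := fun s => s - mi i) (is_derive_bump (s - mi i) (rh0 i)) d1; rewrite mulr1.
have ch i : continuous (h i).
  by move=> s; apply/differentiable_continuous/derivable1_diffP; have [] := dhh i s.
have cdh i : continuous (dh i).
  move=> s; apply: (@continuous_comp _ _ _ (fun s => s - mi i) (dbump (rh i))).
    by apply: cvgB; [exact: cvg_id|exact: cvg_cst].
  exact: nice_continuous (nice_dbump (rh0 i)) _.
pose k m i s := h i s / (h i s + m.+1%:R^-1).
pose dk m i s := m.+1%:R^-1 * dh i s / (h i s + m.+1%:R^-1) ^+ 2.
have dl0 m : 0 < (m.+1%:R^-1 : R) by [].
have den0 m i s : 0 < h i s + m.+1%:R^-1 by rewrite ltr_wpDl.
have dkk m i s : is_derive s (1 : R) (k m i) (dk m i s).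
  have d1 : is_derive s (1 : R) (fun s => h i s + m.+1%:R^-1) (dh i s).
    by have := is_deriveD (dhh i s) (is_derive_cst (m.+1%:R^-1 : R) s 1); rewrite addr0.
  have := is_deriveM (dhh i s) (is_deriveV (f := fun s => h i s + m.+1%:R^-1) (lt0r_neq0 (den0 m i s)) d1).
  congr is_derive; rewrite /GRing.scale /dk /=.
  move: (den0 m i s); move: (m.+1%:R^-1) => dl den; field.
  by rewrite lt0r_neq0.
have cdk m i : continuous (dk m i).
  move=> s; apply: cvgM; first by apply: cvgM; [exact: cvg_cst|exact: cdh].
  apply: cvgV; first by rewrite expf_neq0// lt0r_neq0.
  by apply: cvgM; apply: cvgD; (exact: ch || exact: cvg_cst).
have k01 m i s : 0 <= k m i s <= 1.
  rewrite divr_ge0 ?(ltW (den0 m i s))//= ler_pdivrMr// mul1r lerDl//.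
(* |h'| (1/(m+1)) / (h + 1/(m+1))^2 is at most (m+1) |h'| *)
pose B m := \sum_i m.+1%:R * (15 / (4 * rh i ^+ 2)).
have Bi m i : 0 <= m.+1%:R * (15 / (4 * rh i ^+ 2)).
  by rewrite mulr_ge0// divr_ge0// mulr_ge0// exprn_ge0// ltW.
have B0 m : 0 <= B m by apply: sumr_ge0 => i _.
have dkC m i s : `|dk m i s| <= B m.
  apply: (@le_trans _ _ (m.+1%:R * (15 / (4 * rh i ^+ 2)))); last first.
    by rewrite /B (bigD1 i)//= lerDl; apply: sumr_ge0.
  have C0 : 0 <= 15 / (4 * rh i ^+ 2) by rewrite divr_ge0// mulr_ge0// exprn_ge0// ltW.
  have dC : `|dh i s| <= 15 / (4 * rh i ^+ 2) by exact: dbump_le.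
  rewrite /dk 2!normrM (gtr0_norm (dl0 m)) normfV (gtr0_norm (exprn_gt0 2 (den0 m i s))).
  rewrite ler_pdivrMr ?exprn_gt0//.
  apply: (@le_trans _ _ (m.+1%:R * (15 / (4 * rh i ^+ 2)) * m.+1%:R^-1 ^+ 2)).
    rewrite (_ : _ * _ ^+ 2 = m.+1%:R^-1 * (15 / (4 * rh i ^+ 2))); last first.
      by field; rewrite gt_eqF//= lt0r_neq0.
    by rewrite ler_wpM2l// ltW.
  by rewrite ler_wpM2l// lerXn2r// ?nnegrE ?(ltW (den0 m i s)) ?(ltW (dl0 m))// lerDr.
pose e := 1 + \sum_i (`|mi i| + rh i).
have ei i : `|mi i| + rh i <= e.
  rewrite /e (bigD1 i)//= addrCA lerDl addr_ge0//; apply: sumr_ge0 => j _.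
  by rewrite addr_ge0// ltW.
have e0 : 0 < e by rewrite ltr_wpDr//; apply: sumr_ge0 => j _; rewrite addr_ge0// ltW.
have h_out i s : e <= `|s| -> h i s = 0.
  move=> es; rewrite /h bump_out//.
  have := ei i; have := lerB_dist s (mi i); lra.
have kn m i : nice1 e (k m i).
  exists (1 + B m); split.
  - by rewrite addr_ge0.
  - move=> s; have /andP[k0 k1] := k01 m i s; rewrite ger0_norm//.
    by apply: le_trans k1 _; rewrite lerDl.
  - move=> s t; apply: le_trans (derive_lip (dkk m i) (dkC m i) s t) _.
    by rewrite ler_wpM2r// lerDr.
  - by move=> s es; rewrite /k h_out// mul0r.
exists (fun m => prodf (k m)); split.
  move=> m; have [C1k gE] := C1_prodf (dkk m) (cdk m).
  split => //.
  - exact: (Cc_prodf e0).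
  - by have [C [C0 _ kC]] := prodf_nice (kn m); exists C.
  - exists (B m) => // x i; rewrite gE mxE /prodf (bigD1 i)//= /upd eqxx normrM.
    rewrite -[leRHS]mulr1; apply: ler_pM => //.
    rewrite normr_prod; apply: prodr_ile1 => j /negbTE ->.
    by rewrite normr_ge0/=; have /andP[k0 k1] := k01 m j (x 0 j); rewrite ger0_norm.
  - move=> x; apply/andP; split; first by apply: prodf_ge0 => i s; have /andP[] := k01 m i s.
    by apply: prodr_ile1 => i _; exact: k01.
move=> x; rewrite indicE.
have [bx|bx] := pselect (box a b x).
  rewrite mem_set//.
  have H i : k m i (x 0 i) @[m --> \oo] --> (1 : R).
    have hx : 0 < h i (x 0 i).
      apply: bump_gt0 => //; have /andP[x1 x2] := bx i.
      by rewrite ltr_norml /rh /mi; apply/andP; split; lra.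
    rewrite -[X in _ --> X](mulfV (lt0r_neq0 hx)); apply: cvgM; first exact: cvg_cst.
    apply: cvgV; first exact: lt0r_neq0.
    rewrite -[X in _ --> X]addr0; apply: cvgD; first exact: cvg_cst.
    exact: cvg_harmonic.
  rewrite /prodf -[X in _ --> X](_ : \prod_(i < n) 1 = 1); last by rewrite big1.
  exact: cvg_prodr.
have [i xi] : exists i, ~~ (a 0 i < x 0 i < b 0 i).
  by apply: contrapT => /forallNP H; apply: bx => i; apply/negPn/negP/H.
rewrite memNset// (_ : (fun _ => _) = cst 0); first exact: cvg_cst.
apply/funext => m; rewrite /prodf (bigD1 i)//= /k (_ : h i (x 0 i) = 0) ?mul0r//.
apply: bump_out => //; rewrite leNgt; apply: contra xi; rewrite ltr_norml /rh /mi => /andP[x1 x2].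
by apply/andP; split; lra.
Qed.

Lemma box_measurable (a b : V) : measurable (box a b).
Proof.
rewrite (_ : box a b = \bigcap_(i in [set: 'I_n]) (fun x : V => x 0 i) @^-1` `]a 0 i, b 0 i[).
  apply: fin_bigcap_measurable => // i _; rewrite -[X in measurable X]setTI.
  by apply: measurable_coord => //.
apply/seteqP; split => [x bx i _|x bx i]; first by rewrite /= in_itv/= bx.
by have := bx i I; rewrite /= in_itv.
Qed.

Definition boxes : set (set V) := [set box ab.1 ab.2 | ab in [set: V * V]].

Lemma boxes_setI : setI_closed boxes.
Proof.
move=> _ _ [[a b] _ <-] [[c d] _ <-] /=.
exists (\row_i Num.max (a 0 i) (c 0 i), \row_i Num.min (b 0 i) (d 0 i)) => //=.
apply/seteqP; split => x.
  by move=> H; split => i; have := H i; rewrite !mxE gt_max lt_min => /andP[/andP[? ?] /andP[? ?]]; apply/andP.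
move=> [H1 H2] i; have /andP[? ?] := H1 i; have /andP[? ?] := H2 i.
by rewrite !mxE gt_max lt_min; apply/andP; split; apply/andP.
Qed.

Definition cube (N : nat) : set V := box (\row_i (- N%:R)) (\row_i N%:R).

Lemma bigcup_cube : \bigcup_N cube N = setT.
Proof.
apply/seteqP; split => // x _; exists (Num.Def.truncn `|x|).+1 => // i; rewrite !mxE -ltr_norml.
by apply: le_lt_trans (coord_le_norm x i) _; have /andP[] := truncn_itv (normr_ge0 x).
Qed.

(** The coordinates generate the Borel sets, and the preimage of ]a, b[ under a
    coordinate is a countable union of boxes. *)
Lemma measurable_boxes : @measurable _ V = <<s boxes >>.
Proof.
apply/seteqP; split; last first.
  by apply: smallest_sub; [exact: sigma_algebra_measurable|move=> _ [ab _ <-]; exact: box_measurable].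
move=> A mA.
suff : measurable_fun setT (idfun : g_sigma_algebraType boxes -> V).
  by move=> /(_ measurableT _ mA); rewrite setTI.
apply: measurable_rV => i.
apply: (measurability _ (measurable_realfun.RGenOpens.measurableE R)).
move=> _ [_ [a [b ->]] <-]; rewrite setTI.
rewrite (_ : _ @^-1` _ = \bigcup_N (box (\row_j if j == i then a else - N%:R)
     (\row_j if j == i then b else N%:R))).
  apply: bigcup_measurable => N _; apply: sub_sigma_algebra.
  by exists (\row_j (if j == i then a else - N%:R), \row_j (if j == i then b else N%:R)).
apply/seteqP; split => x /=.
  rewrite in_itv/= => xab; have : setT x by []. rewrite -bigcup_cube => -[N _ Nx].
  exists N => // j; rewrite !mxE; case: eqP => [->//|_]; have := Nx j; rewrite !mxE//.
by move=> [N _ /(_ i)]; rewrite !mxE eqxx in_itv.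
Qed.

End box_tests.

Section box_measures.
Context {R : realType} {n : nat}.
Local Notation V := 'rV[R]_n.

Lemma test_fun_measurable (f : V -> R) : test_fun f -> measurable_fun setT f.
Proof. by move=> [_ [cf _] _ _ _]; exact: measurable_continuous_rV. Qed.

Lemma box_integral_cvg (m : {measure set V -> \bar R}) (a b : V) (f : nat -> V -> R) :
  (m setT < +oo)%E -> (forall k, test_fun (f k)) ->
  (forall x, f k x @[k --> \oo] --> (\1_(box a b) x : R)) ->
  \int[m]_x f k x @[k --> \oo] --> fine (m (box a b)).
Proof.
move=> mT tf fb.
rewrite (_ : fine _ = \int[m]_x (\1_(box a b) x)); last first.
  rewrite /Rintegral integral_indic ?setIT//; exact: box_measurable.
apply: (@Rintegral_bounded_cvg _ _ _ _ _ measurableT _ _ 1) => //.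
- by move=> k; exact: test_fun_measurable.
- by apply: measurable_indic; exact: box_measurable.
- by move=> k x _; have [_ _ _ _ /(_ x)/andP[f0 f1]] := tf k; rewrite ger0_norm.
Qed.

(** Integrals of the approximations of [box_approx] converge to the measures of boxes,
    which form a generating family stable under intersection. *)
Lemma box_measure_unique (m1 m2 : {measure set V -> \bar R}) :
  (m1 setT < +oo)%E -> (m2 setT < +oo)%E ->
  (forall f, test_fun f -> \int[m1]_x f x = \int[m2]_x f x) ->
  forall A, measurable A -> m1 A = m2 A.
Proof.
move=> f1 f2 m12.
have lt (m : {measure set V -> \bar R}) A : (m setT < +oo)%E -> measurable A -> (m A < +oo)%E.
  by move=> mT mA; apply: le_lt_trans mT; apply: le_measure; rewrite ?inE.
apply: (measure_unique boxes cube measurable_boxes boxes_setI _ bigcup_cube).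
- by move=> N; exists (\row_i (- N%:R), \row_i N%:R).
- move=> _ [[a b] _ <-] /=; have [f [tf fb]] := box_approx a b.
  have mb := box_measurable a b.
  have n1 : m1 (box a b) \is a fin_num by rewrite ge0_fin_numE//; exact: lt.
  have n2 : m2 (box a b) \is a fin_num by rewrite ge0_fin_numE//; exact: lt.
  rewrite -(fineK n1) -(fineK n2); congr EFin.
  have H1 := box_integral_cvg f1 tf fb; have H2 := box_integral_cvg f2 tf fb.
  move: H1; rewrite (_ : (fun k => \int[m1]_x f k x) = (fun k => \int[m2]_x f k x)).
    by move=> H1; exact: cvg_unique H1 H2.
  by apply/funext => k; exact: m12.
- by move=> k; apply: lt => //; exact: box_measurable.
Qed.

(** The same approximation, followed by a Dynkin argument, turns measurability in t of
    the integrals of smooth functions into the kernel property. *)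
Lemma box_measurable_kernel d (T : measurableType d) (D : set T) (m : T -> probability V R) :
  measurable D ->
  (forall f, test_fun f -> measurable_fun D (fun t => \int[m t]_x f x)) ->
  forall A, measurable A -> measurable_fun D (fun t => m t A).
Proof.
move=> mD mf A; rewrite measurable_boxes => mA.
apply: (@dynkin_induction _ V boxes (fun A => measurable_fun D (fun t => m t A)) measurable_boxes boxes_setI _ _ _ _ _ mA).
- by under eq_fun do rewrite probability_setT; exact: measurable_cst.
- move=> _ [[a b] _ <-] /=; have [f [tf fb]] := box_approx a b.
  have mb := box_measurable a b.
  under eq_fun => t do rewrite -(@fineK _ (m t (box a b))) ?fin_num_measure//.
  apply/measurable_EFinP.
  apply: (@measurable_fun_cvg _ _ _ D (fun k t => \int[m t]_x f k x)).
  + by move=> k; exact: mf.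
  + move=> t _; apply: box_integral_cvg => //.
    by apply: (le_lt_trans (probability_le1 (m t) measurableT)); rewrite ltry.
- move=> S mS H; under eq_fun do rewrite probability_setC//.
  by apply: emeasurable_funB => //; exact: measurable_cst.
- move=> F mF tF H.
  under eq_fun do rewrite measure_bigcup//=.
  apply: ge0_emeasurable_sum => // k _; exact: H.
Qed.

End box_measures.

(** * Kernels and product measures *)

Section kernels.
Context {R : realType} {n : nat}.
Local Notation V := 'rV[R]_n.
Context d (X : measurableType d) (l : X -> probability V R).
Hypothesis ml : forall A, measurable A -> measurable_fun setT (fun t => l t A).

Let kl : X -> {measure set V -> \bar R} := l.

HB.instance Definition _ := @isKernel.Build _ _ X V R kl ml.
Let kl1 x : kl x setT = 1%E. Proof. exact: probability_setT. Qed.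
HB.instance Definition _ := @Kernel_isProbability.Build _ _ X V R kl kl1.

Lemma measurable_int_kernel (k : X * V -> \bar R) :
  (forall z, (0 <= k z)%E) -> measurable_fun setT k ->
  measurable_fun setT (fun x => \int[l x]_y k (x, y))%E.
Proof. by move=> k0 mk; exact: (measurable_fun_integral_finite_kernel k kl). Qed.

Lemma measurable_Rint_kernel (k : X * V -> R) : measurable_fun setT k ->
  measurable_fun setT (fun x => \int[l x]_y k (x, y)).
Proof.
move=> mk; rewrite /Rintegral; apply: measurableT_comp => //.
under eq_fun do rewrite integralE.
apply: emeasurable_funB.
  rewrite [X in measurable_fun _ X](_ : _ = (fun x => \int[l x]_y ((EFin \o k)^\+%E (x, y)))%E); last first.
    by apply/funext => x; apply: eq_integral => y _; rewrite !funeposE.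
  apply: (@measurable_int_kernel ((EFin \o k)^\+)%E) => //.
  by apply: measurable_funepos; exact/measurable_EFinP.
rewrite [X in measurable_fun _ X](_ : _ = (fun x => \int[l x]_y ((EFin \o k)^\-%E (x, y)))%E); last first.
  by apply/funext => x; apply: eq_integral => y _; rewrite !funenegE.
apply: (@measurable_int_kernel ((EFin \o k)^\-)%E) => //.
by apply: measurable_funeneg; exact/measurable_EFinP.
Qed.

End kernels.

Section product_ae.
Context {R : realType} d1 d2 (T1 : measurableType d1) (T2 : measurableType d2).
Variables (m1 : {sigma_finite_measure set T1 -> \bar R})
  (m2 : {sigma_finite_measure set T2 -> \bar R}).

Lemma ae_sections (P : T1 -> T2 -> Prop) :
  {ae (m1 \x m2)%E, forall z, P z.1 z.2} ->
  {ae m1, forall x, {ae m2, forall y, P x y}}.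
Proof.
move=> [N [mN N0 PN]].
have H : (\int[m1]_x m2 (xsection N x) = 0)%E by exact: N0.
have mx : measurable_fun setT (m2 \o xsection N) by exact: measurable_fun_xsection.
have H2 : ae_eq m1 setT (m2 \o xsection N) (cst 0%E).
  apply/ae_eq_integral_abs => //.
  by rewrite -[RHS]H; apply: eq_integral => x _ /=; rewrite gee0_abs.
apply: filterS H2 => x /(_ I) /= Hx.
exists (xsection N x); split => //; first exact: measurable_xsection.
move=> y nP; rewrite /xsection /= inE; apply: PN; exact: nP.
Qed.

(** The converse of [ae_sections]: by Tonelli the measure of a measurable set is the
    integral of the measures of its sections. *)
Lemma ae_of_sections (A : set (T1 * T2)) : measurable A ->
  {ae m1, forall x, {ae m2, forall y, A (x, y)}} ->
  {ae (m1 \x m2)%E, forall z, A z}.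
Proof.
move=> mA H; exists (~` A); split => //; first exact: measurableC.
have mC : measurable (~` A) by exact: measurableC.
rewrite -[LHS]/(\int[m1]_x m2 (xsection (~` A) x))%E.
rewrite (@ae_eq_integral _ _ _ m1 setT (cst 0%E))//.
- exact: integral0.
- exact: measurable_fun_xsection.
- apply: filterS H => x [N [mN N0 AN]] _ /=.
  apply: (@subset_measure0 _ _ _ m2 _ N) => //; first exact: measurable_xsection.
  by move=> y; rewrite /xsection /= inE => nA; apply: AN.
Qed.

Lemma ae_fst (Q : T1 -> Prop) : {ae m1, forall x, Q x} ->
  {ae (m1 \x m2)%E, forall z, Q z.1}.
Proof.
move=> [N [mN N0 QN]]; exists (N `*` setT); split.
- exact: measurableX.
- transitivity (0 * m2 setT)%E; last exact: mul0e.
  by rewrite -[X in (X * _)%E]N0; exact: product_measure1E.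
- by move=> z /= nQ; split => //; exact: QN.
Qed.

Lemma Rint_Fubini (f : T1 * T2 -> R) :
  (m1 \x m2)%E.-integrable setT (EFin \o f) ->
  (forall x, m2.-integrable setT (fun y => (f (x, y))%:E)) ->
  \int[(m1 \x m2)%E]_z f z = \int[m1]_x \int[m2]_y f (x, y).
Proof.
move=> fi f2; rewrite /Rintegral -(integral12_prod_meas1 fi)//=; congr fine.
apply: eq_integral => x _ /=; rewrite /fubini_F /= fineK//.
by apply: integrable_fin_num => //; exact: f2.
Qed.

Lemma Rint_Fubini2 (f : T1 * T2 -> R) :
  (m1 \x m2)%E.-integrable setT (EFin \o f) ->
  (forall y, m1.-integrable setT (fun x => (f (x, y))%:E)) ->
  \int[(m1 \x m2)%E]_z f z = \int[m2]_y \int[m1]_x f (x, y).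
Proof.
move=> fi f2; rewrite /Rintegral -(integral21_prod_meas1 fi)//=; congr fine.
apply: eq_integral => y _ /=; rewrite /fubini_G /= fineK//.
by apply: integrable_fin_num => //; exact: f2.
Qed.

End product_ae.

Section lebesgue_rV_facts.
Context {R : realType}.
Local Notation leb := (@lebesgue_measure R).
Local Notation lebn n := (@lebesgue_rV R n).

Lemma ae_rV_uncons n (P : R * 'rV[R]_n -> Prop) :
  {ae (leb \x lebn n)%E, forall z, P z} -> {ae lebn n.+1, forall w, P (rV_uncons w)}.
Proof.
move=> [N [mN N0 PN]]; exists (@rV_uncons R n @^-1` N); split.
- by rewrite -[X in measurable X]setTI; exact: measurable_rV_uncons.
- rewrite -[LHS]/((leb \x lebn n)%E (@rV_cons R n @^-1` (@rV_uncons R n @^-1` N))).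
  by rewrite -comp_preimage (_ : _ \o _ = id)//; apply/funext => z /=; rewrite rV_consK.
- by move=> w /= nP; apply: PN.
Qed.

Lemma integral_rV_cons n (f : 'rV[R]_n.+1 -> \bar R) : measurable_fun setT f ->
  (forall w, (0 <= f w)%E) ->
  (\int[lebn n.+1]_w f w = \int[(leb \x lebn n)%E]_z f (rV_cons z))%E.
Proof.
move=> mf f0; rewrite ge0_integral_pushforward//.
exact: measurable_rV_cons.
Qed.

Lemma Rint_rV_cons n (f : 'rV[R]_n.+1 -> R) : measurable_fun setT f ->
  \int[lebn n.+1]_w f w = \int[(leb \x lebn n)%E]_z f (rV_cons z).
Proof.
move=> mf; congr fine; rewrite [LHS]integralE [RHS]integralE; congr (_ - _)%E.
  rewrite integral_rV_cons//; last by apply: measurable_funepos; exact/measurable_EFinP.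
  by apply: eq_integral => z _; rewrite !funeposE.
rewrite integral_rV_cons//; last by apply: measurable_funeneg; exact/measurable_EFinP.
by apply: eq_integral => z _; rewrite !funenegE.
Qed.

Lemma integrable_rV_cons n (f : 'rV[R]_n.+1 -> R) :
  (lebn n.+1).-integrable setT (EFin \o f) ->
  (leb \x lebn n)%E.-integrable setT (fun z => (f (rV_cons z))%:E).
Proof.
move=> /integrableP[mf fi]; apply/integrableP; split.
  apply/measurable_EFinP; apply: (measurableT_comp (f := f)); first exact/measurable_EFinP.
  exact: measurable_rV_cons.
by move: fi; rewrite integral_rV_cons//; exact: measurableT_comp.
Qed.

(** A property that holds almost everywhere holds somewhere in each ball; this is what
    lets continuous functions forget null sets. *)
Lemma ball_not_null n (w : 'rV[R]_n) e : 0 < e ->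
  {ae lebn n, forall q, ~ (`|w - q| < e)} -> False.
Proof.
move=> e0 H.
have H1 c : `|moll (fun=> bump e) (fun=> 0) w - c| <= 0.
  apply: (@moll_bump_close _ _ _ _ _ 0) => //; first by move=> q; rewrite normr0.
  by apply: filterS H => q H /H.
move: (H1 0); rewrite subr0 normr_le0 => /eqP E.
by have := H1 1; rewrite E normr_le0 sub0r oppr_eq0 oner_eq0.
Qed.

Lemma lebn_setT_gt0 n : (0 < lebn n setT)%E.
Proof.
rewrite lt0e measure_ge0 andbT; apply/eqP => H.
apply: (@ball_not_null n 0 1) => //; exists setT; split => //.
Qed.

Lemma ess_sup_time_lty (T : R) (f : R -> \bar R) : (ess_sup_time T f < +oo)%E ->
  exists2 M, 0 <= M & {ae leb, forall t, t \in `]0, T[ -> (f t <= M%:E)%E}.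
Proof.
set S := ess_sup_time T f => Soo.
exists (Num.max 0 (fine S)); first by rewrite le_max lexx.
have [N [mN N0 fN]] := ess_sup_ge (mrestr leb (measurable_itv `]0, T[)) f.
exists (N `&` `]0, T[%classic); split.
- exact: measurableI.
- exact: N0.
- move=> t /= /not_implyP[tT ft]; split => //.
  apply: fN => /= fS; apply: ft; apply: le_trans fS _.
  change (S <= (Num.max 0 (fine S))%:E)%E; case: S Soo => [s| |] //= _; last by rewrite leNye.
  by rewrite lee_fin le_max lexx orbT.
Qed.

End lebesgue_rV_facts.

Lemma ae_mono {R : realType} d (T : measurableType d) (mu : {measure set T -> \bar R})
  (P Q : T -> Prop) : (forall x, P x -> Q x) -> {ae mu, forall x, P x} -> {ae mu, forall x, Q x}.
Proof. by move=> PQ; apply: filterS. Qed.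

Lemma ae_and {R : realType} d (T : measurableType d) (mu : {measure set T -> \bar R})
  (P Q : T -> Prop) : {ae mu, forall x, P x} -> {ae mu, forall x, Q x} ->
  {ae mu, forall x, P x /\ Q x}.
Proof. by move=> hP hQ; near=> x; split; near: x. Unshelve. all: by end_near. Qed.

Lemma within_continuous_comp (S T U : topologicalType) (A : set T) (f : T -> U) (c : S -> T) :
  (forall z, A (c z)) -> continuous c -> {within A, continuous f} -> continuous (f \o c).
Proof.
move=> Ac cc cf z.
have H := cf (c z).
have {}H : f y @[y --> within A (nbhs (c z))] --> f (c z).
  by apply: cvg_trans H; apply: cvg_app; rewrite -nbhs_subspace_in.
rewrite /continuous_at /=; apply: cvg_trans H; move=> P /= HP.
have H : \forall y \near z, A (c y) -> P (f (c y)) := cc z _ HP.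
by apply: (filterS _ H) => y; apply.
Qed.

Lemma Rint_prod_ae_eq {R : realType} d1 d2 (T1 : measurableType d1) (T2 : measurableType d2)
  (m1 : {sigma_finite_measure set T1 -> \bar R})
  (m2 : {sigma_finite_measure set T2 -> \bar R}) (f g : T1 * T2 -> R) :
  (m1 \x m2)%E.-integrable setT (EFin \o f) ->
  (m1 \x m2)%E.-integrable setT (EFin \o g) ->
  (forall x, m2.-integrable setT (fun y => (f (x, y))%:E)) ->
  (forall x, m2.-integrable setT (fun y => (g (x, y))%:E)) ->
  {ae m1, forall x, \int[m2]_y f (x, y) = \int[m2]_y g (x, y)} ->
  \int[(m1 \x m2)%E]_z f z = \int[(m1 \x m2)%E]_z g z.
Proof.
move=> fi gi f2 g2 fg; rewrite /Rintegral -(integral12_prod_meas1 fi)//=.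
rewrite -(integral12_prod_meas1 gi)//=; congr fine.
apply: ae_eq_integral => //.
- exact: measurable_fubini_F fi.
- exact: measurable_fubini_F gi.
apply: filterS fg => x fgx _; rewrite /fubini_F /=.
have f3 := integrable_fin_num measurableT (f2 x).
have g3 := integrable_fin_num measurableT (g2 x).
by rewrite -(fineK f3) -(fineK g3); congr EFin.
Qed.

(** * Mollification of weak derivatives *)

Section space_time_mollification.
Context {R : realType} {d : nat}.
Local Notation V := 'rV[R]_d.
Local Notation W := 'rV[R]_d.+1.
Local Notation leb := (@lebesgue_measure R).
Local Notation lebd := (@lebesgue_rV R d).
Local Notation lebW := (@lebesgue_rV R d.+1).

Definition eta {n} (e : R) : 'I_n -> R -> R := fun=> bump e.

Lemma nice_eta n e (i : 'I_n) : 0 < e -> nice1 e (eta e i).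
Proof. exact: nice_bump. Qed.

Lemma nice_upd n e (k : 'I_n -> R -> R) i dk : (forall j, nice1 e (k j)) -> nice1 e dk ->
  forall j, nice1 e (upd k i dk j).
Proof. by move=> ke dke j; rewrite /upd; case: ifP. Qed.

Lemma rV_consB (p : W) s y : p - rV_cons (s, y) = rV_cons ((rV_uncons p).1 - s, (rV_uncons p).2 - y).
Proof.
apply/rowP => i; case: (unliftP ord0 i) => [j|] ->.
  by rewrite !mxE liftK /= !mxE.
by rewrite !mxE unlift_none.
Qed.

Lemma prodf_cons_sub (k : 'I_d.+1 -> R -> R) (p : W) s y :
  prodf k (p - rV_cons (s, y)) =
  k ord0 (p 0 ord0 - s) * prodf (fun i => k (lift ord0 i)) ((rV_uncons p).2 - y).
Proof. by rewrite rV_consB prodf_cons. Qed.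

Lemma measurable_rV_cons_snd n s : measurable_fun setT (fun y : 'rV[R]_n => rV_cons (s, y)).
Proof.
apply: (measurableT_comp (f := @rV_cons R n)); first exact: measurable_rV_cons.
exact: measurable_pair1.
Qed.

(** A kernel centered at a point is used as a test function of the other variable,
    which turns the sign of its derivative. *)
Lemma is_derive_bump_sub (e a t : R) : 0 < e ->
  is_derive t (1 : R) (fun t => bump e (a - t)) (- dbump e (a - t)).
Proof.
move=> e0; have d1 : is_derive t (1 : R) (fun t => a - t) (- 1).
  by apply: (@is_derive_quad _ _ _ _ 0) => h; rewrite mul0r (_ : _ - _ = 0) ?normr0//; ring.
by have := is_derive1_comp (g := fun t => a - t) (is_derive_bump (a - t) e0) d1; rewrite mulrN1.
Qed.

(** On almost every slice of fixed time the kernel is a test function for the weak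
    partial derivative; Fubini assembles the slices. The conditions on p keep the
    support of the kernel inside ]0, T[. *)
Lemma moll_weak_space (f g : W -> R) (e M : R) (p : W) (j : 'I_d) (T : R) : 0 < e ->
  measurable_fun setT f -> (forall w, `|f w| <= M) ->
  measurable_fun setT g -> (forall w, `|g w| <= M) ->
  e < p 0 ord0 -> p 0 ord0 + e < T ->
  {ae leb, forall s, s \in `]0, T[ ->
    weak_partial j (fun y => f (rV_cons (s, y))) (fun y => g (rV_cons (s, y)))} ->
  moll (upd (eta e) (lift ord0 j) (dbump e)) f p = moll (eta e) g p.
Proof.
move=> e0 mf fM mg gM ep pT wfg.
have ke (i : 'I_d.+1) := nice_eta i e0.
have ke' (i : 'I_d) := nice_eta i e0.
have ue := nice_upd (lift ord0 j) ke (nice_dbump e0).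
have ue' := nice_upd j ke' (nice_dbump e0).
have updE : (fun i => upd (eta e) (lift ord0 j) (dbump e) (lift ord0 i)) = upd (eta e) j (dbump e).
  by apply/funext => i; rewrite /upd (inj_eq lift_inj).
have fs s : measurable_fun setT (fun y : V => f (rV_cons (s, y))).
  by apply: (measurableT_comp (f := f)) => //; exact: measurable_rV_cons_snd.
have gs s : measurable_fun setT (fun y : V => g (rV_cons (s, y))).
  by apply: (measurableT_comp (f := g)) => //; exact: measurable_rV_cons_snd.
have inner (k : 'I_d.+1 -> R -> R) (h : W -> R) : (forall i, nice1 e (k i)) -> measurable_fun setT h -> (forall w, `|h w| <= M) ->
   forall s, lebd.-integrable setT (fun y => (prodf k (p - rV_cons (s, y)) * h (rV_cons (s, y)))%:E).
  move=> kke mh hM s.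
  under eq_fun do rewrite prodf_cons_sub -mulrA.
  apply: integrableZr => //; apply: (@moll_integrable _ _ _ _ _ e M) => //.
  by apply: (measurableT_comp (f := h)) => //; exact: measurable_rV_cons_snd.
have mfi (k : 'I_d.+1 -> R -> R) (h : W -> R) : (forall i, nice1 e (k i)) -> measurable_fun setT h -> (forall w, `|h w| <= M) ->
    measurable_fun setT (fun q : W => prodf k (p - q) * h q).
  by move=> kke mh hM; apply: measurable_funM => //; exact: measurable_prodf_shift kke.
rewrite /moll !Rint_rV_cons; [|exact: mfi|exact: mfi].
apply: Rint_prod_ae_eq.
- exact: (integrable_rV_cons (moll_integrable p e0 ue mf fM)).
- exact: (integrable_rV_cons (moll_integrable p e0 ke mg gM)).
- by move=> s; exact: inner.
- by move=> s; exact: inner.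
apply: (ae_mono _ wfg) => s {}wfg.
under eq_Rintegral do rewrite prodf_cons_sub -mulrA updE.
under [RHS]eq_Rintegral do rewrite prodf_cons_sub -mulrA.
rewrite [LHS]RintegralZl//; last exact: (moll_integrable _ e0 ue' (fs s) (fun y => fM _)).
rewrite [RHS]RintegralZl//; last exact: (moll_integrable _ e0 ke' (gs s) (fun y => gM _)).
rewrite {1}/upd /=.
have [es|es] := leP e `|p 0 ord0 - s|; first by rewrite /eta (bump_out e0 es) !mul0r.
congr (_ * _).
have sT : s \in `]0, T[.
  by move: es; rewrite ltr_norml in_itv/= => /andP[? ?]; apply/andP; split; lra.
pose p' := (rV_uncons p).2.
pose k (i : 'I_d) s := bump e (p' 0 i - s); pose dk (i : 'I_d) s := - dbump e (p' 0 i - s).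
have dkk i t : is_derive t (1 : R) (k i) (dk i t).
  exact: is_derive_bump_sub.
have cdk i : continuous (dk i).
  move=> t; apply: cvgN; apply: (@continuous_comp _ _ _ (fun t => p' 0 i - t) (dbump e)).
    by apply: cvgB; [exact: cvg_cst|exact: cvg_id].
  exact: nice_continuous (nice_dbump e0) _.
have [C1k gE] := C1_prodf dkk cdk.
have Cck : Cc (prodf k).
  apply: (@Cc_prodf _ _ (`|p'| + e)) => [|i]; first by rewrite ltr_wpDl.
  have [C [C0 kC kL kout]] := ke' i; exists C; split => //.
  - by move=> s1; exact: kC.
  - by move=> s1 s2; apply: le_trans (kL _ _) _; rewrite (_ : _ - _ - _ = s2 - s1) ?[`|s2 - _|]distrC//; ring.
  - move=> s1 s1e; rewrite /k bump_out//.
    have := coord_le_norm p' i; have := lerB_dist s1 (p' 0 i); rewrite distrC; lra.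
have := wfg sT _ C1k Cck.
under eq_Rintegral => y _.
  have := congr1 (fun x : V => x 0 j) (gE y); rewrite !mxE => ->.
  rewrite (_ : prodf _ y = - prodf (upd (eta e) j (dbump e)) (p' - y)); last first.
    rewrite /prodf (bigD1 j)//= [in RHS](bigD1 j)//= /upd eqxx mulNr !mxE; congr (- (_ * _)).
    by apply: eq_bigr => i /negbTE ij; rewrite ij /k /eta !mxE.
  rewrite mulrN mulrC -mulN1r; over.
rewrite RintegralZl//; last exact: (moll_integrable _ e0 ue' (fs s) (fun y => fM _)).
rewrite mulN1r => /oppr_inj -> ; apply: eq_Rintegral => y _.
by rewrite mulrC; congr (_ * _); apply: eq_bigr => i _; rewrite /k /eta !mxE.
Qed.

(** Here the kernel itself, as a function of time and space, is a test function of the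
    weak time derivative. *)
Lemma moll_weak_time (f g : W -> R) (e M : R) (p : W) (T : R) : 0 < e ->
  measurable_fun setT f -> (forall w, `|f w| <= M) ->
  measurable_fun setT g -> (forall w, `|g w| <= M) ->
  e < p 0 ord0 -> p 0 ord0 + e < T ->
  (forall psi psit psix, C1c_cylinder T psi psit psix ->
     \int[(leb \x lebd)%E]_z (f (rV_cons z) * psit z.1 z.2) =
     - \int[(leb \x lebd)%E]_z (g (rV_cons z) * psi z.1 z.2)) ->
  moll (upd (eta e) ord0 (dbump e)) f p = moll (eta e) g p.
Proof.
move=> e0 mf fM mg gM ep pT wfg.
have ke (i : 'I_d.+1) := nice_eta i e0.
have ue := nice_upd ord0 ke (nice_dbump e0).
pose psi s y := prodf (eta e) (p - rV_cons (s, y)).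
pose psit s y := - prodf (upd (eta e) ord0 (dbump e)) (p - rV_cons (s, y)).
pose psix i s y := - prodf (upd (eta e) (lift ord0 i) (dbump e)) (p - rV_cons (s, y)).
have cpr k : (forall i, nice1 e (k i)) ->
    continuous (fun z : R * V => prodf k (p - rV_cons (z.1, z.2))).
  move=> kke z.
  apply: (@continuous_comp _ _ _ (fun z : R * V => p - rV_cons z) (prodf k)); last first.
    by apply: continuous_prodf => i; exact: nice_continuous (kke i).
  move: z; apply: continuous_rV => i z.
  rewrite (_ : (fun z => _) = (fun z => p 0 i - rV_cons z 0 i)); last first.
    by apply/funext => y; rewrite [LHS]mxE [X in _ + X]mxE.
  have H : {for z, continuous (fun z : R * V => rV_cons z 0 i)}.
    exact: (@continuous_coord R d.+1 (R * V)%type (@rV_cons R d) i (@continuous_rV_cons R d) z).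
  by apply: (continuousB _ H); exact: cst_continuous.
pose S : set (R * V) := `[p 0 ord0 - e, p 0 ord0 + e] `*` [set y | `|(rV_uncons p).2 - y| <= e].
have cS : compact S.
  apply: compact_setX; first exact: segment_compact.
  apply: bounded_closed_compact.
    exists (`|(rV_uncons p).2| + e); split; first exact: num_real.
    move=> M' MM y /= ye; apply: le_trans (ltW MM).
    have := lerB_dist y (rV_uncons p).2; rewrite distrC; lra.
  apply: (@closed_comp _ _ (fun y : V => `|(rV_uncons p).2 - y|) [set y : R | y <= e]); last exact: closed_le.
  move=> y _; apply: (@continuous_comp _ _ _ (fun y : V => (rV_uncons p).2 - y) (fun y : V => `|y|)).
    by apply: continuousB; [exact: cst_continuous|exact: cvg_id].
  exact: norm_continuous.
have psiS : [set z : R * V | psi z.1 z.2 != 0] `<=` S.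
  move=> [s y] /= pz.
  have H : `|p - rV_cons (s, y)| < e.
    by rewrite ltNge; apply: contra pz => ep'; rewrite /psi (prodf_out ke).
  split => /=.
    have := le_lt_trans (coord_le_norm _ ord0) H; rewrite [X in `|X|]mxE [X in _ + X]mxE rV_cons_coord0/=.
    by rewrite ltr_norml in_itv/= => /andP[? ?]; apply/andP; split; lra.
  apply: norm_le_coord => [|i]; first exact: ltW.
  have := le_lt_trans (coord_le_norm _ (lift ord0 i)) H.
  by rewrite [X in `|X|]mxE [X in _ + X]mxE rV_cons_coordS/= !mxE => /ltW.
have clS : closure [set z : R * V | psi z.1 z.2 != 0] `<=` S.
  have clS : closed S by apply: compact_closed => //; exact: norm_hausdorff.
  by rewrite (proj1 (closure_id _) clS); exact: closure_subset.
have cyl : C1c_cylinder T psi psit psix.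
  split.
  - split.
    + apply: continuous_subspaceT; exact: cpr.
    + apply: continuous_subspaceT => z; apply: cvgN; exact: cpr.
    + move=> i; apply: continuous_subspaceT => z; apply: cvgN; apply: cpr.
      by apply: nice_upd => //; exact: nice_dbump.
    + move=> t y _; rewrite (_ : psi^~ y = (fun t => prodf (eta e) ((rV_uncons p).2 - y) * bump e (p 0 ord0 - t))).
        rewrite (_ : psit t y = prodf (eta e) ((rV_uncons p).2 - y) *: (- dbump e (p 0 ord0 - t))).
          exact/is_deriveZ/is_derive_bump_sub.
        rewrite /psit prodf_cons_sub {1}/upd eqxx scalerN mulrC; congr (- (_ * _)).
      by apply/funext => s; rewrite /psi prodf_cons_sub mulrC.
    + move=> i t y _.
      have := is_derive_prodf (k := fun i s => bump e ((rV_uncons p).2 0 i - s)) y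
        (fun s => is_derive_bump_sub ((rV_uncons p).2 0 i) s e0).
      move=> /(is_deriveZ (bump e (p 0 ord0 - t))).
      rewrite (_ : _ \*: _ = psi t); last first.
        by apply/funext => z; rewrite /psi prodf_cons_sub prodf_shift.
      congr is_derive; rewrite /psix prodf_cons_sub {1}/upd /= -mulrN; congr (_ * _).
      rewrite /prodf (bigD1 i)//= [in RHS](bigD1 i)//= /upd eqxx mulNr !mxE eqxx; congr (- (_ * _)).
      by apply: eq_bigr => j /negbTE ij; rewrite (inj_eq lift_inj) ij !mxE.
  - apply: subclosed_compact cS clS; exact: closed_closure.
  - move=> z /clS [] /=; rewrite !in_itv/= => /andP[? ?] _; split => //=.
    by apply/andP; split; lra.
have := wfg _ _ _ cyl.
rewrite /moll !Rint_rV_cons; first last.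
- by apply: measurable_funM => //; exact: measurable_prodf_shift ue.
- by apply: measurable_funM => //; exact: measurable_prodf_shift ke.
move=> H; apply: oppr_inj.
transitivity (\int[(leb \x lebd)%E]_z (f (rV_cons z) * psit z.1 z.2)).
  rewrite -mulN1r -RintegralZl//; last exact: (integrable_rV_cons (moll_integrable p e0 ue mf fM)).
  by apply: eq_Rintegral => -[t y] _; rewrite /psit mulrN mulN1r mulrC.
rewrite H; congr (- _).
by apply: eq_Rintegral => -[t y] _; rewrite mulrC.
Qed.

End space_time_mollification.

(** * Clamped time *)

Section clamp.
Context {R : realType}.
Variable T : R.
Hypothesis T0 : 0 < T.

(** Freezing functions of time outside [0, T] makes everything defined and continuous
    for all real times. *)
Definition clamp (t : R) : R := Num.max 0 (Num.min t T).

Lemma clamp_itv t : 0 <= clamp t <= T.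
Proof. by rewrite /clamp le_max lexx/= ge_max (ltW T0) ge_min lexx orbT. Qed.

Lemma clamp_id t : 0 <= t <= T -> clamp t = t.
Proof. by move=> /andP[t0 tT]; rewrite /clamp min_l// max_r. Qed.

Lemma clampK t : clamp (clamp t) = clamp t.
Proof. by rewrite clamp_id// clamp_itv. Qed.

Lemma clamp_lip s t : `|clamp s - clamp t| <= `|s - t|.
Proof.
have := ler_norm (s - t); have := ler_norm (t - s).
rewrite [X in _ <= X -> _]distrC ler_norml; set N := `|s - t| => H1 H2.
have := T0; rewrite /clamp.
by case: (leP s T) => sT; case: (leP t T) => tT;
  [case: (leP 0 s) => s0|case: (leP 0 s) => s0|case: (leP 0 T) => s0|case: (leP 0 T) => s0];
  [case: (leP 0 t) => t0|case: (leP 0 t) => t0|case: (leP 0 T) => t0|case: (leP 0 T) => t0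
  |case: (leP 0 t) => t0|case: (leP 0 t) => t0| | ] => T1; apply/andP; split; lra.
Qed.

Lemma continuous_clamp : continuous clamp.
Proof.
apply: (@local_lip_continuous _ _ _ 1) => // s t _; rewrite mul1r; exact: clamp_lip.
Qed.

End clamp.

(** * The Hessian of the kernel and the alignment force *)

Section hessian.
Context {R : realType} {d : nat}.
Local Notation V := 'rV[R]_d.

Lemma mx_coord_le_norm m n (A : 'M[R]_(m, n)) i j : `|A i j| <= `|A|.
Proof.
by rewrite [leRHS]/Num.norm/= mx_normrE; exact: (le_bigmax _ (fun ij : 'I_m * 'I_n => `|A ij.1 ij.2|) (i, j)).
Qed.

Lemma hess_bounds (K : V -> R) :
  [bounded hess K x | x in setT] -> [lipschitz hess K x | x in setT] ->
  exists2 K0, 0 <= K0 & (forall x i j, `|hess K x i j| <= K0) /\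
    (forall x y i j, `|hess K x i j - hess K y i j| <= K0 * `|x - y|).
Proof.
move=> [B [_ HB]] [L [_ HL]].
exists (Num.max (`|B| + 1) (`|L| + 1)); first by rewrite le_max addr_ge0.
split.
  move=> x i j; apply: le_trans (mx_coord_le_norm _ _ _) _.
  rewrite le_max; apply/orP; left; apply: HB => //.
  by rewrite (le_lt_trans (ler_norm B))// ltrDl.
move=> x y i j.
have <- : (hess K x - hess K y) i j = hess K x i j - hess K y i j by rewrite mxE [X in _ + X]mxE.
apply: le_trans (mx_coord_le_norm _ _ _) _.
have L1 : L < `|L| + 1 by rewrite (le_lt_trans (ler_norm L))// ltrDl.
apply: le_trans (HL _ L1 (x, y) (conj I I)) _ => /=.
by rewrite ler_wpM2r// le_max lexx orbT.
Qed.

Lemma mxvE (A : 'M[R]_d) (w : V) i : mxv A w 0 i = \sum_j w 0 j * A i j.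
Proof. by rewrite /mxv mxE; apply: eq_bigr => j _; rewrite mxE. Qed.

Lemma mxv_le (A : 'M[R]_d) (w : V) i K0 M : (forall i j, `|A i j| <= K0) ->
  (forall j, `|w 0 j| <= M) -> `|mxv A w 0 i| <= d%:R * (M * K0).
Proof.
move=> AK wM; rewrite mxvE; apply: le_trans (ler_norm_sum _ _ _) _.
apply: (@le_trans _ _ (\sum_(j < d) M * K0)).
  by apply: ler_sum => j _; rewrite normrM; apply: ler_pM.
by rewrite sumr_const card_ord -(mulr_natl (M * K0)).
Qed.

Lemma measurable_hess_coord (K : V -> R) i j : continuous (hess K) ->
  measurable_fun setT (fun x => hess K x i j).
Proof.
move=> cK; apply: measurable_continuous_rV => x.
apply: (@continuous_comp _ _ _ (hess K) (fun A : 'M[R]_d => A i j)); first exact: cK.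
exact: coord_continuous.
Qed.

Lemma measurable_mxv_hess dd (X : measurableType dd) (D : set X) (K : V -> R)
  (f g : X -> V) i : continuous (hess K) ->
  measurable_fun D f -> measurable_fun D g ->
  measurable_fun D (fun x => mxv (hess K (f x)) (g x) 0 i).
Proof.
move=> cK mf mg; under eq_fun do rewrite mxvE.
apply: measurable_sum => j; apply: measurable_funM; first exact: measurable_rV_coord.
apply: (measurableT_comp (f := fun x => hess K x i j)) => //.
exact: measurable_hess_coord.
Qed.

Variable K : V -> R.
Hypothesis K_cont : continuous (hess K).
Variable K0 : R.
Hypothesis KK0 : forall x i j, `|hess K x i j| <= K0.

Lemma alignment_integrable (m : probability V R) (w : V -> V) x i M :
  measurable_fun setT w -> (forall x j, `|w x 0 j| <= M) ->
  m.-integrable setT (EFin \o (fun y => mxv (hess K (x - y)) (w x - w y) 0 i)).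
Proof.
move=> mw wM; apply: (@bounded_integrable _ _ _ _ _ _ _ (d%:R * ((M + M) * K0))) => //.
- by apply: (le_lt_trans (probability_le1 m measurableT)); rewrite ltry.
- apply: measurable_mxv_hess => //; apply: measurable_rVB => //.
- move=> y _; apply: mxv_le => // j; rewrite !mxE; apply: le_trans (ler_normB _ _) _.
  exact: lerD.
Qed.

Lemma alignment_le (m : probability V R) (w : V -> V) x i M :
  measurable_fun setT w -> (forall x j, `|w x 0 j| <= M) ->
  `|alignment K m w x 0 i| <= d%:R * ((M + M) * K0).
Proof.
move=> mw wM; rewrite mxE.
have -> : d%:R * ((M + M) * K0) = \int[m]_y (d%:R * ((M + M) * K0)).
  by rewrite Rintegral_cst// (_ : fine _ = 1) ?mulr1// -[RHS]/(fine (1%:E)) -(probability_setT m).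
apply: ae_normr_Rintegral_le => //; first exact: alignment_integrable wM.
  apply: (@bounded_integrable _ _ _ _ _ _ _ `|d%:R * ((M + M) * K0)|) => //.
  by apply: (le_lt_trans (probability_le1 m measurableT)); rewrite ltry.
apply/aeW => y _; apply: mxv_le => // j; rewrite !mxE; apply: le_trans (ler_normB _ _) _.
exact: lerD.
Qed.

Lemma alignment_ae_eq (m : probability V R) (w w' : V -> V) x :
  measurable_fun setT w -> measurable_fun setT w' ->
  {ae m, forall y, w y = w' y} -> w x = w' x -> alignment K m w x = alignment K m w' x.
Proof.
move=> mw mw' ww' wx; apply/rowP => i; rewrite !mxE; apply: ae_eq_Rintegral => //.
- apply: measurable_mxv_hess => //; apply: measurable_rVB => //; exact: measurable_cst.
- apply: measurable_mxv_hess => //; apply: measurable_rVB => //; exact: measurable_cst.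
- by apply: ae_mono ww' => y wy _; rewrite wx wy.
Qed.

End hessian.

(** * The strong velocity and its continuous representative *)

Section bounded_extension.
Context {R : realType} d (X : measurableType d) (m : {measure set X -> \bar R}).

(** Data that are known almost everywhere on a domain are replaced by data that are
    measurable and bounded everywhere, as mollification requires. *)
Lemma bounded_extension (D : set X) (f : X -> R) M : 0 <= M -> measurable D ->
  measurable_fun D f -> {ae m, forall z, D z -> `|f z| <= M} ->
  exists g : X -> R, [/\ measurable_fun setT g, (forall z, `|g z| <= M),
    (forall z, ~ D z -> g z = 0) & {ae m, forall z, D z -> g z = f z}].
Proof.
move=> M0 mD mf fM.
exists (fun z => Num.max (- M) (Num.min ((f \_ D) z) M)); split.
- apply: measurable_maxr; first exact: measurable_cst.
  apply: measurable_minr; last exact: measurable_cst.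
  exact/(measurable_restrictT f mD).
- move=> z; rewrite ler_norml le_max lexx/= ge_max ge_min lexx orbT andbT.
  by rewrite (le_trans _ M0)// oppr_le0.
- by move=> z Dz; rewrite patchE memNset// min_l// max_r// oppr_le0.
- apply: ae_mono fM => z zM Dz; have := zM Dz; rewrite ler_norml => /andP[h1 h2].
  by rewrite patchE mem_set// min_l// max_r.
Qed.

End bounded_extension.

Lemma continuous_pair (S X Y : topologicalType) (f : S -> X) (g : S -> Y) :
  continuous f -> continuous g -> continuous (fun z => (f z, g z)).
Proof. by move=> cf cg z; exact: (cvg_pair (cf z) (cg z)). Qed.

Lemma continuous_pairl (X Y : topologicalType) (t : X) : continuous (fun y : Y => (t, y)).
Proof. by apply: continuous_pair => z; [exact: cvg_cst|exact: cvg_id]. Qed.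

Section velocity.
Context {R : realType} {d : nat}.
Local Notation V := 'rV[R]_d.
Local Notation W := 'rV[R]_d.+1.
Local Notation leb := (@lebesgue_measure R).
Local Notation lebd := (@lebesgue_rV R d).
Local Notation lebW := (@lebesgue_rV R d.+1).
Variable T : R.
Hypothesis T0 : 0 < T.

(** If the bound failed at a point, it would fail on a ball around it, and a smaller
    ball whose center is moved to the interior of ]0, T[ would violate the almost
    everywhere bound. *)
Lemma ae_le_everywhere (f : R -> V -> R) c :
  continuous (fun z : R * V => f z.1 z.2) -> (forall t, f (clamp T t) = f t) ->
  {ae (leb \x lebd)%E, forall z, z.1 \in `]0, T[ -> f z.1 z.2 <= c} ->
  forall t x, f t x <= c.
Proof.
move=> cf fc fae t x; rewrite leNgt; apply/negP => fx.
wlog tT : t fx / 0 <= t <= T.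
  by move=> H; apply: (H (clamp T t)); [rewrite fc|exact: clamp_itv].
pose F (w : W) := f (rV_uncons w).1 (rV_uncons w).2.
have cF : continuous F.
  move=> w; apply: (@continuous_comp _ _ _ (@rV_uncons R d) (fun z => f z.1 z.2)).
    exact: continuous_rV_uncons.
  exact: cf.
have Fw : c < F (rV_cons (t, x)) by rewrite /F rV_consK.
have : \forall w \near rV_cons (t, x), c < F w.
  by apply: (cvgr_gt _ (cF _)).
move=> /nbhs_normP[e /= e0 He].
pose h := Num.min (e / 2) (T / 4).
have h0 : 0 < h by rewrite lt_min !divr_gt0.
have he : h <= e / 2 by rewrite ge_min lexx.
have hT : h <= T / 4 by rewrite ge_min lexx orbT.
move: h h0 he hT => h h0 he hT.
have tT1 := andP tT.
have [s sE sT] : exists2 s, `|t - s| <= h & h <= s <= T - h.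
  case: (lerP t (T / 2)) => tT2.
    exists (t + h); first by rewrite opprD addrA subrr sub0r normrN gtr0_norm.
    by case: tT1 => *; apply/andP; split; lra.
  exists (t - h); first by rewrite opprB addrCA subrr addr0 gtr0_norm.
  by case: tT1 => *; apply/andP; split; lra.
apply: (@ball_not_null R d.+1 (rV_cons (s, x)) h) => //.
apply: ae_mono (ae_rV_uncons fae) => w Hw wh.
have ws : `|s - w 0 ord0| < h.
  apply: le_lt_trans wh; have := coord_le_norm (rV_cons (s, x) - w) ord0.
  by rewrite mxE rV_cons_coord0 mxE.
suff : c < F w by rewrite ltNge Hw//= in_itv/=; move: ws sT; rewrite ltr_norml; lra.
apply: He => /=; apply: le_lt_trans (ler_distD (rV_cons (s, x)) _ _) _.
rewrite (splitr e) ler_ltD//; last exact: lt_le_trans wh he.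
apply: norm_le_coord => [|i]; first by rewrite divr_ge0// ltW.
rewrite mxE [X in _ + X]mxE; case: (unliftP ord0 i) => [j|] ->.
  by rewrite !rV_cons_coordS subrr normr0 divr_ge0// ltW.
by rewrite !rV_cons_coord0 (le_trans sE).
Qed.

Lemma ess_sup_bounds (w : R -> V -> V) (Dw : R -> V -> 'M[R]_d) :
  (ess_sup_time T (fun t =>
         ess_sup lebd (fun x => (normv (w t x))%:E) +
         ess_sup lebd (fun x => (normm (Dw t x))%:E)) < +oo)%E ->
  exists2 M, 0 <= M & {ae leb, forall t, t \in `]0, T[ ->
    {ae lebd, forall x, normv (w t x) <= M /\ normm (Dw t x) <= M}}.
Proof.
move=> /ess_sup_time_lty[M M0 HM]; exists M => //.
have pos (f : V -> R) : (forall x, 0 <= f x) -> (0 <= ess_sup lebd (EFin \o f))%E.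
  move=> f0; apply: ess_sup_ger; first exact: lebn_setT_gt0.
  by move=> x /=; rewrite lee_fin.
have bnd (f : V -> R) : (ess_sup lebd (EFin \o f) <= M%:E)%E -> {ae lebd, forall x, f x <= M}.
  move=> fM; apply: ae_mono (ess_sup_ge lebd (EFin \o f)) => x /= /le_trans/(_ fM).
  by rewrite lee_fin.
apply: ae_mono HM => t Ht tT; have := Ht tT.
set a := ess_sup _ _; set b := ess_sup _ _ => abM.
have a0 : (0 <= a)%E by apply: pos => x; exact: sqrtr_ge0.
have b0 : (0 <= b)%E by apply: pos => x; exact: sqrtr_ge0.
by apply: ae_and; apply: bnd; apply: le_trans abM; [rewrite leeDl|rewrite leeDr].
Qed.

Lemma normv_coord (x : V) i : `|x 0 i| <= normv x.
Proof.
rewrite /normv -sqrtr_sqr ler_sqrt ?sqr_ge0//; last first.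
  by apply: sumr_ge0 => j _; rewrite -expr2 sqr_ge0.
by rewrite /dotv (bigD1 i)//= expr2 lerDl sumr_ge0// => j _; rewrite -expr2 sqr_ge0.
Qed.

Lemma normm_coord (A : 'M[R]_d) i j : `|A i j| <= normm A.
Proof.
have E : ddot A A = \sum_k \sum_l A l k ^+ 2.
  rewrite /ddot /mxtrace; apply: eq_bigr => k _; rewrite mxE; apply: eq_bigr => l _.
  by rewrite mxE expr2.
rewrite /normm E -sqrtr_sqr ler_sqrt.
  rewrite (bigD1 j)//= (bigD1 i)//= -addrA lerDl addr_ge0// sumr_ge0// => *.
    exact: sqr_ge0.
  by rewrite sumr_ge0// => *; exact: sqr_ge0.
by rewrite sumr_ge0// => *; rewrite sumr_ge0// => *; exact: sqr_ge0.
Qed.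

Local Notation strip := (`]0, T[ `*` [set: V]).

Lemma measurable_strip : measurable strip.
Proof. by apply: measurableX => //; exact: measurable_itv. Qed.

Lemma strip_section dd (Y : measurableType dd) (f : R -> V -> Y) t : t \in `]0, T[ ->
  measurable_fun strip (fun z : R * V => f z.1 z.2) -> measurable_fun setT (f t).
Proof.
move=> tT mf; apply: (measurable_comp (F := strip) (f := fun z : R * V => f z.1 z.2) (g := pair t)) => //.
- exact: measurable_strip.
- by move=> _ [x _ <-]; split.
Qed.

Lemma ae_strip_bound (f : R -> V -> R) M : 0 <= M ->
  measurable_fun strip (fun z : R * V => f z.1 z.2) ->
  {ae leb, forall t, t \in `]0, T[ -> {ae lebd, forall x, `|f t x| <= M}} ->
  {ae (leb \x lebd)%E, forall z, strip z -> `|f z.1 z.2| <= M}.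
Proof.
move=> M0 mf fM.
pose F := (fun z : R * V => f z.1 z.2) \_ strip.
have mF : measurable_fun setT F by apply/(measurable_restrictT _ measurable_strip).
have : {ae (leb \x lebd)%E, forall z, [set z | `|F z| <= M] z}.
  apply: ae_of_sections.
    have -> : [set z | `|F z| <= M] = setT `&` F @^-1` `[- M, M]%classic.
      by rewrite setTI; apply/seteqP; split=> z /=; rewrite in_itv/= ler_norml.
    by apply: mF => //; exact: measurable_itv.
  apply: ae_mono fM => t Ht; have [tT|tT] := boolP (t \in `]0, T[).
    by apply: ae_mono (Ht tT) => x /=; rewrite /F patchE mem_set.
  apply/aeW => x /=; rewrite /F patchE memNset ?normr0// => -[/=].
  by move=> t1 _; move: tT; rewrite t1.
by apply: ae_mono => z /= + zS; rewrite /F patchE mem_set.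
Qed.

Lemma C1c_cylinder_psi (psi psit : R -> V -> R) psix : C1c_cylinder T psi psit psix ->
  measurable_fun setT (fun z : R * V => psi z.1 z.2) /\
  measurable_fun setT (fun z : R * V => psit z.1 z.2).
Proof.
move=> [[c1 c2 _ _ _] _ _]; split; apply: measurable_continuous_prod.
  by have := @within_continuous_comp (R * V)%type _ _ _ _ id _ _ c1; apply => // ?; exact: cvg_id.
by have := @within_continuous_comp (R * V)%type _ _ _ _ id _ _ c2; apply => // ?; exact: cvg_id.
Qed.

Lemma strip_weak_time (v vt : R -> V -> V) (f g : R * V -> R) k :
  measurable_fun strip (fun z => v z.1 z.2) ->
  weak_time_derivative T v vt ->
  measurable_fun setT f -> measurable_fun setT g ->
  (forall z, ~ strip z -> f z = 0) -> (forall z, ~ strip z -> g z = 0) ->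
  {ae (leb \x lebd)%E, forall z, strip z -> f z = v z.1 z.2 0 k} ->
  {ae (leb \x lebd)%E, forall z, strip z -> g z = vt z.1 z.2 0 k} ->
  forall psi psit psix, C1c_cylinder T psi psit psix ->
     \int[(leb \x lebd)%E]_z (f z * psit z.1 z.2) =
     - \int[(leb \x lebd)%E]_z (g z * psi z.1 z.2).
Proof.
move=> mv [mvt wvt] mf mg f0 g0 fv gv psi psit psix c.
have [mpsi mpsit] := C1c_cylinder_psi c.
have key (h p w : R * V -> R) : measurable_fun setT h -> measurable_fun setT p ->
    measurable_fun strip w -> (forall z, ~ strip z -> h z = 0) ->
    {ae (leb \x lebd)%E, forall z, strip z -> h z = w z} ->
    \int[(leb \x lebd)%E]_z (h z * p z) = \int[(leb \x lebd)%E]_(z in strip) (w z * p z).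
  move=> mh mp mw h0 hw.
  transitivity (\int[(leb \x lebd)%E]_(z in strip) (h z * p z)).
    rewrite [RHS]Rintegral_mkcond; apply: eq_Rintegral => z _.
    rewrite patchE; case: ifPn => // /negP; rewrite inE => nz.
    by rewrite h0// mul0r.
  apply: ae_eq_Rintegral.
  - exact: measurable_strip.
  - by apply: measurable_funTS; exact: measurable_funM.
  - by apply: measurable_funM => //; exact: measurable_funTS.
  - by apply: ae_mono hw => z Hz zS; rewrite Hz.
rewrite (key _ _ (fun z => v z.1 z.2 0 k))//; last exact: measurable_rV_coord.
rewrite (key _ _ (fun z => vt z.1 z.2 0 k))//; last exact: measurable_rV_coord.
exact: wvt c k.
Qed.

Lemma weak_partial_ae_eq (f f' g g' : V -> R) j :
  measurable_fun setT f -> measurable_fun setT g ->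
  measurable_fun setT f' -> measurable_fun setT g' ->
  {ae lebd, forall x, f' x = f x} -> {ae lebd, forall x, g' x = g x} ->
  weak_partial j f g -> weak_partial j f' g'.
Proof.
move=> mf mg mf' mg' ff gg w psi c1 cc; have [dp cp] := c1.
have mD : measurable_fun setT (fun x => 'D_(delta_mx 0 j : V) psi x).
  apply: measurable_continuous_rV => x.
  have := @continuous_coord _ _ _ (grad psi) j cp x.
  by congr (_ _ _); apply/funext => y; rewrite mxE.
have mpsi : measurable_fun setT psi.
  by apply: measurable_continuous_rV => x; exact: differentiable_continuous.
transitivity (\int[lebd]_x (f x * 'D_(delta_mx 0 j : V) psi x)).
  apply: ae_eq_Rintegral => //; [exact: measurable_funM|exact: measurable_funM|].
  by apply: ae_mono ff => x -> _.
rewrite w//; congr (- _).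
apply: ae_eq_Rintegral => //; [exact: measurable_funM|exact: measurable_funM|].
by apply: ae_mono gg => x -> _.
Qed.

Variables (K : V -> R) (K0 : R).
Hypothesis K_cont : continuous (hess K).
Hypothesis K00 : 0 <= K0.
Hypothesis KK0 : forall x i j, `|hess K x i j| <= K0.
Variables (r : R -> probability V R) (v vt vbar : R -> V -> V) (Dv : R -> V -> 'M[R]_d).
Hypothesis r_dens : forall t, t \in `[0, T] -> has_positive_density (r t).
Hypothesis vW : Linfty_W1infty T v Dv.
Hypothesis vtW : weak_time_derivative T v vt.
Hypothesis vPDE : {ae (leb \x lebd)%E, forall z : R * V, z.1 \in `]0, T[ ->
            vt z.1 z.2 + mxv (Dv z.1 z.2) (v z.1 z.2)
              + alignment K (r z.1) (v z.1) z.2 = 0}.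
Hypothesis vbar_cont : {within `[0, T] `*` setT,
            continuous (fun z : R * V => vbar z.1 z.2)}.
Hypothesis v_vbar : {ae (leb \x lebd)%E, forall z : R * V, z.1 \in `]0, T[ ->
            v z.1 z.2 = vbar z.1 z.2}.
Local Notation b := (fun t x => vbar (clamp T t) x).

Lemma clamped_continuous : continuous (fun z : R * V => b z.1 z.2).
Proof.
apply: (within_continuous_comp (f := fun z : R * V => vbar z.1 z.2)
  (c := fun z : R * V => (clamp T z.1, z.2)) _ _ vbar_cont).
  by move=> z; split => //=; rewrite in_itv/=; exact: clamp_itv.
apply: continuous_pair => z; last exact: cvg_snd.
apply: (@continuous_comp _ _ _ fst (clamp T)); first exact: cvg_fst.
exact: continuous_clamp.
Qed.

Lemma clamped_section_continuous t : continuous (b t).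
Proof.
move=> x; apply: (@continuous_comp _ _ _ (fun x : V => (t, x)) (fun z : R * V => b z.1 z.2)).
  exact: continuous_pairl.
exact: clamped_continuous.
Qed.

Lemma measurable_clamped t : measurable_fun setT (b t).
Proof.
apply: measurable_rV => i; apply: measurable_continuous_rV.
exact/continuous_coord/clamped_section_continuous.
Qed.

(** The measure r_t is absolutely continuous; this is where almost everywhere
    statements for Lebesgue measure become statements for particles. *)
Lemma density_ae t (P : V -> Prop) : t \in `[0, T] ->
  {ae lebd, forall x, P x} -> {ae r t, forall x, P x}.
Proof.
move=> /r_dens[f [mf f0 rf]] [N [mN N0 PN]]; exists N; split => //.
rewrite [LHS]rf//; apply: null_set_integral => //; exact: measurableT_comp (measurable_funTS mf).
Qed.

Lemma v_clamped : {ae (leb \x lebd)%E, forall z, strip z -> v z.1 z.2 = b z.1 z.2}.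
Proof.
apply: ae_mono v_vbar => z H [/= zT _]; rewrite clamp_id ?H//.
by move: zT; rewrite in_itv/= => /andP[? ?]; rewrite !ltW.
Qed.

Lemma v_clamped_sections : {ae leb, forall t, t \in `]0, T[ ->
  {ae lebd, forall x, v t x = b t x} /\ {ae r t, forall x, v t x = b t x}}.
Proof.
apply: ae_mono (@ae_sections _ _ _ _ _ leb lebd (fun t x => strip (t, x) -> v t x = b t x) v_clamped).
move=> t Ht tT; have H : {ae lebd, forall x, v t x = b t x}.
  by apply: ae_mono Ht => x; apply; split.
split => //; apply: density_ae H.
by move: tT; rewrite !in_itv/= => /andP[? ?]; rewrite !ltW.
Qed.

(** Everything that the sequel uses of the strong solution: b is bounded, the velocity
    and its weak derivatives have bounded representatives f, gt, gD, mollification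
    exchanges derivatives of f with gt and gD, and almost everywhere f = b and the
    equation holds with b in the nonlinear terms. *)
Lemma strong_data : exists M (f gt : 'I_d -> W -> R) (gD : 'I_d -> 'I_d -> W -> R),
  [/\ 0 <= M, (forall t x k, `|b t x 0 k| <= M),
    (forall k, [/\ measurable_fun setT (f k), (forall w, `|f k w| <= M),
        measurable_fun setT (gt k) & forall w, `|gt k w| <= M]) /\
    (forall k j, measurable_fun setT (gD k j) /\ forall w, `|gD k j w| <= M),
    (forall k e (p : W), 0 < e -> e < p 0 ord0 -> p 0 ord0 + e < T ->
       moll (upd (eta e) ord0 (dbump e)) (f k) p = moll (eta e) (gt k) p /\
       forall j, moll (upd (eta e) (lift ord0 j) (dbump e)) (f k) p = moll (eta e) (gD k j) p) &
    {ae lebW, forall w : W, w 0 ord0 \in `]0, T[ -> forall k,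
       f k w = b (w 0 ord0) (rV_uncons w).2 0 k /\
       gt k w + \sum_j gD k j w * b (w 0 ord0) (rV_uncons w).2 0 j
         + alignment K (r (w 0 ord0)) (b (w 0 ord0)) (rV_uncons w).2 0 k = 0}].
Proof.
have [mv mDv wD /ess_sup_bounds[M1 M10 HM1]] := vW.
have [mvt wvt] := vtW.
have mS := measurable_strip.
have vM k : {ae (leb \x lebd)%E, forall z, strip z -> `|v z.1 z.2 0 k| <= M1}.
  apply: (@ae_strip_bound (fun t x => v t x 0 k)) => //; first exact: measurable_rV_coord.
  apply: ae_mono HM1 => t Ht tT; apply: ae_mono (Ht tT) => x [vx _].
  exact: le_trans (normv_coord _ _) vx.
have mDvc k j : measurable_fun strip (fun z : R * V => Dv z.1 z.2 k j).
  by apply: (measurableT_comp (f := fun A : 'M[R]_d => A k j)) => //; exact: measurable_coord.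
have DM k j : {ae (leb \x lebd)%E, forall z, strip z -> `|Dv z.1 z.2 k j| <= M1}.
  apply: (@ae_strip_bound (fun t x => Dv t x k j)) => //.
  apply: ae_mono HM1 => t Ht tT; apply: ae_mono (Ht tT) => x [_ vx].
  exact: le_trans (normm_coord _ _ _) vx.
have bM t x k : `|b t x 0 k| <= M1.
  rewrite ler_norml; have cb := @continuous_coord _ _ _ _ k clamped_continuous.
  apply/andP; split.
    rewrite lerNl; apply: (@ae_le_everywhere (fun t x => - b t x 0 k)).
    - by move=> z; apply: continuousN; exact: cb.
    - by move=> s; rewrite clampK.
    - apply: ae_mono (ae_and (vM k) v_clamped) => z [vz bz] zT.
      by rewrite -bz// lerNl; have := vz (conj zT I); rewrite ler_norml => /andP[].
  apply: (@ae_le_everywhere (fun t x => b t x 0 k)).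
  - exact: cb.
  - by move=> s; rewrite clampK.
  - apply: ae_mono (ae_and (vM k) v_clamped) => z [vz bz] zT.
    by rewrite -bz//; have := vz (conj zT I); rewrite ler_norml => /andP[].
(* the bound on the time derivative is read off the equation: vt = - Dv v - force *)
have M20 : 0 <= d%:R * (M1 * M1) + d%:R * ((M1 + M1) * K0).
  by rewrite addr_ge0// !mulr_ge0// addr_ge0.
pose M := M1 + (d%:R * (M1 * M1) + d%:R * ((M1 + M1) * K0)).
have M1M : M1 <= M by rewrite lerDl.
have M0 : 0 <= M := le_trans M10 M1M.
(* v is replaced by its continuous representative, in the integral term thanks to the
   density of r *)
have PDE : {ae (leb \x lebd)%E, forall z : R * V, strip z -> forall k,
    vt z.1 z.2 0 k + \sum_j Dv z.1 z.2 k j * b z.1 z.2 0 j + alignment K (r z.1) (b z.1) z.2 0 k = 0}.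
  apply: ae_mono (ae_and vPDE (ae_and v_clamped (ae_fst lebd v_clamped_sections))).
  move=> z [H1 [H2 H3]] zS k; have zT : z.1 \in `]0, T[ := zS.1.
  have := H1 zT => /rowP/(_ k); rewrite mxE [X in X + _]mxE mxvE [RHS]mxE => H.
  rewrite -[RHS]H; congr (_ + _ + _).
    by apply: eq_bigr => j _; rewrite -H2// mulrC.
  have -> // : alignment K (r z.1) (b z.1) z.2 = alignment K (r z.1) (v z.1) z.2.
  symmetry; apply: alignment_ae_eq => //.
  - exact: (strip_section (f := v) zT).
  - exact: measurable_clamped.
  - exact: (H3 zT).2.
  - exact: H2.
have vtM k : {ae (leb \x lebd)%E, forall z, strip z -> `|vt z.1 z.2 0 k| <= M}.
  have H : {ae (leb \x lebd)%E, forall z, forall j, strip z -> `|Dv z.1 z.2 k j| <= M1}.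
    by apply: filter_forall => j; exact: DM.
  apply: ae_mono (ae_and PDE H) => z [Hz HD] zS; have := Hz zS k.
  rewrite -addrA => /eqP; rewrite addr_eq0 => /eqP ->; rewrite normrN.
  apply: le_trans (ler_normD _ _) _; apply: le_trans (_ : _ <= d%:R * (M1 * M1) + d%:R * ((M1 + M1) * K0)) _; last by rewrite lerDr.
  apply: lerD.
    apply: le_trans (ler_norm_sum _ _ _) _; apply: (@le_trans _ _ (\sum_(j < d) M1 * M1)).
      by apply: ler_sum => j _; rewrite normrM; apply: ler_pM => //; exact: HD.
    by rewrite sumr_const card_ord -(mulr_natl (M1 * M1)).
  by apply: alignment_le => //; exact: measurable_clamped.
have vM' k : {ae (leb \x lebd)%E, forall z, strip z -> `|v z.1 z.2 0 k| <= M}.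
  by apply: ae_mono (vM k) => z Hz zS; exact: le_trans (Hz zS) M1M.
have DM' k j : {ae (leb \x lebd)%E, forall z, strip z -> `|Dv z.1 z.2 k j| <= M}.
  by apply: ae_mono (DM k j) => z Hz zS; exact: le_trans (Hz zS) M1M.
have mvk k : measurable_fun strip (fun z : R * V => v z.1 z.2 0 k) by exact: measurable_rV_coord.
have mvtk k : measurable_fun strip (fun z : R * V => vt z.1 z.2 0 k) by exact: measurable_rV_coord.
have XF k := @bounded_extension _ _ _ (leb \x lebd)%E strip (fun z : R * V => v z.1 z.2 0 k) M M0 mS (mvk k) (vM' k).
have [F HF] := choice XF.
have XG k := @bounded_extension _ _ _ (leb \x lebd)%E strip (fun z : R * V => vt z.1 z.2 0 k) M M0 mS (mvtk k) (vtM k).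
have [G HG] := choice XG.
have XD (kj : 'I_d * 'I_d) := @bounded_extension _ _ _ (leb \x lebd)%E strip (fun z : R * V => Dv z.1 z.2 kj.1 kj.2) M M0 mS (mDvc kj.1 kj.2) (DM' kj.1 kj.2).
have [GD HGD] := choice XD.
have mW (g : R * V -> R) : measurable_fun setT g -> measurable_fun setT (g \o @rV_uncons R d).
  by move=> mg; apply: measurableT_comp => //; exact: measurable_rV_uncons.
exists M, (fun k => F k \o @rV_uncons R d), (fun k => G k \o @rV_uncons R d),
  (fun k j => GD (k, j) \o @rV_uncons R d); split => //.
- by move=> t x k; exact: le_trans (bM t x k) M1M.
- split=> [k|k j].
    have [mF FM _ _] := HF k; have [mG GM _ _] := HG k; split; try exact: mW.
      by move=> w; exact: FM.
    by move=> w; exact: GM.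
  by have [mF FM _ _] := HGD (k, j); split; [exact: mW|move=> w; exact: FM].
- move=> k e p e0 ep pT.
  have [mF FM F0 Fv] := HF k; have [mG GM G00 Gv] := HG k; split.
    apply: (moll_weak_time (M := M) (T := T)) => //; try exact: mW.
    - by move=> w; exact: FM.
    - by move=> w; exact: GM.
    move=> psi psit psix c.
    under eq_Rintegral do rewrite /= rV_consK.
    under [in RHS]eq_Rintegral do rewrite /= rV_consK.
    exact: (strip_weak_time mv vtW mF mG F0 G00 Fv Gv c).
  move=> j; have [mD GDM D0 Dvv] := HGD (k, j).
  apply: (moll_weak_space (M := M) (T := T)) => //; try exact: mW.
  - by move=> w; exact: FM.
  - by move=> w; exact: GDM.
  have sec (f : R -> V -> R) (g : R * V -> R) :
      {ae (leb \x lebd)%E, forall z, strip z -> g z = f z.1 z.2} ->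
      {ae leb, forall t, t \in `]0, T[ -> {ae lebd, forall x, g (t, x) = f t x}}.
    move=> gf; have H : {ae (leb \x lebd)%E, forall z,
        (fun t x => strip (t, x) -> g (t, x) = f t x) z.1 z.2} by apply: ae_mono gf => -[].
    apply: ae_mono (@ae_sections _ _ _ _ _ leb lebd (fun t x => strip (t, x) -> g (t, x) = f t x) H).
    by move=> t Ht tT; apply: ae_mono Ht => x; apply; split.
  apply: ae_mono (ae_and wD (ae_and (sec (fun t x => v t x 0 k) (F k) Fv)
    (sec (fun t x => Dv t x k j) _ Dvv))) => s [w [h1 h2]] sT.
  have msec (g : R * V -> R) : measurable_fun setT g -> measurable_fun setT (fun y => g (s, y)).
    by move=> mg; apply: measurableT_comp.
  apply: weak_partial_ae_eq (w sT k j).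
  - by apply: measurable_rV_coord; exact: (strip_section (f := v) sT mv).
  - exact: (strip_section (f := fun t x => Dv t x k j) sT (mDvc k j)).
  - by under eq_fun do rewrite /= rV_consK; exact: msec.
  - by under eq_fun do rewrite /= rV_consK; exact: msec.
  - by apply: ae_mono (h1 sT) => x /= <-; rewrite rV_consK.
  - by apply: ae_mono (h2 sT) => x /= <-; rewrite rV_consK.
have AF : {ae (leb \x lebd)%E, forall z, forall k, strip z -> F k z = v z.1 z.2 0 k}.
  by apply: filter_forall => k; have [] := HF k.
have AG : {ae (leb \x lebd)%E, forall z, forall k, strip z -> G k z = vt z.1 z.2 0 k}.
  by apply: filter_forall => k; have [] := HG k.
have AD : {ae (leb \x lebd)%E, forall z, forall kj, strip z -> GD kj z = Dv z.1 z.2 kj.1 kj.2}.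
  by apply: filter_forall => kj; have [] := HGD kj.
have := ae_and AF (ae_and AG (ae_and AD (ae_and PDE v_clamped))).
move=> /ae_rV_uncons; apply: ae_mono => w [hF [hG [hD [hP hv]]]] wT k.
have wS : strip (rV_uncons w) by split.
split; first by rewrite /= hF// hv.
rewrite -[RHS](hP wS k) /= hG//; congr (_ + _ + _).
by apply: eq_bigr => j _; rewrite hD.
Qed.
End velocity.

(** * Choice of small parameters *)

(** A common lower bound for finitely many positive numbers, from which the small
    parameters of the proofs are chosen. *)
Lemma small_pos (R : realType) (s : seq R) : all (fun x => 0 < x) s ->
  exists2 e, 0 < e & all (fun x => e <= x) s.
Proof.
elim: s => [_|x s IH /= /andP[x0 /IH[e e0 es]]]; first by exists 1.
exists (Num.min x e); first by rewrite lt_min x0.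
by rewrite ge_min lexx/=; apply: sub_all es => y ey; rewrite ge_min ey orbT.
Qed.

Lemma dist_near3 (R : numDomainType) (x x' y y' a b c : R) : `|x - x'| <= a -> `|y - y'| <= b ->
  `|x - y| <= c -> `|x' - y'| <= c + (a + b).
Proof.
move=> xa yb xy; apply: le_trans (ler_distD x _ _) _; rewrite addrCA distrC lerD//.
by apply: le_trans (ler_distD y _ _) _; rewrite lerD.
Qed.

(** Inequalities placing a mollification window of radius e around tau, where tau runs
    in [s + 2 e, t - 2 e], inside [s, t]. *)
Section windows.
Context {R : realFieldType}.
Implicit Types s t tau sg e T : R.

Lemma near_shift s t tau e e1 : 0 < e -> e <= e1 / 4 -> `|t - tau| <= 2 * e -> `|s - tau| < e ->
  `|t - s| < e1.
Proof.
move=> e0 ee tt ts; apply: le_lt_trans (ler_distD tau _ _) _.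
by rewrite (distrC tau); lra.
Qed.

Lemma window_center s t tau e T : 0 < e -> s + 2 * e <= tau -> tau <= t - 2 * e -> 0 <= s -> t <= T ->
  0 < tau - e /\ tau + e < T.
Proof. by move=> *; split; lra. Qed.

Lemma window_in s t sg T : 0 <= s -> t <= T -> s < sg < t -> 0 < sg < T.
Proof. by move=> s0 tT /andP[h1 h2]; rewrite (le_lt_trans s0 h1) (lt_le_trans h2). Qed.

Lemma window s t tau sg e T : `|tau - sg| < e -> s + 2 * e <= tau -> tau <= t - 2 * e ->
  0 <= s -> t <= T -> 0 <= sg <= T /\ s < sg < t.
Proof. by rewrite ltr_norml => /andP[? ?] *; split; apply/andP; split; lra. Qed.

Lemma ball_itv_le tau sg e : `|tau - sg| < e -> tau - e <= sg <= tau + e.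
Proof. by rewrite ltr_norml => /andP[? ?]; apply/andP; split; lra. Qed.

Lemma shrunk_le s t e : 0 < e -> e <= (t - s) / 8 ->
  0 <= (t - 2 * e) - (s + 2 * e) /\ `|(t - 2 * e) - (s + 2 * e)| <= t - s.
Proof. by move=> e0 e8; split; [lra|rewrite ler_norml; apply/andP; split; lra]. Qed.

End windows.

(** * The regularized velocity *)

Section regularized_velocity.
Context {R : realType} {d : nat}.
Local Notation V := 'rV[R]_d.
Local Notation W := 'rV[R]_d.+1.
Local Notation lebW := (@lebesgue_rV R d.+1).
Variable T : R.
Hypothesis T0 : 0 < T.
Variables (b : R -> V -> V) (M : R) (f gt : 'I_d -> W -> R) (gD : 'I_d -> 'I_d -> W -> R).
Hypothesis bc : continuous (fun z : R * V => b z.1 z.2).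
Hypothesis b_clamp : forall t, b (clamp T t) = b t.
Hypothesis M0 : 0 <= M.
Hypothesis mf : forall k, measurable_fun setT (f k).
Hypothesis fM : forall k w, `|f k w| <= M.
Hypothesis mgt : forall k, measurable_fun setT (gt k).
Hypothesis gtM : forall k w, `|gt k w| <= M.
Hypothesis mgD : forall k j, measurable_fun setT (gD k j).
Hypothesis gDM : forall k j w, `|gD k j w| <= M.
Hypothesis f_t : forall k e (p : W), 0 < e -> e < p 0 ord0 -> p 0 ord0 + e < T ->
  moll (upd (eta e) ord0 (dbump e)) (f k) p = moll (eta e) (gt k) p.
Hypothesis f_x : forall k e (p : W), 0 < e -> e < p 0 ord0 -> p 0 ord0 + e < T ->
  forall j, moll (upd (eta e) (lift ord0 j) (dbump e)) (f k) p = moll (eta e) (gD k j) p.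
Variable A : 'I_d -> W -> R.
Hypothesis f_ae : {ae lebW, forall w : W, w 0 ord0 \in `]0, T[ -> forall k,
       f k w = b (w 0 ord0) (rV_uncons w).2 0 k /\
       gt k w + \sum_j gD k j w * b (w 0 ord0) (rV_uncons w).2 0 j + A k w = 0}.

(** The components of b as functions of the single space-time variable, in which the
    mollification takes place. *)
Definition bw k (w : W) : R := b (w 0 ord0) (rV_uncons w).2 0 k.
Definition phi e k (w : W) : R := moll (eta e) (f k) w.
Definition dphi e k (i : 'I_d.+1) (w : W) : R := moll (upd (eta e) i (dbump e)) (f k) w.

Lemma phi_derive e k i w : 0 < e -> is_derive w (delta_mx 0 i : W) (phi e k) (dphi e k i w).
Proof.
move=> e0.
exact: (@moll_derive R d.+1 (eta e) (f k) i (dbump e) e M w e0 (fun j => nice_eta j e0)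
  (nice_dbump e0) (mf k) (fM k) (fun s => is_derive_bump s e0)).
Qed.

Lemma phi_continuous e k : 0 < e -> continuous (phi e k).
Proof.
move=> e0; apply: (@moll_continuous _ _ _ _ e M) => //.
by move=> j; exact: nice_eta e0.
Qed.

Lemma dphi_continuous e k i : 0 < e -> continuous (dphi e k i).
Proof.
move=> e0; apply: (@moll_continuous _ _ _ _ e M) => //.
apply: nice_upd; last exact: nice_dbump.
by move=> j; exact: nice_eta e0.
Qed.

Lemma moll_eta_le (g : W -> R) (C e : R) (w : W) : 0 < e -> measurable_fun setT g -> (forall q : W, `|g q| <= C) ->
  `|moll (eta e) g w| <= C.
Proof.
move=> e0 mg gC; rewrite -(subr0 (moll _ _ _)); apply: (@moll_bump_close _ _ _ _ _ C) => //.
by apply/aeW => q _; rewrite subr0.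
Qed.

Lemma phi_le e k w : 0 < e -> `|phi e k w| <= M.
Proof. by move=> e0; exact: moll_eta_le. Qed.

Lemma dphi_le e k i (w : W) : 0 < e -> e < w 0 ord0 -> w 0 ord0 + e < T -> `|dphi e k i w| <= M.
Proof.
move=> e0 ew wT; rewrite /dphi; case: (unliftP ord0 i) => [j|] ->.
  by rewrite f_x//; exact: moll_eta_le.
by rewrite f_t//; exact: moll_eta_le.
Qed.

Definition bw_lip_cst : R := d.+1%:R * M.

Lemma bw_lip_cst_ge0 : 0 <= bw_lip_cst. Proof. by rewrite mulr_ge0. Qed.

(** The partial derivatives of phi are mollifications of the bounded functions gt and
    gD, so they are bounded by M independently of e; hence the Lipschitz constants do
    not degenerate as e -> 0. *)
Lemma phi_lip e k (w w' : W) : 0 < e -> e < w 0 ord0 -> w 0 ord0 + e < T ->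
  e < w' 0 ord0 -> w' 0 ord0 + e < T -> `|phi e k w - phi e k w'| <= bw_lip_cst * `|w - w'|.
Proof.
move=> e0 ew wT ew' wT'; apply: (@rV_Lipschitz _ _ (phi e k) (dphi e k)) => [i x|i z Hz].
  exact: phi_derive.
have [c /andP[c0 c1] zE] := Hz ord0.
have zE' : z 0 ord0 = (1 - c) * w' 0 ord0 + c * w 0 ord0 by rewrite zE; ring.
have c1' : 0 <= 1 - c by rewrite subr_ge0.
have conv (a b' : R) : 0 < a -> 0 < b' -> 0 < (1 - c) * a + c * b'.
  move=> a0 b0; have [->|cn0] := eqVneq c 0; first by rewrite subr0 mul1r mul0r addr0.
  by rewrite ltr_wpDl ?mulr_ge0 ?mulr_gt0 ?(ltW a0)// lt_neqAle eq_sym cn0.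
apply: dphi_le => //; rewrite zE'.
  by have := conv (w' 0 ord0 - e) (w 0 ord0 - e); rewrite !subr_gt0 => /(_ ew' ew); lra.
by have := conv (T - (w' 0 ord0 + e)) (T - (w 0 ord0 + e)); rewrite !subr_gt0 => /(_ wT' wT); lra.
Qed.

Lemma bw_continuous k : continuous (bw k).
Proof.
apply: continuous_coord => w.
apply: (@continuous_comp _ _ _ (@rV_uncons R d) (fun z => b z.1 z.2)); last exact: bc.
exact: continuous_rV_uncons.
Qed.

Lemma phi_close0 e k (w : W) dl : 0 < e -> e < w 0 ord0 -> w 0 ord0 + e < T ->
  (forall q : W, `|w - q| < e -> `|bw k q - bw k w| <= dl) -> `|phi e k w - bw k w| <= dl.
Proof.
move=> e0 ew wT H; apply: (@moll_bump_close _ _ _ _ _ M) => //.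
apply: ae_mono f_ae => q Hq wq.
have [|-> _] := Hq _ k; last exact: H.
have := coord_le_norm (w - q) ord0; rewrite mxE [X in _ + X]mxE => /le_lt_trans/(_ wq).
by rewrite ltr_norml in_itv/= => /andP[? ?]; apply/andP; split; lra.
Qed.

(** The limit e -> 0 of [phi_lip]. *)
Lemma bw_lip_int k (w w' : W) : 0 < w 0 ord0 < T -> 0 < w' 0 ord0 < T ->
  `|bw k w - bw k w'| <= bw_lip_cst * `|w - w'|.
Proof.
move=> /andP[w0 wT] /andP[w0' wT']; apply/ler_addgt0Pr => dl dl0.
have dl2 : 0 < dl / 2 by rewrite divr_gt0.
have cb (q : W) : \forall q' \near q, `|bw k q - bw k q'| <= dl / 2.
  by move: (@bw_continuous k q) => /cvgrPdist_le; apply.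
have /nbhs_normP[e1 /= e10 He1] := cb w.
have /nbhs_normP[e2 /= e20 He2] := cb w'.
have [|e e0 /= /and5P[h1 h2 h3 h4 /and3P[h5 h6 _]]] := @small_pos R
  [:: e1; e2; w 0 ord0 / 2; w' 0 ord0 / 2; (T - w 0 ord0) / 2; (T - w' 0 ord0) / 2].
  by rewrite /= e10 e20 !divr_gt0// subr_gt0.
have g3 : e < w 0 ord0 by lra.
have g4 : e < w' 0 ord0 by lra.
have g5 : w 0 ord0 + e < T by lra.
have g6 : w' 0 ord0 + e < T by lra.
have c1 : `|phi e k w - bw k w| <= dl / 2.
  by apply: phi_close0 => // q wq; rewrite distrC; apply: He1; exact: lt_le_trans wq h1.
have c2 : `|phi e k w' - bw k w'| <= dl / 2.
  by apply: phi_close0 => // q wq; rewrite distrC; apply: He2; exact: lt_le_trans wq h2.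
have := phi_lip k e0 g3 g5 g4 g6; set X := bw_lip_cst * _ => c3.
by have := dist_near3 c1 c2 c3; rewrite -splitr.
Qed.

(** For times in ]0, T[ this is [bw_lip_int]. Closed times are reached by the affine
    contraction of [0, T] into its interior, which does not increase distances and
    moves points by at most h; other times by clamping. *)
Lemma bw_lip k (w w' : W) : `|bw k w - bw k w'| <= bw_lip_cst * `|w - w'|.
Proof.
wlog [wT wT'] : w w' / 0 <= w 0 ord0 <= T /\ 0 <= w' 0 ord0 <= T.
  move=> H; pose c (w : W) := rV_cons (clamp T (w 0 ord0), (rV_uncons w).2).
  have cE u : bw k (c u) = bw k u.
    by rewrite /bw /c rV_cons_coord0 b_clamp rV_consK.
  rewrite -(cE w) -(cE w'); apply: le_trans (H (c w) (c w') _) _.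
    by rewrite !rV_cons_coord0; split; exact: clamp_itv.
  rewrite ler_wpM2l ?bw_lip_cst_ge0//; apply: norm_le_coord => // i.
  rewrite mxE [X in _ + X]mxE; case: (unliftP ord0 i) => [j|] ->.
    rewrite !rV_cons_coordS/= !mxE; have := coord_le_norm (w - w') (lift ord0 j).
    by rewrite mxE [X in _ + X]mxE.
  rewrite !rV_cons_coord0/=; apply: le_trans (clamp_lip _ _ _) _ => //.
  by have := coord_le_norm (w - w') ord0; rewrite mxE [X in _ + X]mxE.
apply/ler_addgt0Pr => dl dl0.
have dl2 : 0 < dl / 2 by rewrite divr_gt0.
have cb (q : W) : \forall q' \near q, `|bw k q - bw k q'| <= dl / 2.
  by move: (@bw_continuous k q) => /cvgrPdist_le; apply.
have /nbhs_normP[e1 /= e10 He1] := cb w.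
have /nbhs_normP[e2 /= e20 He2] := cb w'.
have [|h h0 /= /and4P[h1 h2 h3 _]] := @small_pos R [:: e1 / 2; e2 / 2; T / 4].
  by rewrite /= !divr_gt0.
(* the image of [0, T] under c is [h, T - h] *)
pose c (w : W) := rV_cons (h + (1 - 2 * h / T) * w 0 ord0, (rV_uncons w).2).
have hT : 0 <= 2 * h / T <= 1.
  by rewrite divr_ge0 ?ler_pdivrMr ?ltW//=; [lra|rewrite mulr_gt0].
have cw (u : W) : 0 <= u 0 ord0 <= T -> `|u - c u| <= h /\ 0 < c u 0 ord0 < T.
  move=> /andP[u0 uT].
  have E : 2 * h / T * u 0 ord0 = 2 * h * (u 0 ord0 / T) by field; rewrite gt_eqF.
  have u1 : 0 <= u 0 ord0 / T <= 1 by rewrite divr_ge0 ?(ltW T0)//= ler_pdivrMr// mul1r.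
  split.
    apply: norm_le_coord => [|i]; first exact: ltW.
    rewrite mxE [X in _ + X]mxE; case: (unliftP ord0 i) => [j|] ->.
      by rewrite !rV_cons_coordS/= !mxE subrr normr0 ltW.
    rewrite !rV_cons_coord0/= mulrBl mul1r E ler_norml.
    by move/andP: u1 => [? ?]; apply/andP; split; nra.
  rewrite !rV_cons_coord0/= mulrBl mul1r E.
  have uE : u 0 ord0 = T * (u 0 ord0 / T) by field; rewrite gt_eqF.
  move: u1; set y := _ / T in uE * => /andP[y0 y1]; rewrite uE.
  by apply/andP; split; nra.
have [cw1 cw2] := cw w wT; have [cw1' cw2'] := cw w' wT'.
have b1 : `|bw k w - bw k (c w)| <= dl / 2.
  by apply: He1 => /=; apply: le_lt_trans cw1 _; lra.
have b2 : `|bw k w' - bw k (c w')| <= dl / 2.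
  by apply: He2 => /=; apply: le_lt_trans cw1' _; lra.
have b3 := bw_lip_int k cw2 cw2'.
have b4 : bw_lip_cst * `|c w - c w'| <= bw_lip_cst * `|w - w'|.
  rewrite ler_wpM2l ?bw_lip_cst_ge0//; apply: norm_le_coord => // i.
  rewrite mxE [X in _ + X]mxE; case: (unliftP ord0 i) => [j|] ->.
    rewrite !rV_cons_coordS/= !mxE; have := coord_le_norm (w - w') (lift ord0 j).
    by rewrite mxE [X in _ + X]mxE.
  rewrite !rV_cons_coord0/= opprD addrACA subrr add0r -mulrBr normrM.
  have := coord_le_norm (w - w') ord0; rewrite mxE [X in _ + X]mxE => H.
  apply: le_trans (_ : 1 * _ <= _); last by rewrite mul1r; exact: H.
  by rewrite ler_wpM2r// ler_norml; case/andP: hT => *; apply/andP; split; lra.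
move: (le_trans b3 b4) b1 b2; set X := bw_lip_cst * _ => {}b3.
by rewrite distrC => b1; rewrite distrC => b2; have := dist_near3 b1 b2 b3; rewrite -splitr.
Qed.

Lemma phi_close e k (w : W) : 0 < e -> e < w 0 ord0 -> w 0 ord0 + e < T ->
  `|phi e k w - bw k w| <= bw_lip_cst * e.
Proof.
move=> e0 ew wT; apply: phi_close0 => // q wq; rewrite distrC.
by apply: le_trans (bw_lip _ _ _) _; rewrite ler_wpM2l ?bw_lip_cst_ge0// ltW.
Qed.

(** The left side is the mollification of gt + \sum_j phi_j(w) gD_j, whose
    coefficients are frozen at w. On the window around w, by the equation satisfied by
    b, this differs from - A k w by increments of A and of b over a distance e. *)
Lemma phi_equation LA e k (w : W) : 0 <= LA ->
  (forall q : W, `|A k w - A k q| <= LA * `|w - q|) ->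
  0 < e -> e < w 0 ord0 -> w 0 ord0 + e < T ->
  `|dphi e k ord0 w + \sum_j phi e j w * dphi e k (lift ord0 j) w + A k w| <=
  (LA + 2 * d%:R * (bw_lip_cst * M)) * e.
Proof.
move=> LA0 AL e0 ew wT.
have ne := fun i : 'I_d.+1 => nice_eta i e0.
pose g (q : W) := gt k q + \sum_j phi e j w * gD k j q.
have mg : measurable_fun setT g.
  apply: measurable_funD; first exact: mgt.
  by apply: measurable_sum => j; apply: measurable_funM; [exact: measurable_cst|exact: mgD].
have gB q : `|g q| <= M + d%:R * (M * M).
  apply: le_trans (ler_normD _ _) _; apply: lerD; first exact: gtM.
  apply: le_trans (ler_norm_sum _ _ _) _; apply: (@le_trans _ _ (\sum_(j < d) M * M)).
    by apply: ler_sum => j _; rewrite normrM; apply: ler_pM => //; exact: phi_le.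
  by rewrite sumr_const card_ord -(mulr_natl (M * M)).
have igt := moll_integrable w e0 ne (mgt k) (gtM k).
have igD j := moll_integrable w e0 ne (mgD k j) (gDM k j).
have -> : dphi e k ord0 w + \sum_j phi e j w * dphi e k (lift ord0 j) w = moll (eta e) g w.
  rewrite /dphi f_t//; under eq_bigr do rewrite f_x//.
  rewrite /moll; under [RHS]eq_Rintegral do rewrite /g mulrDr mulr_sumr.
  rewrite RintegralD//; last first.
    apply: integrable_sumr => // j; under eq_fun do rewrite mulrCA; exact: integrableZr.
  congr (_ + _); rewrite Rintegral_sumr//; last first.
    by move=> j; under eq_fun do rewrite mulrCA; exact: integrableZr.
  apply: eq_bigr => j _; under [RHS]eq_Rintegral do rewrite mulrCA.
  by rewrite RintegralZl.
rewrite -[A k w]opprK; apply: (moll_bump_close e0 mg gB).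
apply: ae_mono f_ae => q Hq wq.
have [|_] := Hq _ k.
  have := coord_le_norm (w - q) ord0; rewrite mxE [X in _ + X]mxE => /le_lt_trans/(_ wq).
  by rewrite ltr_norml in_itv/= => /andP[? ?]; apply/andP; split; lra.
move=> /eqP; rewrite -addrA addr_eq0 => /eqP gtE.
have -> : g q - - A k w = (A k w - A k q) + \sum_j (phi e j w - bw j q) * gD k j q.
  under [in RHS]eq_bigr do rewrite mulrBl.
  rewrite sumrB /g gtE opprK opprD.
  have -> : \sum_j gD k j q * b (q 0 ord0) (rV_uncons q).2 0 j = \sum_j bw j q * gD k j q.
    by apply: eq_bigr => j _; rewrite mulrC.
  ring.
rewrite mulrDl; apply: le_trans (ler_normD _ _) _; apply: lerD.
  by apply: le_trans (AL _) _; rewrite ler_wpM2l// ltW.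
apply: le_trans (ler_norm_sum _ _ _) _; apply: (@le_trans _ _ (\sum_(j < d) (2 * bw_lip_cst * e) * M)).
  apply: ler_sum => j _; rewrite normrM; apply: ler_pM => //.
  rewrite -(subrKA (bw j w)); apply: le_trans (ler_normD _ _) _.
  have c1 := phi_close j e0 ew wT.
  have c2 : `|bw j w - bw j q| <= bw_lip_cst * e.
    by apply: le_trans (bw_lip _ _ _) _; rewrite ler_wpM2l ?bw_lip_cst_ge0// ltW.
  by rewrite (le_trans (lerD c1 c2))// -mulrA mulr2n mulrDl mul1r.
rewrite sumr_const card_ord -(mulr_natl (_ * M)) le_eqVlt; apply/orP; left; apply/eqP; ring.
Qed.

End regularized_velocity.

(** * Smooth test functions and cutoffs *)

Section smooth_functions.
Context {R : realType} {d : nat}.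
Local Notation V := 'rV[R]_d.
Local Notation evec i := (delta_mx 0 i : V).

(** Test functions are carried around with their partial derivatives, in the shape in
    which the weak formulations use them. *)
Definition smooth (psi psit : R -> V -> R) (psix : 'I_d -> R -> V -> R) : Prop :=
  [/\ continuous (fun z : R * V => psi z.1 z.2),
      continuous (fun z : R * V => psit z.1 z.2),
      (forall i, continuous (fun z : R * V => psix i z.1 z.2)),
      (forall t x, is_derive t (1 : R) (psi^~ x) (psit t x)) &
      (forall i t x, is_derive x (evec i) (psi t) (psix i t x))].

Lemma smooth_C1_on I psi psit psix : smooth psi psit psix -> C1_on I psi psit psix.
Proof.
by move=> [c1 c2 c3 d1 d2]; split => // [| |i]; apply: continuous_subspaceT => //; exact: c3.
Qed.

Lemma smooth_mul f ft fx g gt gx : smooth f ft fx -> smooth g gt gx ->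
  smooth (fun t x => f t x * g t x) (fun t x => f t x * gt t x + g t x * ft t x)
    (fun i t x => f t x * gx i t x + g t x * fx i t x).
Proof.
move=> [c1 c2 c3 d1 d2] [c1' c2' c3' d1' d2']; split.
- by move=> z; apply: continuousM; [exact: c1|exact: c1'].
- by move=> z; apply: cvgD; apply: cvgM; [exact: c1|exact: c2'|exact: c1'|exact: c2].
- by move=> i z; apply: cvgD; apply: cvgM; [exact: c1|exact: c3'|exact: c1'|exact: c3].
- by move=> t x; exact: is_deriveM.
- by move=> i t x; exact: is_deriveM.
Qed.

Lemma smooth_time (z dz : R -> R) : (forall s, is_derive s (1 : R) z (dz s)) ->
  continuous dz -> smooth (fun t _ => z t) (fun t _ => dz t) (fun _ _ _ => 0).
Proof.
move=> dzz cdz; have cz : continuous z.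
  by move=> s; apply/differentiable_continuous/derivable1_diffP; have [] := dzz s.
split => //.
- by move=> p; apply: (@continuous_comp _ _ _ fst z); [exact: cvg_fst|exact: cz].
- by move=> p; apply: (@continuous_comp _ _ _ fst dz); [exact: cvg_fst|exact: cdz].
- by move=> i p; exact: cst_continuous.
- by move=> i t x; exact: is_derive_cst.
Qed.

Lemma smooth_space (g : V -> R) (gx : 'I_d -> V -> R) : continuous g ->
  (forall i x, is_derive x (evec i) g (gx i x)) -> (forall i, continuous (gx i)) ->
  smooth (fun _ x => g x) (fun _ _ => 0) (fun i _ x => gx i x).
Proof.
move=> cg dg cgx; split => //.
- by move=> p; apply: (@continuous_comp _ _ _ snd g); [exact: cvg_snd|exact: cg].
- by move=> p; exact: cst_continuous.
- by move=> i p; apply: (@continuous_comp _ _ _ snd (gx i)); [exact: cvg_snd|exact: cgx].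
- by move=> t x; exact: is_derive_cst.
Qed.

(** The bump rescaled to have maximum 1: its derivative is of order 1 / N, so
    multiplying a test function by the cutoff perturbs its derivatives by a vanishing
    amount. *)
Definition cut1 (N : nat) (s : R) : R := 16 * N.+1%:R / 15 * bump N.+1%:R s.
Definition dcut1 (N : nat) (s : R) : R := 16 * N.+1%:R / 15 * dbump N.+1%:R s.

Lemma is_derive_cut1 N s : is_derive s (1 : R) (cut1 N) (dcut1 N s).
Proof.
have := is_deriveZ (16 * N.+1%:R / 15) (is_derive_bump s (ltr0Sn R N)).
by congr is_derive.
Qed.

Lemma cut1_le N s : `|cut1 N s| <= 1.
Proof.
have n0 : 0 < N.+1%:R :> R by [].
rewrite /cut1 normrM ger0_norm ?divr_ge0 ?mulr_ge0//.
apply: le_trans (ler_wpM2l _ (bump_le s n0)) _; first by rewrite divr_ge0 ?mulr_ge0.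
by rewrite le_eqVlt; apply/orP; left; apply/eqP; field; rewrite gt_eqF.
Qed.

Lemma dcut1_le N s : `|dcut1 N s| <= 4 / N.+1%:R.
Proof.
have n0 : 0 < N.+1%:R :> R by [].
rewrite /dcut1 normrM ger0_norm ?divr_ge0 ?mulr_ge0//.
apply: le_trans (ler_wpM2l _ (dbump_le s n0)) _; first by rewrite divr_ge0 ?mulr_ge0.
by rewrite le_eqVlt; apply/orP; left; apply/eqP; field; rewrite gt_eqF.
Qed.

Lemma nice_scale e c (k : R -> R) : nice1 e k -> nice1 e (fun s => c * k s).
Proof.
move=> [C [C0 kC kL k0]]; exists (`|c| * C); split.
- by rewrite mulr_ge0.
- by move=> s; rewrite normrM ler_wpM2l.
- by move=> s t; rewrite -mulrBr normrM -mulrA ler_wpM2l.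
- by move=> s /k0 ->; rewrite mulr0.
Qed.

Lemma nice_cut1 N : nice1 N.+1%:R (cut1 N).
Proof. exact/nice_scale/nice_bump. Qed.

Lemma nice_dcut1 N : nice1 N.+1%:R (dcut1 N).
Proof. exact/nice_scale/nice_dbump. Qed.

Lemma cut1E N s : cut1 N s = (Num.max 0 (1 - (s / N.+1%:R) ^+ 2)) ^+ 2.
Proof.
have n0 : 0 < N.+1%:R :> R by [].
set n : R := N.+1%:R in n0 *.
have -> : Num.max 0 (1 - (s / n) ^+ 2) = n ^- 2 * Num.max 0 (n ^+ 2 - s ^+ 2).
  rewrite maxr_pMr ?invr_ge0 ?exprn_ge0 ?ltW// mulr0; congr Num.max.
  by field; rewrite gt_eqF.
by rewrite /cut1 /bump -/n; field; rewrite gt_eqF.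
Qed.

Lemma cvg_cut1 s : cut1 N s @[N --> \oo] --> (1 : R).
Proof.
under eq_fun do rewrite cut1E.
pose h (y : R) := (Num.max 0 (1 - y ^+ 2)) ^+ 2.
have ch : h y @[y --> (0 : R)] --> h 0.
  have c1 : (1 - y ^+ 2) @[y --> (0 : R)] --> (1 - 0 ^+ 2 : R).
    by apply: cvgB; [exact: cvg_cst|exact: exprn_continuous].
  apply: (@cvg_comp _ _ _ (fun y => 1 - y ^+ 2) (fun y => Num.max 0 y ^+ 2) _ _ _ c1).
  have : {for (1 - 0 ^+ 2 : R), continuous (fun y : R => Num.max 0 y ^+ 2)}; last exact.
  apply/differentiable_continuous/derivable1_diffP.
  by have [] := is_derive_maxsq (1 - 0 ^+ 2 : R).
have h0 : h 0 = 1 by rewrite /h expr0n/= subr0 max_r// expr1n.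
have cs : s * N.+1%:R^-1 @[N --> \oo] --> (0 : R).
  rewrite -[X in _ --> X](mulr0 s); apply: cvgM; first exact: cvg_cst.
  exact: cvg_harmonic.
by have := cvg_comp _ _ cs ch; rewrite h0; exact.
Qed.

Definition cut N (x : V) : R := prodf (fun=> cut1 N) x.
Definition dcut N i (x : V) : R := prodf (upd (fun=> cut1 N) i (dcut1 N)) x.

Lemma smooth_cut N : smooth (fun _ => cut N) (fun _ _ => 0) (fun i _ => dcut N i).
Proof.
have cc k : (forall i, nice1 N.+1%:R (k i)) -> continuous (@prodf R d k).
  by move=> kN; apply: continuous_prodf => i; exact: nice_continuous (kN i).
apply: smooth_space.
- by apply: cc => i; exact: nice_cut1.
- by move=> i x; apply: is_derive_prodf => s; exact: is_derive_cut1.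
- move=> i; apply: cc; apply: nice_upd; last exact: nice_dcut1.
  by move=> j; exact: nice_cut1.
Qed.

Lemma cut_out N x : N.+1%:R <= `|x| -> cut N x = 0.
Proof. by move=> Nx; apply: (@prodf_out _ _ N.+1%:R) => // i; exact: nice_cut1. Qed.

Lemma cut_le N x : `|cut N x| <= 1.
Proof.
rewrite /cut /prodf normr_prod; apply: prodr_ile1 => i _.
by rewrite normr_ge0 cut1_le.
Qed.

Lemma dcut_le N i x : `|dcut N i x| <= 4 / N.+1%:R.
Proof.
rewrite /dcut /prodf normr_prod (bigD1 i)//= /upd eqxx -[leRHS]mulr1.
apply: ler_pM => //; [by rewrite prodr_ge0|exact: dcut1_le|].
by apply: prodr_ile1 => j /negbTE ->; rewrite normr_ge0 cut1_le.
Qed.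

Lemma cvg_cut x : cut N x @[N --> \oo] --> (1 : R).
Proof.
have <- : \prod_(i < d) (1 : R) = 1 by rewrite big1.
by apply: cvg_prodr => i; exact: cvg_cut1.
Qed.

Lemma cvg_dcut i x : dcut N i x @[N --> \oo] --> (0 : R).
Proof.
apply/cvgr0Pnorm_le => e e0.
have : \forall N \near \oo, `|4 * harmonic N| <= e :> R.
  move: e e0; apply/cvgr0Pnorm_le; rewrite -[X in _ --> X](mulr0 4).
  by apply: cvgM; [exact: cvg_cst|exact: cvg_harmonic].
apply: filterS => N; apply: le_trans; apply: le_trans (dcut_le _ _ _) _.
by rewrite ger0_norm// mulr_ge0// invr_ge0.
Qed.

(** The cutoff gives compact support in space, and the hypotheses on a and c keep the
    support away from the times 0 and T. *)
Lemma smooth_cylinder T a c N psi psit psix : smooth psi psit psix -> 0 < a -> c < T ->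
  (forall t x, psi t x != 0 -> a <= t <= c) ->
  C1c_cylinder T (fun t x => cut N x * psi t x)
    (fun t x => cut N x * psit t x + psi t x * 0)
    (fun i t x => cut N x * psix i t x + psi t x * dcut N i x).
Proof.
move=> sp a0 cT supp.
have S1 := smooth_mul (smooth_cut N) sp.
pose S : set (R * V) := `[a, c] `*` [set y | `|y| <= N.+1%:R].
have cS : compact S.
  apply: compact_setX; first exact: segment_compact.
  apply: bounded_closed_compact.
    exists N.+1%:R; split; first exact: num_real.
    by move=> M' MM y /= ye; apply: le_trans (ltW MM).
  apply: (@closed_comp _ _ (fun y : V => `|y|) [set y : R | y <= N.+1%:R]); last exact: closed_le.
  by move=> y _; exact: norm_continuous.
have clS : closed S by apply: compact_closed => //; exact: norm_hausdorff.
have H : closure [set z : R * V | cut N z.2 * psi z.1 z.2 != 0] `<=` S.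
  rewrite (proj1 (closure_id _) clS); apply: closure_subset => -[t x] /=.
  rewrite mulf_eq0 negb_or => /andP[cx px]; split => /=.
    by rewrite in_itv/=; exact: supp px.
  by rewrite leNgt; apply: contra cx => /ltW/cut_out ->.
split.
- exact: smooth_C1_on S1.
- by apply: subclosed_compact cS H; exact: closed_closure.
- move=> z /H [] /=; rewrite !in_itv/= => /andP[? ?] _; split => //=.
  by apply/andP; split; lra.
Qed.

End smooth_functions.

Lemma normv_le (R : realType) d (x : 'rV[R]_d) c : 0 <= c -> (forall i, `|x 0 i| <= c) ->
  normv x <= d%:R * c.
Proof.
move=> c0 xc; rewrite /normv -(@ger0_norm _ (d%:R * c)) ?mulr_ge0// -sqrtr_sqr ler_wsqrtr//.
apply: (@le_trans _ _ (\sum_(i < d) c ^+ 2)).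
  by apply: ler_sum => i _; rewrite -expr2 -real_normK ?num_real// lerXn2r ?nnegrE.
rewrite sumr_const card_ord -(mulr_natl (c ^+ 2)) exprMn ler_wpM2r ?sqr_ge0//.
by rewrite -natrX ler_nat; case: (d) => // n; rewrite expnS expn1 leq_pmull.
Qed.

Lemma leb_itv_lty (R : realType) (a b : R) : (@lebesgue_measure R `]a, b[ < +oo)%E.
Proof. by rewrite lebesgue_measure_itv/=; case: ifP; rewrite ?ltry// -EFinB ltry. Qed.

(** * Transport by a bounded continuous field *)

Section transport.
Context {R : realType} {d : nat}.
Local Notation V := 'rV[R]_d.
Local Notation leb := (@lebesgue_measure R).
Variable T : R.
Hypothesis T0 : 0 < T.

(** A test function bounded by c together with its gradient is c times an admissible
    function of the flat metric. *)
Lemma flat_dist_test (m1 m2 : probability V R) (phi : V -> R) c : 0 < c -> C1 phi ->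
  (forall x, `|phi x| <= c) -> (forall x, normv (grad phi x) <= c) ->
  ((\int[m1]_x phi x - \int[m2]_x phi x)%:E <= c%:E * flat_dist m1 m2)%E.
Proof.
move=> c0 phi1 phic gphic.
have ci0 : 0 < c^-1 by rewrite invr_gt0.
have mphi : measurable_fun setT phi.
  by apply: measurable_continuous_rV => x; apply: differentiable_continuous; case: phi1.
have iphi (m : probability V R) : m.-integrable setT (EFin \o phi).
  apply: (@bounded_integrable _ _ _ _ _ _ _ c) => //.
  by apply: (le_lt_trans (probability_le1 m measurableT)); rewrite ltry.
have gE x : grad (fun x => c^-1 * phi x) x = c^-1 *: grad phi x.
  apply/rowP => i; rewrite !mxE.
  have dx : derivable phi x (delta_mx 0 i) by apply: diff_derivable; case: phi1.
  by have [_] := is_deriveZ c^-1 (DeriveDef dx erefl).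
have nE (y : V) : normv (c^-1 *: y) = c^-1 * normv y.
  rewrite /normv /dotv; under eq_bigr do rewrite !mxE mulrACA -expr2.
  by rewrite -mulr_sumr sqrtrM ?sqr_ge0// sqrtr_sqr ger0_norm// ltW.
have -> : (\int[m1]_x phi x - \int[m2]_x phi x)%:E =
    (c%:E * (\int[m1]_x (c^-1 * phi x) - \int[m2]_x (c^-1 * phi x))%:E)%E.
  have E (m : probability V R) : \int[m]_x (c^-1 * phi x) = c^-1 * \int[m]_x phi x.
    by rewrite RintegralZl//; exact: iphi.
  by rewrite -EFinM !E; congr EFin; field; rewrite gt_eqF.
rewrite lee_pmul2l//; apply: ereal_sup_ubound; exists (fun x => c^-1 * phi x); [split|by []].
- split.
    by move=> x; apply: differentiableM => //; case: phi1.
  have [_ cg] := phi1.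
  move=> x; rewrite (_ : grad _ = (fun x => c^-1 *: grad phi x)); last exact/funext.
  exact: cvgZr (cg x).
- by move=> x; rewrite normrM gtr0_norm// mulrC ler_pdivrMr// mul1r.
- by move=> x; rewrite gE nE mulrC ler_pdivrMr// mul1r.
Qed.

Variable m : R -> probability V R.
Hypothesis mflat : flat_continuous T m.
Local Notation l := (fun t => m (clamp T t)).

(** The supremum of [flat_dist] has no absolute value, so that [flat_dist_test] is
    applied to both phi and - phi. *)
Lemma flat_integral_continuous (phi : V -> R) c : 0 < c -> C1 phi ->
  (forall x, `|phi x| <= c) -> (forall x, normv (grad phi x) <= c) ->
  continuous (fun t => \int[l t]_x phi x).
Proof.
move=> c0 phi1 phic gphic t.
have phi1N : C1 (fun x => - phi x).
  have gE x : grad (fun x => - phi x) x = - grad phi x.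
    apply/rowP => i; rewrite !mxE.
    have dx : derivable phi x (delta_mx 0 i) by apply: diff_derivable; case: phi1.
    by have [_] := is_deriveN (DeriveDef dx erefl).
  split; first by move=> x; apply: differentiableN; case: phi1.
  have [_ cg] := phi1.
  move=> x; rewrite (_ : grad _ = (fun x => - grad phi x)); last exact/funext.
  exact: cvgN (cg x).
have gphiNc x : normv (grad (fun x => - phi x) x) <= c.
  have -> : grad (fun x => - phi x) x = - grad phi x.
    apply/rowP => i; rewrite !mxE.
    have dx : derivable phi x (delta_mx 0 i) by apply: diff_derivable; case: phi1.
    by have [_] := is_deriveN (DeriveDef dx erefl).
  have nN (y : V) : normv (- y) = normv y.
    by rewrite /normv /dotv; under eq_bigr do rewrite !mxE mulrNN.
  by rewrite nN.
have key s t' : (`|\int[m s]_x phi x - \int[m t']_x phi x|%:E <= c%:E * flat_dist (m s) (m t'))%E.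
  have [h|h] := ger0P (\int[m s]_x phi x - \int[m t']_x phi x).
    exact: flat_dist_test.
  have -> : - (\int[m s]_x phi x - \int[m t']_x phi x) = \int[m s]_x - phi x - \int[m t']_x - phi x.
    have E (q : probability V R) : \int[q]_x (- phi x) = - \int[q]_x phi x.
      rewrite -mulN1r -RintegralZl//.
        by apply: eq_Rintegral => x _; rewrite mulN1r.
      apply: (@bounded_integrable _ _ _ _ _ _ _ c) => //.
        by apply: (le_lt_trans (probability_le1 q measurableT)); rewrite ltry.
      by apply: measurable_continuous_rV => x; apply: differentiable_continuous; case: phi1.
    by rewrite !E opprB addrC opprK.
  by apply: flat_dist_test => // x; rewrite normrN.
apply/cvgrPdist_le => e e0.
have tT : clamp T t \in `[0, T] by rewrite in_itv/=; exact: clamp_itv.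
have H : \forall s \near within `[0, T] (nbhs (clamp T t)), (flat_dist (m s) (m (clamp T t)) < (e / c)%:E)%E.
  have ec : (0 < (e / c)%:E)%E by rewrite lte_fin divr_gt0.
  exact: (mflat tT (open_ereal_lt' ec)).
have {}H : \forall s \near clamp T t, 0 <= s <= T -> `|\int[m (clamp T t)]_x phi x - \int[m s]_x phi x| <= e.
  have {}H : \forall s \near clamp T t, `[0, T]%classic s ->
    (flat_dist (m s) (m (clamp T t)) < (e / c)%:E)%E := H.
  apply: filterS H => s Hs sT.
  have {}Hs : (flat_dist (m s) (m (clamp T t)) < (e / c)%:E)%E by apply: Hs; rewrite /= in_itv.
  rewrite distrC -lee_fin; apply: le_trans (key _ _) _.
  apply: le_trans (lee_wpmul2l _ (ltW Hs)) _; first by rewrite lee_fin ltW.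
  by rewrite -EFinM lee_fin mulrC divfK// gt_eqF.
have {}H : \forall s \near t, 0 <= clamp T s <= T ->
  `|\int[m (clamp T t)]_x phi x - \int[m (clamp T s)]_x phi x| <= e := continuous_clamp T0 H.
have {}H : \forall s \near t, `|\int[m (clamp T t)]_x phi x - \int[m (clamp T s)]_x phi x| <= e.
  by apply: filterS H => s; apply; exact: clamp_itv.
exact: H.
Qed.

Variables (b : R -> V -> V) (M : R).
Hypothesis bc : continuous (fun z : R * V => b z.1 z.2).
Hypothesis bM : forall t x k, `|b t x 0 k| <= M.

(** The rate of change of a test function along the field b. *)
Definition flux (psit : R -> V -> R) (psix : 'I_d -> R -> V -> R) t x : R :=
  psit t x + \sum_i psix i t x * b t x 0 i.

Lemma measurable_flux psi psit psix : smooth psi psit psix ->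
  measurable_fun setT (fun z : R * V => flux psit psix z.1 z.2).
Proof.
move=> [_ c2 c3 _ _]; apply: measurable_funD; first exact: measurable_continuous_prod.
apply: measurable_sum => i; apply: measurable_funM; first by apply: measurable_continuous_prod; exact: c3.
by apply: measurable_continuous_prod; exact: (@continuous_coord _ _ _ (fun z : R * V => b z.1 z.2)).
Qed.

Hypothesis mb : forall psi psit psix, smooth psi psit psix -> C1c_cylinder T psi psit psix ->
  \int[leb]_(t in `]0, T[) \int[m t]_x flux psit psix t x = 0.

Definition bounded_on (C : R) (psi psit : R -> V -> R) (psix : 'I_d -> R -> V -> R) : Prop :=
  forall t x, 0 <= t <= T -> [/\ `|psi t x| <= C, `|psit t x| <= C & forall i, `|psix i t x| <= C].

Lemma flux_le C psi psit psix t x : bounded_on C psi psit psix -> 0 <= t <= T ->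
  `|flux psit psix t x| <= C + d%:R * (C * M).
Proof.
move=> H tT; have [_ h2 h3] := H t x tT.
apply: le_trans (ler_normD _ _) _; apply: lerD => //.
apply: le_trans (ler_norm_sum _ _ _) _; apply: (@le_trans _ _ (\sum_(j < d) C * M)).
  by apply: ler_sum => j _; rewrite normrM; apply: ler_pM.
by rewrite sumr_const card_ord -(mulr_natl (C * M)).
Qed.

(** Continuity in the flat metric controls integrals of smooth functions only;
    measurability of t |-> l t A for every Borel set A follows by
    [box_measurable_kernel]. *)
Lemma kernel_flat A : measurable A -> measurable_fun setT (fun t => l t A).
Proof.
apply: box_measurable_kernel => // f [f1 _ _ [C C0 fC] f01].
apply: continuous_measurable_fun; apply: (@flat_integral_continuous _ (1 + d%:R * C)) => //.
- by rewrite ltr_pwDl// mulr_ge0.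
- move=> x; have /andP[f0 fx1] := f01 x; rewrite ger0_norm//.
  by rewrite (le_trans fx1)// lerDl mulr_ge0.
- by move=> x; apply: le_trans (normv_le C0 (fC x)) _; rewrite lerDr.
Qed.

Lemma measurable_kernel_integral (k : R * V -> R) : measurable_fun setT k ->
  measurable_fun setT (fun t => \int[l t]_x k (t, x)).
Proof. by move=> mk; apply: (measurable_Rint_kernel (l := l)) => //; exact: kernel_flat. Qed.

(** The equation is given for tests of compact support. Multiplying by the cutoffs
    [cut] and passing to the limit by dominated convergence extends it to bounded
    tests, because the derivatives of the cutoffs tend to zero. *)
Lemma weak_compact C a c psi psit psix : smooth psi psit psix ->
  bounded_on C psi psit psix -> 0 < a -> c < T ->
  (forall t x, psi t x != 0 -> a <= t <= c) ->
  \int[leb]_(t in `]0, T[) \int[l t]_x flux psit psix t x = 0.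
Proof.
move=> sp bp a0 cT supp.
pose ft N t x := cut N x * psit t x + psi t x * 0.
pose fx N i t x := cut N x * psix i t x + psi t x * dcut N i x.
have sN N : smooth (fun t x => cut N x * psi t x) (ft N) (fx N) := smooth_mul (smooth_cut N) sp.
have mflux N := measurable_flux (sN N).
have tT t : t \in `]0, T[ -> 0 <= t <= T by rewrite in_itv/= => /andP[? ?]; rewrite !ltW.
have I0 N : \int[leb]_(t in `]0, T[) \int[l t]_x flux (ft N) (fx N) t x = 0.
  rewrite -[RHS](mb (sN N) (smooth_cylinder N sp a0 cT supp)).
  by apply: eq_Rintegral => t; rewrite inE/= => /tT ?; rewrite clamp_id.
have bN N : bounded_on (C * 5) (fun t x => cut N x * psi t x) (ft N) (fx N).
  move=> t x /(bp t x)[h1 h2 h3]; have C0 : 0 <= C := le_trans (normr_ge0 _) h1.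
  have cl := cut_le N x; split.
  - by rewrite normrM mulrC; apply: ler_pM => //; rewrite (le_trans cl)// ler1n.
  - by rewrite /ft mulr0 addr0 normrM mulrC; apply: ler_pM => //; rewrite (le_trans cl)// ler1n.
  - move=> i; rewrite /fx; apply: le_trans (ler_normD _ _) _; rewrite !normrM.
    have -> : C * 5 = 1 * C + C * 4 by ring.
    apply: lerD; first exact: ler_pM.
    apply: ler_pM => //; apply: le_trans (dcut_le _ _ _) _.
    by rewrite ler_pdivrMr// ler_peMr// ler1n.
have bd N t x := @flux_le _ _ _ _ t x (bN N).
have mfl := measurable_flux sp.
have cvgx t x : flux (ft N) (fx N) t x @[N --> \oo] --> flux psit psix t x.
  rewrite /flux /ft /fx; apply: cvgD.
    have {2}-> : psit t x = 1 * psit t x + psi t x * 0 by rewrite mul1r mulr0 addr0.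
    by apply: cvgD; [apply: cvgM; [exact: cvg_cut|exact: cvg_cst]|exact: cvg_cst].
  apply: cvg_sumr => i; apply: cvgM; last exact: cvg_cst.
  have {2}-> : psix i t x = 1 * psix i t x + psi t x * 0 by rewrite mul1r mulr0 addr0.
  apply: cvgD; apply: cvgM; [exact: cvg_cut|exact: cvg_cst|exact: cvg_cst|exact: cvg_dcut].
have msec t (k : R * V -> R) : measurable_fun setT k -> measurable_fun setT (fun x => k (t, x)).
  by move=> mk; apply: measurableT_comp.
have finl t : (l t setT < +oo)%E.
  by apply: (le_lt_trans (probability_le1 _ measurableT)); rewrite ltry.
have lim : \int[leb]_(t in `]0, T[) \int[l t]_x flux (ft N) (fx N) t x @[N --> \oo]
    --> \int[leb]_(t in `]0, T[) \int[l t]_x flux psit psix t x.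
  apply: (@Rintegral_bounded_cvg _ _ _ leb _ (measurable_itv _)
    (fun N t => \int[l t]_x flux (ft N) (fx N) t x) (fun t => \int[l t]_x flux psit psix t x) (C * 5 + d%:R * (C * 5 * M))).
  - exact: leb_itv_lty.
  - by move=> N; apply: measurable_funTS; exact: measurable_kernel_integral (mflux N).
  - by apply: measurable_funTS; exact: measurable_kernel_integral mfl.
  - move=> t /tT tt; apply: (@Rintegral_bounded_cvg _ _ _ _ _ measurableT _ _ (C * 5 + d%:R * (C * 5 * M))) => //.
    + exact: finl.
    + by move=> N; exact: (msec t _ (mflux N)).
    + exact: (msec t _ mfl).
    + by move=> N x _; exact: bd.
  - move=> N t /tT tt; have -> : C * 5 + d%:R * (C * 5 * M) = \int[l t]_x (C * 5 + d%:R * (C * 5 * M)).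
      by rewrite Rintegral_cst// (_ : fine _ = 1) ?mulr1// -[RHS]/(fine (1%:E)) -(probability_setT (l t)).
    apply: ae_normr_Rintegral_le => //.
    + apply: (@bounded_integrable _ _ _ _ _ _ _ (C * 5 + d%:R * (C * 5 * M))) => //; first exact: finl.
        exact: (msec t _ (mflux N)).
      by move=> x _; exact: bd.
    + exact: finite_measure_integrable_cst.
    + by apply/aeW => x _; exact: bd.
have := cvg_lim (@Rhausdorff R) lim.
under eq_fun do rewrite I0.
by move=> /(_ eventually_filter) <-; exact: lim_cst.
Qed.

Lemma Rint_rV1 (f : R -> R) : (@lebesgue_rV R 1).-integrable setT (fun q => (f (q 0 ord0))%:E) ->
  measurable_fun setT f ->
  \int[@lebesgue_rV R 1]_q f (q 0 ord0) = \int[leb]_s f s.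
Proof.
move=> fi mf.
have mF : measurable_fun setT (fun q : 'rV[R]_1 => f (q 0 ord0)).
  by apply: measurableT_comp => //; exact: measurable_coord.
have f1 : fine (@lebesgue_rV R 0 setT) = 1.
  by rewrite (_ : @lebesgue_rV R 0 setT = 1%E)//; rewrite /= diracT.
have i0 s : (@lebesgue_rV R 0).-integrable setT (fun y => (f (rV_cons (s, y) 0 ord0))%:E).
  under eq_fun do rewrite rV_cons_coord0.
  apply: (@bounded_integrable _ _ _ _ _ _ _ `|f s|) => //.
    by rewrite /= diracT ltry.
  exact: (@measurable_cst _ _ _ _ setT (f s)).
rewrite Rint_rV_cons//.
rewrite (@Rint_Fubini _ _ _ _ _ leb (@lebesgue_rV R 0) (fun z => f (rV_cons z 0 ord0))); last exact: i0.
  apply: eq_Rintegral => s _; under eq_Rintegral do rewrite rV_cons_coord0.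
  transitivity (\int[@lebesgue_rV R 0]_(x in setT) (f s)); first by [].
  by rewrite Rintegral_cst// f1 mulr1.
exact: (integrable_rV_cons fi).
Qed.

(** Weak form to increments: the equation tested with bump(tau - .) psi says that the
    mollification in time of the function G(tau) = \int psi_tau dl_tau has the
    mollified flux as its derivative, hence is B-Lipschitz. Since G is continuous, the
    mollifications at points near s and t converge to G s and G t. *)
Lemma transport_increment C psi psit psix B s t : smooth psi psit psix ->
  bounded_on C psi psit psix -> 0 <= s <= t -> t <= T -> 0 <= B ->
  (forall tau, s < tau < t -> `|\int[l tau]_x flux psit psix tau x| <= B) ->
  continuous (fun tau => \int[l tau]_x psi (clamp T tau) x) ->
  `|\int[l t]_x psi t x - \int[l s]_x psi s x| <= B * (t - s).
Proof.
move=> sp bp /andP[s0 st] tT B0 HB cG.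
have [->|sneqt] := eqVneq s t; first by rewrite !subrr normr0 mulr0.
have {sneqt}st : s < t by rewrite lt_neqAle sneqt.
pose G tau := \int[l tau]_x psi (clamp T tau) x.
have Gt : \int[l t]_x psi t x = G t by rewrite /G clamp_id// (le_trans s0 (ltW st)).
have Gs : \int[l s]_x psi s x = G s by rewrite /G clamp_id// s0 (le_trans (ltW st)).
rewrite {}Gt {}Gs.
have mG : measurable_fun setT G by exact: continuous_measurable_fun.
have GC tau : `|G tau| <= C.
  have -> : C = \int[l tau]_x C.
    by rewrite Rintegral_cst// (_ : fine _ = 1) ?mulr1// -[RHS]/(fine (1%:E)) -(probability_setT (l tau)).
  have bpt x := (bp (clamp T tau) x (clamp_itv T0 _)).
  have fin : (l tau setT < +oo)%E.
    by apply: (le_lt_trans (probability_le1 _ measurableT)); rewrite ltry.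
  apply: ae_normr_Rintegral_le => //.
  - apply: (@bounded_integrable _ _ _ _ _ _ _ C) => //.
      case: sp => c1 _ _ _ _; apply: (measurableT_comp (f := fun z : R * V => psi z.1 z.2) (g := pair (clamp T tau))) => //.
      exact: measurable_continuous_prod.
    by move=> x _; case: (bpt x).
  - exact: finite_measure_integrable_cst.
  - by apply/aeW => x _; case: (bpt x).
pose g (w : 'rV[R]_1) := G (w 0 ord0).
have mg : measurable_fun setT g by apply: measurableT_comp => //; exact: measurable_coord.
apply/ler_addgt0Pr => dl dl0.
have dl2 : 0 < dl / 2 by rewrite divr_gt0.
have [e1 e10 He1] : exists2 e1, 0 < e1 & forall q, `|t - q| < e1 -> `|G t - G q| <= dl / 2.
  have : \forall q \near t, `|G t - G q| <= dl / 2 by move: (cG t) => /cvgrPdist_le; apply.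
  by move=> /nbhs_normP[e1 /= e10 He1]; exists e1.
have [e2 e20 He2] : exists2 e2, 0 < e2 & forall q, `|s - q| < e2 -> `|G s - G q| <= dl / 2.
  have : \forall q \near s, `|G s - G q| <= dl / 2 by move: (cG s) => /cvgrPdist_le; apply.
  by move=> /nbhs_normP[e2 /= e20 He2]; exists e2.
have [|e e0 /= /and4P[h1 h2 h3 _]] := @small_pos R [:: e1 / 4; e2 / 4; (t - s) / 8].
  by rewrite /= !divr_gt0// subr_gt0.
(* a window of radius e around a point of [a, c] stays in ]s, t[, where the flux is
   bounded by B *)
pose a := s + 2 * e; pose c := t - 2 * e.
pose row (tau : R) : 'rV[R]_1 := \row_i tau.
have n0 (i : 'I_1) : nice1 e (eta e i) := nice_eta i e0.
have close tau tau' : (forall q, `|tau - q| < e -> `|G q - G tau'| <= dl / 2) ->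
    `|moll (eta e) g (row tau) - G tau'| <= dl / 2.
  move=> H; apply: (@moll_bump_close _ _ _ _ _ C) => //; first by move=> q; exact: GC.
  apply/aeW => q wq; apply: H; apply: le_lt_trans wq.
  by have := coord_le_norm (row tau - q) ord0; rewrite !mxE.
have close_t : `|moll (eta e) g (row c) - G t| <= dl / 2.
  apply: close => q; rewrite distrC => cq; rewrite distrC; apply: He1.
  apply: (@near_shift R q t c e e1 e0 h1 _ cq); rewrite /c opprB addrCA subrr addr0 ger0_norm ?mulr_ge0 ?(ltW e0)//.
have close_s : `|moll (eta e) g (row a) - G s| <= dl / 2.
  apply: close => q; rewrite distrC => cq; rewrite distrC; apply: He2.
  apply: (@near_shift R q s a e e2 e0 h2 _ cq); rewrite /a opprD addNKr normrN ger0_norm ?mulr_ge0 ?(ltW e0)//.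
have n1 := nice_upd ord0 n0 (nice_dbump e0).
have prod1 k (w q : 'rV[R]_1) : prodf k (w - q) = k ord0 (w 0 ord0 - q 0 ord0).
  by rewrite /prodf big_ord1 !mxE.
have dB (w : 'rV[R]_1) : a <= w 0 ord0 <= c -> `|moll (upd (eta e) ord0 (dbump e)) g w| <= B.
  move=> /andP[]; set tau := w 0 ord0 => wa wc.
  have taus : s + 2 * e <= tau by [].
  have taut : tau <= t - 2 * e by [].
  pose z sg := bump e (tau - sg); pose dz sg := - dbump e (tau - sg).
  have zz sg : is_derive sg (1 : R) z (dz sg) := is_derive_bump_sub tau sg e0.
  have cz1 : continuous z.
    by move=> sg; apply/differentiable_continuous/derivable1_diffP; have [] := zz sg.
  have cdb : continuous (dbump e) := nice_continuous (nice_dbump e0).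
  have cdz : continuous dz.
    move=> sg; apply: cvgN; apply: (@continuous_comp _ _ _ (fun sg => tau - sg) (dbump e)); last exact: cdb.
    by apply: cvgB; [exact: cvg_cst|exact: cvg_id].
  have z0 sg : e <= `|tau - sg| -> z sg = 0 by exact: bump_out.
  have dz0 sg : e <= `|tau - sg| -> dz sg = 0 by move=> h; rewrite /dz dbump_out// oppr0.
  have sz := @smooth_time _ d _ _ zz cdz.
  have szp := smooth_mul sz sp.
  pose H sg := \int[l sg]_x flux psit psix sg x.
  have mH : measurable_fun setT H := measurable_kernel_integral (measurable_flux sp).
  have inT sg : `|tau - sg| < e -> 0 <= sg <= T /\ s < sg < t.
    by move=> h; exact: (window h taus taut s0 tT).
  have fluxE sg x : flux (fun t x => z t * psit t x + psi t x * dz t)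
      (fun i t x => z t * psix i t x + psi t x * 0) sg x = z sg * flux psit psix sg x + dz sg * psi sg x.
    rewrite /flux mulrDr mulr_sumr addrAC; congr (_ + _); last exact: mulrC.
    by congr (_ + _); apply: eq_bigr => i _; rewrite mulr0 addr0 mulrA.
  have D0 : \int[leb]_(sg in `]0, T[) (z sg * H sg + dz sg * G sg) = 0.
    have [ze [_ zC _ _]] := nice_bump e0; have [dze [dze0 dzC _ _]] := nice_dbump e0.
    have ze0 : 0 <= ze := le_trans (normr_ge0 _) (zC 0).
    have bzp : bounded_on (ze * C + C * dze) (fun t x => z t * psi t x)
      (fun t x => z t * psit t x + psi t x * dz t) (fun i t x => z t * psix i t x + psi t x * 0).
      move=> sg x sgT; have [p1 p2 p3] := bp sg x sgT.
      have C0 : 0 <= C := le_trans (normr_ge0 _) p1.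
      have Cd : 0 <= C * dze by exact: mulr_ge0.
      have zs : `|z sg| <= ze by exact: zC.
      split.
      - by rewrite -[leLHS]addr0 lerD// normrM; apply: ler_pM.
      - apply: le_trans (ler_normD _ _) _; rewrite [`|z sg * _|]normrM [`|psi sg x * _|]normrM.
        apply: lerD; apply: ler_pM => //.
        by rewrite /dz normrN.
      - by move=> i; rewrite mulr0 -[leLHS]addr0 lerD// addr0 normrM; apply: ler_pM.
    rewrite -[RHS](@weak_compact _ (tau - e) (tau + e) _ _ _ szp bzp); first last.
    - move=> sg x; apply: contraNT => Hn; rewrite z0 ?mul0r//.
      by rewrite leNgt; apply: contra Hn; exact: ball_itv_le.
    - by have [] := window_center e0 taus taut s0 tT.
    - by have [] := window_center e0 taus taut s0 tT.
    apply: eq_Rintegral => sg; rewrite inE/= in_itv/= => /andP[sg0 sgT].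
    under [RHS]eq_Rintegral do rewrite fluxE.
    have sgTT : 0 <= sg <= T by rewrite !ltW.
    have fin : (l sg setT < +oo)%E.
      by apply: (le_lt_trans (probability_le1 _ measurableT)); rewrite ltry.
    have ifl : (l sg).-integrable setT (EFin \o flux psit psix sg).
      apply: (@bounded_integrable _ _ _ _ _ _ _ (C + d%:R * (C * M))) => //.
        exact: (measurableT_comp (g := pair sg) (measurable_flux sp)).
      by move=> x _; exact: flux_le bp sgTT.
    have ips : (l sg).-integrable setT (EFin \o psi sg).
      apply: (@bounded_integrable _ _ _ _ _ _ _ C) => //.
        case: sp => c1 _ _ _ _; exact: (measurableT_comp (g := pair sg) (measurable_continuous_prod c1)).
      by move=> x _; case: (bp sg x sgTT).
    rewrite RintegralD//; [|exact: integrableZr|exact: integrableZr].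
    by rewrite !RintegralZl// /H /G clamp_id.
  have bz : leb.-integrable setT (EFin \o z).
    apply/integrableP; split; first by apply/measurable_EFinP; exact: continuous_measurable_fun.
    under eq_integral do rewrite /= ger0_norm ?bump_ge0//.
    by rewrite integral_bump// ltry.
  have izH : leb.-integrable setT (EFin \o (fun sg => z sg * H sg)).
    apply: (@le_integrabler R _ _ leb setT measurableT (fun sg => z sg * H sg) (fun sg => B * z sg)) => //.
    - by apply: measurable_funM => //; exact: continuous_measurable_fun.
    - move=> sg _; have [h|/inT[k1 k2]] := leP e `|tau - sg|.
        by rewrite z0// mul0r mulr0 normr0.
      rewrite normrM mulrC [`|z sg|]ger0_norm; last exact: bump_ge0.
      by rewrite ler_wpM2r ?bump_ge0// HB.
    - exact: integrableZr.
  have idz : leb.-integrable setT (EFin \o (fun sg => dz sg * G sg)).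
    have [dze [dze0 dzC _ _]] := nice_dbump e0.
    have bi : leb.-integrable `]0, T[ (EFin \o (fun sg => dz sg * G sg)).
      apply: (@bounded_integrable _ _ _ _ _ _ _ (dze * C)).
      - exact: measurable_itv.
      - exact: leb_itv_lty.
      - by apply: measurable_funTS; apply: measurable_funM => //; exact: continuous_measurable_fun.
      - by move=> sg _; rewrite normrM; apply: ler_pM => //; rewrite /dz normrN.
    have := bi; rewrite integrable_mkcond//.
    congr (_.-integrable _ _); apply/funext => sg; rewrite patchE; case: ifPn => //= sgT.
    rewrite dz0 ?mul0r// leNgt; apply: contra sgT => /inT[k1 k2].
    by rewrite inE/= in_itv/=; exact: window_in k2.
  have off sg : ~ `]0, T[%classic sg -> z sg * H sg = 0 /\ dz sg * G sg = 0.
    move=> Hn; have h : e <= `|tau - sg|.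
      rewrite leNgt; apply/negP => /inT[k1 k2]; apply: Hn; rewrite /= in_itv/=.
      exact: window_in k2.
    by rewrite z0// dz0// !mul0r.
  have mollE : moll (upd (eta e) ord0 (dbump e)) g w = - \int[leb]_sg (dz sg * G sg).
    have -> : - (\int[leb]_sg (dz sg * G sg)) = \int[leb]_sg (dbump e (tau - sg) * G sg).
      rewrite -mulN1r -RintegralZl//; apply: eq_Rintegral => sg _.
      by rewrite mulN1r /dz [X in - X]mulNr opprK.
    rewrite -(@Rint_rV1 (fun sg => dbump e (tau - sg) * G sg)).
    - by apply: eq_Rintegral => q _; rewrite prod1 /upd eqxx.
    - have := moll_integrable w e0 n1 mg (fun q => GC _).
      by congr (_.-integrable _ _); apply/funext => q; rewrite /= prod1 /upd eqxx.
    - apply: measurable_funM => //.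
      apply: continuous_measurable_fun => sg.
      apply: (@continuous_comp _ _ _ (fun sg => tau - sg) (dbump e)); last exact: cdb.
      by apply: cvgB; [exact: cvg_cst|exact: cvg_id].
  have D1 : \int[leb]_sg (z sg * H sg) = - \int[leb]_sg (dz sg * G sg).
    apply/eqP; rewrite -addr_eq0 -RintegralD//; apply/eqP; rewrite -[RHS]D0 [RHS]Rintegral_mkcond.
    apply: eq_Rintegral => sg _; rewrite patchE; case: ifPn => // /negP; rewrite inE => /off[-> ->].
    by rewrite addr0.
  rewrite mollE -D1.
  have -> : B = \int[leb]_sg (B * z sg).
    rewrite RintegralZl//; have -> : \int[leb]_sg z sg = 1 by rewrite /Rintegral integral_bump.
    by rewrite mulr1.
  apply: ae_normr_Rintegral_le => //; first exact: integrableZr.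
  apply/aeW => sg _; have [h|/inT[k1 k2]] := leP e `|tau - sg|.
    by rewrite z0// mul0r mulr0 normr0.
  rewrite normrM mulrC [`|z sg|]ger0_norm; last exact: bump_ge0.
  by rewrite ler_wpM2r ?bump_ge0// HB.
have Dd (i : 'I_1) w : is_derive w (delta_mx 0 i : 'rV[R]_1) (moll (eta e) g) (moll (upd (eta e) ord0 (dbump e)) g w).
  rewrite (ord1 i).
  exact: (@moll_derive R 1 (eta e) g ord0 (dbump e) e C w e0 (fun j => nice_eta j e0)
    (nice_dbump e0) mg (fun q => GC _) (fun s => is_derive_bump s e0)).
have est : `|moll (eta e) g (row c) - moll (eta e) g (row a)| <= 1%:R * B * `|row c - row a|.
  apply: (@rV_Lipschitz _ _ (moll (eta e) g) (fun _ w => moll (upd (eta e) ord0 (dbump e)) g w)) => // i q Hq.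
  have [k /andP[k0 k1] qE] := Hq ord0; apply: dB; rewrite qE !mxE.
  have ac : 0 <= c - a := (shrunk_le e0 h3).1.
  have p1 := mulr_ge0 k0 ac; have p2 : 0 <= (1 - k) * (c - a) by rewrite mulr_ge0// subr_ge0.
  by apply/andP; split; lra.
have rca : `|row c - row a| <= t - s.
  apply: norm_le_coord => [|i]; first by rewrite subr_ge0 ltW.
  by rewrite !mxE; exact: (shrunk_le e0 h3).2.
have {}est : `|moll (eta e) g (row c) - moll (eta e) g (row a)| <= B * (t - s).
  by apply: le_trans est _; rewrite mul1r ler_wpM2l.
by have := dist_near3 close_t close_s est; rewrite -splitr.
Qed.

End transport.

(** * Lipschitz test functions *)

Section partial_derivatives.
Context {R : realType} {d : nat}.
Local Notation V := 'rV[R]_d.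
Local Notation evec i := (delta_mx 0 i : V).

(** The candidate for the differential of a function with prescribed partial
    derivatives. *)
Definition dot_coord (c : 'I_d -> R) (h : V) : R := \sum_i h 0 i * c i.

Lemma dot_coord_linear c : linear (dot_coord c : V -> R^o).
Proof.
move=> a x y; rewrite /dot_coord scaler_sumr -big_split/=; apply: eq_bigr => i _.
by rewrite !mxE mulrDl -mulrA.
Qed.

HB.instance Definition _ c := GRing.isLinear.Build R V R^o _ (dot_coord c : V -> R^o) (dot_coord_linear c).

(** By [rV_MVT] the increment is the sum of the partial derivatives at intermediate
    points, which differ from those at the base point by o(1). *)
Lemma C1_of_partials (f : V -> R) (g : 'I_d -> V -> R) :
  (forall i x, is_derive x (evec i) f (g i x)) -> (forall i, continuous (g i)) ->
  C1 f /\ forall x, grad f x = \row_i g i x.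
Proof.
move=> dfg cg.
have gE x : grad f x = \row_i g i x.
  by apply/rowP => i; rewrite !mxE; have [_ ->] := dfg i x.
split => //; split; last first.
  rewrite (_ : grad f = (fun x => \row_i g i x)); last exact/funext.
  by apply: continuous_rV => i; under eq_fun do rewrite mxE; exact: cg.
move=> x.
have clin : continuous (dot_coord (g^~ x)).
  apply: (@local_lip_continuous _ _ _ (\sum_i `|g i x|)) => [|w w' _]; first by rewrite sumr_ge0.
  rewrite -linearB/= /dot_coord mulr_suml; apply: le_trans (ler_norm_sum _ _ _) _.
  apply: ler_sum => i _; rewrite normrM mulrC ler_wpM2l//; exact: coord_le_norm.
have lo : f \o shift x = cst (f x) + (dot_coord (g^~ x) : V -> R^o) +o_ 0 id.
  apply/eqaddoP => e e0.
  have de : 0 < e / d.+1%:R by rewrite divr_gt0.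
  have near_g : \forall y \near x, forall i, `|g i x - g i y| <= e / d.+1%:R.
    apply: (@filter_forall _ _ (fun i y => `|g i x - g i y| <= e / d.+1%:R) (nbhs x)) => i.
    by move: (cg i x) => /cvgrPdist_le; apply.
  have [r /= r0 Hr] := (nbhs_normP _ _).1 near_g.
  have K : \forall h \near (0 : V), `|(f \o shift x - (cst (f x) + dot_coord (g^~ x))) h| <= e * `|h|; last exact: K.
  apply/nbhs_normP; exists r => // h /=; rewrite sub0r normrN => hr.
  have [xi [xiE fE]] := rV_MVT dfg x (h + x).
  have -> : (f \o shift x - (cst (f x) + dot_coord (g^~ x))) h =
      \sum_i h 0 i * (g i (xi i) - g i x).
    transitivity (f (h + x) - (f x + dot_coord (g^~ x) h)); first by [].
    rewrite opprD addrA fE /dot_coord -sumrB.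
    by apply: eq_bigr => i _; rewrite mxE addrK mulrBr.
  apply: le_trans (ler_norm_sum _ _ _) _.
  apply: (@le_trans _ _ (\sum_(i < d) `|h| * (e / d.+1%:R))).
    apply: ler_sum => i _; rewrite normrM; apply: ler_pM => //; first exact: coord_le_norm.
    rewrite distrC; apply: (Hr (xi i)) => /=; apply: le_lt_trans hr.
    apply: norm_le_coord => // j; have [c /andP[c0 c1] E] := xiE i j.
    rewrite mxE [X in _ + X]mxE E mxE addrK opprD addrA subrr sub0r normrN normrM ger0_norm//.
    by apply: le_trans (coord_le_norm h j); rewrite ler_piMl.
  rewrite sumr_const card_ord -(mulr_natl (_ * _)) mulrCA [id h]/= mulrC.
  rewrite ler_wpM2r// mulrCA ler_piMr ?(ltW e0)// ler_pdivrMr// mul1r ler_nat; exact: leqnSn.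
apply/diff_locallyP; rewrite (diff_unique clin lo); split; [exact: clin|exact: lo].
Qed.
End partial_derivatives.

Lemma lip_itv (R : realType) (k dk : R -> R) (a b C : R) :
  (forall s, is_derive s (1 : R) k (dk s)) ->
  (forall s, a <= s <= b -> `|dk s| <= C) ->
  forall s t, a <= s <= b -> a <= t <= b -> `|k s - k t| <= C * `|s - t|.
Proof.
move=> dkk dkC s t; wlog st : s t / t <= s.
  move=> H h1 h2; have [|/ltW] := leP t s; first by move=> ?; exact: H.
  by rewrite distrC [`|s - t|]distrC => ?; exact: H.
move=> /andP[as_ sb] /andP[at_ tb].
have [] := @MVT_segment R k dk t s st.
- apply: continuous_subspaceT => c.
  by apply/differentiable_continuous/derivable1_diffP; exact: ex_derive.
- move=> c; rewrite in_itv/= => /andP[tc cs] ->; rewrite normrM ler_wpM2r// dkC//.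
  by rewrite (le_trans at_ tc) (le_trans cs sb).
Qed.

Section lipschitz_tests.
Context {R : realType} {d : nat}.
Local Notation V := 'rV[R]_d.
Local Notation evec i := (delta_mx 0 i : V).
Local Notation lebd := (@lebesgue_rV R d).

Definition lipf (L : R) (g : V -> R) : Prop := forall x y, `|g x - g y| <= L * `|x - y|.

Lemma lipf_continuous L g : 0 <= L -> lipf L g -> continuous g.
Proof. by move=> L0 gL; apply: (@local_lip_continuous _ _ _ L) => // w w' _; exact: gL. Qed.

(** Since the derivative of the kernel has integral zero, g may be replaced by g - g
    w, which is at most L e on the support. The integral of |dbump e| is at most 15 /
    (2 e). *)
Lemma moll_dbump_lip g L c e i w : 0 < e -> 0 <= L -> lipf L g -> (forall x, `|g x| <= c) ->
  `|moll (upd (eta e) i (dbump e)) g w| <= 15 / 2 * L.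
Proof.
move=> e0 L0 gL gc.
have mg : measurable_fun setT g by apply: measurable_continuous_rV; exact: lipf_continuous gL.
have ne := fun i : 'I_d => nice_eta i e0.
have nu := nice_upd i ne (nice_dbump e0).
pose o1 : V -> R := fun=> 1.
have mo1 : measurable_fun setT o1 by exact: measurable_cst.
have one (q : V) : `|o1 q| <= 1 by rewrite normr1.
(* this integral is the derivative of the mollification of the constant 1 *)
have Z : \int[lebd]_q (prodf (upd (eta e) i (dbump e)) (w - q) * 1) = 0.
  have D := (@moll_derive R d (eta e) o1 i (dbump e) e 1 w e0 ne
      (nice_dbump e0) mo1 one (fun s => is_derive_bump s e0)).
  have m1 : moll (eta e) o1 = cst 1 :> (V -> R).
    apply/funext => x; apply/eqP; rewrite -subr_eq0 -normr_le0.
    apply: (@moll_bump_close _ _ _ _ _ 1) => //.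
    by apply/aeW => q _; rewrite subrr normr0.
  have [_ D1] := D; rewrite -[LHS]/(moll (upd (eta e) i (dbump e)) o1 w) -D1 m1.
  exact: derive_cst.
(* a majorant of |dbump| in the i-th coordinate, of integral 15 / (2 e), and the bump
   in the others *)
pose k (j : 'I_d) s := if j == i then 15 / (4 * e ^+ 2) * box1 (w 0 i) e s else bump e (w 0 j - s).
have c0 : 0 <= 15 / (4 * e ^+ 2) by rewrite divr_ge0// mulr_ge0// sqr_ge0.
have box0 a r s : 0 <= box1 a r s :> R by rewrite /box1; case: ifP.
have k0 j s : 0 <= k j s.
  by rewrite /k; case: ifP => _; [rewrite mulr_ge0|exact: bump_ge0].
have mk j : measurable_fun setT (k j).
  rewrite /k; case: (j == i).
    by apply: measurable_funM; [exact: measurable_cst|exact: measurable_boxf1].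
  apply: continuous_measurable_fun => s; apply: (@continuous_comp _ _ _ (fun s => w 0 j - s) (bump e)).
    by apply: cvgB; [exact: cvg_cst|exact: cvg_id].
  exact: (nice_continuous (nice_bump e0)).
have Ik j : (\int[@lebesgue_measure R]_s (k j s)%:E = (if j == i then 15 / (2 * e) else 1)%:E)%E.
  rewrite /k; case: (j == i); last exact: integral_bump.
  under eq_integral do rewrite EFinM.
  rewrite ge0_integralZl//; last 2 first.
  - by apply/measurable_EFinP; exact: measurable_boxf1.
  - by move=> s _; rewrite lee_fin.
  by rewrite integral_box1 ?ltW// -EFinM; congr EFin; field; rewrite gt_eqF.
have IP : (\int[lebd]_q (prodf k q)%:E = (15 / (2 * e))%:E)%E.
  rewrite (integral_prodf k0 mk Ik); congr EFin; rewrite (bigD1 i)//= eqxx big1 ?mulr1//.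
  by move=> j /negbTE ->.
have iP : lebd.-integrable setT (EFin \o prodf k).
  apply/integrableP; split; first by apply/measurable_EFinP; exact: measurable_prodf.
  under eq_integral do rewrite /= ger0_norm ?prodf_ge0//.
  by rewrite IP ltry.
have i1 : lebd.-integrable setT (EFin \o (fun q => prodf (upd (eta e) i (dbump e)) (w - q) * g q)).
  exact: (moll_integrable w e0 nu mg gc).
have i2 : lebd.-integrable setT (EFin \o (fun q => g w * (prodf (upd (eta e) i (dbump e)) (w - q) * 1))).
  by apply: integrableZr => //; exact: (moll_integrable w e0 nu mo1 one).
have -> : moll (upd (eta e) i (dbump e)) g w =
    \int[lebd]_q (prodf (upd (eta e) i (dbump e)) (w - q) * (g q - g w)).
  rewrite /moll -[LHS]subr0 -[X in _ - X](mulr0 (g w)) -[X in g w * X]Z -RintegralZl//; last first.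
    exact: (moll_integrable w e0 nu mo1 one).
  rewrite -RintegralB//; apply: eq_Rintegral => q _.
  by rewrite mulr1 mulrBr [g w * _]mulrC.
have -> : 15 / 2 * L = \int[lebd]_q ((L * e) * prodf k q).
  by rewrite RintegralZl// /Rintegral IP/=; field; rewrite gt_eqF.
apply: ae_normr_Rintegral_le => //.
- have := integrableBr measurableT i1 i2.
  by congr (_.-integrable _ (_ \o _)); apply/funext => q; rewrite mulr1 mulrBr [g w * _]mulrC.
- exact: integrableZr.
- apply/aeW => q _; rewrite normrM mulrC.
  have [h|h] := leP e `|w - q|.
    by rewrite (prodf_out nu h e0) normr0 mulr0 mulr_ge0 ?prodf_ge0// mulr_ge0// ltW.
  apply: ler_pM => //.
    by apply: le_trans (gL _ _) _; rewrite ler_wpM2l// distrC ltW.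
  rewrite prodf_shift /prodf normr_prod; apply: ler_prod => j _; rewrite normr_ge0/= /upd /k.
  case: eqP => [->|_]; last by rewrite ger0_norm ?bump_ge0.
  have [h1|h1] := leP `|w 0 i - q 0 i| e; first by rewrite /box1 h1 mulr1; exact: dbump_le.
  by rewrite [dbump _ _](dbump_out e0 (ltW h1)) normr0 mulr_ge0.
Qed.

(** Mollification keeps sup norms, and by [moll_dbump_lip] it keeps Lipschitz
    constants up to the factor 15 / 2, at every scale dl. *)
Lemma lip_approx g L c dl : 0 < dl -> 0 <= L -> lipf L g -> (forall x, `|g x| <= c) ->
  exists (h : V -> R) (hx : 'I_d -> V -> R),
    [/\ (forall x, `|h x| <= c), (forall x, `|h x - g x| <= L * dl),
      (forall i x, is_derive x (evec i) h (hx i x)), (forall i, continuous (hx i)) &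
      (forall i x, `|hx i x| <= 15 / 2 * L)].
Proof.
move=> e0 L0 gL gc.
have mg : measurable_fun setT g by apply: measurable_continuous_rV; exact: lipf_continuous gL.
have ne := fun i : 'I_d => nice_eta i e0.
exists (moll (eta dl) g), (fun i => moll (upd (eta dl) i (dbump dl)) g); split.
- move=> x; rewrite -(subr0 (moll _ _ _)); apply: (@moll_bump_close _ _ _ _ _ c) => //.
  by apply/aeW => q _; rewrite subr0.
- move=> x; apply: (@moll_bump_close _ _ _ _ _ c) => //.
  by apply/aeW => q xq; apply: le_trans (gL _ _) _; rewrite ler_wpM2l// distrC ltW.
- move=> i x.
  exact: (@moll_derive R d (eta dl) g i (dbump dl) dl c x e0 ne
      (nice_dbump e0) mg gc (fun s => is_derive_bump s e0)).
- move=> i; apply: (@moll_continuous _ _ _ _ dl c) => //.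
  by apply: nice_upd => //; exact: nice_dbump.
- by move=> i x; exact: (@moll_dbump_lip g L c).
Qed.

End lipschitz_tests.

Section probability_integrals.
Context {R : realType} {d : nat}.
Local Notation V := 'rV[R]_d.

Lemma prob_fin (m : probability V R) : (m setT < +oo)%E.
Proof. by apply: (le_lt_trans (probability_le1 m measurableT)); rewrite ltry. Qed.

Lemma prob_cst (m : probability V R) (c : R) : \int[m]_x c = c.
Proof.
by rewrite Rintegral_cst// (_ : fine _ = 1) ?mulr1// -[RHS]/(fine (1%:E)) -(probability_setT m).
Qed.

Lemma prob_integrable (m : probability V R) (f : V -> R) c : measurable_fun setT f ->
  (forall x, `|f x| <= c) -> m.-integrable setT (EFin \o f).
Proof.
by move=> mf fc; apply: (@bounded_integrable _ _ _ _ _ _ _ c) => //; exact: prob_fin.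
Qed.

Lemma prob_diff_le (m : probability V R) (f g : V -> R) c :
  m.-integrable setT (EFin \o f) -> m.-integrable setT (EFin \o g) ->
  (forall x, `|f x - g x| <= c) -> `|\int[m]_x f x - \int[m]_x g x| <= c.
Proof.
move=> mf mg fg; rewrite -RintegralB// -(prob_cst m c).
apply: ae_normr_Rintegral_le => //.
- exact: integrableBr.
- exact: finite_measure_integrable_cst.
- exact/aeW.
Qed.

Lemma prob_le (m : probability V R) (f : V -> R) c :
  measurable_fun setT f -> (forall x, `|f x| <= c) -> `|\int[m]_x f x| <= c.
Proof.
move=> mf fc; have -> : \int[m]_x f x = \int[m]_x f x - \int[m]_x (fun=> 0) x.
  by rewrite prob_cst subr0.
apply: prob_diff_le; [exact: prob_integrable fc|exact: finite_measure_integrable_cst|].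
by move=> x; rewrite subr0.
Qed.

End probability_integrals.

(** * Time regularity of the transported measure *)

Section transport_lipschitz.
Context {R : realType} {d : nat}.
Local Notation V := 'rV[R]_d.
Local Notation leb := (@lebesgue_measure R).
Variable T : R.
Hypothesis T0 : 0 < T.
Variable m : R -> probability V R.
Hypothesis mflat : flat_continuous T m.
Local Notation l := (fun t => m (clamp T t)).
Variables (b : R -> V -> V) (M : R).
Hypothesis bc : continuous (fun z : R * V => b z.1 z.2).
Hypothesis M0 : 0 <= M.
Hypothesis bM : forall t x k, `|b t x 0 k| <= M.
Hypothesis mb : forall psi psit psix, smooth psi psit psix -> C1c_cylinder T psi psit psix ->
  \int[leb]_(t in `]0, T[) \int[m t]_x flux b psit psix t x = 0.

Lemma smooth_C1 (psi psit : R -> V -> R) psix t : smooth psi psit psix ->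
  C1 (psi t) /\ forall x : V, grad (psi t) x = \row_i (psix i t x : R).
Proof.
move=> [_ _ c3 _ d2]; apply: (@C1_of_partials _ _ (psi t) (fun i => psix i t)) => i x.
 apply: (@continuous_comp _ _ _ (fun x : V => (t, x)) (fun z : R * V => psix i z.1 z.2)).
  exact: continuous_pairl.
exact: c3.
Qed.

Lemma smooth_measurable (psi psit : R -> V -> R) psix t : smooth psi psit psix -> measurable_fun setT (psi t).
Proof.
move=> [c1 _ _ _ _]; exact: (measurableT_comp (g := pair t) (measurable_continuous_prod c1)).
Qed.

(** Both the measure and the test function move: freezing the test function at time t
    leaves a case of [flat_integral_continuous], and the error is controlled by the
    bound C on the time derivative. *)
Lemma moving_continuous C psi psit psix : smooth psi psit psix ->
  bounded_on T C psi psit psix ->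
  continuous (fun tau => \int[l tau]_x psi (clamp T tau) x).
Proof.
move=> sp bp t; apply/cvgrPdist_le => e e0.
have cT s := clamp_itv T0 s.
have C0 : 0 <= C by have [h _ _] := bp _ 0 (cT t); exact: le_trans (normr_ge0 _) h.
have [c1 gE] := smooth_C1 (clamp T t) sp.
have cont := @flat_integral_continuous _ _ _ T0 m mflat (psi (clamp T t)) (1 + (1 + d%:R) * C).
have {}cont : continuous (fun s => \int[l s]_x psi (clamp T t) x).
  apply: cont => //.
  - by rewrite ltr_pwDl// mulr_ge0// addr_ge0.
  - move=> x; have [h _ _] := bp _ x (cT t); apply: le_trans h _.
    by rewrite mulrDl mul1r addrCA lerDl addr_ge0// mulr_ge0.
  - move=> x; rewrite gE; apply: le_trans (normv_le C0 _) _.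
      by move=> i; rewrite mxE; have [_ _ h] := bp _ x (cT t).
    by rewrite mulrDl addrA lerDr addr_ge0// mul1r.
have e2 : 0 < e / 2 by rewrite divr_gt0.
have [r r0 Hr] : exists2 r, 0 < r & forall s, `|t - s| < r ->
    `|\int[l t]_x psi (clamp T t) x - \int[l s]_x psi (clamp T t) x| <= e / 2.
  have : \forall s \near t, `|\int[l t]_x psi (clamp T t) x - \int[l s]_x psi (clamp T t) x| <= e / 2.
    by move: (cont t) => /cvgrPdist_le; apply.
  by move=> /nbhs_normP[r /= r0 Hr]; exists r.
have C1' : 0 < C + 1 by rewrite ltr_wpDl.
have [|r' r'0 /= /and3P[h1 h2 _]] := @small_pos R [:: r; e / 2 / (C + 1)].
  by rewrite /= r0 !divr_gt0.
have K : \forall s \near t, `|\int[l t]_x psi (clamp T t) x - \int[l s]_x psi (clamp T s) x| <= e; last exact: K.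
apply/nbhs_normP; exists r' => // s /= ts.
have k1 := Hr s (lt_le_trans ts h1).
have k2 : `|\int[l s]_x psi (clamp T t) x - \int[l s]_x psi (clamp T s) x| <= e / 2.
  apply: prob_diff_le => [||x].
  - apply: (@prob_integrable _ _ _ _ C); first exact: smooth_measurable sp.
    by move=> x; have [h _ _] := bp _ x (cT t).
  - apply: (@prob_integrable _ _ _ _ C); first exact: smooth_measurable sp.
    by move=> x; have [h _ _] := bp _ x (cT s).
  - have [_ _ _ d1 _] := sp.
    have := @lip_itv R (psi^~ x) (psit^~ x) 0 T C (fun s => d1 s x) _ _ _ (cT t) (cT s).
    move=> /(_ (fun s sT => let: And3 _ h _ := bp s x sT in h)) /le_trans; apply.
    apply: le_trans (_ : C * (e / 2 / (C + 1)) <= _).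
      rewrite ler_wpM2l// (le_trans (clamp_lip T0 _ _))// ltW//; exact: lt_le_trans ts h2.
    by rewrite mulrA ler_pdivrMr//; lra.
move: k1 k2; rewrite !ler_norml => /andP[? ?] /andP[? ?]; apply/andP; split; lra.
Qed.

Lemma transport_estimate C psi psit psix B s t : smooth psi psit psix ->
  bounded_on T C psi psit psix -> 0 <= s <= t -> t <= T -> 0 <= B ->
  (forall tau, s < tau < t -> `|\int[l tau]_x flux b psit psix tau x| <= B) ->
  `|\int[l t]_x psi t x - \int[l s]_x psi s x| <= B * (t - s).
Proof.
move=> sp bp st tT B0 HB; apply: (transport_increment T0 mflat bc bM mb sp bp st tT B0 HB).
exact: moving_continuous bp.
Qed.

Lemma static_bounded C h (hx : 'I_d -> V -> R) : (forall x, `|h x| <= C) ->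
  (forall i x, `|hx i x| <= C) ->
  bounded_on T C (fun _ x => h x) (fun _ _ => 0) (fun i _ x => hx i x).
Proof.
by move=> hC hxC t x _; split => //; rewrite normr0; exact: le_trans (normr_ge0 _) (hC x).
Qed.

(** Particles move at speed at most M. For smooth tests this is [transport_estimate];
    a Lipschitz test is approximated by [lip_approx]. *)
Lemma transport_lipschitz g L c s t : 0 <= L -> lipf L g -> (forall x, `|g x| <= c) ->
  `|\int[l t]_x g x - \int[l s]_x g x| <= d%:R * (15 / 2 * L * M) * `|t - s|.
Proof.
move=> L0 gL gc.
wlog [st [s0 tT]] : s t / s <= t /\ 0 <= s /\ t <= T.
  move=> H; have Hc a a' : clamp T a <= clamp T a' -> `|\int[l a']_x g x - \int[l a]_x g x| <= d%:R * (15 / 2 * L * M) * `|a' - a|.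
    move=> aa'; have /andP[a0 _] := clamp_itv T0 a; have /andP[_ aT] := clamp_itv T0 a'.
    have := H (clamp T a) (clamp T a'); rewrite !clampK// => /(_ (conj aa' (conj a0 aT)))/le_trans; apply.
    by rewrite ler_wpM2l ?clamp_lip// !mulr_ge0.
  have [h|/ltW h] := leP (clamp T s) (clamp T t); first exact: Hc.
  by rewrite distrC [`|t - s|]distrC; exact: Hc.
apply/ler_addgt0Pr => e e0.
have L1 : 0 < 2 * L + 1 by rewrite ltr_wpDl// mulr_ge0.
pose dl := e / (2 * L + 1).
have dl0 : 0 < dl by rewrite divr_gt0.
have [h [hx [hc hg dh ch hxL]]] := lip_approx dl0 L0 gL gc.
have c_h : continuous h.
  have [[dfh _] _] := C1_of_partials dh ch.
  by move=> x; exact: differentiable_continuous.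
have sh := smooth_space c_h dh ch.
have c0 : 0 <= c := le_trans (normr_ge0 _) (gc 0).
have L150 : 0 <= 15 / 2 * L by rewrite mulr_ge0.
have bh : bounded_on T (c + 15 / 2 * L) (fun _ x => h x) (fun _ _ => 0) (fun i _ x => hx i x).
  apply: static_bounded => [x|i x]; first by rewrite (le_trans (hc x))// lerDl.
  by rewrite (le_trans (hxL i x))// lerDr.
have est : `|\int[l t]_x h x - \int[l s]_x h x| <= d%:R * (15 / 2 * L * M) * (t - s).
  apply: (transport_estimate sh bh) => //; first by rewrite s0.
    by rewrite !mulr_ge0.
  move=> tau _; apply: prob_le.
    exact: (measurableT_comp (g := pair tau) (measurable_flux bc sh)).
  move=> x; rewrite /flux add0r; apply: le_trans (ler_norm_sum _ _ _) _.
  apply: (@le_trans _ _ (\sum_(j < d) 15 / 2 * L * M)).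
    by apply: ler_sum => j _; rewrite normrM; apply: ler_pM.
  by rewrite sumr_const card_ord -(mulr_natl (_ * M)).
have mg : measurable_fun setT g by apply: measurable_continuous_rV; exact: lipf_continuous gL.
have ig tau := prob_integrable (l tau) mg gc.
have ih tau := prob_integrable (l tau) (measurable_continuous_rV c_h) hc.
have d1 tau : `|\int[l tau]_x h x - \int[l tau]_x g x| <= L * dl.
  exact: prob_diff_le.
have Ldl : 2 * (L * dl) <= e.
  by rewrite mulrA /dl mulrA ler_pdivrMr//; lra.
rewrite [`|t - s|]ger0_norm ?subr_ge0//.
move: est (d1 s) (d1 t); set X := _ * (t - s).
by move=> h3 h1 h2; apply: le_trans (dist_near3 h2 h1 h3) _; rewrite lerD2l; lra.
Qed.

End transport_lipschitz.

(** * Regularity of the alignment force *)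

Section alignment_lipschitz.
Context {R : realType} {d : nat}.
Local Notation V := 'rV[R]_d.
Variables (K : V -> R) (K0 : R).
Hypothesis K00 : 0 <= K0.
Hypothesis K_cont : continuous (hess K).
Hypothesis KK0 : forall x i j, `|hess K x i j| <= K0.
Hypothesis KL : forall x y i j, `|hess K x i j - hess K y i j| <= K0 * `|x - y|.
Variables (b : R -> V -> V) (M L : R).
Hypothesis M0 : 0 <= M.
Hypothesis L0 : 0 <= L.
Hypothesis bM : forall t x k, `|b t x 0 k| <= M.
Hypothesis bL : forall t s x y k, `|b t x 0 k - b s y 0 k| <= L * (`|t - s| + `|x - y|).
Hypothesis bm : forall t, measurable_fun setT (b t).

Lemma mxv_diff_le (w w' : V) (B B' : 'M[R]_d) k e1 c1 e2 c2 : 0 <= e1 -> 0 <= c2 ->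
  (forall j, `|w 0 j - w' 0 j| <= e1) -> (forall i j, `|B i j| <= c1) ->
  (forall j, `|w' 0 j| <= c2) -> (forall i j, `|B i j - B' i j| <= e2) ->
  `|mxv B w 0 k - mxv B' w' 0 k| <= d%:R * (e1 * c1 + c2 * e2).
Proof.
move=> e10 c20 ww Bc wc BB; rewrite !mxvE -sumrB.
apply: le_trans (ler_norm_sum _ _ _) _.
apply: (@le_trans _ _ (\sum_(j < d) (e1 * c1 + c2 * e2))).
  apply: ler_sum => j _.
  have -> : w 0 j * B k j - w' 0 j * B' k j = (w 0 j - w' 0 j) * B k j + w' 0 j * (B k j - B' k j).
    by ring.
  apply: le_trans (ler_normD _ _) _; rewrite !normrM; apply: lerD; exact: ler_pM.
by rewrite sumr_const card_ord -(mulr_natl (_ + _)).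
Qed.

Definition force t x k z := mxv (hess K (x - z)) (b t x - b t z) 0 k.

Definition Lforce : R := d%:R * (2 * L * K0 + 2 * M * K0).

Lemma Lforce_ge0 : 0 <= Lforce.
Proof. by rewrite mulr_ge0// addr_ge0// !mulr_ge0. Qed.

Lemma force_le t x k z : `|force t x k z| <= d%:R * ((M + M) * K0).
Proof.
apply: mxv_le => // j; rewrite !mxE; apply: le_trans (ler_normB _ _) _; exact: lerD.
Qed.

Lemma force_lip t s x y k z z' :
  `|force t x k z - force s y k z'| <= Lforce * (`|t - s| + `|x - y| + `|z - z'|).
Proof.
set q := _ + `|z - z'|.
have q0 : 0 <= q by rewrite !addr_ge0.
have -> : Lforce * q = d%:R * ((L * (2 * q)) * K0 + (2 * M) * (K0 * q)) by rewrite /Lforce; ring.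
apply: mxv_diff_le => //.
- by rewrite !mulr_ge0.
- by rewrite mulr_ge0.
- move=> j; rewrite !mxE.
  have -> : b t x 0 j - b t z 0 j - (b s y 0 j - b s z' 0 j) =
    (b t x 0 j - b s y 0 j) - (b t z 0 j - b s z' 0 j) by ring.
  apply: le_trans (ler_normB _ _) _; apply: le_trans (lerD (bL _ _ _ _ _) (bL _ _ _ _ _)) _.
  rewrite -mulrDr ler_wpM2l// /q; have := normr_ge0 (x - y); have := normr_ge0 (z - z'); lra.
- by move=> j; rewrite !mxE; apply: le_trans (ler_normB _ _) _; rewrite mulr2n mulrDl mul1r; exact: lerD.
- move=> i j; apply: le_trans (KL _ _ _ _) _; rewrite ler_wpM2l//.
  have -> : x - z - (y - z') = (x - y) - (z - z') by rewrite !opprB [z' - y]addrC addrACA [- z + z']addrC.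
  by apply: le_trans (ler_normB _ _) _; rewrite /q -addrA lerDr.
Qed.

Lemma force_lipf t x k : lipf Lforce (force t x k).
Proof.
move=> z z'; have := force_lip t t x x k z z'.
by rewrite (subrr t) (subrr x) (normr0 R) (normr0 V) !add0r.
Qed.

Lemma alignment_force (m : probability V R) t x k :
  alignment K m (b t) x 0 k = \int[m]_z force t x k z.
Proof. by rewrite mxE. Qed.

Lemma force_measurable t x k : measurable_fun setT (force t x k).
Proof.
by apply: measurable_continuous_rV; apply: lipf_continuous (@force_lipf _ _ _); exact: Lforce_ge0.
Qed.

(** The force is Lipschitz in all its variables. Moving (t, x) to (s, y) changes the
    integrand, and then changing the measure integrates one Lipschitz function of z
    against m1 - m2. *)
Lemma alignment_diff (m1 m2 : probability V R) C t s x y k : 0 <= C ->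
  (forall g L c, 0 <= L -> lipf L g -> (forall x, `|g x| <= c) ->
     `|\int[m1]_x g x - \int[m2]_x g x| <= C * L) ->
  `|alignment K m1 (b t) x 0 k - alignment K m2 (b s) y 0 k| <=
  Lforce * (`|t - s| + `|x - y|) + C * Lforce.
Proof.
move=> C0 HC; rewrite [X in `|X - _|]alignment_force [X in `|_ - X|]alignment_force.
apply: le_trans (ler_distD (\int[m1]_z force s y k z) _ _) _; apply: lerD.
  apply: prob_diff_le; [exact: (prob_integrable m1 (force_measurable t x k) (@force_le _ _ _))|
    exact: (prob_integrable m1 (force_measurable s y k) (@force_le _ _ _))|].
  by move=> z; have := force_lip t s x y k z z; rewrite (subrr z) (normr0 V) addr0.
by apply: HC; [exact: Lforce_ge0|exact: force_lipf|exact: force_le].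
Qed.

End alignment_lipschitz.

(** * Straight characteristics *)

Section smooth_composition.
Context {R : realType} {d : nat}.
Local Notation V := 'rV[R]_d.
Local Notation evec i := (delta_mx 0 i : V).

Lemma smooth_add (f ft : R -> V -> R) fx g gt gx : smooth f ft fx -> smooth g gt gx ->
  smooth (fun t x => f t x + g t x) (fun t x => ft t x + gt t x)
    (fun i t x => fx i t x + gx i t x).
Proof.
move=> [c1 c2 c3 d1 d2] [c1' c2' c3' d1' d2']; split.
- by move=> z; apply: cvgD; [exact: c1|exact: c1'].
- by move=> z; apply: cvgD; [exact: c2|exact: c2'].
- by move=> i z; apply: cvgD; [exact: c3|exact: c3'].
- by move=> t x; exact: is_deriveD.
- by move=> i t x; exact: is_deriveD.
Qed.

Lemma smooth_coord (i : 'I_d) : @smooth R d (fun _ x => x 0 i) (fun _ _ => 0)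
  (fun j _ _ => (i == j)%:R).
Proof.
apply: smooth_space.
- exact: coord_continuous.
- move=> j x; apply: is_derive_line0.
  have -> : (fun c : R => (x + c *: evec j) 0 i) = (fun c => x 0 i + (i == j)%:R * c).
    by apply/funext => c; rewrite !mxE eqxx/= mulrC.
  apply: (@is_derive_quad _ _ _ _ 0) => h.
  by rewrite mul0r normr_le0; apply/eqP; ring.
- by move=> j x; exact: cst_continuous.
Qed.

(** The chain rule for a function of d smooth coordinates, in time through [rV_chain]
    and in each space direction likewise. *)
Lemma smooth_comp (g : V -> R) (gx : 'I_d -> V -> R) (Y Yt : 'I_d -> R -> V -> R)
    (Yx : 'I_d -> 'I_d -> R -> V -> R) :
  (forall i x, is_derive x (evec i) g (gx i x)) -> (forall i, continuous (gx i)) ->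
  (forall i, smooth (Y i) (Yt i) (Yx i)) ->
  smooth (fun t x => g (\row_i Y i t x))
    (fun t x => \sum_i Yt i t x * gx i (\row_i Y i t x))
    (fun j t x => \sum_i Yx i j t x * gx i (\row_i Y i t x)).
Proof.
move=> dg cg sY.
have cY : continuous (fun z : R * V => \row_i Y i z.1 z.2).
  by apply: continuous_rV => i; under eq_fun do rewrite mxE; case: (sY i).
have cgY i : continuous (fun z : R * V => gx i (\row_i Y i z.1 z.2)).
  by move=> z; apply: (@continuous_comp _ _ _ (fun z : R * V => \row_i Y i z.1 z.2) (gx i)); [exact: cY|exact: cg].
have cg0 : continuous g.
  by have [[dfg _] _] := C1_of_partials dg cg; move=> x; exact: differentiable_continuous.
split.
- by move=> z; apply: (@continuous_comp _ _ _ (fun z : R * V => \row_i Y i z.1 z.2) g); [exact: cY|exact: cg0].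
- by move=> z; apply: cvg_sumr => i; apply: cvgM; [case: (sY i) => _ c _ _ _; exact: c|exact: cgY].
- by move=> j z; apply: cvg_sumr => i; apply: cvgM; [case: (sY i) => _ _ c _ _; exact: c|exact: cgY].
- move=> t x; apply: (rV_chain (c := fun t => \row_i Y i t x) (dc := fun i => Yt i t x) dg).
    by move=> i; exact: cg.
  by move=> i; under eq_fun do rewrite mxE; case: (sY i).
- move=> j t x; apply: is_derive_line0.
  have := @rV_chain _ _ g gx (fun c => \row_i Y i t (x + c *: evec j)) (fun i => Yx i j t x) 0 dg.
  rewrite scale0r addr0; apply.
    by move=> i; exact: cg.
  move=> i; under eq_fun do rewrite mxE; apply: is_derive_line.
  by rewrite scale0r addr0; case: (sY i).
Qed.

(** Backward straight characteristics: a test function that is constant to first order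
    along the flow of [f] on a short time interval ending at [a]. *)
Section straight.
Variables (a : R) (f ft : 'I_d -> R -> V -> R) (fx : 'I_d -> 'I_d -> R -> V -> R).
Variables (g : V -> R) (gx : 'I_d -> V -> R).
Hypothesis sf : forall i, smooth (f i) (ft i) (fx i).
Hypothesis dg : forall i x, is_derive x (evec i) g (gx i x).
Hypothesis cg : forall i, continuous (gx i).

(** The position at time a of a particle leaving x at time t with the constant
    velocity f t x. *)
Definition foot (t : R) (x : V) : V := \row_i (x 0 i + (a - t) * f i t x).
Definition chart (t : R) (x : V) : R := g (foot t x).
Definition chart_t (t : R) (x : V) : R := \sum_i (0 + ((a - t) * ft i t x + f i t x * -1)) * gx i (foot t x).
Definition chart_x (j : 'I_d) (t : R) (x : V) : R :=
  \sum_i ((i == j)%:R + ((a - t) * fx i j t x + f i t x * 0)) * gx i (foot t x).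

Lemma smooth_chart : smooth chart chart_t chart_x.
Proof.
have st : smooth (fun t (x : V) => a - t) (fun _ _ => -1) (fun _ _ _ => 0).
  apply: smooth_time => [s|]; last by move=> s; exact: cst_continuous.
  by apply: (@is_derive_quad _ _ _ _ 0) => h; rewrite mul0r normr_le0; apply/eqP; ring.
apply: (smooth_comp dg cg (fun i => smooth_add (smooth_coord i) (smooth_mul st (sf i)))).
Qed.

(** Along a velocity w the test function varies with w - f, up to a factor a - t: the
    leading terms f and - f cancel. *)
Lemma chart_flux (w : R -> V -> V) t x : flux w chart_t chart_x t x =
  \sum_i gx i (foot t x) * (w t x 0 i - f i t x + (a - t) * (ft i t x + \sum_j fx i j t x * w t x 0 j)).
Proof.
rewrite /flux /chart_t /chart_x.
under [X in _ + X]eq_bigr do rewrite mulr_suml.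
rewrite exchange_big/= -big_split/=; apply: eq_bigr => i _.
have -> : \sum_j ((i == j)%:R + ((a - t) * fx i j t x + f i t x * 0)) * gx i (foot t x) * w t x 0 j =
    gx i (foot t x) * (\sum_j (i == j)%:R * w t x 0 j + (a - t) * \sum_j fx i j t x * w t x 0 j).
  rewrite mulr_sumr -big_split/= mulr_sumr; apply: eq_bigr => j _; ring.
rewrite (bigD1 i)//= eqxx mul1r big1 ?addr0; last first.
  by move=> j; rewrite eq_sym => /negbTE ->; rewrite mul0r.
ring.
Qed.

Lemma chart_end x : chart a x = g x.
Proof.
by rewrite /chart; congr g; apply/rowP => i; rewrite mxE subrr mul0r addr0.
Qed.

End straight.

End smooth_composition.

(** * C^1 approximate solutions *)

Section approximate_field.
Context {R : realType} {d : nat}.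
Local Notation V := 'rV[R]_d.
Local Notation W := 'rV[R]_d.+1.
Local Notation evec i := (delta_mx 0 i : V).
Local Notation lebW := (@lebesgue_rV R d.+1).

(** A C^1 field close to [b] up to a constant times e, with bounds independent of e,
    that solves up to the same order the equation of Burgers type with forcing [A]
    satisfied by [b]. The constant C' of [af_global] depends on e; it serves to make
    the field an admissible test function. The last 4 e of the time interval are given
    up to the regularization. *)
Record approx_field (T : R) (b : R -> V -> V) (A : 'I_d -> R -> V -> R) (M C e : R)
    (f ft : 'I_d -> R -> V -> R) (fx : 'I_d -> 'I_d -> R -> V -> R) : Prop := ApproxField {
  af_smooth : forall k, smooth (f k) (ft k) (fx k);
  af_global : exists2 C', 0 <= C' & forall k t x, `|ft k t x| <= C' /\ forall j, `|fx k j t x| <= C';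
  af_le : forall k t x, `|f k t x| <= M;
  af_close : forall k t x, 0 <= t <= T - 4 * e -> `|f k t x - b t x 0 k| <= C * e;
  af_t : forall k t x, 0 <= t <= T - 4 * e -> `|ft k t x| <= M;
  af_x : forall k j t x, 0 <= t <= T - 4 * e -> `|fx k j t x| <= M;
  af_eq : forall k t x, 0 <= t <= T - 4 * e ->
    `|ft k t x + \sum_j f j t x * fx k j t x + A k t x| <= C * e }.

Variable T : R.
Hypothesis T0 : 0 < T.
Variables (b : R -> V -> V) (M : R) (f gt : 'I_d -> W -> R) (gD : 'I_d -> 'I_d -> W -> R).
Hypothesis bc : continuous (fun z : R * V => b z.1 z.2).
Hypothesis b_clamp : forall t, b (clamp T t) = b t.
Hypothesis M0 : 0 <= M.
Hypothesis mf : forall k, measurable_fun setT (f k).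
Hypothesis fM : forall k w, `|f k w| <= M.
Hypothesis mgt : forall k, measurable_fun setT (gt k).
Hypothesis gtM : forall k w, `|gt k w| <= M.
Hypothesis mgD : forall k j, measurable_fun setT (gD k j).
Hypothesis gDM : forall k j w, `|gD k j w| <= M.
Hypothesis f_t : forall k e (p : W), 0 < e -> e < p 0 ord0 -> p 0 ord0 + e < T ->
  moll (upd (eta e) ord0 (dbump e)) (f k) p = moll (eta e) (gt k) p.
Hypothesis f_x : forall k e (p : W), 0 < e -> e < p 0 ord0 -> p 0 ord0 + e < T ->
  forall j, moll (upd (eta e) (lift ord0 j) (dbump e)) (f k) p = moll (eta e) (gD k j) p.
Variable A : 'I_d -> R -> V -> R.
Hypothesis f_ae : {ae lebW, forall w : W, w 0 ord0 \in `]0, T[ -> forall k,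
       f k w = b (w 0 ord0) (rV_uncons w).2 0 k /\
       gt k w + \sum_j gD k j w * b (w 0 ord0) (rV_uncons w).2 0 j
         + A k (w 0 ord0) (rV_uncons w).2 = 0}.
Local Notation L := (@bw_lip_cst R d M).

Lemma rV_cons_norm_le t s (x y : V) : `|rV_cons (t, x) - rV_cons (s, y)| <= `|t - s| + `|x - y|.
Proof.
apply: norm_le_coord => [|i]; first by rewrite addr_ge0.
rewrite mxE [X in _ + X]mxE; case: (unliftP ord0 i) => [j|] ->.
  rewrite !rV_cons_coordS/=; have := coord_le_norm (x - y) j; rewrite mxE [X in _ + X]mxE => /le_trans; apply.
  by rewrite lerDr.
by rewrite !rV_cons_coord0/= lerDl.
Qed.

Lemma bw_cons k t x : bw b k (rV_cons (t, x)) = b t x 0 k.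
Proof. by rewrite /bw rV_cons_coord0 rV_consK. Qed.

Lemma b_lip t s x y k : `|b t x 0 k - b s y 0 k| <= L * (`|t - s| + `|x - y|).
Proof.
rewrite -!bw_cons.
apply: le_trans (bw_lip T0 bc b_clamp M0 mf fM mgt gtM mgD gDM f_t f_x f_ae _ _ _) _.
by rewrite ler_wpM2l ?mulr_ge0//; exact: rV_cons_norm_le.
Qed.

(** The regularized velocity is only controlled at times in ]e, T - e[. Shifting it in
    time by 2 e brings the initial time into that range, at the price of an error 2 L
    e because b is Lipschitz in time. *)
Lemma approx_field_exists LA : 0 <= LA ->
  (forall t s x y k, `|A k t x - A k s y| <= LA * (`|t - s| + `|x - y|)) ->
  forall e, 0 < e -> exists p pt px,
    approx_field T b A M (3 * L + (5 * LA + 2 * d%:R * (L * M))) e p pt px.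
Proof.
move=> LA0 AL e e0.
have L0 : 0 <= L by rewrite mulr_ge0.
(* for 0 <= t <= T - 4 e the window [t + e, t + 3 e] stays in ]0, T[ *)
pose w (t : R) (x : V) : W := rV_cons (t + 2 * e, x).
have c1 : continuous (fun z : R * V => w z.1 z.2).
  move=> z; apply: (@continuous_comp _ _ _ (fun z : R * V => (z.1 + 2 * e, z.2)) (@rV_cons R d)).
    move: z; apply: continuous_pair => z; last exact: cvg_snd.
    by apply: cvgD; [exact: cvg_fst|exact: cvg_cst].
  exact: continuous_rV_cons.
have cw (h : W -> R) : continuous h -> continuous (fun z : R * V => h (w z.1 z.2)).
  by move=> ch z; apply: (@continuous_comp _ _ _ (fun z : R * V => w z.1 z.2) h); [exact: c1|exact: ch].
exists (fun k t x => phi f e k (w t x)), (fun k t x => dphi f e k ord0 (w t x)),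
  (fun k j t x => dphi f e k (lift ord0 j) (w t x)).
have inT t : 0 <= t <= T - 4 * e -> e < (w t 0 : W) 0 ord0 /\ (w t 0 : W) 0 ord0 + e < T.
  by rewrite rV_cons_coord0/= => /andP[? ?]; split; lra.
have inTx t x : 0 <= t <= T - 4 * e -> e < (w t x : W) 0 ord0 /\ (w t x : W) 0 ord0 + e < T.
  by move=> /inT; rewrite !rV_cons_coord0.
have wt t x : `|w t x - rV_cons (t, x)| <= 2 * e.
  apply: le_trans (rV_cons_norm_le _ _ _ _) _.
  by rewrite subrr normr0 addr0 addrAC subrr add0r ger0_norm// mulr_ge0// ltW.
split.
- move=> k; split.
  + exact/cw/(phi_continuous mf fM).
  + exact/cw/(dphi_continuous mf fM).
  + by move=> i; exact/cw/(dphi_continuous mf fM).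
  + move=> t x; have := phi_derive mf fM k ord0 (w t x) e0.
    have E s : w s x = rV_cons (2 * e, x) + s *: delta_mx 0 ord0.
      apply/rowP => i; rewrite [RHS]mxE [X in _ + X]mxE; case: (unliftP ord0 i) => [j|] ->.
        by rewrite !rV_cons_coordS !mxE/= mulr0 addr0.
      by rewrite !rV_cons_coord0/= !mxE/= mulr1 addrC.
    rewrite E => /is_derive_line; rewrite (_ : (fun c => _) = (fun s => phi f e k (w s x)))//.
    by apply/funext => s; rewrite E.
  + move=> i t x; apply: is_derive_line0.
    have E c : w t (x + c *: evec i) = w t x + c *: delta_mx 0 (lift ord0 i).
      apply/rowP => l; rewrite [RHS]mxE; case: (unliftP ord0 l) => [j|] ->.
        by rewrite !rV_cons_coordS !mxE/= (inj_eq lift_inj).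
      by rewrite !rV_cons_coord0/= !mxE/= mulr0 addr0.
    have := phi_derive mf fM k (lift ord0 i) (w t x + (0 : R) *: delta_mx 0 (lift ord0 i)) e0.
    move=> /is_derive_line; rewrite scale0r addr0.
    by rewrite (_ : (fun c => phi f e k (w t x + _)) = (fun c => phi f e k (w t (x + c *: evec i))))//; apply/funext => c; rewrite E.
- have ne := fun i : 'I_d.+1 => nice_eta i e0.
  have H i : exists2 C', 0 <= C' & forall k w, `|dphi f e k i w| <= C'.
    have nu := nice_upd i ne (nice_dbump e0).
    have [C [C0 HC _]] := prodf_nice nu.
    exists (M * C * (2 * (e + 1)) ^+ d.+1).
      by rewrite !mulr_ge0// exprn_ge0// mulr_ge0// addr_ge0// ltW.
    by move=> k q; apply: moll_le.
  have [C' HC'] : exists C' : 'I_d.+1 -> R, forall i, 0 <= C' i /\ forall k w, `|dphi f e k i w| <= C' i.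
    have H' i : exists c, 0 <= c /\ forall k w, `|dphi f e k i w| <= c.
      by have [c c0 hc] := H i; exists c.
    by have [c hc] := choice H'; exists c.
  have S i : C' i <= \sum_i C' i.
    by rewrite (bigD1 i)//= lerDl sumr_ge0// => j _; have [] := HC' j.
  exists (\sum_i C' i); first by rewrite sumr_ge0// => j _; have [] := HC' j.
  move=> k t x; split=> [|j].
    by have [_ h] := HC' ord0; exact: le_trans (h k _) (S ord0).
  by have [_ h] := HC' (lift ord0 j); exact: le_trans (h k _) (S _).
- by move=> k t x; exact: phi_le.
- move=> k t x /(inTx t x)[h1 h2].
  have c2 := phi_close T0 bc b_clamp M0 mf fM mgt gtM mgD gDM f_t f_x f_ae k e0 h1 h2.
  have c3 : `|bw b k (w t x) - b t x 0 k| <= L * `|w t x - rV_cons (t, x)|.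
    rewrite -(bw_cons k t x).
    exact: (bw_lip T0 bc b_clamp M0 mf fM mgt gtM mgD gDM f_t f_x f_ae).
  have c4 : L * `|w t x - rV_cons (t, x)| <= L * (2 * e) by rewrite ler_wpM2l.
  apply: le_trans (ler_distD (bw b k (w t x)) _ _) _.
  apply: le_trans (lerD c2 (le_trans c3 c4)) _.
  have : 0 <= (5 * LA + 2 * d%:R * (L * M)) * e.
    by rewrite mulr_ge0 ?(ltW e0)// addr_ge0// !mulr_ge0.
  rewrite [X in _ -> _ <= X]mulrDl; set Z := (_ + _) * e => Z0; lra.
- by move=> k t x /(inTx t x)[h1 h2]; exact: (dphi_le mgt gtM mgD gDM f_t f_x).
- by move=> k j t x /(inTx t x)[h1 h2]; exact: (dphi_le mgt gtM mgD gDM f_t f_x).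
- move=> k t x /(inTx t x)[h1 h2].
  have AW : forall q : W, `|A k ((w t x) 0 ord0) (rV_uncons (w t x)).2 - A k (q 0 ord0) (rV_uncons q).2|
      <= (2 * LA) * `|w t x - q|.
    move=> q; apply: le_trans (AL _ _ _ _ _) _;
    have -> : 2 * LA * `|w t x - q| = LA * (`|w t x - q| + `|w t x - q|) by ring.
    rewrite ler_wpM2l//; apply: lerD; first by have := coord_le_norm (w t x - q) ord0; rewrite mxE [X in _ + X]mxE.
    apply: norm_le_coord => // i; have := coord_le_norm (w t x - q) (lift ord0 i).
    by rewrite mxE [X in _ + X]mxE !mxE.
  have LA20 : 0 <= 2 * LA by rewrite mulr_ge0.
  have := phi_equation T0 bc b_clamp M0 mf fM mgt gtM mgD gDM f_t f_x
    (A := fun k w => A k (w 0 ord0) (rV_uncons w).2) f_ae LA20 AW e0 h1 h2.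
  rewrite rV_consK/= rV_cons_coord0/=; set S := _ + \sum_j _ => HS.
  have c5 := AL (t + 2 * e) t x x k.
  have E1 : `|t + 2 * e - t| = 2 * e.
    by rewrite addrAC subrr add0r ger0_norm// mulr_ge0// ltW.
  rewrite E1 (subrr x) (normr0 V) addr0 in c5.
  apply: le_trans (_ : `|S + A k (t + 2 * e) x| + `|A k (t + 2 * e) x - A k t x| <= _).
    have -> : S + A k t x = (S + A k (t + 2 * e) x) - (A k (t + 2 * e) x - A k t x) by ring.
    exact: ler_normB.
  have : 0 <= 3 * L * e by rewrite !mulr_ge0// ltW.
  move: HS c5; set X := `|_|; set Y := `|_| => HS c5 Le.
  have LAe : 0 <= LA * e by rewrite mulr_ge0// ltW.
  lra.
Qed.

End approximate_field.

(** * Square integrable velocities *)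

Lemma norm_sum_le (R : realType) d (F : 'I_d -> R) X : (forall i, `|F i| <= X) ->
  `|\sum_i F i| <= d%:R * X.
Proof.
move=> FX; apply: le_trans (ler_norm_sum _ _ _) _.
by apply: (le_trans (ler_sum _ (fun i _ => FX i))); rewrite sumr_const card_ord -(mulr_natl X).
Qed.

Section time_integrals.
Context {R : realType}.
Local Notation leb := (@lebesgue_measure R).

Lemma leb_itv_cc (a b : R) : (leb `[a, b] < +oo)%E.
Proof. by rewrite lebesgue_measure_itv/=; case: ifP; rewrite ?ltry// -EFinB ltry. Qed.

Lemma leb_itv_oc (a b : R) : (leb `]a, b] < +oo)%E.
Proof. by rewrite lebesgue_measure_itv/=; case: ifP; rewrite ?ltry// -EFinB ltry. Qed.

Lemma Rint_increment (f : R -> R) s t : 0 <= s <= t ->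
  leb.-integrable `[0, t] (EFin \o f) ->
  \int[leb]_(x in `[0, t]) f x - \int[leb]_(x in `[0, s]) f x = \int[leb]_(x in `]s, t]) f x.
Proof.
move=> /andP[s0 st] fi; rewrite (@Rintegral_itvB _ f (BLeft 0) (BRight t) s)//.
Qed.

Lemma Rint_itv_cst (s t c : R) : s <= t -> \int[leb]_(x in `]s, t]) c = c * (t - s).
Proof.
move=> st; rewrite Rintegral_cst//; congr (_ * _).
have := lebesgue_measure_itv (`]s, t]); rewrite /= lte_fin => ->.
case: ltP => [|ts]; first by rewrite -EFinB.
by rewrite (le_anti _ : s = t) ?subrr// st.
Qed.

Lemma ae_neq (a : R) : {ae leb, forall x, x != a}.
Proof.
exists [set a]; split => //; first exact: lebesgue_measure_set1.
by move=> x /= /negP; rewrite negbK => /eqP.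
Qed.

Lemma ae_itv (T : R) (P : R -> Prop) : {ae leb, forall t, t \in `]0, T[ -> P t} ->
  {ae leb, forall t, 0 <= t <= T -> P t}.
Proof.
move=> H; apply: ae_mono (ae_and H (ae_and (ae_neq 0) (ae_neq T))).
move=> t [Pt [t0 tT]] /andP[h0 hT]; apply: Pt.
by rewrite in_itv/= lt_neqAle eq_sym t0 h0 lt_neqAle tT.
Qed.

Lemma prob_le_le (d : nat) (p : probability 'rV[R]_d R) f g :
  p.-integrable setT (EFin \o f) -> p.-integrable setT (EFin \o g) ->
  (forall x, `|f x| <= g x) -> `|\int[p]_x f x| <= \int[p]_x g x.
Proof. by move=> mf mg fg; apply: ae_normr_Rintegral_le => //; exact/aeW. Qed.

End time_integrals.

Section square_integrable.
Context {R : realType} {d : nat}.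
Local Notation V := 'rV[R]_d.
Local Notation leb := (@lebesgue_measure R).

Lemma normv_sq (x : V) : normv x ^+ 2 = \sum_i x 0 i ^+ 2.
Proof.
rewrite /normv sqr_sqrtr; first by apply: eq_bigr => i _; rewrite expr2.
by apply: sumr_ge0 => i _; rewrite -expr2 sqr_ge0.
Qed.

Lemma measurable_normv_sq dd (X : measurableType dd) (D : set X) (f : X -> V) :
  measurable_fun D f -> measurable_fun D (fun x => normv (f x) ^+ 2).
Proof.
move=> mf; under eq_fun do rewrite normv_sq.
by apply: measurable_sum => i; apply: measurable_funX; exact: measurable_rV_coord.
Qed.

Lemma coord_le_sq (x : V) i : `|x 0 i| <= 1 + normv x ^+ 2.
Proof.
have h := normv_coord x i.
have : 0 <= (normv x - 1) ^+ 2 by exact: sqr_ge0.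
by rewrite sqrrB expr1n mulr1; have := normr_ge0 (x 0 i); lra.
Qed.

Lemma sq_integrable (p : probability V R) (w : V -> V) c : measurable_fun setT w ->
  (\int[p]_x (normv (w x) ^+ 2)%:E <= c%:E)%E ->
  p.-integrable setT (fun x => (normv (w x) ^+ 2)%:E) /\
  \int[p]_x (normv (w x) ^+ 2) <= c.
Proof.
move=> mw wc; have i2 : p.-integrable setT (fun x => (normv (w x) ^+ 2)%:E).
  apply/integrableP; split.
    by apply/measurable_EFinP; exact: measurable_normv_sq.
  under eq_integral do rewrite /= ger0_norm ?sqr_ge0//.
  by apply: le_lt_trans wc _; rewrite ltry.
split => //; rewrite -lee_fin /Rintegral fineK//.
exact: integrable_fin_num.
Qed.

Lemma sq_dominated (p : probability V R) (w : V -> V) c (f : V -> R) a : measurable_fun setT w ->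
  (\int[p]_x (normv (w x) ^+ 2)%:E <= c%:E)%E -> measurable_fun setT f ->
  0 <= a -> (forall x, `|f x| <= a * (1 + normv (w x) ^+ 2)) ->
  p.-integrable setT (EFin \o f) /\ `|\int[p]_x f x| <= a * (1 + c).
Proof.
move=> mw wc mf a0 fa; have [i2 l2] := sq_integrable mw wc.
have ig : p.-integrable setT (EFin \o (fun x => a * (1 + normv (w x) ^+ 2))).
  apply: integrableZr => //; apply: integrableDr => //; exact: finite_measure_integrable_cst.
have if_ : p.-integrable setT (EFin \o f).
  by apply: (le_integrabler measurableT mf _ ig) => x _.
split => //; apply: le_trans (prob_le_le if_ ig fa) _.
rewrite RintegralZl//; last by apply: integrableDr => //; exact: finite_measure_integrable_cst.
rewrite ler_wpM2l// RintegralD//; last exact: finite_measure_integrable_cst.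
by rewrite prob_cst lerD2l.
Qed.

Variable T : R.
Hypothesis T0 : 0 < T.
Variable rho : R -> probability V R.
Hypothesis rho_flat : flat_continuous T rho.
Local Notation l := (fun t => rho (clamp T t)).

(** Setting u to zero at the exceptional times where its L^2 norm exceeds the
    essential bound gives a velocity w that obeys the bound at every time. These times
    form a measurable set by [kernel_flat]. The velocity U is the extension of u by
    zero, used where all times matter. *)
Lemma clean_velocity (u : R -> V -> V) :
  measurable_fun (`[0, T] `*` setT) (fun z : R * V => u z.1 z.2) ->
  (ess_sup_time T (fun t => \int[rho t]_x (normv (u t x) ^+ 2)%:E) < +oo)%E ->
  exists (w U : R -> V -> V) (Mu : R),
    [/\ 0 <= Mu, measurable_fun setT (fun z : R * V => w z.1 z.2),
        measurable_fun setT (fun z : R * V => U z.1 z.2),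
        (forall t, (\int[l t]_x (normv (w t x) ^+ 2)%:E <= Mu%:E)%E) &
        (forall t, 0 <= t <= T -> U t = u t) /\
        {ae leb, forall t, 0 <= t <= T -> w t = u t}].
Proof.
move=> mu /ess_sup_time_lty[Mu Mu0 HMu].
have mS : measurable (`[0, T] `*` [set: V]) by apply: measurableX => //; exact: measurable_itv.
pose ext (S : set (R * V)) t x : V := \row_i ((fun z : R * V => u z.1 z.2 0 i) \_ S) (t, x).
have mext S : measurable S -> S `<=` `[0, T] `*` [set: V] ->
    measurable_fun setT (fun z : R * V => ext S z.1 z.2).
  move=> mSS sub; apply: measurable_rV => i; rewrite /ext; under eq_fun do rewrite mxE -surjective_pairing.
  apply/(measurable_restrictT _ mSS); apply: (measurable_funS mS sub).
  exact: measurable_rV_coord.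
have extE S t x : S (t, x) -> ext S t x = u t x.
  by move=> Stx; apply/rowP => i; rewrite mxE patchE mem_set.
pose U := ext (`[0, T] `*` [set: V]).
have mU := mext _ mS (fun _ => id).
pose N t := (\int[l t]_x (normv (U t x) ^+ 2)%:E)%E.
have mN : measurable_fun setT N.
  apply: (measurable_int_kernel (l := l) (kernel_flat T0 rho_flat)
    (k := fun z : R * V => (normv (U z.1 z.2) ^+ 2)%:E)).
    by move=> z; rewrite lee_fin sqr_ge0.
  by apply/measurable_EFinP; exact: measurable_normv_sq.
(* the times at which the essential bound of the kinetic energy holds *)
pose E := [set t | (N t <= Mu%:E)%E] `&` `[0, T]%classic.
have mE : measurable E.
  apply: measurableI; last exact: measurable_itv.
  have -> : [set t | (N t <= Mu%:E)%E] = setT `&` N @^-1` `]-oo, Mu%:E]%classic.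
    by rewrite setTI; apply/seteqP; split=> t /=; rewrite in_itv.
  by apply: mN => //; exact: emeasurable_itv.
pose w := ext (E `*` setT).
have mES : measurable (E `*` [set: V]) by exact: measurableX.
have mw : measurable_fun setT (fun z : R * V => w z.1 z.2).
  by apply: mext => // z [[_ h] _]; split.
have UE t : 0 <= t <= T -> U t = u t.
  by move=> tT; apply/funext => x; apply: extE; split => //=; rewrite in_itv.
exists w, U, Mu; split => //.
- move=> t; have [Et|nEt] := pselect (E t).
    have -> : w t = U t.
      apply/funext => x; rewrite UE; first by apply: extE; split.
      by case: Et => _ /=; rewrite in_itv.
    by case: Et.
  rewrite (eq_integral (cst 0%E)); first by rewrite integral0 lee_fin.
  move=> x _; rewrite /= normv_sq big1// => i _.
  by rewrite mxE patchE memNset ?expr0n// => -[].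
- split => //; apply: (ae_itv (P := fun t => w t = u t)) => //.
  apply: ae_mono HMu => t Ht tT.
  have tTT : 0 <= t <= T by move: tT; rewrite in_itv/= => /andP[? ?]; rewrite !ltW.
  apply/funext => x; apply: extE; split => //=; split; rewrite ?in_itv//=.
  rewrite /= /N clamp_id//.
  by under eq_integral do rewrite UE//; exact: Ht.
Qed.

Lemma weak_continuity_clean (rho0 : probability V R) (u w U : R -> V -> V) :
  weak_continuity T rho0 rho u ->
  measurable_fun setT (fun z : R * V => w z.1 z.2) ->
  measurable_fun setT (fun z : R * V => U z.1 z.2) ->
  (forall t, 0 <= t <= T -> U t = u t) ->
  {ae leb, forall t, 0 <= t <= T -> w t = u t} ->
  forall C t psi psit psix, 0 <= t <= T -> smooth psi psit psix ->
    bounded_on T C psi psit psix ->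
    \int[l t]_x psi t x - \int[rho0]_x psi 0 x =
    \int[leb]_(tau in `[0, t]) \int[l tau]_x flux w psit psix tau x.
Proof.
move=> wc mw mU UE wE C t psi psit psix tT sp bp.
have C0 : 0 <= C by have [h _ _] := bp _ 0 tT; exact: le_trans (normr_ge0 _) h.
have t_in s : s \in `[0, T] -> 0 <= s <= T by rewrite in_itv.
rewrite clamp_id//; have tT' : t \in `[0, T] by rewrite in_itv.
rewrite (wc t tT' psi psit psix (smooth_C1_on _ sp)); last first.
  exists ((1 + d%:R) * C) => s x /t_in sT; have [h1 h2 h3] := bp s x sT.
  have dC : C <= (1 + d%:R) * C by rewrite mulrDl mul1r lerDl mulr_ge0.
  have n1 : 1 <= 1 + normv x ^+ 2 by rewrite lerDl sqr_ge0.
  have n2 : 1 <= 1 + normv x by rewrite lerDl sqrtr_ge0.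
  have dC0 : 0 <= (1 + d%:R) * C := le_trans C0 dC.
  split.
  - by apply: le_trans h1 (le_trans dC _); rewrite ler_peMr.
  - by apply: le_trans h2 (le_trans dC _); rewrite ler_peMr.
  - apply: (@le_trans _ _ (d%:R * C)); first by apply: normv_le => // i; rewrite mxE.
    apply: (@le_trans _ _ ((1 + d%:R) * C)); last by rewrite ler_peMr.
    by rewrite mulrDl mul1r lerDr.
have mflux (q : R -> V -> V) : measurable_fun setT (fun z : R * V => q z.1 z.2) ->
    measurable_fun setT (fun tau => \int[l tau]_x flux q psit psix tau x).
  move=> mq; apply: (measurable_kernel_integral T0 rho_flat
    (k := fun z : R * V => flux q psit psix z.1 z.2)).
  have [_ c2 c3 _ _] := sp.
  apply: measurable_funD; first exact: measurable_continuous_prod.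
  apply: measurable_sum => i; apply: measurable_funM; first by apply: measurable_continuous_prod; exact: c3.
  exact: (measurable_rV_coord (f := fun z : R * V => q z.1 z.2)).
transitivity (\int[leb]_(tau in `[0, t]) \int[l tau]_x flux U psit psix tau x).
  apply: eq_Rintegral => tau; rewrite inE/= in_itv/= => /andP[tau0 taut].
  have tauT : 0 <= tau <= T by rewrite tau0 (le_trans taut)//; case/andP: tT.
  rewrite clamp_id//; apply: eq_Rintegral => x _; rewrite /flux UE// /dotv; congr (_ + _).
  by apply: eq_bigr => i _; rewrite mxE.
apply: ae_eq_Rintegral.
- exact: measurable_itv.
- by apply: measurable_funTS; exact: mflux.
- by apply: measurable_funTS; exact: mflux.
- apply: ae_mono wE => tau Htau; rewrite /= in_itv/= => /andP[tau0 taut].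
  have tauT : 0 <= tau <= T by rewrite tau0 (le_trans taut)//; case/andP: tT.
  by apply: eq_Rintegral => x _; rewrite /flux Htau// UE.
Qed.

End square_integrable.

(** * Distance between the two densities *)

Section distance.
Context {R : realType} {d : nat}.
Local Notation V := 'rV[R]_d.
Local Notation leb := (@lebesgue_measure R).
Variable T : R.
Hypothesis T0 : 0 < T.
Variables (rho r : R -> probability V R) (rho0 : probability V R).
Hypothesis rho_flat : flat_continuous T rho.
Local Notation l := (fun t => rho (clamp T t)).
Local Notation lr := (fun t => r (clamp T t)).
Variables (b w : R -> V -> V) (M Mu : R).
Hypothesis bc : continuous (fun z : R * V => b z.1 z.2).
Hypothesis M0 : 0 <= M.
Hypothesis bM : forall t x k, `|b t x 0 k| <= M.
Hypothesis mw : measurable_fun setT (fun z : R * V => w z.1 z.2).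
Hypothesis Mu0 : 0 <= Mu.
Hypothesis wMu : forall t, (\int[l t]_x (normv (w t x) ^+ 2)%:E <= Mu%:E)%E.
Hypothesis weak_w : forall C t psi psit psix, 0 <= t <= T -> smooth psi psit psix ->
    bounded_on T C psi psit psix ->
    \int[l t]_x psi t x - \int[rho0]_x psi 0 x =
    \int[leb]_(tau in `[0, t]) \int[l tau]_x flux w psit psix tau x.

Lemma mwt t : measurable_fun setT (w t).
Proof. exact: (measurableT_comp (g := pair t) mw). Qed.

Lemma mbt t : measurable_fun setT (b t).
Proof.
apply: measurable_rV => i; apply: (measurableT_comp (g := pair t) (f := fun z : R * V => b z.1 z.2 0 i)) => //.
by apply: measurable_continuous_prod; exact: (@continuous_coord _ _ _ (fun z : R * V => b z.1 z.2)).
Qed.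

(** The l^1 norm, because fluxes are estimated one coordinate at a time. *)
Definition gap t x : R := \sum_i `|w t x 0 i - b t x 0 i|.
Definition Gap t : R := \int[l t]_x gap t x.

Lemma gap_ge0 t x : 0 <= gap t x.
Proof. by apply: sumr_ge0. Qed.

Lemma measurable_gap : measurable_fun setT (fun z : R * V => gap z.1 z.2).
Proof.
apply: measurable_sum => i; apply: measurableT_comp => //; apply: measurable_funB.
  exact: measurable_rV_coord mw.
by apply: measurable_continuous_prod; exact: (@continuous_coord _ _ _ (fun z : R * V => b z.1 z.2)).
Qed.

Lemma gap_le t x : gap t x <= d%:R * (1 + M) * (1 + normv (w t x) ^+ 2).
Proof.
apply: (@le_trans _ _ (\sum_(i < d) (1 + M) * (1 + normv (w t x) ^+ 2))).
  apply: ler_sum => i _; apply: le_trans (ler_normB _ _) _.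
  rewrite mulrDl mul1r; apply: lerD; first exact: coord_le_sq.
  by apply: le_trans (bM _ _ _) _; rewrite ler_peMr// lerDl sqr_ge0.
by rewrite sumr_const card_ord -(mulr_natl (_ * _)) mulrA.
Qed.

Definition gap_bound : R := d%:R * (1 + M) * (1 + Mu).

Lemma gap_integrable t : (l t).-integrable setT (EFin \o gap t) /\ `|Gap t| <= gap_bound.
Proof.
apply: (sq_dominated (mwt t) (wMu t)).
- exact: (measurableT_comp (g := pair t) measurable_gap).
- by rewrite mulr_ge0// addr_ge0.
- by move=> x; rewrite ger0_norm ?gap_ge0//; exact: gap_le.
Qed.

Lemma Gap_ge0 t : 0 <= Gap t.
Proof. by apply: Rintegral_ge0 => x _; exact: gap_ge0. Qed.

Lemma measurable_Gap : measurable_fun setT Gap.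
Proof.
exact: (measurable_kernel_integral T0 rho_flat (k := fun z : R * V => gap z.1 z.2) measurable_gap).
Qed.

Lemma Gap_integrable t : leb.-integrable `[0, t] (EFin \o Gap).
Proof.
apply: (@bounded_integrable _ _ _ _ _ _ _ gap_bound).
- exact: measurable_itv.
- exact: leb_itv_cc.
- exact: measurable_funTS measurable_Gap.
- by move=> s _; have [] := gap_integrable s.
Qed.

(** The quantity that bounds the distance between the densities at time t. *)
Definition PGap t : R := \int[leb]_(s in `[0, t]) Gap s.

Lemma PGap_increment s t : 0 <= s <= t -> PGap t - PGap s = \int[leb]_(x in `]s, t]) Gap x.
Proof. by move=> st; exact: Rint_increment (Gap_integrable t). Qed.

(** The continuity equation gives the increment between s and t as an integral of the
    flux, dominated by the gap and a constant. *)
Lemma rho_estimate C c1 c2 s t psi psit psix : smooth psi psit psix ->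
  bounded_on T C psi psit psix -> 0 <= s <= t -> t <= T -> 0 <= c1 -> 0 <= c2 ->
  (forall tau x, s < tau <= t -> `|flux w psit psix tau x| <= c1 * gap tau x + c2) ->
  `|\int[l t]_x psi t x - \int[l s]_x psi s x| <= c1 * (PGap t - PGap s) + c2 * (t - s).
Proof.
move=> sp bp /andP[s0 st] tT c10 c20 H.
have sT : 0 <= s <= T by rewrite s0 (le_trans st).
have tTT : 0 <= t <= T by rewrite (le_trans s0).
have C0 : 0 <= C by have [h _ _] := bp _ 0 sT; exact: le_trans (normr_ge0 _) h.
pose F tau := \int[l tau]_x flux w psit psix tau x.
have mfl : measurable_fun setT (fun z : R * V => flux w psit psix z.1 z.2).
  have [_ cc2 cc3 _ _] := sp.
  apply: measurable_funD; first exact: measurable_continuous_prod.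
  apply: measurable_sum => i; apply: measurable_funM; first by apply: measurable_continuous_prod; exact: cc3.
  exact: measurable_rV_coord mw.
have mF : measurable_fun setT F := measurable_kernel_integral T0 rho_flat mfl.
have ifl tau : 0 <= tau <= T -> (l tau).-integrable setT (EFin \o flux w psit psix tau) /\
    `|F tau| <= ((1 + d%:R) * C) * (1 + Mu).
  move=> tauT; apply: (sq_dominated (mwt tau) (wMu tau)).
  - exact: (measurableT_comp (g := pair tau) mfl).
  - by rewrite mulr_ge0// addr_ge0.
  - move=> x; have [_ h2 h3] := bp tau x tauT.
    apply: le_trans (ler_normD _ _) _; rewrite mulrDl mul1r mulrDl; apply: lerD.
      by apply: le_trans h2 _; rewrite ler_peMr// lerDl sqr_ge0.
    apply: le_trans (ler_norm_sum _ _ _) _.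
    apply: (@le_trans _ _ (\sum_(i < d) C * (1 + normv (w tau x) ^+ 2))).
      by apply: ler_sum => i _; rewrite normrM; apply: ler_pM => //; exact: coord_le_sq.
    by rewrite sumr_const card_ord -(mulr_natl (_ * _)) mulrA.
have iF : leb.-integrable `[0, t] (EFin \o F).
  apply: (@bounded_integrable _ _ _ _ _ _ _ (((1 + d%:R) * C) * (1 + Mu))).
  - exact: measurable_itv.
  - exact: leb_itv_cc.
  - exact: measurable_funTS mF.
  - move=> tau; rewrite /= in_itv/= => /andP[h1 h2]; apply: (ifl tau _).2.
    by rewrite h1 (le_trans h2).
have -> : \int[l t]_x psi t x - \int[l s]_x psi s x = \int[leb]_(tau in `]s, t]) F tau.
  rewrite -(@Rint_increment _ F s t) ?s0//.
  by rewrite -(weak_w tTT sp bp) -(weak_w sT sp bp); ring.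
have sub : `]s, t]%classic `<=` `[0, t]%classic.
  by move=> x; rewrite /= !in_itv/= => /andP[h1 h2]; rewrite h2 (le_trans s0 (ltW h1)).
have iFs : leb.-integrable `]s, t] (EFin \o F).
  by apply: integrableS iF => //; exact: measurable_itv.
have iGs : leb.-integrable `]s, t] (EFin \o Gap).
  by apply: integrableS (Gap_integrable t) => //; exact: measurable_itv.
have ic : leb.-integrable `]s, t] (EFin \o (fun=> c2)).
  apply: (@bounded_integrable _ _ _ _ _ _ _ `|c2|) => //.
  exact: leb_itv_oc.
rewrite PGap_increment ?s0// -(Rint_itv_cst c2 st) -RintegralZl//.
rewrite -RintegralD//; last exact: integrableZr.
apply: ae_normr_Rintegral_le => //.
  by apply: integrableDr => //; exact: integrableZr.
apply/aeW => tau; rewrite /= in_itv/= => /andP[h1 h2].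
have tauT : 0 <= tau <= T by rewrite (le_trans s0 (ltW h1)) (le_trans h2).
have [ifg _] := gap_integrable tau.
have -> : c1 * Gap tau + c2 = \int[l tau]_x (c1 * gap tau x + c2).
  rewrite RintegralD//; [|exact: integrableZr|exact: finite_measure_integrable_cst].
  by rewrite RintegralZl// prob_cst.
apply: prob_le_le.
- exact: (ifl tau tauT).1.
- by apply: integrableDr => //; [exact: integrableZr|exact: finite_measure_integrable_cst].
- by move=> x; apply: H; rewrite h1.
Qed.

(** The bounded Lipschitz distance, with the sup norm of the tests left free: the
    Lipschitz constant alone enters the estimates. *)
Definition lipdist_le (p q : probability V R) (c : R) : Prop :=
  forall (g : V -> R) (L B : R), 0 <= L -> lipf L g -> (forall x, `|g x| <= B) ->
    `|\int[p]_x g x - \int[q]_x g x| <= c * L.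

Variables (A : 'I_d -> R -> V -> R) (C0 : R).
Hypothesis C00 : 0 <= C0.
Hypothesis approx : forall e, 0 < e -> exists f ft fx, approx_field T b A M C0 e f ft fx.
Hypothesis r_est : forall C psi psit psix B s t, smooth psi psit psix ->
  bounded_on T C psi psit psix -> 0 <= s <= t -> t <= T -> 0 <= B ->
  (forall tau, s < tau < t -> `|\int[lr tau]_x flux b psit psix tau x| <= B) ->
  `|\int[lr t]_x psi t x - \int[lr s]_x psi s x| <= B * (t - s).
Hypothesis init : lipdist_le (l 0) (lr 0) 0.

Definition k1 : R := d%:R * (C0 + M + d%:R * (M * M)).
(** 15 / 2 is the loss of Lipschitz constant in [lip_approx]; k1 enters twice, for rho
    and for r; 4 counts the four approximations of g or of its chart within L h^2. *)
Definition step_cst : R := 15 / 2 * (1 + d%:R * M) + 15 * k1 + 4.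

Lemma k1_ge0 : 0 <= k1.
Proof. by rewrite mulr_ge0// !addr_ge0// !mulr_ge0. Qed.

Lemma step_cst_ge0 : 0 <= step_cst.
Proof. by rewrite !addr_ge0// mulr_ge0 ?k1_ge0// addr_ge0// mulr_ge0. Qed.

(** The function g is smoothed at scale h^2 and transported by a [chart] from time s
    to time s + h. On the side of r the chart varies by O(h^2), and on the side of rho
    by O(h^2) plus the gap of velocities accumulated in the step. At time s the chart
    is g at the foot of the characteristics, of Lipschitz constant (1 + d M h) L, and
    the distance at time s applies. *)
Lemma lipdist_step s h c : 0 <= s -> 0 < h -> h <= 1 -> s + h <= T - 4 * h -> 0 <= c ->
  lipdist_le (l s) (lr s) c ->
  lipdist_le (l (s + h)) (lr (s + h))
    ((1 + d%:R * M * h) * c + step_cst * (h ^+ 2 + (PGap (s + h) - PGap s))).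
Proof.
move=> s0 h0 h1 shT c0 Dc g L B L0 gL gB.
set a := s + h.
have sa : s <= a by rewrite /a lerDl ltW.
have aT : a <= T by rewrite /a; lra.
have dl0 : 0 < h ^+ 2 by rewrite exprn_gt0.
have [gd [gx [gdB gdg dg cg gxL]]] := lip_approx dl0 L0 gL gB.
have [f [ft [fx af]]] := approx h0.
have [sf [C' C'0 fC'] fM fclose ftM fxM _] := af.
have sc := smooth_chart a sf dg cg.
set LG := 15 / 2 * L in gxL.
have LG0 : 0 <= LG by rewrite mulr_ge0.
have B0 : 0 <= B := le_trans (normr_ge0 _) (gB 0).
pose CB := B + d%:R * ((1 + T * C' + M) * LG).
have TC : 0 <= T * C' by rewrite mulr_ge0// ltW.
have bc_ : bounded_on T CB (chart a f gd) (chart_t a f ft gx) (chart_x a f fx gx).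
  move=> t x /andP[t0 tT].
  have at_ : `|a - t| <= T.
    by rewrite ler_norml; apply/andP; split; [|]; move: sa aT; rewrite /a; lra.
  split.
  - by apply: le_trans (gdB _) _; rewrite lerDl !mulr_ge0// !addr_ge0.
  - rewrite /CB addrC -[leLHS]addr0 lerD//; apply: norm_sum_le => i; rewrite normrM; apply: ler_pM => //.
    rewrite add0r; apply: le_trans (ler_normD _ _) _; rewrite normrM mulrN1 normrN.
    have h2 := ler_pM (normr_ge0 _) (normr_ge0 _) at_ (fC' i t x).1.
    by have := fM i t x; lra.
  - move=> j; rewrite /CB addrC -[leLHS]addr0 lerD//; apply: norm_sum_le => i; rewrite normrM; apply: ler_pM => //.
    apply: le_trans (ler_normD _ _) _; rewrite mulr0 addr0 normrM.
    have h2 := ler_pM (normr_ge0 _) (normr_ge0 _) at_ ((fC' i t x).2 j).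
    have h3 : `|(i == j)%:R| <= 1 :> R by case: (i == j); rewrite ?normr1 ?normr0.
    have := M0; lra.
have in4 t : s < t <= a -> 0 <= t <= T - 4 * h.
  by move=> /andP[h2 h3]; rewrite (le_trans s0 (ltW h2))/= (le_trans h3).
have gapi t x i : `|w t x 0 i - b t x 0 i| <= gap t x.
  by rewrite /gap (bigD1 i)//= lerDl sumr_ge0.
have LGk : 0 <= LG * k1 * h := mulr_ge0 (mulr_ge0 LG0 k1_ge0) (ltW h0).
have est_r : `|\int[lr a]_x gd x - \int[lr s]_x chart a f gd s x| <= LG * k1 * h * h.
  have := @r_est CB _ _ _ (LG * k1 * h) s a sc bc_.
  rewrite (_ : a - s = h); last by rewrite /a addrAC subrr add0r.
  under [X in `|X - _|]eq_Rintegral do rewrite chart_end.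
  rewrite s0 sa aT; apply => //.
  move=> tau /andP[st ta]; have tauI : s < tau <= a by rewrite st ltW.
  have tau4 := in4 _ tauI.
  apply: prob_le.
    exact: (measurableT_comp (g := pair tau) (measurable_flux bc sc)).
  move=> x; rewrite chart_flux.
  have -> : LG * k1 * h = d%:R * (LG * ((C0 + M + d%:R * (M * M)) * h)) by rewrite /k1; ring.
  apply: norm_sum_le => i; rewrite normrM; apply: ler_pM => //.
  apply: le_trans (ler_normD _ _) _.
  have -> : (C0 + M + d%:R * (M * M)) * h = C0 * h + h * (M + d%:R * (M * M)) by ring.
  apply: lerD; first by rewrite distrC; exact: fclose.
  rewrite normrM; apply: ler_pM => //.
    by rewrite ler_norml; apply/andP; split; move: st ta; rewrite /a; lra.
  apply: le_trans (ler_normD _ _) _; apply: lerD; first exact: ftM.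
  by apply: norm_sum_le => j; rewrite normrM; apply: ler_pM => //; exact: fxM.
have est_rho : `|\int[l a]_x gd x - \int[l s]_x chart a f gd s x| <=
    LG * (1 + d%:R * M) * (PGap a - PGap s) + LG * k1 * h * h.
  have := @rho_estimate CB (LG * (1 + d%:R * M)) (LG * k1 * h) s a _ _ _ sc bc_.
  rewrite (_ : a - s = h); last by rewrite /a addrAC subrr add0r.
  under [X in `|X - _|]eq_Rintegral do rewrite chart_end.
  rewrite s0 sa aT; apply => //.
    by rewrite mulr_ge0// addr_ge0// mulr_ge0.
  move=> tau x tauI; have tau4 := in4 _ tauI.
  have gp := gap_ge0 tau x.
  have /andP[ta0 tah] : 0 <= a - tau <= h.
    by move: tauI => /andP[]; rewrite /a => ? ?; apply/andP; split; lra.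
  have term i : `|w tau x 0 i - f i tau x + (a - tau) * (ft i tau x + \sum_j fx i j tau x * w tau x 0 j)|
      <= `|w tau x 0 i - b tau x 0 i| + (C0 + M + d%:R * (M * M)) * h + M * gap tau x.
    have e1 : `|w tau x 0 i - f i tau x| <= `|w tau x 0 i - b tau x 0 i| + C0 * h.
      apply: le_trans (ler_distD (b tau x 0 i) _ _) _.
      by rewrite lerD2l distrC; exact: fclose.
    have e2 : `|\sum_j fx i j tau x * w tau x 0 j| <= M * gap tau x + d%:R * (M * M).
      have -> : \sum_j fx i j tau x * w tau x 0 j =
          \sum_j fx i j tau x * (w tau x 0 j - b tau x 0 j) + \sum_j fx i j tau x * b tau x 0 j.
        by rewrite -big_split/=; apply: eq_bigr => j _; ring.
      apply: le_trans (ler_normD _ _) _; apply: lerD.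
        apply: le_trans (ler_norm_sum _ _ _) _; rewrite /gap mulr_sumr; apply: ler_sum => j _.
        by rewrite normrM ler_wpM2r//; exact: fxM.
      by apply: norm_sum_le => j; rewrite normrM; apply: ler_pM => //; exact: fxM.
    have e3 : `|(a - tau) * (ft i tau x + \sum_j fx i j tau x * w tau x 0 j)| <=
        h * (M + d%:R * (M * M)) + M * gap tau x.
      rewrite normrM (ger0_norm ta0).
      have e4 : `|ft i tau x + \sum_j fx i j tau x * w tau x 0 j| <= M + d%:R * (M * M) + M * gap tau x.
        apply: le_trans (ler_normD _ _) _; have := ftM i tau x tau4; lra.
      apply: le_trans (ler_pM ta0 (normr_ge0 _) tah e4) _.
      rewrite mulrDr lerD2l ler_piMl// mulr_ge0//.
    by apply: le_trans (ler_normD _ _) _; apply: le_trans (lerD e1 e3) _; lra.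
  rewrite chart_flux; apply: le_trans (ler_norm_sum _ _ _) _.
  apply: (@le_trans _ _ (\sum_i LG * (`|w tau x 0 i - b tau x 0 i| +
      ((C0 + M + d%:R * (M * M)) * h + M * gap tau x)))).
    by apply: ler_sum => i _; rewrite normrM addrA; apply: ler_pM => //; exact: term.
  rewrite -mulr_sumr big_split/= sumr_const card_ord -(mulr_natl (_ + M * _)) -/(gap tau x).
  by rewrite /k1 le_eqVlt; apply/orP; left; apply/eqP; ring.
have c0_gd : continuous gd.
  by have [[dfg _] _] := C1_of_partials dg cg; move=> x; exact: differentiable_continuous.
have mg : measurable_fun setT g by apply: measurable_continuous_rV; exact: lipf_continuous gL.
have s4 : 0 <= s <= T - 4 * h by rewrite s0 (le_trans sa).
have foot_lip x y : `|foot a f s x - foot a f s y| <= (1 + d%:R * M * h) * `|x - y|.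
  apply: norm_le_coord => [|i]; first by rewrite mulr_ge0// addr_ge0// !mulr_ge0// ltW.
  rewrite !mxE (_ : a - s = h); last by rewrite /a addrAC subrr add0r.
  have -> : x 0 i + h * f i s x - (y 0 i + h * f i s y) = (x 0 i - y 0 i) + h * (f i s x - f i s y) by ring.
  apply: le_trans (ler_normD _ _) _; rewrite mulrDl mul1r; apply: lerD.
    by have := coord_le_norm (x - y) i; rewrite mxE [X in _ + X]mxE.
  rewrite normrM (gtr0_norm h0) (_ : d%:R * M * h * `|x - y| = h * (d%:R * M * `|x - y|)); last by ring.
  rewrite ler_wpM2l ?(ltW h0)//.
  have [_ _ _ _ dfx] := sf i.
  apply: (@rV_Lipschitz _ _ (f i s) (fun j => fx i j s) M y x) => j z _.
  exact: fxM.
pose gt x := g (foot a f s x).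
have gtL : lipf (L * (1 + d%:R * M * h)) gt.
  by move=> x y; apply: le_trans (gL _ _) _; rewrite -mulrA ler_wpM2l// foot_lip.
have gtB x : `|gt x| <= B by exact: gB.
have L1 : 0 <= 1 + d%:R * M * h by rewrite addr_ge0// !mulr_ge0// ltW.
have est_c := Dc gt _ B (mulr_ge0 L0 L1) gtL gtB.
have mgt : measurable_fun setT gt by apply: measurable_continuous_rV; apply: lipf_continuous gtL; exact: mulr_ge0.
have mgd := measurable_continuous_rV c0_gd.
have mch : measurable_fun setT (chart a f gd s) := smooth_measurable s sc.
have chB x : `|chart a f gd s x| <= B by exact: gdB.
have d1 (p : probability V R) : `|\int[p]_x gd x - \int[p]_x g x| <= L * h ^+ 2.
  by apply: prob_diff_le => //; [exact: prob_integrable gdB|exact: prob_integrable gB].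
have d2 (p : probability V R) : `|\int[p]_x chart a f gd s x - \int[p]_x gt x| <= L * h ^+ 2.
  apply: prob_diff_le; [exact: prob_integrable chB|exact: prob_integrable gtB|].
  by move=> x; exact: gdg.
rewrite -/a in est_r est_rho.
have hh : 0 <= L * h ^+ 2 by rewrite mulr_ge0// ltW.
have PP : 0 <= PGap a - PGap s.
  by rewrite PGap_increment ?s0//; apply: Rintegral_ge0 => tau _; exact: Gap_ge0.
have k1L : 0 <= k1 * (L * h ^+ 2) by rewrite mulr_ge0// k1_ge0.
have dM : 0 <= 1 + d%:R * M by rewrite addr_ge0// mulr_ge0.
have PPL : 0 <= L * (PGap a - PGap s) by rewrite mulr_ge0.
have PPM : 0 <= (1 + d%:R * M) * (L * h ^+ 2) by rewrite mulr_ge0.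
have PPk : 0 <= k1 * (L * (PGap a - PGap s)) by rewrite mulr_ge0// k1_ge0.
(* the path g, gd, chart, gt for rho, the distance at time s, and the same path back
   for r *)
have T1 : `|\int[l a]_x g x - \int[lr a]_x g x| <=
   (L * h ^+ 2 + (LG * (1 + d%:R * M) * (PGap a - PGap s) + LG * k1 * h * h) + L * h ^+ 2) +
   c * (L * (1 + d%:R * M * h)) + (L * h ^+ 2 + LG * k1 * h * h + L * h ^+ 2).
  apply: le_trans (ler_distD (\int[lr s]_x gt x) _ _) _; apply: lerD.
    apply: le_trans (ler_distD (\int[l s]_x gt x) _ _) _; apply: lerD; last exact: est_c.
    apply: le_trans (ler_distD (\int[l s]_x chart a f gd s x) _ _) _; apply: lerD; last exact: d2.
    apply: le_trans (ler_distD (\int[l a]_x gd x) _ _) _; apply: lerD; last exact: est_rho.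
    by rewrite distrC; exact: d1.
  rewrite distrC.
  apply: le_trans (ler_distD (\int[lr s]_x chart a f gd s x) _ _) _; apply: lerD; last exact: d2.
  apply: le_trans (ler_distD (\int[lr a]_x gd x) _ _) _; apply: lerD; last exact: est_r.
  by rewrite distrC; exact: d1.
apply: le_trans T1 _.
rewrite -subr_ge0 (_ : _ - _ = (15 * k1 + 4) * (L * (PGap a - PGap s)) + 15 / 2 * (1 + d%:R * M) * (L * h ^+ 2)).
  have k10 := k1_ge0; apply: addr_ge0; apply: mulr_ge0 => //; first by rewrite addr_ge0// mulr_ge0.
  by rewrite mulr_ge0.
by rewrite /step_cst /LG; field.
Qed.

Lemma lipdist_mono p q c c' : c <= c' -> lipdist_le p q c -> lipdist_le p q c'.
Proof.
by move=> cc H g L B L0 gL gB; apply: le_trans (H g L B L0 gL gB) _; rewrite ler_wpM2r.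
Qed.

Lemma PGap_ge0 t : 0 <= PGap t.
Proof. by apply: Rintegral_ge0 => s _; exact: Gap_ge0. Qed.

Lemma PGap_le s t : 0 <= s <= t -> PGap s <= PGap t.
Proof.
move=> st; rewrite -subr_ge0 PGap_increment//; apply: Rintegral_ge0 => tau _; exact: Gap_ge0.
Qed.

(** A discrete Gronwall argument over j steps. *)
Lemma lipdist_iter h j : 0 < h -> h <= 1 -> j%:R * h <= T - 4 * h ->
  lipdist_le (l (j%:R * h)) (lr (j%:R * h))
    ((1 + d%:R * M * h) ^+ j * step_cst * (j%:R * h ^+ 2 + PGap (j%:R * h))).
Proof.
move=> h0 h1; have q1 : 1 <= 1 + d%:R * M * h by rewrite lerDl !mulr_ge0// ltW.
elim: j => [_|j IH hj].
  rewrite mul0r; apply: lipdist_mono init.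
  by rewrite expr0 mul1r mul0r add0r mulr_ge0 ?step_cst_ge0 ?PGap_ge0.
have jh : j.+1%:R * h = j%:R * h + h by rewrite -natr1 mulrDl mul1r.
have jh0 : 0 <= j%:R * h by rewrite mulr_ge0// ltW.
have hj' : j%:R * h <= T - 4 * h by apply: le_trans hj; rewrite jh lerDl ltW.
have qj : 1 <= (1 + d%:R * M * h) ^+ j by exact: exprn_ege1.
have a0 : 0 <= (1 + d%:R * M * h) ^+ j * step_cst * (j%:R * h ^+ 2 + PGap (j%:R * h)).
  rewrite !mulr_ge0 ?step_cst_ge0 ?(le_trans ler01 qj)// addr_ge0 ?PGap_ge0// mulr_ge0//.
  by rewrite exprn_ge0// ltW.
have := lipdist_step jh0 h0 h1 _ a0 (IH hj'); rewrite -jh => /(_ hj); apply: lipdist_mono.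
have qS : 1 <= (1 + d%:R * M * h) ^+ j.+1 by exact: exprn_ege1.
have X0 : 0 <= step_cst * (h ^+ 2 + (PGap (j.+1%:R * h) - PGap (j%:R * h))).
  rewrite mulr_ge0 ?step_cst_ge0// addr_ge0 ?exprn_ge0 ?(ltW h0)// subr_ge0 PGap_le// jh0/= jh lerDl ltW//.
rewrite -subr_ge0 (_ : _ - _ = ((1 + d%:R * M * h) ^+ j.+1 - 1) *
   (step_cst * (h ^+ 2 + (PGap (j.+1%:R * h) - PGap (j%:R * h))))).
  by rewrite mulr_ge0// subr_ge0.
by rewrite -natr1 exprS; ring.
Qed.

(** N + 1 steps of length h = t / (N + 1): the growth factor is at most exp(d M t),
    and the sum t h of the quadratic errors tends to 0. *)
Lemma lipdist_gap t : 0 <= t < T -> lipdist_le (l t) (lr t) (expR (d%:R * M * T) * step_cst * PGap t).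
Proof.
move=> /andP[t0 tT]; have E0 := expR_ge0 (d%:R * M * T).
have [->|tn0] := eqVneq t 0.
  by apply: lipdist_mono init; rewrite !mulr_ge0 ?step_cst_ge0 ?PGap_ge0.
have {tn0}t0 : 0 < t by rewrite lt_neqAle eq_sym tn0.
move=> g L B L0 gL gB; apply/ler_addgt0Pr => e e0.
set E := expR _ in E0 *.
pose q := 1 + E * step_cst * t * L.
have q0 : 0 < q by rewrite ltr_pwDl// !mulr_ge0 ?step_cst_ge0// ltW.
have [|k kk /= /and4P[h1 h2 h3 _]] := @small_pos R [:: 1; (T - t) / 4; e / q].
  by rewrite /= ltr01 !divr_gt0// subr_gt0.
have [N N2] : exists N : nat, N.+1%:R^-1 < k / t.
  have := near_infty_natSinv_lt (PosNum (divr_gt0 kk t0)).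
  by move=> [N _ /(_ N (leqnn _))] /=; exists N.
pose h := t / N.+1%:R.
have h0 : 0 < h by rewrite divr_gt0.
have hk : h <= k by rewrite /h mulrC -ler_pdivlMr// ltW.
have tE : N.+1%:R * h = t by rewrite /h mulrC divfK// pnatr_eq0.
have := @lipdist_iter h N.+1 h0 (le_trans hk h1); rewrite tE => /(_ _ g L B L0 gL gB).
move=> H; apply: le_trans (H _) _; first by move: hk h2; lra.
have qE : (1 + d%:R * M * h) ^+ N.+1 <= E.
  apply: (@le_trans _ _ (expR (d%:R * M * h) ^+ N.+1)).
    rewrite lerXn2r ?nnegrE ?expR_ge0 ?expR_ge1Dx// addr_ge0// !mulr_ge0// ltW//.
  by rewrite -expRM_natl mulrCA tE ler_expR ler_wpM2l ?mulr_ge0// ltW.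
have Q0 : 0 <= (1 + d%:R * M * h) ^+ N.+1 by rewrite exprn_ge0// addr_ge0// !mulr_ge0// ltW.
have th : N.+1%:R * h ^+ 2 = t * h by rewrite expr2 mulrA tE.
rewrite th.
have P0 := PGap_ge0 t.
apply: (@le_trans _ _ (E * step_cst * (t * h + PGap t) * L)).
  by rewrite ler_wpM2r// ler_wpM2r ?ler_wpM2r ?step_cst_ge0// addr_ge0// mulr_ge0// ltW.
rewrite mulrDr mulrDl addrC lerD2l.
have hq : h * q <= e by rewrite -ler_pdivlMr// (le_trans hk).
by move: hq; rewrite /q mulrDr mulr1; lra.
Qed.

End distance.

(** * Integrals against positive matrix-valued measures *)

Lemma polar_bound (R : realFieldType) (x y s tr : R) : 0 <= x + y + 2 * 1 * s ->
  0 <= x + y + 2 * -1 * s -> 0 <= x -> 0 <= y -> x + y <= tr -> `|s| <= tr.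
Proof. by rewrite ler_norml => *; apply/andP; split; lra. Qed.

Section charge_integrals.
Context {R : realType} {d : nat}.
Local Notation V := 'rV[R]_d.

Definition bounded_measurable (f : V -> R) : Prop :=
  measurable_fun setT f /\ exists c, forall x, `|f x| <= c.

Lemma bounded_measurableM f g : bounded_measurable f -> bounded_measurable g ->
  bounded_measurable (fun x => f x * g x).
Proof.
move=> [mf [c fc]] [mg [c' gc]]; split; first exact: measurable_funM.
by exists (c * c') => x; rewrite normrM; apply: ler_pM.
Qed.

Lemma bounded_measurable_cst c : bounded_measurable (fun=> c).
Proof. by split; [exact: measurable_cst|exists `|c|]. Qed.

Lemma bounded_measurable_integrable (m : {finite_measure set V -> \bar R}) f :
  bounded_measurable f -> m.-integrable setT (EFin \o f).
Proof.
move=> [mf [c fc]]; apply: (@bounded_integrable _ _ _ _ _ _ _ c) => //.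
exact: fin_num_fun_lty.
Qed.

Section one_charge.
Variable nu : {charge set V -> \bar R}.
Local Notation P := (jordan_pos (hahnP nu)).
Local Notation N := (jordan_neg (hahnP nu)).

Lemma charge_integralD f g : bounded_measurable f -> bounded_measurable g ->
  charge_integral nu (fun x => f x + g x) = charge_integral nu f + charge_integral nu g.
Proof.
move=> bf bg; rewrite /charge_integral !RintegralD//; try exact: bounded_measurable_integrable.
ring.
Qed.

Lemma charge_integralZ k f : bounded_measurable f ->
  charge_integral nu (fun x => k * f x) = k * charge_integral nu f.
Proof.
move=> bf; rewrite /charge_integral !RintegralZl//; try exact: bounded_measurable_integrable.
ring.
Qed.

Lemma charge_integral_setT : (charge_integral nu (fun=> 1))%:E = nu setT.
Proof.
rewrite (jordan_decomp (hahnP nu) measurableT)/= /cadd/= /cscale/= /charge_integral.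
rewrite !Rintegral_cst// !mul1r EFinB !fineK ?mulN1e//; exact: fin_num_measure.
Qed.

(** Dominated convergence for both parts of the Jordan decomposition: conditions on
    tests of compact support extend to bounded tests. *)
Lemma charge_integral_cut f : bounded_measurable f ->
  charge_integral nu (fun x => cut N0 x * f x) @[N0 --> \oo] --> charge_integral nu f.
Proof.
move=> [mf [c fc]].
have mc N0 : measurable_fun setT (@cut R d N0) := smooth_measurable 0 (smooth_cut N0).
have key (m : {finite_measure set V -> \bar R}) :
    \int[m]_x (cut N0 x * f x) @[N0 --> \oo] --> \int[m]_x f x.
  apply: (@Rintegral_bounded_cvg _ _ _ m _ measurableT (fun N0 x => cut N0 x * f x) f c).
  - exact: fin_num_fun_lty.
  - by move=> N0; exact: measurable_funM.
  - exact: mf.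
  - move=> x _; rewrite -[X in _ --> X](mul1r (f x)); apply: cvgM; last exact: cvg_cst.
    exact: cvg_cut.
  - move=> N0 x _; rewrite normrM -[leRHS]mul1r; apply: ler_pM => //; exact: cut_le.
by apply: cvgB; exact: key.
Qed.

End one_charge.

(** The Hahn decompositions of the two charges may differ, so the comparison goes
    through the measures P1 + N2 and P2 + N1, which coincide. *)
Lemma charge_integral_eq (nu1 nu2 : {charge set V -> \bar R}) f :
  (forall A, measurable A -> nu1 A = nu2 A) -> bounded_measurable f -> (forall x, 0 <= f x) ->
  charge_integral nu1 f = charge_integral nu2 f.
Proof.
move=> nu12 bf f0; have [mf _] := bf.
have I (m : {finite_measure set V -> \bar R}) : (\int[m]_x (f x)%:E)%E = (\int[m]_x f x)%:E.
  rewrite /Rintegral fineK//; apply: integrable_fin_num => //; exact: bounded_measurable_integrable.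
set P1 := jordan_pos (hahnP nu1); set N1 := jordan_neg (hahnP nu1).
set P2 := jordan_pos (hahnP nu2); set N2 := jordan_neg (hahnP nu2).
have E A : measurable A -> (P1 A + N2 A = P2 A + N1 A)%E.
  move=> mA; have := nu12 A mA.
  rewrite (jordan_decomp (hahnP nu1) mA) (jordan_decomp (hahnP nu2) mA)/= /cadd/= /cscale/= !mulN1e.
  rewrite -/P1 -/N1 -/P2 -/N2.
  have f1 : P1 A \is a fin_num by exact: fin_num_measure.
  have f2 : P2 A \is a fin_num by exact: fin_num_measure.
  have f3 : N1 A \is a fin_num by exact: fin_num_measure.
  have f4 : N2 A \is a fin_num by exact: fin_num_measure.
  rewrite -(fineK f1) -(fineK f2) -(fineK f3) -(fineK f4) -!EFinB -!EFinD => -[H].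
  by congr EFin; lra.
have : (\int[measure_add P1 N2]_x (f x)%:E = \int[measure_add P2 N1]_x (f x)%:E)%E.
  by apply: eq_measure_integral => A mA _; apply: (etrans (measure_addE _ _ _)); rewrite E//; exact/esym/measure_addE.
have mE : measurable_fun setT (EFin \o f) by exact/measurable_EFinP.
rewrite !ge0_integral_measure_add//; try by move=> x _; rewrite lee_fin.
rewrite !I -!EFinD => -[]; rewrite /charge_integral -/P1 -/N1 -/P2 -/N2; lra.
Qed.

Variable m : @mx_charge R d.
Hypothesis mpos : mx_pos_sym m.
Local Notation I i j f := (charge_integral (m i j) f).

Lemma Cc_bounded_measurable (f : V -> R) : Cc f -> bounded_measurable f.
Proof.
move=> [cf kf]; split; first exact: measurable_continuous_rV.
set S := closure _ in kf.
have : compact (f @` S) by apply: continuous_compact => //; exact: continuous_subspaceT.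
move=> /compact_bounded[c [_ Hc]]; exists (`|c| + 1) => x.
have [->|fx] := eqVneq (f x) 0; first by rewrite normr0 addr_ge0.
apply: Hc; first by rewrite (le_lt_trans (ler_norm c))// ltrDl.
by exists x => //; apply: subset_closure.
Qed.

Lemma quad_form_ge0 (xi : V) f : Cc f -> (forall x, 0 <= f x) ->
  0 <= \sum_i \sum_j xi 0 i * xi 0 j * I i j f.
Proof.
move=> cf f0; have [_ /(_ xi f cf f0)] := mpos; rewrite /mx_integral.
congr (0 <= _); apply: eq_bigr => i _; apply: eq_bigr => j _.
rewrite -charge_integralZ; last exact: Cc_bounded_measurable.
congr charge_integral; apply/funext => x; rewrite mxE mulrC; congr (_ * _).
by rewrite /tensor mxE big_ord1 mxE.
Qed.

Lemma diag_ge0 i f : Cc f -> (forall x, 0 <= f x) -> 0 <= I i i f.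
Proof.
move=> cf f0; have := quad_form_ge0 (delta_mx 0 i) cf f0.
rewrite (bigD1 i)//= (bigD1 i)//= !mxE !eqxx/= !mul1r big1 ?addr0; last first.
  by move=> j /negbTE ji; rewrite mul1r mxE eqxx ji/= mul0r.
rewrite big1 ?addr0// => k /negbTE ki; rewrite big1// => j _.
by rewrite mxE eqxx ki/= !mul0r.
Qed.

Definition Itr f : R := \sum_k I k k f.

(** Polarization: positivity along e_i + e_j and e_i - e_j bounds the off-diagonal
    term by the diagonal ones. *)
Lemma offdiag_le i j f : Cc f -> (forall x, 0 <= f x) -> `|I i j f| <= Itr f.
Proof.
move=> cf f0.
have [<-|ij] := eqVneq i j.
  rewrite ger0_norm ?diag_ge0// /Itr (bigD1 i)//= lerDl sumr_ge0// => k _; exact: diag_ge0.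
have sym : I j i f = I i j f.
  apply: charge_integral_eq => //; last exact: Cc_bounded_measurable.
  by move=> A mA; rewrite mpos.1.
(* positivity of the quadratic form at e_i + s e_j, for s = 1 or s = -1 *)
have dec (s : R) : s ^+ 2 = 1 -> 0 <= I i i f + I j j f + 2 * s * I i j f.
  move=> s2; have := quad_form_ge0 (delta_mx 0 i + s *: delta_mx 0 j) cf f0.
  have E k : (delta_mx 0 i + s *: delta_mx 0 j : V) 0 k = (k == i)%:R + s * (k == j)%:R.
    by rewrite !mxE eqxx.
  have S (F : 'I_d -> R) : \sum_k (delta_mx 0 i + s *: delta_mx 0 j : V) 0 k * F k = F i + s * F j.
    under eq_bigr do rewrite E mulrDl.
    rewrite big_split/=; congr (_ + _).
      rewrite (bigD1 i)//= eqxx mul1r big1 ?addr0// => k /negbTE ->; exact: mul0r.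
    rewrite (bigD1 j)//= eqxx mulr1 big1 ?addr0// => k /negbTE ->; by rewrite mulr0 mul0r.
  under eq_bigr do under eq_bigr do rewrite -mulrA.
  under eq_bigr do rewrite -mulr_sumr S.
  by rewrite S sym => H; have : s * (s * I j j f) = I j j f; [rewrite mulrA -expr2 s2 mul1r|lra].
have h1 := dec 1 (expr1n _ _); have h2 := dec (-1) (sqrr_sign _ 1).
have : I i i f + I j j f <= Itr f.
  rewrite /Itr (bigD1 i)//= (bigD1 j)//=; last by rewrite eq_sym.
  rewrite addrA lerDl sumr_ge0// => k _; exact: diag_ge0.
by apply: polar_bound h1 h2 _ _; exact: diag_ge0.
Qed.

Lemma Cc_abs (f : V -> R) : Cc f -> Cc (fun x => `|f x|).
Proof.
move=> [cf kf]; split.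
  by move=> x; apply: (@continuous_comp _ _ _ f (fun y => `|y|)); [exact: cf|exact: norm_continuous].
by move: kf; congr (compact (closure _)); apply/funext => x /=; rewrite normr_eq0.
Qed.

Lemma Cc_sum_abs (f : V -> R) : Cc f -> Cc (fun x => `|f x| + f x).
Proof.
move=> cf; have [ca ka] := Cc_abs cf; split.
  by have [c _] := cf; move=> x; exact: (continuousD (ca x) (c x)).
apply: (@subclosed_compact _ _ (closure [set x | `|f x| != 0])) => //.
  exact: closed_closure.
apply: closure_subset => x /=; apply: contra => /eqP fx.
by move: fx => /eqP; rewrite normr_eq0 => /eqP ->; rewrite normr0 addr0.
Qed.

(** A signed f is written (|f| + f) - |f|, a difference of nonnegative functions. *)
Lemma offdiag_abs_le i j f : Cc f -> `|I i j f| <= 3 * Itr (fun x => `|f x|).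
Proof.
move=> cf; have ca := Cc_abs cf; have cs := Cc_sum_abs cf.
have bf := Cc_bounded_measurable cf; have ba := Cc_bounded_measurable ca.
have D i' j' : I i' j' (fun x => `|f x| + f x) = I i' j' (fun x => `|f x|) + I i' j' f.
  exact: charge_integralD.
have s0 x : 0 <= `|f x| + f x by have := ler_norm (- f x); rewrite normrN; lra.
have h1 := offdiag_le i j ca (fun x => normr_ge0 _).
have h2 := offdiag_le i j cs s0.
have h3 : Itr (fun x => `|f x| + f x) <= 2 * Itr (fun x => `|f x|).
  rewrite /Itr mulr_sumr; apply: ler_sum => k _; rewrite D.
  have ce : Cc (fun x => `|f x| + - f x).
    have cN : Cc (fun x => - f x).
      case: cf => c k0; split; first by move=> x; exact: (continuousN (c x)).
      by move: k0; congr (compact (closure _)); apply/funext => x /=; rewrite oppr_eq0.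
    have := Cc_sum_abs cN; rewrite (_ : (fun x => `|- f x| + - f x) = (fun x => `|f x| + - f x))//.
    by apply/funext => x; rewrite normrN.
  have : 0 <= I k k (fun x => `|f x| + - f x).
    by apply: diag_ge0 => // x; have := ler_norm (f x); lra.
  rewrite charge_integralD//; last first.
    case: bf => mf [c fc]; split; first exact: measurableT_comp.
    by exists c => x; rewrite normrN.
  have -> : I k k (fun x => - f x) = - I k k f.
    rewrite -mulN1r -charge_integralZ//; congr charge_integral.
    by apply/funext => x; rewrite mulN1r.
  lra.
have -> : I i j f = I i j (fun x => `|f x| + f x) - I i j (fun x => `|f x|) by rewrite D; ring.
apply: le_trans (ler_normB _ _) _; lra.
Qed.

Lemma Cc_cut N (f : V -> R) : continuous f -> Cc (fun x => cut N x * f x).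
Proof.
move=> cf; have cc : continuous (@cut R d N).
  by apply: continuous_prodf => i; exact: nice_continuous (nice_cut1 N).
split; first by move=> x; exact: (continuousM (cc x) (cf x)).
have [_ k] : Cc (@cut R d N) by apply: (@Cc_prodf _ _ N.+1%:R) => // i; exact: nice_cut1.
apply: subclosed_compact k _; first exact: closed_closure.
by apply: closure_subset => x /=; apply: contra => /eqP ->; rewrite mul0r.
Qed.

Definition trR : R := fine (mx_trace m).

Lemma trRE : Itr (fun=> 1) = trR.
Proof.
rewrite /trR /mx_trace; apply: EFin_inj; rewrite fineK; last first.
  by apply/sum_fin_numP => k _ _; exact: fin_num_measure.
by rewrite /Itr -sumEFin; apply: eq_bigr => k _; exact: charge_integral_setT.
Qed.

(** For tests of compact support this is [offdiag_abs_le] with |f| <= c; the cutoffs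
    carry it to bounded continuous functions. *)
Lemma charge_integral_bound i j (f : V -> R) c : continuous f -> (forall x, `|f x| <= c) ->
  `|I i j f| <= 3 * c * trR.
Proof.
move=> cf fc; have c0 : 0 <= c := le_trans (normr_ge0 _) (fc 0).
have bf : bounded_measurable f by split; [exact: measurable_continuous_rV|exists c].
have cut0 N x : 0 <= @cut R d N x.
  by apply: prodf_ge0 => k s; rewrite cut1E exprn_ge0// le_max lexx.
have Nbound N : `|I i j (fun x => cut N x * f x)| <= 3 * c * Itr (fun x => cut N x * 1).
  apply: le_trans (offdiag_abs_le i j (Cc_cut N cf)) _; rewrite -mulrA ler_wpM2l//.
  rewrite /Itr mulr_sumr; apply: ler_sum => k _.
  have cN1 := Cc_cut N (@cst_continuous V R 1).
  have bN1 := Cc_bounded_measurable cN1.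
  have ca := Cc_abs (Cc_cut N cf).
  have bca := Cc_bounded_measurable ca.
  rewrite -charge_integralZ// -subr_ge0.
  have E : I k k (fun x => c * (cut N x * 1)) - I k k (fun x => `|cut N x * f x|) =
      I k k (fun x => cut N x * (c - `|f x|)).
    have bc1 : bounded_measurable (fun x => c * (cut N x * 1)).
      exact: (bounded_measurableM (bounded_measurable_cst c)).
    have -> : (fun x => cut N x * (c - `|f x|)) = (fun x => c * (cut N x * 1) + -1 * `|cut N x * f x|).
      by apply/funext => x; rewrite normrM (ger0_norm (cut0 N x)); ring.
    rewrite charge_integralD//; last exact: (bounded_measurableM (bounded_measurable_cst (-1))).
    by rewrite (charge_integralZ (m k k) (-1))// mulN1r.
  rewrite E; apply: diag_ge0 => [|x]; last by rewrite mulr_ge0// subr_ge0.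
  apply: Cc_cut => x; apply: (continuousB (@cst_continuous _ _ c x)).
  by apply: (@continuous_comp _ _ _ f (fun y => `|y|)); [exact: cf|exact: norm_continuous].
have l1 : `|I i j (fun x => cut N x * f x)| @[N --> \oo] --> `|I i j f|.
  by apply: cvg_norm; exact: charge_integral_cut.
have l2 : 3 * c * Itr (fun x => cut N x * 1) @[N --> \oo] --> 3 * c * Itr (fun=> 1).
  apply: cvgM; first exact: cvg_cst.
  apply: cvg_sumr => k; apply: charge_integral_cut; exact: bounded_measurable_cst.
rewrite -trRE; apply: (ler_cvg_to l1 l2); exact: nearW.
Qed.

Lemma mx_integral_bound (F : V -> 'M[R]_d) c : (forall i j, continuous (fun x => F x i j)) ->
  (forall x i j, `|F x i j| <= c) -> `|mx_integral m F| <= d%:R * (d%:R * (3 * c * trR)).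
Proof.
move=> cF Fc; apply: norm_sum_le => i; apply: norm_sum_le => j.
by apply: charge_integral_bound => // x; exact: Fc.
Qed.

Lemma trR_ge0 : 0 <= trR.
Proof.
rewrite -trRE /Itr; apply: sumr_ge0 => k _.
have l : I k k (fun x => cut N x * 1) @[N --> \oo] --> I k k (fun=> 1).
  apply: charge_integral_cut; exact: bounded_measurable_cst.
apply: (cvgr_to_ge l); apply: nearW => N; apply: diag_ge0 => [|x].
  exact/Cc_cut/cst_continuous.
by rewrite mulr1; apply: prodf_ge0 => i s; rewrite cut1E exprn_ge0// le_max lexx.
Qed.

Lemma mx_trace_fin : mx_trace m = trR%:E.
Proof.
rewrite /trR fineK//; apply/sum_fin_numP => k _ _; exact: fin_num_measure.
Qed.

(** All entries are dominated by the trace, so the two parts of the Jordan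
    decomposition of each entry have the same integrals against smooth functions, and
    agree. *)
Lemma trace0_null : trR = 0 -> forall i j A, measurable A -> m i j A = 0%E.
Proof.
move=> tr0 i j A mA.
rewrite (jordan_decomp (hahnP (m i j)) mA)/= /cadd/= /cscale/= mulN1e.
rewrite (@box_measure_unique _ _ (jordan_pos (hahnP (m i j))) (jordan_neg (hahnP (m i j))))//.
- by rewrite subee//; exact: fin_num_measure.
- exact: fin_num_fun_lty.
- exact: fin_num_fun_lty.
move=> f [[df _] cf _ _ f01].
have [cf1 _] := cf.
have := @charge_integral_bound i j f 1 cf1; rewrite tr0 mulr0 normr_le0 => H.
have : I i j f == 0.
  by apply: H => x; have /andP[h1 h2] := f01 x; rewrite ger0_norm.
by rewrite /charge_integral subr_eq0 => /eqP.
Qed.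

End charge_integrals.

(** * Domination of arbitrary integrands *)

Section nonmeasurable_integrands.
Context {R : realType} d (X : measurableType d) (m : {measure set X -> \bar R}).
Variable D : set X.
Hypothesis mD : measurable D.

(** The minorant is set to 0 on a null measurable set, after which monotonicity
    applies. *)
Lemma ae_ge_integral_nonmeas (f g : X -> \bar R) :
  (forall x, (0 <= f x)%E) -> (forall x, (0 <= g x)%E) -> measurable_fun D g ->
  {ae m, forall x, D x -> (g x <= f x)%E} ->
  (\int[m]_(x in D) g x <= \int[m]_(x in D) f x)%E.
Proof.
move=> f0 g0 mg [N [mN N0 fgN]].
pose h x := (g x * (\1_(~` N) x)%:E)%E.
have mh : measurable_fun D h.
  apply: emeasurable_funM => //; apply/measurable_EFinP.
  by apply: measurable_indic; exact: measurableC.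
have h0 x : (0 <= h x)%E by rewrite mule_ge0.
have -> : (\int[m]_(x in D) g x = \int[m]_(x in D) h x)%E.
  apply: ge0_ae_eq_integral => //.
  exists N; split => // x; apply: contra_notP => Nx Dx.
  by rewrite /h indicE mem_set// mule1.
have hf x : D x -> (h x <= f x)%E.
  move=> Dx; rewrite /h indicE; have [Nx|Nx] := pselect (N x).
    by rewrite memNset ?mule0//; exact.
  rewrite mem_set// mule1; apply: contrapT => fg; apply: Nx; apply: fgN => /(_ Dx).
  exact.
rewrite !ge0_integralE//; apply: le_ereal_sup => _ [k /= kf <-].
exists k => // x; apply: le_trans (kf x) _; rewrite /patch; case: ifP => //.
by rewrite inE => Dx; exact: hf.
Qed.

Lemma ae_eq_integral_nonmeas (f g : X -> \bar R) : measurable_fun D g ->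
  {ae m, forall x, D x -> f x = g x} ->
  (\int[m]_(x in D) f x = \int[m]_(x in D) g x)%E.
Proof.
move=> mg fg; rewrite integralE [RHS]integralE.
congr (_ - _)%E; apply/eqP; rewrite eq_le; apply/andP; split.
- apply: ae_le_integral_nonmeas => //; first exact: measurable_funepos.
  by apply: ae_mono fg => x H Dx; rewrite !funeposE H.
- apply: ae_ge_integral_nonmeas => //; first exact: measurable_funepos.
  by apply: ae_mono fg => x H Dx; rewrite !funeposE H.
- apply: ae_le_integral_nonmeas => //; first exact: measurable_funeneg.
  by apply: ae_mono fg => x H Dx; rewrite !funenegE H.
- apply: ae_ge_integral_nonmeas => //; first exact: measurable_funeneg.
  by apply: ae_mono fg => x H Dx; rewrite !funenegE H.
Qed.

Lemma ae_eq_Rintegral_nonmeas (f g : X -> R) : measurable_fun D g ->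
  {ae m, forall x, D x -> f x = g x} ->
  \int[m]_(x in D) f x = \int[m]_(x in D) g x.
Proof.
move=> mg fg; congr fine; apply: ae_eq_integral_nonmeas; first exact/measurable_EFinP.
by apply: ae_mono fg => x H Dx; rewrite /= H.
Qed.

(** Positive and negative parts of f are estimated separately by monotonicity. This
    bounds the time integrals of \int grad f_s : d mu_s, where both the field and the
    measure depend on time. *)
Lemma ae_normr_Rintegral_nonmeas (f g : X -> R) : m.-integrable D (EFin \o g) ->
  (forall x, 0 <= g x) -> {ae m, forall x, D x -> `|f x| <= g x} ->
  `|\int[m]_(x in D) f x| <= \int[m]_(x in D) g x.
Proof.
move=> ig g0 fg; have [/measurable_EFinP mg _] := integrableP _ _ _ ig.
have fin : (\int[m]_(x in D) (g x)%:E)%E \is a fin_num by exact: integrable_fin_num.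
have P : (\int[m]_(x in D) (EFin \o f)^\+ x <= \int[m]_(x in D) (g x)%:E)%E.
  apply: ae_le_integral_nonmeas => //; first exact/measurable_EFinP.
  apply: ae_mono fg => x H Dx; rewrite funeposE/= -EFin_max lee_fin ge_max g0 andbT.
  exact: le_trans (ler_norm _) (H Dx).
have N : (\int[m]_(x in D) (EFin \o f)^\- x <= \int[m]_(x in D) (g x)%:E)%E.
  apply: ae_le_integral_nonmeas => //; first exact/measurable_EFinP.
  apply: ae_mono fg => x H Dx; rewrite funenegE/= -EFin_max lee_fin ge_max g0 andbT.
  by apply: le_trans (H Dx); rewrite -normrN ler_norm.
have P0 : (0 <= \int[m]_(x in D) (EFin \o f)^\+ x)%E by exact: integral_ge0.
have N0 : (0 <= \int[m]_(x in D) (EFin \o f)^\- x)%E by exact: integral_ge0.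
have fE : \int[m]_(x in D) f x = fine (\int[m]_(x in D) (EFin \o f)^\+ x - \int[m]_(x in D) (EFin \o f)^\- x)%E.
  by rewrite /Rintegral integralE.
rewrite fE /Rintegral; move: P N P0 N0 fin.
set p := (\int[m]_(x in D) _ ^\+ x)%E; set n := (\int[m]_(x in D) _ ^\- x)%E.
case: (\int[m]_(x in D) (g x)%:E)%E => // G; case: p => // p; case: n => // n.
rewrite !lee_fin => pG nG p0 n0 _ /=; rewrite ler_norml; apply/andP; split; lra.
Qed.

End nonmeasurable_integrands.

Lemma rV_is_derive {R : realType} (U : normedModType R) n (F : U -> 'rV[R]_n) (f : 'I_n -> U -> R)
  (df : 'I_n -> R) t v : (forall k, is_derive t v (f k) (df k)) ->
  (forall x, F x = \row_k f k x) -> is_derive t v F (\row_k df k).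
Proof.
move=> D FE; have E i j : (fun x => F x i j) = f j.
  by apply/funext => x; rewrite FE mxE.
have DF : derivable F t v.
  by apply/derivable_mxP => i j; rewrite E; have [] := D j.
split => //; rewrite derive_mx//; apply/rowP => j; rewrite !mxE E.
by have [_ ->] := D j.
Qed.

(** * Integrals over pairs of particles *)

Section double_integrals.
Context {R : realType} {d : nat}.
Local Notation V := 'rV[R]_d.
Variables (p : probability V R) (q : V -> V) (c : R).
Hypothesis mq : measurable_fun setT q.
Hypothesis c0 : 0 <= c.
Hypothesis qc : (\int[p]_x (normv (q x) ^+ 2)%:E <= c%:E)%E.
Variables (k : V * V -> R) (a : R).
Hypothesis mk : measurable_fun setT k.
Hypothesis a0 : 0 <= a.
Local Notation N x := (1 + normv (q x) ^+ 2).
Hypothesis ka : forall z, `|k z| <= a * (N z.1 * N z.2).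

Let N_ge0 x : 0 <= N x. Proof. by rewrite addr_ge0// sqr_ge0. Qed.

Lemma pair_integrable1 x : p.-integrable setT (fun y => (k (x, y))%:E) /\
  `|\int[p]_y k (x, y)| <= a * (1 + c) * N x.
Proof.
have mf : measurable_fun setT (fun y => k (x, y)) by exact: (measurableT_comp (g := pair x) mk).
have [|i l] := sq_dominated mq qc mf (mulr_ge0 a0 (N_ge0 x)).
  by move=> y; rewrite -mulrA; exact: ka (x, y).
by split => //; rewrite mulrAC.
Qed.

Lemma pair_integrable : (p \x p)%E.-integrable setT (EFin \o k).
Proof.
apply/(integrable12ltyP p p); first exact/measurable_EFinP.
have iN : p.-integrable setT (EFin \o (fun x => a * (1 + c) * N x)).
  apply: integrableZr => //; apply: integrableDr => //; first exact: finite_measure_integrable_cst.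
  exact: (sq_integrable mq qc).1.
apply: (@le_lt_trans _ _ (\int[p]_x (a * (1 + c) * N x)%:E)%E); last first.
  by rewrite ltey_eq; apply/orP; left; apply: integrable_fin_num.
apply: ge0_le_integral => //.
- by move=> x _; exact: integral_ge0.
- apply: (@measurable_int_kernel _ _ _ _ (fun _ : V => p) _ (fun z => `|(EFin \o k) z|%E)) => //.
  by apply: measurableT_comp => //; exact/measurable_EFinP.
- by have [/measurable_EFinP /measurable_EFinP] := integrableP _ _ _ iN.
- move=> x _; have mf : measurable_fun setT (fun y => `|k (x, y)|).
    by apply: measurableT_comp => //; exact: (measurableT_comp (g := pair x) mk).
  have [|i l] := sq_dominated mq qc mf (mulr_ge0 a0 (N_ge0 x)).
    by move=> y; rewrite normr_id -mulrA; exact: ka (x, y).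
  rewrite -[leLHS]fineK; last exact: integrable_fin_num.
  rewrite lee_fin mulrAC; apply: le_trans l; exact: ler_norm.
Qed.

Lemma pair_iterated : \int[(p \x p)%E]_z k z = \int[p]_x \int[p]_y k (x, y).
Proof. by apply: Rint_Fubini; [exact: pair_integrable|move=> x; exact: (pair_integrable1 x).1]. Qed.

Lemma pair_swap : \int[(p \x p)%E]_z k z = \int[(p \x p)%E]_z k (z.2, z.1).
Proof.
rewrite [RHS](@Rint_Fubini2 _ _ _ _ _ p p (fun z => k (z.2, z.1))).
- exact: pair_iterated.
- apply/(integrable21ltyP p p (f := fun z => (k (z.2, z.1))%:E)).
    by apply/measurable_EFinP; apply: measurableT_comp => //; exact: measurable_fun_pair.
  by apply/(integrable12ltyP p p (f := EFin \o k)); [exact/measurable_EFinP|exact: pair_integrable].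
- by move=> x; exact: (pair_integrable1 x).1.
Qed.

Lemma pair_bound : `|\int[(p \x p)%E]_z k z| <= a * (1 + c) * (1 + c).
Proof.
rewrite pair_iterated.
have mf : measurable_fun setT (fun x => \int[p]_y k (x, y)).
  by apply: (@measurable_Rint_kernel _ _ _ _ (fun _ : V => p) _ k) => //.
have [|//] := sq_dominated mq qc mf (mulr_ge0 a0 (addr_ge0 ler01 c0)).
by move=> x; exact: (pair_integrable1 x).2.
Qed.

End double_integrals.

Section growth.
Context {R : realType} {d : nat}.
Local Notation V := 'rV[R]_d.
Local Notation leb := (@lebesgue_measure R).
Variable T : R.
Hypothesis T0 : 0 < T.
Variable rho : R -> probability V R.
Hypothesis rho_flat : flat_continuous T rho.
Local Notation l := (fun t => rho (clamp T t)).
Variables (w : R -> V -> V) (Mu : R).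
Hypothesis mw : measurable_fun setT (fun z : R * V => w z.1 z.2).
Hypothesis Mu0 : 0 <= Mu.
Hypothesis wMu : forall t, (\int[l t]_x (normv (w t x) ^+ 2)%:E <= Mu%:E)%E.
Variable t : R.

Definition weight s x y : R := 2 + normv (w s x) + normv (w s y).

(** Kernels on pairs of particles, of polynomial growth m in the velocities. The class
    is stable under sums and products, and its members are integrable for m at most 2;
    this discharges all the integrability questions of the relative energy. *)
Definition growth (m : nat) (k : R -> V -> V -> R) : Prop :=
  measurable_fun setT (fun z : R * (V * V) => k z.1 z.2.1 z.2.2) /\
  exists2 a : R, 0 <= a & forall (s : R) x y, 0 <= s <= t -> `|k s x y| <= a * weight s x y ^+ m.

Lemma weight_ge1 s x y : 1 <= weight s x y.
Proof.
have h : 0 <= normv (w s x) := sqrtr_ge0 _; have h' : 0 <= normv (w s y) := sqrtr_ge0 _.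
by rewrite /weight; lra.
Qed.

Lemma growthD m k k' : growth m k -> growth m k' -> growth m (fun s x y => k s x y + k' s x y).
Proof.
move=> [mk [a a0 ka]] [mk' [a' a'0 ka']]; split; first exact: measurable_funD.
exists (a + a'); first exact: addr_ge0.
by move=> s x y st; apply: le_trans (ler_normD _ _) _; rewrite mulrDl lerD ?ka ?ka'.
Qed.

Lemma growthM m m' k k' : growth m k -> growth m' k' ->
  growth (m + m') (fun s x y => k s x y * k' s x y).
Proof.
move=> [mk [a a0 ka]] [mk' [a' a'0 ka']]; split; first exact: measurable_funM.
exists (a * a'); first exact: mulr_ge0.
by move=> s x y st; rewrite normrM exprD mulrACA ler_pM ?ka ?ka'.
Qed.

Lemma growthS m m' k : (m <= m')%N -> growth m k -> growth m' k.
Proof.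
move=> mm [mk [a a0 ka]]; split => //; exists a => // s x y st.
apply: le_trans (ka _ _ _ st) _; rewrite ler_wpM2l//; apply: ler_weXn2l => //; exact: weight_ge1.
Qed.

Lemma growth_bounded (k : R -> V -> V -> R) (a : R) : measurable_fun setT (fun z : R * (V * V) => k z.1 z.2.1 z.2.2) ->
  (forall (s : R) x y, 0 <= s <= t -> `|k s x y| <= a) -> growth 0 k.
Proof.
move=> mk ka; split => //; exists `|a| => // s x y st; rewrite expr0 mulr1.
exact: le_trans (ka _ _ _ st) (ler_norm _).
Qed.

Lemma growth_cst (a : R) : growth 0 (fun _ _ _ => a).
Proof. by apply: (@growth_bounded _ `|a|) => //; exact: measurable_cst. Qed.

Lemma growthN m k : growth m k -> growth m (fun s x y => - k s x y).
Proof.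
move=> [mk [a a0 ka]]; split; first exact: measurableT_comp.
by exists a => // s x y st; rewrite normrN ka.
Qed.

Lemma growthB m k k' : growth m k -> growth m k' -> growth m (fun s x y => k s x y - k' s x y).
Proof. by move=> gk /growthN; exact: growthD. Qed.

Lemma growth_sum m (I : Type) (r : seq I) (k : I -> R -> V -> V -> R) : (forall i, growth m (k i)) ->
  growth m (fun s x y => \sum_(i <- r) k i s x y).
Proof.
move=> gk; elim: r => [|i r IH].
  rewrite (_ : (fun s x y => _) = fun _ _ _ => 0); first exact: growthS (growth_cst 0).
  by do 3!apply/funext=> ?; rewrite big_nil.
rewrite (_ : (fun s x y => _) = fun s x y => k i s x y + \sum_(i <- r) k i s x y); first exact: growthD.
by do 3!apply/funext=> ?; rewrite big_cons.
Qed.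

Lemma growth_norm m k : growth m k -> growth m (fun s x y => `|k s x y|).
Proof.
move=> [mk [a a0 ka]]; split; first exact: measurableT_comp.
by exists a => // s x y st; rewrite normr_id ka.
Qed.

Lemma growth_swap m k : growth m k -> growth m (fun s x y => k s y x).
Proof.
move=> [mk [a a0 ka]]; split.
  apply: (measurableT_comp (g := fun z : R * (V * V) => (z.1, (z.2.2, z.2.1))) mk).
  do 2!(apply: measurable_fun_pair => //); exact: measurableT_comp.
exists a => // s x y st; apply: le_trans (ka _ _ _ st) _.
by rewrite /weight addrAC.
Qed.

Lemma growth_velocity i : growth 1 (fun s x _ => w s x 0 i).
Proof.
split.
  apply: (measurableT_comp (g := fun z : R * (V * V) => (z.1, z.2.1)) (f := fun z : R * V => w z.1 z.2 0 i)).
    exact: measurable_rV_coord mw.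
  apply: measurable_fun_pair => //; exact: measurableT_comp.
exists 1 => // s x y st; rewrite mul1r expr1; apply: le_trans (normv_coord _ _) _.
by have h' : 0 <= normv (w s y) := sqrtr_ge0 _; rewrite /weight; lra.
Qed.

Lemma growth_field (f : R -> V -> R) (a : R) : measurable_fun setT (fun z : R * V => f z.1 z.2) ->
  (forall s x, 0 <= s <= t -> `|f s x| <= a) -> growth 0 (fun s x _ => f s x).
Proof.
move=> mf fa; apply: growth_bounded => [|s x y]; last exact: fa.
apply: (measurableT_comp (g := fun z : R * (V * V) => (z.1, z.2.1)) (f := fun z : R * V => f z.1 z.2)) => //.
apply: measurable_fun_pair => //; exact: measurableT_comp.
Qed.

(** A product of moments of order two of the two particles, which is integrable for
    the product measure. *)
Lemma weight_sq s x y :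
  weight s x y ^+ 2 <= 12 * ((1 + normv (w s x) ^+ 2) * (1 + normv (w s y) ^+ 2)).
Proof.
rewrite /weight; set a := normv _; set c := normv _.
have h1 : 0 <= (a - c) ^+ 2 := sqr_ge0 _.
have h2 : 0 <= (2 - a) ^+ 2 := sqr_ge0 _.
have h3 : 0 <= (2 - c) ^+ 2 := sqr_ge0 _.
have h4 : 0 <= a ^+ 2 * c ^+ 2 := mulr_ge0 (sqr_ge0 _) (sqr_ge0 _).
rewrite -subr_ge0 (_ : _ - _ = (a - c) ^+ 2 + (2 - a) ^+ 2 + (2 - c) ^+ 2 +
  12 * (a ^+ 2 * c ^+ 2) + 9 * (a ^+ 2 + c ^+ 2)); last ring.
by have := sqr_ge0 a; have := sqr_ge0 c; lra.
Qed.

Definition pair_int (k : R -> V -> V -> R) (s : R) : R := \int[(l s \x l s)%E]_z k s z.1 z.2.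

Variable k : R -> V -> V -> R.
Hypothesis gk : growth 2 k.

Lemma growth2_bound : exists2 a : R, 0 <= a & forall s : R, 0 <= s <= t -> forall z : V * V,
  `|k s z.1 z.2| <= a * ((1 + normv (w s z.1) ^+ 2) * (1 + normv (w s z.2) ^+ 2)).
Proof.
have [_ [a a0 ka]] := gk; exists (a * 12); first exact: mulr_ge0.
move=> s st z; apply: le_trans (ka _ _ _ st) _.
by rewrite -mulrA ler_wpM2l// weight_sq.
Qed.

Lemma growth_mslice s : measurable_fun setT (fun z : V * V => k s z.1 z.2).
Proof. exact: (measurableT_comp (g := pair s) gk.1). Qed.

Lemma pair_int_integrable (s : R) : 0 <= s <= t ->
  (l s \x l s)%E.-integrable setT (EFin \o (fun z => k s z.1 z.2)).
Proof.
move=> st; have [a a0 ka] := growth2_bound.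
exact: (pair_integrable (mwt mw s) (wMu s) (growth_mslice s) a0 (ka s st)).
Qed.

Lemma pair_int_section (s : R) x : 0 <= s <= t -> (l s).-integrable setT (fun y => (k s x y)%:E).
Proof.
move=> st; have [a a0 ka] := growth2_bound.
exact: (pair_integrable1 (mwt mw s) (wMu s) (growth_mslice s) a0 (ka s st) x).1.
Qed.

Lemma pair_int_iterated (s : R) : 0 <= s <= t -> pair_int k s = \int[l s]_x \int[l s]_y k s x y.
Proof.
move=> st; have [a a0 ka] := growth2_bound.
exact: (pair_iterated (mwt mw s) (wMu s) (growth_mslice s) a0 (ka s st)).
Qed.

Lemma pair_int_swap (s : R) : 0 <= s <= t -> pair_int k s = pair_int (fun s x y => k s y x) s.
Proof.
move=> st; have [a a0 ka] := growth2_bound.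
exact: (pair_swap (mwt mw s) (wMu s) (growth_mslice s) a0 (ka s st)).
Qed.

Lemma pair_int_time_integrable : leb.-integrable `[0, t] (EFin \o pair_int k).
Proof.
have [a a0 ka] := growth2_bound.
apply: (@bounded_integrable _ _ _ _ _ _ _ (a * (1 + Mu) * (1 + Mu))) => //.
- exact: leb_itv_cc.
- apply: (eq_measurable_fun (fun s => \int[l s]_x \int[l s]_y k s x y)).
    by move=> s; rewrite inE/= in_itv/= => st; rewrite pair_int_iterated.
  apply: measurable_funTS.
  apply: (measurable_Rint_kernel (kernel_flat T0 rho_flat)
    (k := fun z : R * V => \int[l z.1]_y k z.1 z.2 y)).
  apply: (@measurable_Rint_kernel _ _ _ _ (fun z : R * V => l z.1) _
    (fun z : (R * V) * V => k z.1.1 z.1.2 z.2)).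
    by move=> A mA; apply: (measurableT_comp (kernel_flat T0 rho_flat mA)).
  apply: (measurableT_comp (g := fun z : R * V * V => (z.1.1, (z.1.2, z.2))) gk.1).
  by do 2!(apply: measurable_fun_pair; first exact: measurableT_comp).
- move=> s; rewrite /= in_itv/= => st.
  exact: (pair_bound (mwt mw s) Mu0 (wMu s) (growth_mslice s) a0 (ka s st)).
Qed.

End growth.

Section pair_linear.
Context {R : realType} {d : nat}.
Local Notation V := 'rV[R]_d.
Variable T : R.
Variable rho : R -> probability V R.
Local Notation l := (fun t => rho (clamp T t)).
Variables (w : R -> V -> V) (Mu : R).
Hypothesis mw : measurable_fun setT (fun z : R * V => w z.1 z.2).
Hypothesis Mu0 : 0 <= Mu.
Hypothesis wMu : forall t, (\int[l t]_x (normv (w t x) ^+ 2)%:E <= Mu%:E)%E.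
Variable t : R.
Local Notation J := (pair_int T rho).
Variable s : R.
Hypothesis st : 0 <= s <= t.

Lemma pair_intD k k' : growth w t 2 k -> growth w t 2 k' ->
  J (fun s x y => k s x y + k' s x y) s = J k s + J k' s.
Proof. by move=> gk gk'; apply: RintegralD => //; exact: (pair_int_integrable mw wMu _ st). Qed.

Lemma pair_intZ a k : growth w t 2 k ->
  J (fun s x y => a * k s x y) s = a * J k s.
Proof. by move=> gk; apply: RintegralZl => //; exact: (pair_int_integrable mw wMu _ st). Qed.

Lemma pair_int_le k k' : growth w t 2 k -> growth w t 2 k' ->
  (forall x y, k s x y <= k' s x y) -> J k s <= J k' s.
Proof.
move=> gk gk' kk'; apply: le_Rintegral => //; exact: (pair_int_integrable mw wMu _ st).
Qed.

Lemma pair_int_fst (g : R -> V -> R) : growth w t 2 (fun s x _ => g s x) ->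
  J (fun s x _ => g s x) s = \int[l s]_x g s x.
Proof.
move=> gg; rewrite (pair_int_iterated mw wMu gg st).
by apply: eq_Rintegral => x _; rewrite prob_cst.
Qed.

(** Particles of a pair are exchangeable, so that only the symmetric part of a kernel
    contributes. *)
Lemma pair_int_symmetric k (g : R -> V -> R) : growth w t 2 k -> growth w t 2 (fun s x _ => g s x) ->
  (forall x y, k s x y + k s y x <= g s x + g s y) -> J k s <= \int[l s]_x g s x.
Proof.
move=> gk gg kg.
have gg' := growth_swap gg; have gk' := growth_swap gk.
have := pair_int_le (growthD gk gk') (growthD gg gg') kg.
rewrite !pair_intD// -(pair_int_swap mw wMu gk st) -(pair_int_swap mw wMu gg st).
by rewrite pair_int_fst//; lra.
Qed.

End pair_linear.

(** * Pointwise inequalities for the relative energy *)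

Section pointwise.
Context {R : realType} {d : nat}.
Local Notation V := 'rV[R]_d.
Local Notation M := 'M[R]_d.

Lemma dotv_mxvE (a c : V) (D : M) : dotv a (mxv D c) = \sum_k \sum_j a 0 k * (c 0 j * D k j).
Proof. by apply: eq_bigr => k _; rewrite mxvE mulr_sumr. Qed.

(** Contribution of an ordered pair of particles, with velocities W, to the rate of
    relative energy along the field F: the alignment term in the equation of the
    strong velocity B, tested with W - F, minus the alignment term of the momentum
    balance along F, minus half of the dissipation. *)
Definition interaction (D : M) (W1 W2 F1 F2 B1 B2 : V) : R :=
  dotv (W1 - F1) (mxv D (B1 - B2)) - dotv F1 (mxv D (W2 - W1))
  - 2^-1 * dotv (W1 - W2) (mxv D (W1 - W2)).

(** With Y = (W1 - F1) - (W2 - F2) and Z = (F1 - B1) - (F2 - B2), the sum over the two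
    orders equals - Y . D Y - Y . D Z. The first term has a sign, and the second is of
    order s, the distance between F and B. *)
Lemma interaction_symmetric (D : M) K0 s (W1 W2 F1 F2 B1 B2 : V) : pos_semidef D ->
  (forall i j, `|D i j| <= K0) ->
  (forall k, `|F1 0 k - B1 0 k| <= s) -> (forall k, `|F2 0 k - B2 0 k| <= s) ->
  interaction D W1 W2 F1 F2 B1 B2 + interaction D W2 W1 F2 F1 B2 B1 <=
  d%:R * (2 * s * K0) * (\sum_k `|W1 0 k - F1 0 k|) + d%:R * (2 * s * K0) * (\sum_k `|W2 0 k - F2 0 k|).
Proof.
move=> psd DK FB1 FB2.
pose Y : V := (W1 - F1) - (W2 - F2).
pose Z : V := (F1 - B1) - (F2 - B2).
have E : interaction D W1 W2 F1 F2 B1 B2 + interaction D W2 W1 F2 F1 B2 B1 =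
    - dotv Y (mxv D Y) - dotv Y (mxv D Z).
  rewrite /interaction !dotv_mxvE !mulr_sumr -!sumrN -!big_split/=.
  apply: eq_bigr => k _; rewrite !mulr_sumr -!sumrN -!big_split/=; apply: eq_bigr => j _.
  by rewrite /Y /Z !mxE; field.
rewrite E; apply: (@le_trans _ _ `|dotv Y (mxv D Z)|).
  have := psd Y; have := ler_norm (- dotv Y (mxv D Z)); rewrite normrN; lra.
rewrite -mulrDr -big_split/= mulr_sumr; apply: le_trans (ler_norm_sum _ _ _) _.
apply: ler_sum => k _; rewrite normrM mulrC; apply: ler_pM => //.
  apply: mxv_le => // j; rewrite /Z !mxE; apply: le_trans (ler_normB _ _) _.
  by have := FB1 j; have := FB2 j; lra.
by rewrite /Y !mxE; exact: ler_normB.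
Qed.

(** The material derivative of f along w is the one along f, known from the equation,
    plus grad f (w - f); the latter is quadratic once multiplied by w - f. *)
Lemma transport_pointwise (w f ft a a' : 'I_d -> R) (fx : 'I_d -> 'I_d -> R) M0 s s2 :
  (forall k, `|ft k + \sum_j f j * fx k j + a' k| <= s) ->
  (forall k, `|a' k - a k| <= s2) -> (forall k j, `|fx k j| <= M0) ->
  - \sum_k (w k - f k) * (ft k + \sum_j fx k j * w j) <=
  \sum_k (w k - f k) * a k + ((s + s2) * (\sum_k `|w k - f k|) + M0 * (\sum_k `|w k - f k|) ^+ 2).
Proof.
move=> h1 h2 h3; set S := \sum_k `|_|.
have S0 : 0 <= S by exact: sumr_ge0.
rewrite expr2 mulrA -mulrDl -lerBlDl -opprD -big_split/= -sumrN mulr_sumr.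
apply: ler_sum => k _.
apply: le_trans (ler_norm _) _; rewrite normrN -mulrDr normrM mulrC; apply: ler_wpM2r => //.
have -> : ft k + \sum_j fx k j * w j + a k =
    (ft k + \sum_j f j * fx k j + a' k) - (a' k - a k) + \sum_j fx k j * (w j - f j).
  have -> : \sum_j fx k j * (w j - f j) = \sum_j fx k j * w j - \sum_j f j * fx k j.
    by rewrite -sumrB; apply: eq_bigr => j _; ring.
  ring.
apply: le_trans (ler_normD _ _) _; apply: lerD.
  by apply: le_trans (ler_normB _ _) _; exact: lerD.
apply: le_trans (ler_norm_sum _ _ _) _; rewrite /S mulr_sumr; apply: ler_sum => j _.
by rewrite normrM ler_wpM2r.
Qed.

(** The three quantities given by the energy inequality, the momentum balance and the
    continuity equation complete a square. *)
Lemma energy_square (p : probability V R) (q : V -> V) (c : R) (f : 'I_d -> V -> R) (M0 : R) :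
  measurable_fun setT q -> 0 <= M0 ->
  (\int[p]_x (normv (q x) ^+ 2)%:E <= c%:E)%E ->
  (forall k, measurable_fun setT (f k)) -> (forall k x, `|f k x| <= M0) ->
  2^-1 * \int[p]_x (normv (q x) ^+ 2) - \int[p]_x dotv (\row_k f k x) (q x)
    + 2^-1 * \int[p]_x (\sum_k f k x ^+ 2) = 2^-1 * \int[p]_x (\sum_k (q x 0 k - f k x) ^+ 2).
Proof.
move=> mq M00 qc mf fM.
have i1 := (sq_integrable mq qc).1.
have dE x : dotv (\row_k f k x) (q x) = \sum_k f k x * q x 0 k.
  by apply: eq_bigr => k _; rewrite mxE.
have i2 : p.-integrable setT (EFin \o (fun x => dotv (\row_k f k x) (q x))).
  rewrite (_ : (fun x => _) = (fun x => \sum_k f k x * q x 0 k)); last exact/funext.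
  apply: (integrable_sumr measurableT) => k.
  have mfk : measurable_fun setT (fun x => f k x * q x 0 k).
    by apply: measurable_funM; [exact: mf|exact: measurable_rV_coord mq].
  have [//|//] := sq_dominated mq qc mfk M00.
  by move=> x; rewrite normrM ler_pM// coord_le_sq.
have i3 : p.-integrable setT (EFin \o (fun x => \sum_k f k x ^+ 2)).
  apply: (integrable_sumr measurableT) => k; apply: (@prob_integrable _ _ _ _ (M0 ^+ 2)).
    exact: measurable_funX.
  by move=> x; rewrite normrX lerXn2r// nnegrE.
have i2' := integrableZr measurableT 2 i2.
have -> : \int[p]_x (\sum_k (q x 0 k - f k x) ^+ 2) =
    \int[p]_x (normv (q x) ^+ 2) - 2 * \int[p]_x dotv (\row_k f k x) (q x) + \int[p]_x (\sum_k f k x ^+ 2).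
  rewrite -RintegralZl// -RintegralB// -RintegralD//; last exact: integrableBr.
  apply: eq_Rintegral => x _; rewrite dE normv_sq !mulr_sumr -sumrB -big_split/=.
  by apply: eq_bigr => k _; ring.
by field.
Qed.

End pointwise.

(** * Balance laws for C^1 fields *)

Lemma ddot_tensor (R : realType) d (q : 'rV[R]_d) (B : 'M[R]_d) :
  ddot (tensor q q) B = \sum_k \sum_j q 0 k * q 0 j * B k j.
Proof.
rewrite /ddot /mxtrace exchange_big/=; apply: eq_bigr => i _; rewrite mxE; apply: eq_bigr => k _.
by rewrite !mxE big_ord1 !mxE.
Qed.

Lemma normm_le (R : realType) d (B : 'M[R]_d) c : 0 <= c -> (forall i j, `|B i j| <= c) ->
  normm B <= d%:R * c.
Proof.
move=> c0 Bc; have dc : 0 <= d%:R * c by rewrite mulr_ge0.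
rewrite -(ger0_norm dc) -sqrtr_sqr ler_wsqrtr// /ddot /mxtrace.
rewrite (_ : (d%:R * c) ^+ 2 = d%:R * (d%:R * c ^+ 2)); last ring.
apply: le_trans (ler_norm _) (norm_sum_le _) => i; rewrite mxE; apply: norm_sum_le => j.
by rewrite mxE normrM expr2 ler_pM.
Qed.

Section balance_laws.
Context {R : realType} {d : nat}.
Local Notation V := 'rV[R]_d.
Local Notation leb := (@lebesgue_measure R).
Variables (T : R) (K : V -> R) (K0 : R).
Hypothesis T0 : 0 < T.
Hypothesis K_cont : continuous (hess K).
Hypothesis KK0 : forall x i j, `|hess K x i j| <= K0.
Variables (rho0 : probability V R) (rho : R -> probability V R).
Hypothesis rho_flat : flat_continuous T rho.
Local Notation l := (fun t => rho (clamp T t)).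
Variables (u0 : V -> V) (u w : R -> V -> V) (mu : R -> @mx_charge R d) (Mu : R).
Hypothesis mw : measurable_fun setT (fun z : R * V => w z.1 z.2).
Hypothesis Mu0 : 0 <= Mu.
Hypothesis wMu : forall t, (\int[l t]_x (normv (w t x) ^+ 2)%:E <= Mu%:E)%E.
Hypothesis wE : {ae leb, forall t, 0 <= t <= T -> w t = u t}.
Local Notation J := (pair_int T rho).

Definition pair_form (P Q : R -> V -> V -> V) s x y : R :=
  dotv (P s x y) (mxv (hess K (x - y)) (Q s x y)).

Lemma growth_form t m m' (P Q : R -> V -> V -> V) :
  (forall k, growth w t m (fun s x y => P s x y 0 k)) ->
  (forall k, growth w t m' (fun s x y => Q s x y 0 k)) ->
  growth w t (m + m') (pair_form P Q).
Proof.
move=> gP gQ; rewrite (_ : pair_form P Q = fun s x y =>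
  \sum_k \sum_j P s x y 0 k * (Q s x y 0 j * hess K (x - y) k j)); last first.
  by do 3!apply/funext => ?; exact: dotv_mxvE.
apply: growth_sum => k; apply: growth_sum => j; apply: growthM; first exact: gP.
rewrite -[m']addn0; apply: growthM; first exact: gQ.
apply: (@growth_bounded _ _ _ _ _ K0) => // .
apply: (measurableT_comp (measurable_hess_coord k j K_cont)).
by apply: measurable_rVB; exact: measurableT_comp.
Qed.

Lemma growth_rowB t m (P Q : R -> V -> V -> V) :
  (forall k, growth w t m (fun s x y => P s x y 0 k)) ->
  (forall k, growth w t m (fun s x y => Q s x y 0 k)) ->
  forall k, growth w t m (fun s x y => (P s x y - Q s x y) 0 k).
Proof.
move=> gP gQ k; rewrite (_ : (fun s x y => _) = fun s x y => P s x y 0 k - Q s x y 0 k).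
  exact: growthB.
by do 3!apply/funext => ?; rewrite mxE [X in _ + X]mxE.
Qed.

Lemma growth_dw t k : growth w t 1 (fun s x y => (w s x - w s y) 0 k).
Proof.
apply: (growth_rowB (P := fun s x _ => w s x) (Q := fun s _ y => w s y)) => {}k.
  exact: growth_velocity.
exact: (growth_swap (growth_velocity mw t k)).
Qed.

Definition dissipation s x y : R :=
  pair_form (fun s x y => w s x - w s y) (fun s x y => w s x - w s y) s x y.

Lemma growth_dissipation t : growth w t 2 dissipation.
Proof. by apply: (@growth_form t 1 1) => k; exact: growth_dw. Qed.

Variable c0 : R.
Hypothesis mu0 : measurable_fun setT u0.
Hypothesis u0_c : (\int[rho0]_x (normv (u0 x) ^+ 2)%:E <= c0%:E)%E.
Hypothesis energy : energy_inequalities T K rho0 u0 rho u mu.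
Hypothesis momentum : weak_momentum T K rho0 u0 rho u mu.

Lemma energy_clean : {ae leb, forall t, t \in `]0, T[ ->
  2^-1 * \int[l t]_x (normv (w t x) ^+ 2) + 2^-1 * trR (mu t)
   + 2^-1 * \int[leb]_(s in `[0, t]) J dissipation s <=
  2^-1 * \int[rho0]_x (normv (u0 x) ^+ 2)}.
Proof.
apply: ae_mono (ae_and energy wE) => t [E W] tT; have [_ {}E] := E tT.
move: (tT); rewrite in_itv/= => /andP[t0 tT'].
have tTT : 0 <= t <= T by rewrite !ltW.
have {}W := W tTT.
have [i0 _] := sq_integrable mu0 u0_c.
have [it _] := sq_integrable (mwt mw t) (wMu t).
have id_ : leb.-integrable `[0, t] (EFin \o J dissipation) :=
  pair_int_time_integrable T0 rho_flat mw Mu0 wMu (growth_dissipation t).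
have ED : (\int[leb]_(s in `[0%R, t]) \int[(rho s \x rho s)%E]_z
         (dotv (u s z.1 - u s z.2)
            (mxv (hess K (z.1 - z.2)) (u s z.1 - u s z.2)))%:E =
    (\int[leb]_(s in `[0, t]) J dissipation s)%:E)%E.
  rewrite /Rintegral fineK; last exact: integrable_fin_num.
  apply: ae_eq_integral_nonmeas => //.
    by have [] := integrableP _ _ _ id_.
  apply: ae_mono wE => s Ws; rewrite /= in_itv/= => /andP[s0 st].
  have sT : 0 <= s <= T by rewrite s0 (le_trans st (ltW tT')).
  have st' : 0 <= s <= t by rewrite s0.
  have := integrable_fin_num measurableT (pair_int_integrable mw wMu (growth_dissipation t) st').
  by rewrite /pair_int /Rintegral -Ws// (clamp_id sT) => /fineK ->.
move: E; rewrite ED /kinetic mx_trace_fin -W -{1}(clamp_id tTT).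
rewrite -(fineK (integrable_fin_num measurableT it)) -(fineK (integrable_fin_num measurableT i0)).
by rewrite -!EFinM -!EFinD lee_fin.
Qed.

(** Rate of |f|^2 / 2 along w. *)
Definition square_flux (f ft : 'I_d -> R -> V -> R) (fx : 'I_d -> 'I_d -> R -> V -> R) s x (_ : V) : R :=
  \sum_k f k s x * (ft k s x + \sum_j fx k j s x * w s x 0 j).

(** Rate of f . w due to transport. This and [square_flux] ignore the second particle,
    so as to be added to the alignment terms under the same integral. *)
Definition momentum_flux (ft : 'I_d -> R -> V -> R) (fx : 'I_d -> 'I_d -> R -> V -> R) s x (_ : V) : R :=
  \sum_k w s x 0 k * (ft k s x + \sum_j fx k j s x * w s x 0 j).

Section fields.
Variables (f ft : 'I_d -> R -> V -> R) (fx : 'I_d -> 'I_d -> R -> V -> R) (C : R).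
Hypothesis sf : forall k, smooth (f k) (ft k) (fx k).
Hypothesis fC : forall k s x, `|f k s x| <= C.
Hypothesis ftC : forall k s x, `|ft k s x| <= C.
Hypothesis fxC : forall k j s x, `|fx k j s x| <= C.
Local Notation F := (fun s x (_ : V) => \row_k f k s x).

Lemma growth_f t k : growth w t 0 (fun s x _ => f k s x).
Proof.
have [cf _ _ _ _] := sf k; apply: (@growth_field _ _ _ _ _ C) => //.
exact: measurable_continuous_prod.
Qed.

Lemma growth_F t k : growth w t 0 (fun s x y => F s x y 0 k).
Proof.
rewrite (_ : (fun s x y => _) = fun s x _ => f k s x); first exact: growth_f.
by do 3!apply/funext => ?; rewrite mxE.
Qed.

Lemma growth_material t k : growth w t 1 (fun s x _ => ft k s x + \sum_j fx k j s x * w s x 0 j).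
Proof.
have [_ cft cfx _ _] := sf k; apply: growthD.
  apply: (@growthS _ _ _ _ 0) => //; apply: (@growth_field _ _ _ _ _ C) => //.
  exact: measurable_continuous_prod.
apply: growth_sum => j; apply: (@growthM _ _ _ _ 0 1); last exact: growth_velocity.
by apply: (@growth_field _ _ _ _ _ C) => //; exact: measurable_continuous_prod.
Qed.

Lemma growth_square_flux t : growth w t 2 (square_flux f ft fx).
Proof.
apply: growth_sum => k; apply: (@growthS _ _ _ _ 1) => //.
by apply: (@growthM _ _ _ _ 0 1); [exact: growth_f|exact: growth_material].
Qed.

Lemma growth_momentum_flux t : growth w t 2 (momentum_flux ft fx).
Proof.
apply: growth_sum => k.
by apply: (@growthM _ _ _ _ 1 1); [exact: growth_velocity|exact: growth_material].
Qed.

Lemma growth_power t : growth w t 2 (pair_form F (fun s x y => w s y - w s x)).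
Proof.
apply: (@growthS _ _ _ _ 1) => //; apply: (@growth_form t 0 1) => k; first exact: growth_F.
exact: (growth_swap (growth_dw t k)).
Qed.

Hypothesis weak_w : forall C t psi psit psix, 0 <= t <= T -> smooth psi psit psix ->
    bounded_on T C psi psit psix ->
    \int[l t]_x psi t x - \int[rho0]_x psi 0 x =
    \int[leb]_(tau in `[0, t]) \int[l tau]_x flux w psit psix tau x.

(** The continuity equation tested with |f|^2 / 2. *)
Lemma square_balance t : 0 <= t <= T ->
  2^-1 * \int[l t]_x (\sum_k f k t x ^+ 2) - 2^-1 * \int[rho0]_x (\sum_k f k 0 x ^+ 2) =
  \int[leb]_(s in `[0, t]) J (square_flux f ft fx) s.
Proof.
move=> tT.
have C0 (i : 'I_d) : 0 <= C := le_trans (normr_ge0 _) (fC i 0 0).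
pose ss k := smooth_mul (sf k) (sf k).
have bk k : bounded_on T (C * C + C * C) (fun t x => f k t x * f k t x)
    (fun t x => f k t x * ft k t x + f k t x * ft k t x)
    (fun i t x => f k t x * fx k i t x + f k t x * fx k i t x).
  move=> s x _; have CC : 0 <= C * C by rewrite mulr_ge0// (C0 k).
  split.
  - by apply: (@le_trans _ _ (C * C)); [rewrite normrM; exact: ler_pM|rewrite lerDl].
  - by apply: le_trans (ler_normD _ _) _; apply: lerD; rewrite normrM; exact: ler_pM.
  - by move=> i; apply: le_trans (ler_normD _ _) _; apply: lerD; rewrite normrM; exact: ler_pM.
have E k := weak_w tT (ss k) (bk k).
have int2 (p : probability V R) s k : p.-integrable setT (EFin \o (fun x => f k s x ^+ 2)).
  apply: (@prob_integrable _ _ _ _ (C ^+ 2)); last first.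
    by move=> x; rewrite normrX lerXn2r// nnegrE (C0 k).
  by apply: measurable_funX; exact: smooth_measurable (sf k).
rewrite !(Rintegral_sumr measurableT)//; try by move=> k; exact: int2.
rewrite -mulrBr -sumrB.
transitivity (2^-1 * \sum_k \int[leb]_(tau in `[0, t]) J (fun s x _ =>
   2 * (f k s x * (ft k s x + \sum_j fx k j s x * w s x 0 j))) tau).
  congr (_ * _); apply: eq_bigr => k _; under eq_Rintegral do rewrite expr2.
  under [X in _ - X]eq_Rintegral do rewrite expr2.
  rewrite E; apply: eq_Rintegral => s; rewrite inE/= in_itv/= => st.
  rewrite (pair_int_fst mw wMu (t := t) (s := s) st (g := fun s x =>
    2 * (f k s x * (ft k s x + \sum_j fx k j s x * w s x 0 j)))).
    apply: eq_Rintegral => x _; rewrite /flux mulrDr mulrDr mulr_sumr mulr_sumr; congr (_ + _); first ring.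
    by apply: eq_bigr => j _; ring.
  apply: (@growthM _ _ _ _ 0 2); first exact: growth_cst.
  apply: (@growthS _ _ _ _ 1) => //.
  by apply: (@growthM _ _ _ _ 0 1); [exact: growth_f|exact: growth_material].
have gk k : growth w t 2 (fun s x (_ : V) => f k s x * (ft k s x + \sum_j fx k j s x * w s x 0 j)).
  apply: (@growthS _ _ _ _ 1) => //.
  by apply: (@growthM _ _ _ _ 0 1); [exact: growth_f|exact: growth_material].
have ik k := pair_int_time_integrable T0 rho_flat mw Mu0 wMu (gk k).
rewrite mulr_sumr.
transitivity (\sum_k \int[leb]_(tau in `[0, t]) J (fun s x (_ : V) =>
   f k s x * (ft k s x + \sum_j fx k j s x * w s x 0 j)) tau).
  apply: eq_bigr => k _.
  rewrite (_ : \int[leb]_(tau in `[0, t]) _ = 2 * \int[leb]_(tau in `[0, t]) J (fun s x (_ : V) =>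
   f k s x * (ft k s x + \sum_j fx k j s x * w s x 0 j)) tau); first by rewrite mulrA mulVf// mul1r.
  rewrite -(RintegralZl 2 _ (ik k))//.
  apply: eq_Rintegral => s; rewrite inE/= in_itv/= => st.
  exact: (pair_intZ mw wMu st 2 (gk k)).
rewrite -(Rintegral_sumr _)//.
apply: eq_Rintegral => s; rewrite inE/= in_itv/= => st.
rewrite /pair_int -(Rintegral_sumr measurableT)// => k.
exact: (pair_int_integrable mw wMu (gk k) st).
Qed.

End fields.

(** The exceptional null set of times does not depend on the field f, so that e -> 0
    can be taken afterwards at a fixed time. *)
Lemma momentum_clean : {ae leb, forall t, t \in `]0, T[ ->
  forall (f ft : 'I_d -> R -> V -> R) (fx : 'I_d -> 'I_d -> R -> V -> R) (C : R), 0 <= C ->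
  (forall k, smooth (f k) (ft k) (fx k)) ->
  (forall k s x, `|f k s x| <= C) ->
  (forall k s x, `|ft k s x| <= C) ->
  (forall k j s x, `|fx k j s x| <= C) ->
  \int[l t]_x dotv (\row_k f k t x) (w t x) - \int[rho0]_x dotv (\row_k f k 0 x) (u0 x) =
  \int[leb]_(s in `[0, t]) J (momentum_flux ft fx) s
  + \int[leb]_(s in `[0, t]) mx_integral (mu s) (fun x => \matrix_(i, j) fx i j s x)
  + \int[leb]_(s in `[0, t])
      J (pair_form (fun s x _ => \row_k f k s x) (fun s x y => w s y - w s x)) s}.
Proof.
apply: ae_mono (ae_and momentum wE) => t [H W] tT f ft fx C C0 sf fC ftC fxC.
move: (tT); rewrite in_itv/= => /andP[t0 tT'].
have tTT : 0 <= t <= T by rewrite !ltW.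
have {}W := W tTT.
pose F s x : V := \row_k f k s x.
pose Ft s x : V := \row_k ft k s x.
pose Fx j s x : V := \row_k fx k j s x.
have sF : @C1_on _ _ V `[0, T[ F Ft Fx.
  have crow (g : 'I_d -> R -> V -> R) : (forall k, continuous (fun z : R * V => g k z.1 z.2)) ->
      {within `[0, T[ `*` [set: V], continuous (fun z : R * V => \row_k g k z.1 z.2 : V)}.
    move=> cg; apply: continuous_subspaceT; apply: continuous_rV => i.
    rewrite (_ : (fun x => _) = (fun z : R * V => g i z.1 z.2)); first exact: cg.
    by apply/funext => z; rewrite mxE.
  split.
  - by apply: crow => k; have [] := sf k.
  - by apply: crow => k; have [] := sf k.
  - by move=> i; apply: (crow (fun k => fx k i)) => k; have [] := sf k.
  - move=> s x _; apply: (@rV_is_derive _ _ _ _ (fun k s => f k s x)) => // k.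
    by have [_ _ _ h _] := sf k; exact: h.
  - move=> i s x _; apply: (@rV_is_derive _ _ _ _ (fun k => f k s)) => // k.
    by have [_ _ _ _ h] := sf k; exact: h.
have jE s : jacx Fx s = fun x => \matrix_(i, j) fx i j s x.
  by apply/funext => x; apply/matrixP => i j; rewrite !mxE.
have nbound (g : V) : (forall i, `|g 0 i| <= C) -> normv g <= d%:R * C by exact: normv_le.
rewrite clamp_id// W (H tT F Ft Fx sF).
  rewrite (_ : (fun tau => mx_integral (mu tau) (jacx Fx tau)) =
    fun s => mx_integral (mu s) (fun x => \matrix_(i, j) fx i j s x)); last first.
    by apply/funext => s; rewrite jE.
  have E1 : \int[leb]_(tau in `[0, t]) \int[rho tau]_x (dotv (Ft tau x) (u tau x) +
         ddot (tensor (u tau x) (u tau x)) (jacx Fx tau x)) =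
      \int[leb]_(s in `[0, t]) J (momentum_flux ft fx) s.
    apply: ae_eq_Rintegral_nonmeas => //.
      have := pair_int_time_integrable T0 rho_flat mw Mu0 wMu (growth_momentum_flux sf ftC fxC t).
      by move=> /integrableP[/measurable_EFinP].
    apply: ae_mono wE => s Ws; rewrite /= in_itv/= => /andP[s0 st].
    have sT : 0 <= s <= T by rewrite s0 (le_trans st (ltW tT')).
    have st' : 0 <= s <= t by rewrite s0.
    have gm := growth_momentum_flux sf ftC fxC t.
    rewrite -Ws// (pair_int_fst mw wMu st' (g := fun s x => momentum_flux ft fx s x 0) gm).
    rewrite (clamp_id sT); apply: eq_Rintegral => x _.
    rewrite ddot_tensor /momentum_flux /dotv jE -big_split/=.
    apply: eq_bigr => k _; rewrite mxE mulrDr mulrC mulr_sumr; congr (_ + _).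
    by apply: eq_bigr => j _; rewrite mxE -mulrA; congr (_ * _); rewrite mulrC.
  have E2 : \int[leb]_(tau in `[0, t]) \int[(rho tau \x rho tau)%E]_z
        dotv (F tau z.1) (mxv (hess K (z.1 - z.2)) (u tau z.2 - u tau z.1)) =
     \int[leb]_(s in `[0, t])
       J (pair_form (fun s x _ => \row_k f k s x) (fun s x y => w s y - w s x)) s.
    apply: ae_eq_Rintegral_nonmeas => //.
      have := pair_int_time_integrable T0 rho_flat mw Mu0 wMu (growth_power sf fC t).
      by move=> /integrableP[/measurable_EFinP].
    apply: ae_mono wE => s Ws; rewrite /= in_itv/= => /andP[s0 st].
    have sT : 0 <= s <= T by rewrite s0 (le_trans st (ltW tT')).
    by rewrite -Ws// /pair_int (clamp_id sT).
  by rewrite E1 E2.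
exists (d%:R * C) => s x _.
have dC : 0 <= d%:R * C by rewrite mulr_ge0.
have n1 : d%:R * C <= d%:R * C * (1 + normv x) by rewrite ler_peMr// lerDl sqrtr_ge0.
split.
- by apply: le_trans n1; apply: nbound => k; rewrite mxE.
- by apply: le_trans n1; apply: nbound => k; rewrite mxE.
- by rewrite jE; apply: normm_le => // i j; rewrite mxE.
Qed.

End balance_laws.

(** * Rate of the relative energy *)

Section relative_density.
Context {R : realType} {d : nat}.
Local Notation V := 'rV[R]_d.
Local Notation leb := (@lebesgue_measure R).
Variables (T : R) (K : V -> R) (K0 : R).
Hypothesis K_cont : continuous (hess K).
Hypothesis KK0 : forall x i j, `|hess K x i j| <= K0.
Hypothesis K_even : forall x, hess K (- x) = hess K x.
Hypothesis K_psd : forall x, pos_semidef (hess K x).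
Variable rho : R -> probability V R.
Local Notation l := (fun t => rho (clamp T t)).
Variables (w b : R -> V -> V) (Mu M : R).
Hypothesis mw : measurable_fun setT (fun z : R * V => w z.1 z.2).
Hypothesis Mu0 : 0 <= Mu.
Hypothesis wMu : forall t, (\int[l t]_x (normv (w t x) ^+ 2)%:E <= Mu%:E)%E.
Hypothesis bc : continuous (fun z : R * V => b z.1 z.2).
Hypothesis M0 : 0 <= M.
Hypothesis bM : forall t x k, `|b t x 0 k| <= M.
Local Notation J := (pair_int T rho).

Lemma growth_b t k : growth w t 0 (fun s x _ => b s x 0 k).
Proof.
apply: (@growth_field _ _ _ _ (fun s x => b s x 0 k) M) => //.
by apply: measurable_continuous_prod; exact: (@continuous_coord _ _ _ (fun z : R * V => b z.1 z.2)).
Qed.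

Lemma growth_gap t : growth w t 1 (fun s x _ => gap b w s x).
Proof.
apply: growth_sum => k; apply: growth_norm; apply: growthB; first exact: growth_velocity.
by apply: (@growthS _ _ _ _ 0) => //; exact: growth_b.
Qed.

(** Comparable to the relative energy, up to a dimensional factor. *)
Definition Qgap s : R := \int[l s]_x (gap b w s x ^+ 2).

Lemma gap_sq_integrable s : 0 <= s -> (l s).-integrable setT (EFin \o (fun x => gap b w s x ^+ 2)).
Proof.
move=> s0; have g2 : growth w s 2 (fun s x _ => gap b w s x ^+ 2).
  rewrite (_ : (fun _ _ _ => _) = fun s x (_ : V) => gap b w s x * gap b w s x); last first.
    by do 3!apply/funext => ?; rewrite expr2.
  by apply: (@growthM _ _ _ _ 1 1); exact: growth_gap.
have := pair_int_section mw wMu (growth_swap g2) (s := s) 0; apply.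
by rewrite s0 lexx.
Qed.

Lemma Qgap_ge0 s : 0 <= Qgap s.
Proof. by apply: Rintegral_ge0 => x _; exact: sqr_ge0. Qed.

(** The variance of the gap under a probability measure is nonnegative. *)
Lemma Gap_sq_le s : 0 <= s -> Gap T rho b w s ^+ 2 <= Qgap s.
Proof.
move=> s0; have i2 := gap_sq_integrable s0.
have [i1 _] := gap_integrable bc M0 bM mw wMu s.
set G := Gap T rho b w s.
have : 0 <= \int[l s]_x ((gap b w s x - G) ^+ 2) by apply: Rintegral_ge0 => x _; exact: sqr_ge0.
have -> : \int[l s]_x ((gap b w s x - G) ^+ 2) = \int[l s]_x (gap b w s x ^+ 2 + (- 2 * G) * gap b w s x + G ^+ 2).
  by apply: eq_Rintegral => x _; ring.
have i1' := integrableZr measurableT (- 2 * G) i1.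
rewrite RintegralD//; [|exact: integrableDr|exact: finite_measure_integrable_cst].
rewrite RintegralD// RintegralZl// prob_cst -/(Qgap s) -/(Gap T rho b w s) -/G.
rewrite (_ : _ + _ + _ = Qgap s - G ^+ 2); last ring.
by rewrite subr_ge0.
Qed.

Variables (f ft : 'I_d -> R -> V -> R) (fx : 'I_d -> 'I_d -> R -> V -> R) (A : 'I_d -> R -> V -> R) (C0 e C : R).
Hypothesis af : approx_field T b A M C0 e f ft fx.
Hypothesis ftC : forall k s x, `|ft k s x| <= C.
Hypothesis fxC : forall k j s x, `|fx k j s x| <= C.
Hypothesis MC : M <= C.
Hypothesis C00 : 0 <= C0.
Hypothesis e0 : 0 < e.

Definition defect s x : R := \sum_k `|w s x 0 k - f k s x|.

(** Rate of change of the relative energy along the field [f], as a function of a pair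
    of particles. *)
Definition energy_rate s x y : R := square_flux w f ft fx s x y - momentum_flux w ft fx s x y
  - pair_form K (fun s x _ => \row_k f k s x) (fun s x y => w s y - w s x) s x y
  - 2^-1 * dissipation K w s x y.

Let sf k : smooth (f k) (ft k) (fx k) := af_smooth af k.
Let fC k s x : `|f k s x| <= C := le_trans (af_le af k s x) MC.

Lemma growth_wf t k : growth w t 1 (fun s x _ => w s x 0 k - f k s x).
Proof.
apply: growthB; first exact: growth_velocity.
by apply: (@growthS _ _ _ _ 0) => //; exact: (growth_f w sf fC).
Qed.

Lemma growth_energy_rate t : growth w t 2 energy_rate.
Proof.
apply: growthB; last by apply: (@growthM _ _ _ _ 0 2); [exact: growth_cst|exact: growth_dissipation].
apply: growthB; last exact: (growth_power K_cont KK0 mw sf fC t).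
apply: growthB; first exact: (growth_square_flux mw sf fC ftC fxC t).
exact: (growth_momentum_flux mw sf ftC fxC t).
Qed.

Lemma growth_defect t : growth w t 1 (fun s x _ => defect s x).
Proof. by apply: growth_sum => k; apply: growth_norm; exact: growth_wf. Qed.

(** Its integral over the second particle is the alignment of the strong velocity with
    the measure l s of the particles, tested with w - f. *)
Definition align_pair s x y : R := \sum_k (w s x 0 k - f k s x) * force K b s x k y.

Lemma growth_align t : growth w t 2 align_pair.
Proof.
rewrite (_ : align_pair = pair_form K (fun s x _ => \row_k (w s x 0 k - f k s x)) (fun s x y => b s x - b s y)).
  apply: (@growthS _ _ _ _ 1) => //; apply: (@growth_form _ _ _ _ K_cont KK0 _ _ 1 0).
    move=> k; rewrite (_ : (fun s x y => _) = fun s x (_ : V) => w s x 0 k - f k s x); first exact: growth_wf.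
    by do 3!apply/funext => ?; rewrite mxE.
  apply: (growth_rowB (P := fun s x _ => b s x) (Q := fun s _ y => b s y)) => k; first exact: growth_b.
  exact: (growth_swap (growth_b t k)).
do 3!apply/funext => ?; rewrite /align_pair /pair_form /dotv.
by apply: eq_bigr => k _; rewrite mxE.
Qed.

Variables (t s sigma : R).
Hypothesis st : 0 <= s <= t.
Hypothesis tT : t <= T - 4 * e.
Hypothesis A_close : forall k x, `|A k s x - alignment K (l s) (b s) x 0 k| <= sigma.

Let s4 : 0 <= s <= T - 4 * e.
Proof. by case/andP: st => s0 s1; rewrite s0 (le_trans s1). Qed.

Definition err s x : R := (C0 * e + sigma) * defect s x + M * defect s x ^+ 2.

Lemma growth_err : growth w t 2 (fun s x _ => err s x).
Proof.
apply: growthD.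
  apply: (@growthS _ _ _ _ 1) => //; apply: (@growthM _ _ _ _ 0 1); first exact: growth_cst.
  exact: growth_defect.
apply: (@growthM _ _ _ _ 0 2); first exact: growth_cst.
rewrite (_ : (fun _ _ _ => _) = fun s x (_ : V) => defect s x * defect s x); last first.
  by do 3!apply/funext => ?; rewrite expr2.
by apply: (@growthM _ _ _ _ 1 1); exact: growth_defect.
Qed.

Let mbs : measurable_fun setT (b s) := mbt bc s.

Lemma align_average x : \int[l s]_y align_pair s x y =
  \sum_k (w s x 0 k - f k s x) * alignment K (l s) (b s) x 0 k.
Proof.
rewrite /align_pair (Rintegral_sumr measurableT); last first.
  by move=> k; apply: (integrableZr measurableT); exact: (alignment_integrable K_cont KK0 _ x k mbs (bM s)).
apply: eq_bigr => k _; rewrite RintegralZl//; last exact: (alignment_integrable K_cont KK0 _ x k mbs (bM s)).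
by rewrite [in RHS]mxE.
Qed.

(** The kernel Z is nonnegative after integration over the second particle: this is
    [transport_pointwise], where the average of [align_pair] replaces the forcing A up
    to sigma. Adding Z to the rate exchanges the transport terms for errors and the
    alignment kernel, and leaves pairs to which [interaction_symmetric] applies. *)
Lemma energy_rate_le : J energy_rate s <=
  \int[l s]_x ((C0 * e + sigma + d%:R * (2 * (C0 * e) * K0)) * defect s x + M * defect s x ^+ 2).
Proof.
pose N s x y := - pair_form K (fun s x _ => \row_k f k s x) (fun s x y => w s y - w s x) s x y
  - 2^-1 * dissipation K w s x y.
pose G s x y := square_flux w f ft fx s x y - momentum_flux w ft fx s x y.
have gG : growth w t 2 G.
  apply: growthB; first exact: (growth_square_flux mw sf fC ftC fxC t).
  exact: (growth_momentum_flux mw sf ftC fxC t).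
have gN : growth w t 2 N.
  apply: growthB; last by apply: (@growthM _ _ _ _ 0 2); [exact: growth_cst|exact: growth_dissipation].
  apply: growthN; exact: (growth_power K_cont KK0 mw sf fC t).
pose Z s x y := align_pair s x y + (err s x - G s x y).
have gZ : growth w t 2 Z.
  by apply: growthD; [exact: growth_align|apply: growthB; [exact: growth_err|exact: gG]].
have GE s' x y : G s' x y = - \sum_k (w s' x 0 k - f k s' x) * (ft k s' x + \sum_j fx k j s' x * w s' x 0 j).
  rewrite /G /square_flux /momentum_flux -sumrB -sumrN; apply: eq_bigr => k _; ring.
have Z0 : 0 <= J Z s.
  rewrite (pair_int_iterated mw wMu gZ st); apply: Rintegral_ge0 => x _.
  have -> : \int[l s]_y Z s x y = \int[l s]_y align_pair s x y + (err s x - G s x 0).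
    rewrite /Z (_ : (fun y => _) = fun y => align_pair s x y + (err s x - G s x 0)); last first.
      by apply/funext => y; rewrite !GE.
    rewrite RintegralD//; first by rewrite prob_cst.
      exact: (pair_int_section mw wMu (growth_align t) x st).
    exact: finite_measure_integrable_cst.
  rewrite align_average GE addrA subr_ge0 /err.
  apply: (@transport_pointwise _ _ _ _ _ _ (fun k => A k s x)) => [k|k|k j].
  - exact: (af_eq af).
  - exact: A_close.
  - exact: (af_x af).
pose KK s x y := energy_rate s x y + Z s x y.
have gKK : growth w t 2 KK by apply: growthD => //; exact: growth_energy_rate.
have le1 : J energy_rate s <= J KK s.
  by rewrite (pair_intD mw wMu st (growth_energy_rate t) gZ) lerDl.
apply: le_trans le1 _.
have gdef (c : R) : growth w t 2 (fun s x (_ : V) => (C0 * e + sigma + c) * defect s x + M * defect s x ^+ 2).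
  rewrite (_ : (fun _ _ _ => _) = fun s x (_ : V) => err s x + c * defect s x); last first.
    by do 3!apply/funext => ?; rewrite /err; ring.
  apply: growthD; first exact: growth_err.
  by apply: (@growthS _ _ _ _ 1) => //; apply: (@growthM _ _ _ _ 0 1); [exact: growth_cst|exact: growth_defect].
apply: (pair_int_symmetric mw wMu st gKK (gdef _)) => x y.
have KE x' y' : KK s x' y' = err s x' +
    interaction (hess K (x' - y')) (w s x') (w s y') (\row_k f k s x') (\row_k f k s y') (b s x') (b s y').
  rewrite /KK /Z /energy_rate -/(G s x' y') /interaction /dissipation /pair_form.
  have -> : align_pair s x' y' = dotv (w s x' - \row_k f k s x') (mxv (hess K (x' - y')) (b s x' - b s y')).
    by rewrite /align_pair /dotv; apply: eq_bigr => k _; rewrite [in RHS]mxE [X in _ = (_ + X) * _]mxE [X in _ = (_ - X) * _]mxE.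
  ring.
(* evenness of the Hessian: both orders of the pair see the same matrix *)
have Ey : hess K (y - x) = hess K (x - y) by rewrite -K_even opprB.
rewrite !KE Ey.
have := @interaction_symmetric _ _ (hess K (x - y)) K0 (C0 * e) (w s x) (w s y)
  (\row_k f k s x) (\row_k f k s y) (b s x) (b s y) (K_psd _) (KK0 _).
have fE z : \sum_k `|w s z 0 k - (\row_k0 f k0 s z) 0 k| = defect s z.
  by apply: eq_bigr => k _; rewrite mxE.
rewrite !fE /err => h.
have {}h := h (fun k => _) (fun k => _).
have h1 k : `|(\row_k0 f k0 s x) 0 k - b s x 0 k| <= C0 * e by rewrite mxE; exact: (af_close af).
have h2 k : `|(\row_k0 f k0 s y) 0 k - b s y 0 k| <= C0 * e by rewrite mxE; exact: (af_close af).
have := h h1 h2; lra.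
Qed.

Hypothesis sigma0 : 0 <= sigma.

Definition kappa : R := d%:R * (C0 * e).

Lemma defect_le x : defect s x <= gap b w s x + kappa.
Proof.
have -> : kappa = \sum_(k < d) C0 * e by rewrite sumr_const card_ord -(mulr_natl (C0 * e)).
rewrite /defect /gap -big_split/=; apply: ler_sum => k _.
by apply: le_trans (ler_distD (b s x 0 k) _ _) _; rewrite lerD2l distrC; exact: (af_close af).
Qed.

Lemma energy_rate_bound : J energy_rate s <=
  (C0 * e + sigma + d%:R * (2 * (C0 * e) * K0)) * (Gap T rho b w s + kappa)
   + M * (2 * Qgap s + 2 * kappa ^+ 2).
Proof.
apply: le_trans energy_rate_le _.
set be := C0 * e + sigma + _.
have K00 : 0 <= d%:R * (2 * (C0 * e) * K0).
  have [i|d0] := pselect (inhabited 'I_d).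
    case: i => i; have : 0 <= K0 := le_trans (normr_ge0 _) (KK0 0 i i).
    by move=> K00; rewrite !mulr_ge0// ltW.
  rewrite (_ : d%:R = 0 :> R) ?mul0r//; case: (posnP d) => [->//|dp].
  by exfalso; apply: d0; split; exact: (Ordinal dp).
have be0 : 0 <= be by rewrite !addr_ge0// mulr_ge0// ltW.
have k0 : 0 <= kappa by rewrite !mulr_ge0// ltW.
have s0 : 0 <= s by case/andP: st.
have i2 := gap_sq_integrable s0.
have [i1 _] := gap_integrable bc M0 bM mw wMu s.
have -> : be * (Gap T rho b w s + kappa) + M * (2 * Qgap s + 2 * kappa ^+ 2) =
    \int[l s]_x (be * (gap b w s x + kappa) + M * (2 * gap b w s x ^+ 2 + 2 * kappa ^+ 2)).
  have ck (c : R) : (l s).-integrable setT (EFin \o (fun _ : V => c)) by exact: finite_measure_integrable_cst.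
  have j1 := integrableDr measurableT i1 (ck kappa).
  have j2 := integrableDr measurableT (integrableZr measurableT 2 i2) (ck (2 * kappa ^+ 2)).
  rewrite RintegralD//; [|exact: integrableZr|exact: integrableZr].
  rewrite RintegralZl// RintegralZl// RintegralD// RintegralD//; last exact: integrableZr.
  by rewrite RintegralZl// !prob_cst.
apply: le_Rintegral => //.
- have := pair_int_section mw wMu (growth_swap (growthD (@growthM _ _ _ _ 0 2 _ _ (growth_cst _ t be)
    (growthS (leqnSn 1) (growth_defect t))) (@growthM _ _ _ _ 0 2 _ _ (growth_cst _ t M)
    (@growthM _ _ _ _ 1 1 _ _ (growth_defect t) (growth_defect t))))) 0 st.
  by apply: eq_integrable => // x _; rewrite expr2.
- have ck (c : R) : (l s).-integrable setT (EFin \o (fun _ : V => c)) by exact: finite_measure_integrable_cst.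
  have j1 := integrableDr measurableT i1 (ck kappa).
  have j2 := integrableDr measurableT (integrableZr measurableT 2 i2) (ck (2 * kappa ^+ 2)).
  by apply: integrableDr => //; exact: integrableZr.
- move=> x _; have dl := defect_le x.
  have d0 : 0 <= defect s x by apply: sumr_ge0.
  apply: lerD; first by rewrite ler_wpM2l.
  rewrite ler_wpM2l//; apply: (@le_trans _ _ ((gap b w s x + kappa) ^+ 2)).
    by rewrite lerXn2r// nnegrE// (le_trans d0).
  have : 0 <= (gap b w s x - kappa) ^+ 2 := sqr_ge0 _.
  by rewrite sqrrB sqrrD; lra.
Qed.

End relative_density.

(** * The relative energy inequality *)

Lemma sum_sqr_le (R : realFieldType) d (a : 'I_d -> R) :
  (\sum_k a k) ^+ 2 <= d%:R * \sum_k a k ^+ 2.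
Proof.
have -> : d%:R * \sum_k a k ^+ 2 = \sum_k \sum_j (a k ^+ 2 + a j ^+ 2) / 2.
  have E k : \sum_j (a k ^+ 2 + a j ^+ 2) / 2 = (d%:R * a k ^+ 2 + \sum_j a j ^+ 2) / 2.
    by rewrite -mulr_suml big_split/= sumr_const card_ord -(mulr_natl (a k ^+ 2)).
  under [RHS]eq_bigr do rewrite E.
  rewrite -mulr_suml big_split/= sumr_const card_ord -mulr_sumr -(mulr_natl (\sum_j _)).
  by field.
rewrite expr2 mulr_suml; apply: ler_sum => k _; rewrite mulr_sumr; apply: ler_sum => j _.
have := sqr_ge0 (a k - a j); rewrite sqrrB; lra.
Qed.

(** Energy inequality minus momentum balance plus the balance of |f|^2 / 2. *)
Lemma balance_arith (R : realFieldType) (W U MW MU F2 F20 I I0 tr a1 a2 a3 a4 a5 : R) :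
  2^-1 * W + 2^-1 * tr + 2^-1 * a1 <= 2^-1 * U -> MW - MU = a3 + a2 + a5 ->
  2^-1 * F2 - 2^-1 * F20 = a4 ->
  2^-1 * W - MW + 2^-1 * F2 = 2^-1 * I -> 2^-1 * U - MU + 2^-1 * F20 = 2^-1 * I0 ->
  2^-1 * I + 2^-1 * tr <= 2^-1 * I0 + (a4 - a3 - a5 - 2^-1 * a1) - a2.
Proof. lra. Qed.

Lemma relative_arith (R : realFieldType) (n c r D3 e t T q I I1 tr XX YY Q eps : R) :
  0 <= n -> 0 <= c -> 0 <= r -> 0 <= e -> e <= 1 -> 0 <= t -> t <= T -> 0 <= I -> 0 <= tr ->
  2^-1 * I + 2^-1 * tr <= 2^-1 * I1 + XX - YY ->
  Q <= 2 * n * I + 2 * (n * c * e) ^+ 2 -> XX <= r * (q + e * t) -> `|YY| <= D3 * q ->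
  I1 <= n * (c * e) ^+ 2 ->
  e * ((4 * n + 2) * (n * c ^+ 2 + r * T) + 2 * (n * c) ^+ 2 + 1) <= eps ->
  Q + tr <= (4 * n + 2) * (r + D3) * q + eps.
Proof.
move=> n0 c0 r0 e0 e1 t0 tT I0 tr0 FE Qt X Y I1e ee.
have e2 : e ^+ 2 <= e by rewrite expr2 ler_piMl.
have n1 : 0 <= 4 * n + 2 by lra.
have ntr : 0 <= n * tr := mulr_ge0 n0 tr0.
have h1 : (4 * n + 2) * (2^-1 * I + 2^-1 * tr) <= (4 * n + 2) * (2^-1 * I1 + XX - YY) by rewrite ler_wpM2l.
have Yq : - YY <= D3 * q by apply: le_trans Y; rewrite -normrN ler_norm.
have h2 : (4 * n + 2) * (2^-1 * I1 + XX - YY) <=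
    (4 * n + 2) * (2^-1 * (n * (c * e) ^+ 2) + r * (q + e * t) + D3 * q).
  by rewrite ler_wpM2l// -!addrA lerD ?lerD// ler_wpM2l.
have h3 : (4 * n + 2) * (2^-1 * (n * (c * e) ^+ 2) + r * (q + e * t) + D3 * q) <=
    (4 * n + 2) * (r + D3) * q + e * ((4 * n + 2) * (n * c ^+ 2 + r * T)).
  rewrite (_ : _ + e * _ = (4 * n + 2) * (e * (n * c ^+ 2) + r * (q + e * T) + D3 * q)); last ring.
  rewrite ler_wpM2l// lerD2r lerD//; last by rewrite ler_wpM2l// lerD2l ler_wpM2l.
  have nc : 0 <= n * c ^+ 2 by rewrite mulr_ge0// exprn_ge0.
  have : n * c ^+ 2 * e ^+ 2 <= n * c ^+ 2 * e by rewrite ler_wpM2l.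
  have : 0 <= n * c ^+ 2 * e by rewrite mulr_ge0.
  by rewrite exprMn; lra.
have h4 : 2 * (n * c * e) ^+ 2 <= e * (2 * (n * c) ^+ 2).
  rewrite (_ : 2 * (n * c * e) ^+ 2 = 2 * (n * c) ^+ 2 * e ^+ 2); last ring.
  by rewrite [leRHS]mulrC ler_wpM2l// mulr_ge0// sqr_ge0.
move: h1 h2 h3 h4 ee Qt ntr I0 e0.
set X1 := (4 * n + 2) * (2^-1 * I1 + XX - YY); set X2 := (4 * n + 2) * (_ + _ + D3 * q).
set X3 := (4 * n + 2) * (r + D3) * q; set X4 := (4 * n + 2) * (n * c ^+ 2 + r * T).
set X5 := (n * c * e) ^+ 2; set X6 := (n * c) ^+ 2.
lra.
Qed.

Lemma rate_arith (R : realFieldType) (C0 D0 CA k0 M e G P Q CG T st : R) :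
  0 <= C0 -> 0 <= D0 -> 0 <= CA -> 0 <= k0 -> 0 <= M -> 0 <= e -> e <= 1 ->
  0 <= G -> G <= CG -> 0 <= P -> P <= T * CG -> P * G <= T * st -> Q <= st -> 0 <= st -> 0 <= T ->
  (C0 * e + CA * P + D0 * e) * (G + k0 * e) + M * (2 * Q + 2 * (k0 * e) ^+ 2) <=
  (CA * T + 2 * M + (C0 + D0) * (CG + k0) + CA * (T * CG) * k0 + 2 * M * k0 ^+ 2) * (st + e).
Proof.
move=> C00 D00 CA0 k00 M0 e0 e1 G0 GC P0 PC PG Qs st0 T0.
have CG0 : 0 <= CG := le_trans G0 GC.
have ee : e ^+ 2 <= e by rewrite expr2 ler_piMl.
have CD : 0 <= C0 + D0 := addr_ge0 C00 D00.
have h1 : (C0 + D0) * (e * G) <= (C0 + D0) * (CG * e).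
  by rewrite ler_wpM2l// mulrC ler_wpM2r.
have h2 : CA * (P * G) <= CA * (T * st) by rewrite ler_wpM2l.
have h3 : (C0 + D0) * k0 * e ^+ 2 <= (C0 + D0) * k0 * e by rewrite ler_wpM2l// mulr_ge0.
have h4 : CA * k0 * e * P <= CA * k0 * e * (T * CG) by rewrite ler_wpM2l// !mulr_ge0.
have h5 : 2 * M * Q <= 2 * M * st by rewrite ler_wpM2l// mulr_ge0.
have h6 : 2 * M * k0 ^+ 2 * e ^+ 2 <= 2 * M * k0 ^+ 2 * e by rewrite ler_wpM2l// !mulr_ge0// exprn_ge0.
have p1 : 0 <= (CA * T + 2 * M) * e by rewrite mulr_ge0// addr_ge0// mulr_ge0.
have p2 : 0 <= ((C0 + D0) * (CG + k0) + CA * (T * CG) * k0 + 2 * M * k0 ^+ 2) * st.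
  rewrite mulr_ge0// !addr_ge0//; first by rewrite mulr_ge0// addr_ge0.
    by rewrite !mulr_ge0.
  by rewrite mulr_ge0 ?mulr_ge0// exprn_ge0.
rewrite -subr_ge0 (_ : _ - _ =
   ((C0 + D0) * (CG * e) - (C0 + D0) * (e * G)) + (CA * (T * st) - CA * (P * G)) +
   ((C0 + D0) * k0 * e - (C0 + D0) * k0 * e ^+ 2) + (CA * k0 * e * (T * CG) - CA * k0 * e * P) +
   (2 * M * st - 2 * M * Q) + (2 * M * k0 ^+ 2 * e - 2 * M * k0 ^+ 2 * e ^+ 2) +
   (CA * T + 2 * M) * e + ((C0 + D0) * (CG + k0) + CA * (T * CG) * k0 + 2 * M * k0 ^+ 2) * st).
  lra.
ring.
Qed.

Lemma Rint_combine {R : realType} dd (X : measurableType dd) (m : {measure set X -> \bar R})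
  (D : set X) (k1 k2 k3 k4 : X -> R) (c : R) : measurable D ->
  m.-integrable D (EFin \o k1) -> m.-integrable D (EFin \o k2) ->
  m.-integrable D (EFin \o k3) -> m.-integrable D (EFin \o k4) ->
  \int[m]_(x in D) (k1 x - k2 x - k3 x - c * k4 x) =
  \int[m]_(x in D) k1 x - \int[m]_(x in D) k2 x - \int[m]_(x in D) k3 x - c * \int[m]_(x in D) k4 x.
Proof.
move=> mD i1 i2 i3 i4; have i4' := integrableZr mD c i4.
have i12 := integrableBr mD i1 i2.
have i123 := integrableBr mD i12 i3.
by rewrite RintegralB// RintegralB// RintegralB// RintegralZl.
Qed.

Section steps.
Context {R : realType}.
Local Notation leb := (@lebesgue_measure R).

(** The majorants in time of the Gronwall argument: once the relative energy is known
    to vanish up to time a, it is bounded by eta afterwards. *)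
Definition step (a eta s : R) : R := if s <= a then 0 else eta.

Lemma step_bounds a eta s : 0 <= eta -> 0 <= step a eta s <= eta.
Proof. by rewrite /step => e0; case: ifP; rewrite lexx e0. Qed.

Lemma measurable_step a eta : measurable_fun setT (step a eta).
Proof.
rewrite (_ : step a eta = fun s => eta * \1_(`]a, +oo[%classic) s).
  by apply: measurable_funM => //; apply: measurable_indic; exact: measurable_itv.
apply/funext => s; rewrite /step indicE; case: leP => sa.
  by rewrite memNset ?mulr0//= in_itv/= andbT; apply/negP; rewrite -leNgt.
by rewrite mem_set ?mulr1//= in_itv/= andbT.
Qed.

Lemma step_integrable a eta t : 0 <= eta -> leb.-integrable `[0, t] (EFin \o step a eta).
Proof.
move=> e0; apply: (@bounded_integrable _ _ _ _ _ _ _ eta) => //.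
- exact: leb_itv_cc.
- exact: measurable_funTS (measurable_step _ _).
- by move=> s _; have /andP[h1 h2] := step_bounds a s e0; rewrite ger0_norm.
Qed.

Lemma Rint_step a eta t : 0 <= eta -> 0 <= a <= t ->
  \int[leb]_(s in `[0, t]) step a eta s = eta * (t - a).
Proof.
move=> e0 at_; have := Rint_increment at_ (step_integrable a t e0).
have -> : \int[leb]_(x in `[0, a]) step a eta x = 0.
  transitivity (\int[leb]_(x in `[0, a]) (0 : R)); last by rewrite Rintegral_cst// mul0r.
  apply: eq_Rintegral => x; by rewrite inE/= in_itv/= => /andP[_ xa]; rewrite /step xa.
rewrite subr0 => ->; case/andP: at_ => _ at_; rewrite -(Rint_itv_cst _ at_).
apply: eq_Rintegral => x; rewrite inE/= in_itv/= => /andP[ax _].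
by rewrite /step leNgt ax.
Qed.

End steps.

Section relative_energy.
Context {R : realType} {d : nat}.
Local Notation V := 'rV[R]_d.
Local Notation leb := (@lebesgue_measure R).
Variables (T : R) (K : V -> R) (K0 : R).
Hypothesis T0 : 0 < T.
Hypothesis K_cont : continuous (hess K).
Hypothesis K00 : 0 <= K0.
Hypothesis KK0 : forall x i j, `|hess K x i j| <= K0.
Hypothesis K_even : forall x, hess K (- x) = hess K x.
Hypothesis K_psd : forall x, pos_semidef (hess K x).
Variables (rho0 : probability V R) (rho : R -> probability V R).
Hypothesis rho_flat : flat_continuous T rho.
Local Notation l := (fun t => rho (clamp T t)).
Variables (u0 : V -> V) (u w b : R -> V -> V) (mu : R -> @mx_charge R d) (Mu M c0 : R).
Hypothesis mw : measurable_fun setT (fun z : R * V => w z.1 z.2).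
Hypothesis Mu0 : 0 <= Mu.
Hypothesis wMu : forall t, (\int[l t]_x (normv (w t x) ^+ 2)%:E <= Mu%:E)%E.
Hypothesis wE : {ae leb, forall t, 0 <= t <= T -> w t = u t}.
Hypothesis mu0 : measurable_fun setT u0.
Hypothesis u0_c : (\int[rho0]_x (normv (u0 x) ^+ 2)%:E <= c0%:E)%E.
Hypothesis energy : energy_inequalities T K rho0 u0 rho u mu.
Hypothesis momentum : weak_momentum T K rho0 u0 rho u mu.
Hypothesis weak_w : forall C t psi psit psix, 0 <= t <= T -> smooth psi psit psix ->
    bounded_on T C psi psit psix ->
    \int[l t]_x psi t x - \int[rho0]_x psi 0 x =
    \int[leb]_(tau in `[0, t]) \int[l tau]_x flux w psit psix tau x.
Hypothesis bc : continuous (fun z : R * V => b z.1 z.2).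
Hypothesis M0 : 0 <= M.
Hypothesis bM : forall t x k, `|b t x 0 k| <= M.
Local Notation J := (pair_int T rho).
Local Notation PGap := (PGap T rho b w).
Local Notation Gap := (Gap T rho b w).
Local Notation Qgap := (Qgap T rho w b).
Variables (A : 'I_d -> R -> V -> R) (C0 : R).
Hypothesis C00 : 0 <= C0.

(** The relative energy inequality along an approximate field, before any estimate of
    its right side. *)
Lemma field_energy : {ae leb, forall t, t \in `]0, T[ ->
  forall f ft fx e C, approx_field T b A M C0 e f ft fx -> M <= C ->
  (forall k s x, `|ft k s x| <= C) -> (forall k j s x, `|fx k j s x| <= C) ->
  2^-1 * \int[l t]_x (\sum_k (w t x 0 k - f k t x) ^+ 2) + 2^-1 * trR (mu t) <=
  2^-1 * \int[rho0]_x (\sum_k (u0 x 0 k - f k 0 x) ^+ 2)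
  + \int[leb]_(s in `[0, t]) J (energy_rate K w f ft fx) s
  - \int[leb]_(s in `[0, t]) mx_integral (mu s) (fun x => \matrix_(i, j) fx i j s x)}.
Proof.
have E := energy_clean T0 K_cont KK0 rho_flat mw Mu0 wMu wE mu0 u0_c energy.
have P := momentum_clean T0 K_cont KK0 rho_flat mw Mu0 wMu wE momentum.
apply: ae_mono (ae_and E P) => t [{}E {}P] tT f ft fx e C af MC ftC fxC.
have {}E := E tT.
have tTT : 0 <= t <= T by move: tT; rewrite in_itv/= => /andP[? ?]; rewrite !ltW.
have sf := af_smooth af.
have fC k s x : `|f k s x| <= C := le_trans (af_le af k s x) MC.
have C'0 : 0 <= C := le_trans M0 MC.
have {}P := P tT f ft fx C C'0 sf fC ftC fxC.
have S := square_balance T0 rho_flat mw Mu0 wMu sf fC ftC fxC weak_w tTT.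
have mf s k : measurable_fun setT (f k s) := smooth_measurable s (sf k).
have e1 := energy_square (f := fun k => f k t) (mwt mw t) C'0 (wMu t) (mf t) (fun k => fC k t).
have e2 := energy_square (f := fun k => f k 0) mu0 C'0 u0_c (mf 0) (fun k => fC k 0).
have g1 := growth_square_flux mw sf fC ftC fxC t.
have g2 := growth_momentum_flux mw sf ftC fxC t.
have g3 := growth_power K_cont KK0 mw sf fC t.
have g4 := growth_dissipation K_cont KK0 mw t.
have i1 := pair_int_time_integrable T0 rho_flat mw Mu0 wMu g1.
have i2 := pair_int_time_integrable T0 rho_flat mw Mu0 wMu g2.
have i3 := pair_int_time_integrable T0 rho_flat mw Mu0 wMu g3.
have i4 := pair_int_time_integrable T0 rho_flat mw Mu0 wMu g4.
have RE : \int[leb]_(s in `[0, t]) J (energy_rate K w f ft fx) s =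
   \int[leb]_(s in `[0, t]) J (square_flux w f ft fx) s
   - \int[leb]_(s in `[0, t]) J (momentum_flux w ft fx) s
   - \int[leb]_(s in `[0, t]) J (pair_form K (fun s x _ => \row_k f k s x) (fun s x y => w s y - w s x)) s
   - 2^-1 * \int[leb]_(s in `[0, t]) J (dissipation K w) s.
  apply: etrans (Rint_combine 2^-1 _ i1 i2 i3 i4); last exact: measurable_itv.
  apply: eq_Rintegral => s; rewrite inE/= in_itv/= => st.
  have j1 := pair_int_integrable mw wMu g1 st.
  have j2 := pair_int_integrable mw wMu g2 st.
  have j3 := pair_int_integrable mw wMu g3 st.
  have j4 := pair_int_integrable mw wMu g4 st.
  exact: (Rint_combine 2^-1 measurableT j1 j2 j3 j4).
by rewrite RE; exact: (balance_arith E P S e1 e2).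
Qed.

Hypothesis mupos : {ae leb, forall t, t \in `]0, T[ -> mx_pos_sym (mu t)}.
Hypothesis approx : forall e, 0 < e -> exists f ft fx, approx_field T b A M C0 e f ft fx.
Variable CA : R.
Hypothesis CA0 : 0 <= CA.
Hypothesis A_close : forall s x k, 0 <= s < T ->
  `|A k s x - alignment K (l s) (b s) x 0 k| <= CA * PGap s.
Hypothesis b0 : {ae rho0, forall x, b 0 x = u0 x}.

Lemma initial_defect f ft fx e : 0 < e -> 4 * e <= T -> approx_field T b A M C0 e f ft fx ->
  \int[rho0]_x (\sum_k (u0 x 0 k - f k 0 x) ^+ 2) <= d%:R * (C0 * e) ^+ 2.
Proof.
move=> e0 eT af; have mf k : measurable_fun setT (f k 0) := smooth_measurable 0 (af_smooth af k).
have msq (q : V -> V) : measurable_fun setT q ->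
    measurable_fun setT (fun x => \sum_k (q x 0 k - f k 0 x) ^+ 2).
  move=> mq; apply: measurable_sum => k; apply: measurable_funX; apply: measurable_funB => //.
  exact: measurable_rV_coord mq.
have -> : \int[rho0]_x (\sum_k (u0 x 0 k - f k 0 x) ^+ 2) = \int[rho0]_x (\sum_k (b 0 x 0 k - f k 0 x) ^+ 2).
  apply: ae_eq_Rintegral => //; [exact: msq|exact: msq (mbt bc 0)|].
  by apply: ae_mono b0 => x ->.
apply: le_trans (ler_norm _) _; apply: prob_le; first exact: msq (mbt bc 0).
move=> x; apply: norm_sum_le => k; rewrite normrX distrC lerXn2r// ?nnegrE ?mulr_ge0// ?(ltW e0)//.
apply: (af_close af); rewrite lexx/=; lra.
Qed.

(** The gap to b is compared with the defect to f, at distance C0 e. *)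
Lemma Qgap_defect f ft fx e t : 0 < e -> 0 <= t <= T - 4 * e -> approx_field T b A M C0 e f ft fx ->
  Qgap t <= 2 * d%:R * \int[l t]_x (\sum_k (w t x 0 k - f k t x) ^+ 2) + 2 * kappa (d := d) C0 e ^+ 2.
Proof.
move=> e0 tT af; have t0 : 0 <= t by case/andP: tT.
have gd : growth w t 2 (fun s x (_ : V) => \sum_k (w s x 0 k - f k s x) * (w s x 0 k - f k s x)).
  apply: growth_sum => k.
  by apply: (@growthM _ _ _ _ 1 1); exact: (growth_wf mw af (lexx M) t k).
have tt : 0 <= t <= t by rewrite t0 lexx.
have id_ : (l t).-integrable setT (EFin \o (fun x => \sum_k (w t x 0 k - f k t x) ^+ 2)).
  have := pair_int_section mw wMu (growth_swap gd) 0 tt.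
  by apply: eq_integrable => // x _; congr EFin; apply: eq_bigr => k _; rewrite expr2.
have i2 := integrableZr measurableT (2 * d%:R) id_.
have ic : (l t).-integrable setT (EFin \o (fun _ : V => 2 * kappa (d := d) C0 e ^+ 2)).
  exact: finite_measure_integrable_cst.
rewrite -RintegralZl// -(prob_cst (l t) (2 * kappa (d := d) C0 e ^+ 2)) -RintegralD//.
apply: le_Rintegral => //; [exact: (gap_sq_integrable mw wMu bc bM t0)|exact: integrableDr|].
move=> x _; set S := \sum_k _.
pose a k := `|w t x 0 k - f k t x|.
have gS : gap b w t x <= \sum_k a k + kappa (d := d) C0 e.
  have -> : kappa (d := d) C0 e = \sum_(k < d) C0 * e by rewrite sumr_const card_ord -(mulr_natl (C0 * e)).
  rewrite /gap -big_split/=; apply: ler_sum => k _.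
  by apply: le_trans (ler_distD (f k t x) _ _) _; rewrite lerD2l; exact: (af_close af).
have aS : (\sum_k a k) ^+ 2 <= d%:R * S.
  apply: le_trans (sum_sqr_le a) _; rewrite ler_wpM2l// /S; apply: ler_sum => k _.
  by rewrite /a real_normK// num_real.
have k0 : 0 <= kappa (d := d) C0 e by rewrite !mulr_ge0// ltW.
have a0 : 0 <= \sum_k a k by apply: sumr_ge0 => k _; exact: normr_ge0.
apply: (@le_trans _ _ ((\sum_k a k + kappa (d := d) C0 e) ^+ 2)).
  by rewrite lerXn2r// nnegrE ?gap_ge0// addr_ge0.
have := sqr_ge0 (\sum_k a k - kappa (d := d) C0 e); rewrite sqrrB sqrrD -mulrA; lra.
Qed.

Definition rate_cst : R :=
  CA * T + 2 * M + (C0 + 2 * d%:R * C0 * K0) * (@gap_bound R d M Mu + d%:R * C0)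
  + CA * (T * @gap_bound R d M Mu) * (d%:R * C0) + 2 * M * (d%:R * C0) ^+ 2.

Definition relative_cst : R := (4 * d%:R + 2) * (rate_cst + d%:R * (d%:R * (3 * M))).

Lemma rate_cst_ge0 : 0 <= rate_cst.
Proof.
have cg : 0 <= @gap_bound R d M Mu by rewrite !mulr_ge0// addr_ge0.
have T0' := ltW T0.
by rewrite /rate_cst; repeat (apply: addr_ge0 || apply: mulr_ge0 || apply: exprn_ge0 => // || done).
Qed.

Lemma relative_cst_ge0 : 0 <= relative_cst.
Proof. by have := rate_cst_ge0 => h; rewrite mulr_ge0// addr_ge0// ?mulr_ge0. Qed.

(** The gap at each time is at most the square root of [Qgap]. *)
Lemma integrated_gap_le_sqrt a eta t s : 0 <= eta -> t < T -> 0 <= s <= t ->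
  {ae leb, forall s, 0 <= s <= t -> Qgap s <= step a eta s} -> PGap s <= T * Num.sqrt eta.
Proof.
move=> e0 tT /andP[s0 st] H.
apply: (@le_trans _ _ (\int[leb]_(x in `[0, s]) Num.sqrt eta)); last first.
  rewrite Rintegral_cst// mulrC ler_wpM2r ?sqrtr_ge0//.
  have := lebesgue_measure_itv (`[0, s]); rewrite /= lte_fin => ->.
  by case: ifP => _ /=; rewrite ?oppr0 ?addr0 ?(ltW T0)//; lra.
apply: ae_le_Rintegral => //.
- exact: (Gap_integrable T0 rho_flat bc M0 bM mw wMu).
- apply: (@bounded_integrable _ _ _ _ _ _ _ `|Num.sqrt eta|) => //; exact: leb_itv_cc.
- apply: ae_mono H => x H; rewrite /= in_itv/= => /andP[x0 xs].
  have {}H := H _; have xt : 0 <= x <= t by rewrite x0 (le_trans xs).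
  have Q := H xt; have G0 := Gap_ge0 T rho b w x.
  have Gs := Gap_sq_le mw wMu bc M0 bM x0.
  have /andP[_ se] := step_bounds a x e0.
  rewrite -(ger0_norm G0) -sqrtr_sqr ler_wsqrtr//.
  exact: le_trans Gs (le_trans Q se).
Qed.

(** Everything on the right side of [field_energy] is of first order in the majorant,
    up to O(e): the error sigma = CA * PGap caused by the distance between rho and r
    is only of order sqrt(eta), but it is multiplied by the gap, which is of order
    sqrt(eta) as well. Then e -> 0. *)
Lemma relative_energy : {ae leb, forall t, t \in `]0, T[ ->
  forall a eta, 0 <= a <= t -> 0 <= eta ->
  {ae leb, forall s, 0 <= s <= t -> Qgap s <= step a eta s /\ trR (mu s) <= step a eta s} ->
  Qgap t + trR (mu t) <= relative_cst * (eta * (t - a))}.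
Proof.
apply: ae_mono (ae_and field_energy mupos) => t [FE MP] tin a eta at_ eta0 H.
have {}FE := FE tin; have {}MP := MP tin.
move: (tin); rewrite in_itv/= => /andP[t0 tT].
have cg : 0 <= @gap_bound R d M Mu by rewrite !mulr_ge0// addr_ge0.
have R0 := rate_cst_ge0.
apply/ler_addgt0Pr => eps eps0.
pose C4 := (4 * d%:R + 2) * (d%:R * C0 ^+ 2 + rate_cst * T) + 2 * (d%:R * C0) ^+ 2.
have C40 : 0 <= C4.
  by rewrite addr_ge0// ?mulr_ge0// ?exprn_ge0 ?mulr_ge0// ?addr_ge0// ?mulr_ge0// ?exprn_ge0// ltW.
have C41 : 0 < C4 + 1 by rewrite ltr_pwDr.
have [|e e0 /= /and4P[h1 h2 h3 _]] := @small_pos R [:: 1; (T - t) / 4; eps / (C4 + 1)].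
  by rewrite /= ltr01 !divr_gt0// subr_gt0.
have tT4 : t <= T - 4 * e by lra.
have eT4 : 4 * e <= T by lra.
have [f [ft [fx af]]] := approx e0.
have [C' C'0 HC'] := af_global af.
have MC : M <= C' + M by rewrite lerDr.
have ftC k s x : `|ft k s x| <= C' + M by apply: le_trans (HC' k s x).1 _; rewrite lerDl.
have fxC k j s x : `|fx k j s x| <= C' + M by apply: le_trans ((HC' k s x).2 j) _; rewrite lerDl.
have {}FE := FE f ft fx e _ af MC ftC fxC.
have I0 := initial_defect e0 eT4 af.
have t4 : 0 <= t <= T - 4 * e by rewrite ltW.
have Qt := Qgap_defect e0 t4 af.
have tr0 := trR_ge0 MP.
have stepT := Rint_step eta0 at_.
have istep := step_integrable a t eta0.
have X : \int[leb]_(s in `[0, t]) J (energy_rate K w f ft fx) s <=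
    rate_cst * (eta * (t - a) + e * t).
  have ice : leb.-integrable `[0, t] (EFin \o (fun _ => e)).
    apply: (@bounded_integrable _ _ _ _ _ _ _ `|e|) => //; exact: leb_itv_cc.
  have ise : leb.-integrable `[0, t] (EFin \o (fun s => step a eta s + e)) by apply: integrableDr.
  have -> : rate_cst * (eta * (t - a) + e * t) = \int[leb]_(s in `[0, t]) (rate_cst * (step a eta s + e)).
    rewrite RintegralZl// RintegralD// stepT Rintegral_cst//; congr (_ * (_ + e * _)).
    by have := lebesgue_measure_itv (`[0, t]); rewrite /= lte_fin t0 => ->; rewrite /= oppr0 addr0.
  apply: ae_le_Rintegral => //.
  - apply: (pair_int_time_integrable T0 rho_flat mw Mu0 wMu).
    exact: (growth_energy_rate K_cont KK0 mw af ftC fxC MC t).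
  - by apply: integrableZr.
  have HQ : {ae leb, forall s, 0 <= s <= t -> Qgap s <= step a eta s}.
    by apply: ae_mono H => s Hs st; have [] := Hs st.
  apply: ae_mono (HQ) => s Q; rewrite /= in_itv/= => st; have {}Q := Q st.
  have /andP[s0 s1] := st.
  have sT : 0 <= s < T by rewrite s0 (le_lt_trans s1).
  have P0 : 0 <= PGap s := PGap_ge0 T rho b w s.
  have sg0 : 0 <= CA * PGap s by rewrite mulr_ge0.
  have B := energy_rate_bound K_cont KK0 K_even K_psd mw wMu bc M0 bM af ftC fxC MC C00 e0 st tT4
    (fun k x => A_close x k sT) sg0.
  apply: le_trans B _.
  have /andP[st0 ste] := step_bounds a s eta0.
  have G0 : 0 <= Gap s := Gap_ge0 T rho b w s.
  have GC : Gap s <= @gap_bound R d M Mu.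
    by have [_] := gap_integrable bc M0 bM mw wMu s; apply: le_trans; exact: ler_norm.
  have Gs := le_trans (Gap_sq_le mw wMu bc M0 bM s0) Q.
  have PC : PGap s <= T * @gap_bound R d M Mu.
    apply: (@le_trans _ _ (\int[leb]_(x in `[0, s]) @gap_bound R d M Mu)); last first.
      rewrite Rintegral_cst// mulrC ler_wpM2r//.
      have := lebesgue_measure_itv (`[0, s]); rewrite /= lte_fin => ->.
      by case: ifP => _ /=; rewrite ?oppr0 ?addr0 ?(ltW T0)//; lra.
    apply: le_Rintegral => //.
    - exact: (Gap_integrable T0 rho_flat bc M0 bM mw wMu).
    - apply: (@bounded_integrable _ _ _ _ _ _ _ `|@gap_bound R d M Mu|) => //; exact: leb_itv_cc.
    - move=> x _; have [_] := gap_integrable bc M0 bM mw wMu x.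
      by apply: le_trans; exact: ler_norm.
  (* both factors are at most sqrt(eta), and the gap vanishes before time a *)
  have PG : PGap s * Gap s <= T * step a eta s.
    have Gsq : Gap s <= Num.sqrt (step a eta s).
      by rewrite -(ger0_norm G0) -sqrtr_sqr ler_wsqrtr.
    have Ps := integrated_gap_le_sqrt eta0 tT st HQ.
    move: Gsq; rewrite /step; case: ifP => _ Gsq.
      have -> : Gap s = 0 by apply/eqP; rewrite eq_le G0 andbT; rewrite sqrtr0 in Gsq.
      by rewrite !mulr0.
    apply: le_trans (ler_pM P0 G0 Ps Gsq) _.
    by rewrite -mulrA -expr2 sqr_sqrtr.
  have := rate_arith C00 (D0 := 2 * d%:R * C0 * K0) (k0 := d%:R * C0) _ CA0 _ M0 (ltW e0) h1 G0 GC P0 PC PG Q st0 (ltW T0).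
  rewrite (_ : kappa C0 e = d%:R * C0 * e); last by rewrite /kappa mulrA.
  rewrite (_ : d%:R * (2 * (C0 * e) * K0) = 2 * d%:R * C0 * K0 * e); last ring.
  by apply; rewrite !mulr_ge0.
(* mu pairs with a gradient bounded by M, and its entries are dominated by its trace *)
have Y : `|\int[leb]_(s in `[0, t]) mx_integral (mu s) (fun x => \matrix_(i, j) fx i j s x)| <=
    d%:R * (d%:R * (3 * M)) * (eta * (t - a)).
  rewrite -stepT -RintegralZl//; apply: ae_normr_Rintegral_nonmeas => //.
  - by apply: integrableZr.
  - by move=> s; have /andP[h _] := step_bounds a s eta0; rewrite !mulr_ge0.
  apply: ae_mono (ae_and H (ae_and mupos (ae_neq 0))) => s [Hs [mps s0']]; rewrite /= in_itv/= => st.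
  have [_ trs] := Hs st; have /andP[s0 s1] := st.
  have mps' : mx_pos_sym (mu s).
    by apply: mps; rewrite in_itv/= lt_neqAle eq_sym s0' s0 (le_lt_trans s1).
  apply: (@le_trans _ _ (d%:R * (d%:R * (3 * M * trR (mu s))))).
    apply: (mx_integral_bound mps') => [i j x|x i j].
      rewrite (_ : (fun x => _) = fx i j s); last by apply/funext => y; rewrite mxE.
      have [_ _ c _ _] := af_smooth af i.
      exact: (@continuous_comp _ _ _ (pair s) (fun z : R * V => fx i j z.1 z.2) x (@continuous_pairl _ _ s x) (c j _)).
    by rewrite mxE; apply: (af_x af); rewrite s0 (le_trans s1).
  rewrite -!mulrA !ler_wpM2l//.
have kE : kappa (d := d) C0 e = d%:R * C0 * e by rewrite /kappa mulrA.
move: FE Qt X Y I0; rewrite kE /relative_cst.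
set I := \int[l t]_x _; set I1 := \int[rho0]_x _; set XX := \int[leb]_(s in _) J _ s.
set YY := \int[leb]_(s in _) mx_integral _ _; set Q := Qgap t; set tr := trR _.
have I_ge0 : 0 <= I by apply: Rintegral_ge0 => x _; apply: sumr_ge0 => k _; exact: sqr_ge0.
set q := eta * (t - a) => FE Qt X Y I0.
have eps1 : e * (C4 + 1) <= eps by rewrite -ler_pdivlMr.
by apply: (relative_arith _ C00 R0 (ltW e0) h1 (ltW t0) (ltW tT) I_ge0 tr0 FE Qt X Y I0 eps1).
Qed.

End relative_energy.

(** * A Gronwall lemma *)

Section gronwall.
Context {R : realType}.
Local Notation leb := (@lebesgue_measure R).

(** On a time interval of length h with C h <= 1 / 2, every bound eta of y improves to
    eta / 2, so y <= 0 there; the interval then starts at a + h. The bounds are step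
    functions, whose integral eta (t - a) is explicit. *)
Lemma gronwall_steps (y : R -> R) (C B T : R) : 0 <= C -> 0 <= B ->
  {ae leb, forall t, t \in `]0, T[ -> y t <= B} ->
  {ae leb, forall t, t \in `]0, T[ -> forall a eta, 0 <= a <= t -> 0 <= eta ->
     {ae leb, forall s, 0 <= s <= t -> y s <= step a eta s} -> y t <= C * (eta * (t - a))} ->
  {ae leb, forall t, t \in `]0, T[ -> y t <= 0}.
Proof.
move=> C0 B0 yB H.
pose h := (2 * (C + 1))^-1.
have C1 : 0 < C + 1 by rewrite ltr_pwDr.
have h0 : 0 < h by rewrite invr_gt0 mulr_gt0.
have Ch : C * h <= 2^-1.
  by rewrite /h invfM mulrCA ler_piMr// ler_pdivrMr// mul1r lerDl.
suff P n : {ae leb, forall t, t \in `]0, T[ -> t <= n%:R * h -> y t <= 0}.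
  have [N TN] : exists N : nat, T <= N%:R * h.
    exists (Num.truncn `|T / h|).+1; rewrite -ler_pdivrMr//.
    by apply: le_trans (ler_norm _) (ltW _); exact: truncnS_gt.
  apply: ae_mono (P N) => t yt tT; apply: yt => //; apply: le_trans TN.
  by move: tT; rewrite in_itv/= => /andP[_ /ltW].
elim: n => [|n IH].
  by apply/aeW => t; rewrite in_itv/= mul0r leNgt => /andP[->].
set a := n%:R * h in IH.
have a0 : 0 <= a by rewrite mulr_ge0// ltW.
have Sn : n.+1%:R * h = a + h by rewrite -natr1 mulrDl mul1r.
(* k halvings of the a priori bound B on the interval ]a, a + h] *)
suff Q k : {ae leb, forall t, t \in `]0, T[ -> t <= a + h -> y t <= step a (B / 2 ^+ k) t}.
  have : {ae leb, forall t, forall k, t \in `]0, T[ -> t <= a + h -> y t <= step a (B / 2 ^+ k) t}.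
    exact/ae_foralln.
  apply: ae_mono => t Qt tT tah; apply/ler_addgt0Pr => e e0; rewrite add0r.
  have [k] : exists k : nat, B / 2 ^+ k <= e.
    exists (Num.truncn (B / e)).+1; rewrite ler_pdivrMr ?exprn_gt0// -ler_pdivrMl// mulrC.
    apply: le_trans (ltW (truncnS_gt _)) _.
    by rewrite -natrX ler_nat ltnW// ltn_expl.
  move=> ke; rewrite Sn in tah; apply: le_trans (Qt k tT tah) _.
  rewrite /step; case: ifP => // _; exact: ltW.
elim: k => [|k IHk].
  apply: ae_mono (ae_and IH yB) => t [y0 yb] tT tah; rewrite /step expr0 divr1; case: ifP => ta.
    exact: y0.
  exact: yb.
have eta0 : 0 <= B / 2 ^+ k by rewrite mulr_ge0// invr_ge0 exprn_ge0.
apply: ae_mono (ae_and IH H) => t [y0 Ht] tT tah; rewrite /step; case: ifP => ta; first exact: y0.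
move/negbT: ta; rewrite -ltNge => ta.
have atT : 0 <= a <= t by rewrite a0 ltW.
have := Ht tT a (B / 2 ^+ k) atT eta0.
have tT' : t < T by move: tT; rewrite in_itv/= => /andP[].
move=> /(_ _)/le_trans; apply.
  apply: ae_mono (ae_and IHk (ae_neq 0)) => s [ys s0] /andP[s1 s2].
  apply: ys; first by rewrite in_itv/= lt_neqAle eq_sym s0 s1/= (le_lt_trans s2).
  exact: le_trans tah.
apply: (@le_trans _ _ (C * (B / 2 ^+ k * h))).
  by rewrite ler_wpM2l// ler_wpM2l//; lra.
rewrite (_ : C * _ = B / 2 ^+ k * (C * h)); last ring.
by rewrite exprSr invfM [leRHS]mulrA ler_wpM2l.
Qed.

End gronwall.

(** * Uniqueness *)

Section measures_and_densities.
Context {R : realType} {d : nat}.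
Local Notation V := 'rV[R]_d.
Local Notation leb := (@lebesgue_measure R).
Local Notation lebd := (@lebesgue_rV R d).

(** The integral of a positive density over a set vanishes only if the set is null. *)
Lemma density_ae_converse (m : probability V R) (P : V -> Prop) : has_positive_density m ->
  {ae m, forall x, P x} -> {ae lebd, forall x, P x}.
Proof.
move=> [f [mf f0 mE]] [N [mN mN0 PN]].
have : (\int[lebd]_(x in N) `|(f x)%:E| = 0)%E.
  rewrite -mN0 mE//; apply: eq_integral => x _; rewrite gee0_abs// lee_fin ltW//.
have mfN : measurable_fun N (EFin \o f) by apply/measurable_EFinP; exact: measurable_funTS.
move=> /(ae_eq_integral_abs lebd mN mfN); apply: ae_mono => x Nf.
apply: contrapT => nP; have Nx : N x by exact: PN.
by have := Nf Nx; rewrite /= => -[] fx; have := f0 x; rewrite fx ltxx.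
Qed.

Lemma ae_same_measure (m1 m2 : probability V R) (P : V -> Prop) :
  (forall A, measurable A -> m1 A = m2 A) -> {ae m1, forall x, P x} -> {ae m2, forall x, P x}.
Proof. by move=> m12 [N [mN N0 PN]]; exists N; split => //; rewrite -m12. Qed.

Lemma Rint_same_measure (m1 m2 : probability V R) (f : V -> R) :
  (forall A, measurable A -> m1 A = m2 A) -> \int[m1]_x f x = \int[m2]_x f x.
Proof. by move=> m12; congr fine; apply: eq_measure_integral => A mA _; exact: m12. Qed.

(** The functions of [box_measure_unique] are bounded and Lipschitz. *)
Lemma lipdist0_eq (m1 m2 : probability V R) : lipdist_le m1 m2 0 -> forall A, measurable A -> m1 A = m2 A.
Proof.
move=> D; apply: box_measure_unique; [exact: prob_fin|exact: prob_fin|].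
move=> f [_ _ [C C0 fC] _ f01].
have := D f C 1 C0 fC; rewrite mul0r => h.
apply/eqP; rewrite -subr_eq0 -normr_le0; apply: h => x.
by have /andP[h1 h2] := f01 x; rewrite ger0_norm.
Qed.

Variable T : R.
Hypothesis T0 : 0 < T.

(** Integrals of smooth functions are continuous up to the final time. *)
Lemma flat_limit_eq (m1 m2 : R -> probability V R) : flat_continuous T m1 -> flat_continuous T m2 ->
  (forall t, 0 <= t < T -> forall A, measurable A -> m1 t A = m2 t A) ->
  forall A, measurable A -> m1 T A = m2 T A.
Proof.
move=> f1 f2 m12; apply: box_measure_unique; [exact: prob_fin|exact: prob_fin|].
move=> f [cf _ _ [C C0 gC] f01].
have TT : 0 <= T <= T by rewrite lexx ltW.
pose c := 1 + d%:R * C.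
have c0 : 0 < c by rewrite ltr_pwDl// mulr_ge0.
have fc x : `|f x| <= c.
  by have /andP[h1 h2] := f01 x; rewrite ger0_norm// (le_trans h2)// lerDl mulr_ge0.
have gc x : normv (grad f x) <= c.
  by apply: le_trans (normv_le C0 (gC x)) _; rewrite lerDr.
have c1 := flat_integral_continuous T0 f1 c0 cf fc gc.
have c2 := flat_integral_continuous T0 f2 c0 cf fc gc.
pose g t := \int[m1 (clamp T t)]_x f x - \int[m2 (clamp T t)]_x f x.
have cg : continuous g by move=> t; apply: cvgB; [exact: c1|exact: c2].
suff : g T = 0 by rewrite /g clamp_id// => /eqP; rewrite subr_eq0 => /eqP.
have L : g x @[x --> T^'-] --> g T by apply: cvg_at_left_filter; exact: cg.
have Z : g x @[x --> T^'-] --> 0.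
  apply: cvg_near_cst; near=> x.
  have x0 : 0 < x by near: x; exact: nbhs_left_gt.
  have xT : x < T by near: x; exact: nbhs_left_lt.
  rewrite /g clamp_id ?(ltW x0) ?(ltW xT)//.
  by rewrite (Rint_same_measure f (m12 x _)) ?subrr// (ltW x0).
exact: (cvg_unique (@Rhausdorff R) L Z).
Unshelve. all: by end_near. Qed.

(** At time zero the weak formulation identifies integrals of C^1 functions;
    [lip_approx] passes to Lipschitz ones. *)
Lemma initial_lipdist (m1 m2 m0 : probability V R) :
  (forall h (hx : 'I_d -> V -> R) C, (forall x, `|h x| <= C) -> (forall i x, `|hx i x| <= C) ->
     (forall i x, is_derive x (delta_mx 0 i : V) h (hx i x)) -> (forall i, continuous (hx i)) ->
     \int[m1]_x h x = \int[m0]_x h x) ->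
  (forall A, measurable A -> m2 A = m0 A) -> lipdist_le m1 m2 0.
Proof.
move=> H m20 g L B L0 gL gB; rewrite mul0r (Rint_same_measure g m20).
have mg : measurable_fun setT g by apply: measurable_continuous_rV; exact: lipf_continuous gL.
have B0 : 0 <= B := le_trans (normr_ge0 _) (gB 0).
apply/ler_addgt0Pr => e e0; rewrite add0r.
pose dl := e / (2 * (L + 1)).
have L1 : 0 < L + 1 by rewrite ltr_pwDr.
have dl0 : 0 < dl by rewrite divr_gt0// mulr_gt0.
have Ldl : L * dl <= e / 2.
  rewrite /dl (_ : L * _ = e / 2 * (L / (L + 1))); last by field; rewrite gt_eqF.
  by rewrite ler_piMr// ?divr_ge0 ?(ltW e0)// ler_pdivrMr// mul1r lerDl.
have [h [hx [hB hg dh ch hxL]]] := lip_approx dl0 L0 gL gB.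
have ch0 : continuous h.
  by have [[dfh _] _] := C1_of_partials dh ch; move=> x; exact: differentiable_continuous.
have mh := measurable_continuous_rV ch0.
have hgd (p : probability V R) : `|\int[p]_x h x - \int[p]_x g x| <= e / 2.
  apply: le_trans Ldl; apply: prob_diff_le => //; [exact: prob_integrable hB|exact: prob_integrable gB].
have E : \int[m1]_x h x = \int[m0]_x h x.
  apply: (H h hx (B + 15 / 2 * L)) => // [x|i x].
    by apply: le_trans (hB x) _; rewrite lerDl mulr_ge0.
  by apply: le_trans (hxL i x) _; rewrite lerDr.
have h1 := hgd m1; have h2 := hgd m0.
apply: le_trans (ler_distD (\int[m1]_x h x) _ _) _; rewrite (splitr e); apply: lerD.
  by rewrite distrC.
by rewrite E.
Qed.

End measures_and_densities.

Section strong_velocity.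
Context {R : realType} {d : nat}.
Local Notation V := 'rV[R]_d.
Local Notation leb := (@lebesgue_measure R).
Local Notation lebd := (@lebesgue_rV R d).

(** For almost every time v = b holds r_t-almost everywhere, so v may be replaced by
    its continuous representative under the integrals. *)
Lemma transport_by_representative (T : R) (r : R -> probability V R) (v b : R -> V -> V) : 0 < T ->
  flat_continuous T r -> continuous (fun z : R * V => b z.1 z.2) ->
  {ae leb, forall t, t \in `]0, T[ -> {ae r t, forall x, v t x = b t x}} ->
  (forall psi psit psix, C1c_cylinder T psi psit psix ->
        \int[leb]_(t in `]0, T[)
          \int[r t]_x (psit t x + dotv (gradx psix t x) (v t x)) = 0) ->
  forall psi psit psix, smooth psi psit psix -> C1c_cylinder T psi psit psix ->
  \int[leb]_(t in `]0, T[) \int[r t]_x flux b psit psix t x = 0.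
Proof.
move=> T0 rflat bc vb H psi psit psix sp cp; apply: etrans (H _ _ _ cp); apply/esym.
have mfl := measurable_flux bc sp.
apply: ae_eq_Rintegral_nonmeas.
- exact: measurable_itv.
- apply: (eq_measurable_fun (fun t => \int[r (clamp T t)]_x flux b psit psix t x)).
    by move=> t; rewrite inE/= in_itv/= => /andP[t0 tT]; rewrite clamp_id// !ltW.
  apply: measurable_funTS.
  exact: (measurable_kernel_integral T0 rflat (k := fun z : R * V => flux b psit psix z.1 z.2) mfl).
- apply: ae_mono vb => t vt tT; apply: ae_eq_Rintegral_nonmeas => //.
    exact: (measurableT_comp (g := pair t) mfl).
  apply: ae_mono (vt tT) => x vx _; rewrite vx /flux /dotv; congr (_ + _).
  by apply: eq_bigr => i _; rewrite mxE.
Qed.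

End strong_velocity.

Section vanishing.
Context {R : realType} {d : nat}.
Local Notation V := 'rV[R]_d.
Local Notation leb := (@lebesgue_measure R).
Local Notation lebd := (@lebesgue_rV R d).
Variables (T : R) (K : V -> R) (K0 : R).
Hypothesis T0 : 0 < T.
Hypothesis K_cont : continuous (hess K).
Hypothesis KK0 : forall x i j, `|hess K x i j| <= K0.
Hypothesis K_psd : forall x, pos_semidef (hess K x).
Variables (rho0 : probability V R) (rho : R -> probability V R).
Hypothesis rho_flat : flat_continuous T rho.
Local Notation l := (fun t => rho (clamp T t)).
Variables (u0 : V -> V) (u w b : R -> V -> V) (mu : R -> @mx_charge R d) (Mu M c0 : R).
Hypothesis mw : measurable_fun setT (fun z : R * V => w z.1 z.2).
Hypothesis Mu0 : 0 <= Mu.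
Hypothesis wMu : forall t, (\int[l t]_x (normv (w t x) ^+ 2)%:E <= Mu%:E)%E.
Hypothesis bc : continuous (fun z : R * V => b z.1 z.2).
Hypothesis M0 : 0 <= M.
Hypothesis bM : forall t x k, `|b t x 0 k| <= M.

(** An a priori bound, with which the Gronwall argument starts. *)
Lemma Qgap_le t : Qgap T rho w b t <= 2 * d%:R * (1 + d%:R * M ^+ 2) * (1 + Mu).
Proof.
have dM : 0 <= d%:R * M ^+ 2 by rewrite mulr_ge0// exprn_ge0.
have mg : measurable_fun setT (fun x => gap b w t x ^+ 2).
  by apply: measurable_funX; exact: (measurableT_comp (g := pair t) (measurable_gap bc mw)).
have a0 : 0 <= 2 * d%:R * (1 + d%:R * M ^+ 2) by rewrite mulr_ge0// addr_ge0.
have [|_] := sq_dominated (mwt mw t) (wMu t) mg a0; last by apply: le_trans; exact: ler_norm.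
move=> x; rewrite ger0_norm ?sqr_ge0//; apply: le_trans (sum_sqr_le _) _.
have h : \sum_k `|w t x 0 k - b t x 0 k| ^+ 2 <= 2 * (normv (w t x) ^+ 2 + d%:R * M ^+ 2).
  have -> : d%:R * M ^+ 2 = \sum_(k < d) M ^+ 2 by rewrite sumr_const card_ord -(mulr_natl (M ^+ 2)).
  rewrite normv_sq -big_split/= mulr_sumr; apply: ler_sum => k _; rewrite real_normK ?num_real//.
  have bk : b t x 0 k ^+ 2 <= M ^+ 2.
    by rewrite -(real_normK (num_real (b t x 0 k))) lerXn2r// nnegrE.
  have := sqr_ge0 (w t x 0 k + b t x 0 k); rewrite sqrrB sqrrD; lra.
apply: le_trans (ler_wpM2l (ler0n _ _) h) _.
rewrite mulrCA -!mulrA ler_wpM2l// ler_wpM2l// mulrDl mul1r.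
have n0 : 0 <= normv (w t x) ^+ 2 := sqr_ge0 _.
have dn : 0 <= d%:R * M ^+ 2 * normv (w t x) ^+ 2 by rewrite mulr_ge0.
by move: dn; rewrite -!mulrA mulrDr mulr1; lra.
Qed.

Hypothesis wE : {ae leb, forall t, 0 <= t <= T -> w t = u t}.
Hypothesis mu0 : measurable_fun setT u0.
Hypothesis u0_c : (\int[rho0]_x (normv (u0 x) ^+ 2)%:E <= c0%:E)%E.
Hypothesis energy : energy_inequalities T K rho0 u0 rho u mu.

(** An a priori bound from the energy inequality, whose other terms are nonnegative. *)
Lemma trace_le : {ae leb, forall t, t \in `]0, T[ -> trR (mu t) <= c0}.
Proof.
apply: ae_mono (energy_clean T0 K_cont KK0 rho_flat mw Mu0 wMu wE mu0 u0_c energy) => t E tT.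
have {}E := E tT; have [_ u0c] := sq_integrable mu0 u0_c.
have h1 : 0 <= \int[l t]_x (normv (w t x) ^+ 2) by apply: Rintegral_ge0 => x _; exact: sqr_ge0.
have h2 : 0 <= \int[leb]_(s in `[0, t]) pair_int T rho (dissipation K w) s.
  by apply: Rintegral_ge0 => s _; apply: Rintegral_ge0 => z _; exact: K_psd.
move: E h1 h2 u0c; set X1 := \int[l t]_x _; set X2 := \int[leb]_(s in _) _; set X3 := \int[rho0]_x _.
lra.
Qed.

Hypothesis Qgap0 : {ae leb, forall t, t \in `]0, T[ -> Qgap T rho w b t <= 0}.

Lemma Gap_eq0 : {ae leb, forall t, t \in `]0, T[ -> Gap T rho b w t = 0}.
Proof.
apply: ae_mono Qgap0 => t Q tT; have {}Q := Q tT.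
have t0 : 0 <= t by move: tT; rewrite in_itv/= => /andP[/ltW].
have := le_trans (Gap_sq_le mw wMu bc M0 bM t0) Q.
by rewrite le_eqVlt ltNge sqr_ge0 orbF sqrf_eq0 => /eqP.
Qed.

Lemma PGap_eq0 t : 0 <= t < T -> PGap T rho b w t = 0.
Proof.
move=> /andP[t0 tT].
transitivity (\int[leb]_(s in `[0, t]) (0 : R)); last by rewrite Rintegral_cst// mul0r.
apply: ae_eq_Rintegral => //.
  by apply: measurable_funTS; exact: (measurable_Gap T0 rho_flat bc mw).
apply: ae_mono (ae_and Gap_eq0 (ae_neq 0)) => s [Gs s0]; rewrite /= in_itv/= => /andP[h1 h2].
by apply: Gs; rewrite in_itv/= lt_neqAle eq_sym s0 h1 (le_lt_trans h2).
Qed.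

(** A nonnegative function of zero integral vanishes almost everywhere. *)
Lemma velocities_agree : {ae leb, forall t, t \in `]0, T[ -> {ae l t, forall x, w t x = b t x}}.
Proof.
apply: ae_mono Gap_eq0 => t G tT; have {}G := G tT.
have [ig _] := gap_integrable bc M0 bM mw wMu t.
have mg : measurable_fun setT (EFin \o gap b w t) by have [] := integrableP _ _ _ ig.
have : (\int[l t]_x `|(EFin \o gap b w t) x| = 0)%E.
  under eq_integral do rewrite gee0_abs ?lee_fin ?gap_ge0//.
  by move: G; rewrite /Gap /Rintegral => G; rewrite -[LHS]fineK ?G//; exact: integrable_fin_num.
move=> /(ae_eq_integral_abs _ measurableT mg); apply: ae_mono => x gx.
have {}gx : gap b w t x = 0 by have := gx I => -[].
apply/rowP => k; apply/eqP; rewrite -subr_eq0 -normr_le0 -gx /gap (bigD1 k)//= lerDl sumr_ge0//.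
Qed.

End vanishing.

Theorem corollary2p8 (R : realType) (d : nat) (T : R) (K : 'rV[R]_d -> R)
    (rho0 : probability 'rV[R]_d R) (u0 : 'rV[R]_d -> 'rV[R]_d)
    (r : R -> probability 'rV[R]_d R) (v : R -> 'rV[R]_d -> 'rV[R]_d)
    (rho : R -> probability 'rV[R]_d R) (u : R -> 'rV[R]_d -> 'rV[R]_d)
    (mu : R -> @mx_charge R d)
    (d_ge1 : (1 <= d)%N) (T_gt0 : 0 < T)
    (K_D2 : twice_differentiable K)
    (K_cont : continuous (hess K))
    (K_bounded : [bounded hess K x | x in setT])
    (K_even : forall x, hess K (- x) = hess K x)
    (K_psd : forall x, pos_semidef (hess K x))
    (K_lip : [lipschitz hess K x | x in setT])
    (rho0_moment : (\int[rho0]_x (normv x ^+ 2)%:E < +oo)%E)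
    (u0_meas : measurable_fun setT u0)
    (u0_L2 : (\int[rho0]_x (normv (u0 x) ^+ 2)%:E < +oo)%E)
    (strong : strong_solution T K rho0 u0 r v)
    (sol : measure_solution T K rho0 u0 rho u mu) :
  [/\ (forall t, t \in `[0, T] -> forall A, measurable A -> rho t A = r t A),
      {ae (@lebesgue_measure R \x @lebesgue_rV R d)%E,
        forall z : R * 'rV[R]_d, z.1 \in `[0, T] -> u z.1 z.2 = v z.1 z.2} &
      {ae @lebesgue_measure R, forall t, t \in `]0, T[ ->
        forall i j A, measurable A -> mu t i j A = 0%E}].
Proof.
have [K0 K00 [KK0 KL]] := hess_bounds K_bounded K_lip.
case: strong => rflat rdens r0 rweak [Dv [vt [vbar [vW vtW vPDE [vbar_cont v_vbar] vb0]]]].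
case: sol => [[rho_flat [mu_ uL2] [_ mupos _] _ _] wcont wmom wen].
have [c0 u0c] : exists c0 : R, (\int[rho0]_x (normv (u0 x) ^+ 2)%:E <= c0%:E)%E.
  exists (fine (\int[rho0]_x (normv (u0 x) ^+ 2)%:E)%E); rewrite fineK// ge0_fin_numE//.
  by apply: integral_ge0 => x _; rewrite lee_fin sqr_ge0.
pose b t x := vbar (clamp T t) x.
have bc : continuous (fun z : R * 'rV[R]_d => b z.1 z.2) := clamped_continuous T_gt0 vbar_cont.
have b_clamp t : b (clamp T t) = b t by rewrite /b clampK.
have [M [f [gt [gD [M0 bM [fg gDM] f_moll f_ae]]]]] :=
  strong_data T_gt0 K_cont K00 KK0 rdens vW vtW vPDE vbar_cont v_vbar.
have vsec := v_clamped_sections rdens v_vbar.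
have mf k : measurable_fun setT (f k) by have [] := fg k.
have fM k w : `|f k w| <= M by have [] := fg k.
have mgt k : measurable_fun setT (gt k) by have [] := fg k.
have gtM k w : `|gt k w| <= M by have [] := fg k.
have mgD k j : measurable_fun setT (gD k j) by have [] := gDM k j.
have gDM' k j w : `|gD k j w| <= M by have [] := gDM k j.
have f_t k e (p : 'rV[R]_d.+1) : 0 < e -> e < p 0 ord0 -> p 0 ord0 + e < T ->
    moll (upd (eta e) ord0 (dbump e)) (f k) p = moll (eta e) (gt k) p.
  by move=> e0 h1 h2; have [] := f_moll k e p e0 h1 h2.
have f_x k e (p : 'rV[R]_d.+1) : 0 < e -> e < p 0 ord0 -> p 0 ord0 + e < T ->
    forall j, moll (upd (eta e) (lift ord0 j) (dbump e)) (f k) p = moll (eta e) (gD k j) p.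
  by move=> e0 h1 h2; have [] := f_moll k e p e0 h1 h2.
(* the forcing of the strong velocity is its alignment with the strong density *)
pose A k t x := alignment K (r (clamp T t)) (b t) x 0 k.
have A_ae : {ae @lebesgue_rV R d.+1, forall w : 'rV[R]_d.+1, w 0 ord0 \in `]0, T[ -> forall k,
    f k w = b (w 0 ord0) (rV_uncons w).2 0 k /\
    gt k w + \sum_j gD k j w * b (w 0 ord0) (rV_uncons w).2 0 j
      + A k (w 0 ord0) (rV_uncons w).2 = 0}.
  apply: ae_mono f_ae => w H wT k; have [h1 h2] := H wT k; split => //.
  by rewrite /A clamp_id//; move: wT; rewrite in_itv/= => /andP[? ?]; rewrite !ltW.
have bL t s x y k : `|b t x 0 k - b s y 0 k| <= @bw_lip_cst R d M * (`|t - s| + `|x - y|).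
  exact: (b_lip T_gt0 bc b_clamp M0 mf fM mgt gtM mgD gDM' f_t f_x A_ae).
have L0 : 0 <= @bw_lip_cst R d M by rewrite mulr_ge0.
have vr : {ae @lebesgue_measure R, forall t, t \in `]0, T[ -> {ae r t, forall x, v t x = b t x}}.
  by apply: ae_mono vsec => t H tT; have [] := H tT.
have mb := transport_by_representative T_gt0 rflat bc vr rweak.
pose LF := Lforce (d := d) K0 M (@bw_lip_cst R d M).
have LF0 : 0 <= LF by exact: Lforce_ge0.
pose Cr := d%:R * (15 / 2 * M).
have Cr0 : 0 <= Cr by rewrite !mulr_ge0.
have AL t s x y k : `|A k t x - A k s y| <= (LF + Cr * LF) * (`|t - s| + `|x - y|).
  have c0' : 0 <= Cr * `|t - s| by rewrite mulr_ge0.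
  have := alignment_diff K00 KK0 KL M0 L0 bM bL (m1 := r (clamp T t)) (m2 := r (clamp T s)) t s x y k c0' _.
  move=> /(_ _)/le_trans; apply.
    move=> g L c Lg0 gL gc.
    have := transport_lipschitz T_gt0 rflat bc M0 bM mb s t Lg0 gL gc.
    by congr (_ <= _); rewrite /Cr; ring.
  rewrite -/LF mulrDl lerD2l.
  by rewrite mulrAC; apply: ler_wpM2l; [exact: mulr_ge0|rewrite lerDl].
pose C0 := 3 * @bw_lip_cst R d M + (5 * (LF + Cr * LF) + 2 * d%:R * (@bw_lip_cst R d M * M)).
have LA0 : 0 <= LF + Cr * LF by rewrite addr_ge0// mulr_ge0.
have C00 : 0 <= C0 by rewrite !addr_ge0// ?mulr_ge0// ?addr_ge0// mulr_ge0.
have approx e : 0 < e -> exists f ft fx, approx_field T b A M C0 e f ft fx.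
  exact: (approx_field_exists T_gt0 bc b_clamp M0 mf fM mgt gtM mgD gDM' f_t f_x A_ae LA0 AL).
have [w [U [Mu [Mu0 mw mU wMu [UE wE]]]]] := clean_velocity T_gt0 rho_flat mu_ uL2.
have weak_w := weak_continuity_clean T_gt0 rho_flat wcont mw mU UE wE.
have TT : 0 <= (0 : R) <= T by rewrite lexx ltW.
have init : lipdist_le (rho (clamp T 0)) (r (clamp T 0)) 0.
  apply: (@initial_lipdist _ _ _ _ rho0); last by move=> B mB; rewrite clamp_id// r0.
  move=> h hx C hC hxC dh ch.
  have ch0 : continuous h.
    by have [[dfh _] _] := C1_of_partials dh ch; move=> x; exact: differentiable_continuous.
  have := weak_w C 0 _ _ _ TT (smooth_space ch0 dh ch) (@static_bounded _ _ T C h hx hC hxC).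
  rewrite set_itv1 Rintegral_set1 => /eqP; rewrite subr_eq0 => /eqP; exact.
have r_est := transport_estimate T_gt0 rflat bc bM mb.
have D := lipdist_gap T_gt0 rho_flat bc M0 bM mw wMu weak_w C00 approx r_est init.
pose CD := expR (d%:R * M * T) * @step_cst R d M C0.
have CD0 : 0 <= CD by rewrite mulr_ge0 ?expR_ge0// step_cst_ge0.
(* rho against r in the alignment force costs the accumulated gap *)
have A_close s x k : 0 <= s < T ->
    `|A k s x - alignment K (rho (clamp T s)) (b s) x 0 k| <= CD * LF * PGap T rho b w s.
  move=> sT; have P0 := PGap_ge0 T rho b w s.
  have := alignment_diff K00 KK0 KL M0 L0 bM bL (m1 := r (clamp T s)) (m2 := rho (clamp T s)) s s x x k
    (mulr_ge0 CD0 P0) _.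
  move=> /(_ _)/le_trans; apply.
    by move=> g L c Lg0 gL gc; rewrite distrC; exact: (D s sT g L c Lg0 gL gc).
  by rewrite !subrr normr0 (normr0 ('rV[R]_d)) addr0 mulr0 add0r mulrAC.
have b0 : {ae rho0, forall x, b 0 x = u0 x}.
  by apply: ae_mono vb0 => x; rewrite /b clamp_id.
have RE := relative_energy T_gt0 K_cont K00 KK0 K_even K_psd rho_flat mw Mu0 wMu wE u0_meas u0c wen
  wmom weak_w bc M0 bM C00 mupos approx (mulr_ge0 CD0 LF0) A_close b0.
have TB := trace_le T_gt0 K_cont KK0 K_psd rho_flat mw Mu0 wMu wE u0_meas u0c wen.
have QB := Qgap_le mw wMu bc M0 bM.
(* the maximum of both quantities lets one step function dominate both *)
pose y t := Num.max (Qgap T rho w b t) (trR (mu t)).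
have y0 : {ae @lebesgue_measure R, forall t, t \in `]0, T[ -> y t <= 0}.
  apply: (@gronwall_steps R y (@relative_cst R d T K0 Mu M C0 (CD * LF))
    (`|2 * d%:R * (1 + d%:R * M ^+ 2) * (1 + Mu)| + `|c0|)).
  - by apply: relative_cst_ge0 => //; exact: mulr_ge0.
  - exact: addr_ge0.
  - apply: ae_mono TB => t tb tT; rewrite /y ge_max; apply/andP; split.
      by apply: le_trans (QB t) _; apply: le_trans (ler_norm _) _; rewrite lerDl.
    by apply: le_trans (tb tT) _; apply: le_trans (ler_norm _) _; rewrite lerDr.
  - apply: ae_mono (ae_and RE mupos) => t [H mp] tT a eta at_ eta0 Hs.
    have Hs' : {ae @lebesgue_measure R, forall s, 0 <= s <= t ->
        Qgap T rho w b s <= step a eta s /\ trR (mu s) <= step a eta s}.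
      by apply: ae_mono Hs => s ys st; have := ys st; rewrite /y ge_max => /andP.
    have B := H tT a eta at_ eta0 Hs'.
    have q0 := Qgap_ge0 T rho w b t; have t0 := trR_ge0 (mp tT).
    by rewrite /y ge_max; apply/andP; split; apply: le_trans B; rewrite ?lerDl ?lerDr.
have Q0 : {ae @lebesgue_measure R, forall t, t \in `]0, T[ -> Qgap T rho w b t <= 0}.
  by apply: ae_mono y0 => t yt tT; have := yt tT; rewrite /y ge_max => /andP[].
have same t : 0 <= t < T -> forall B, measurable B -> rho t B = r t B.
  move=> tT; have := D t tT; rewrite (PGap_eq0 T_gt0 rho_flat mw wMu bc M0 bM Q0 tT) mulr0.
  have tT' : 0 <= t <= T by case/andP: tT => -> /ltW.
  by rewrite !clamp_id// => D0; exact: lipdist0_eq.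
split.
- move=> t; rewrite in_itv/= => /andP[t0]; rewrite le_eqVlt => /orP[/eqP ->|tT].
    exact: (flat_limit_eq T_gt0 rho_flat rflat same).
  by apply: same; rewrite t0.
- have wb : {ae @lebesgue_measure R, forall t, {ae @lebesgue_rV R d, forall x, t \in `]0, T[ -> w t x = b t x}}.
    apply: ae_mono (velocities_agree mw wMu bc M0 bM Q0) => t H.
    have [tT|ntT] := boolP (t \in `]0, T[); last by apply/aeW.
    move: (tT); rewrite in_itv/= => /andP[t0 tT'].
    have tTT : 0 <= t <= T by rewrite !ltW.
    have := H tT; rewrite clamp_id// => /(ae_same_measure (same t _)) => Hr.
    have tT0 : 0 <= t < T by rewrite ltW.
    have tI : t \in `[0, T] by rewrite in_itv.
    by apply: ae_mono (density_ae_converse (rdens t tI) (Hr tT0)) => x ->.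
  (* equality holds for almost every x at almost every t, and Fubini turns this into a
     statement about (t, x) once the set is measurable *)
  pose S : set (R * 'rV[R]_d) := ~` (`]0, T[ `*` setT) `|` [set z | w z.1 z.2 = b z.1 z.2].
  have mS : measurable S.
    apply: measurableU; first by apply: measurableC; exact: measurable_strip.
    have -> : [set z : R * 'rV[R]_d | w z.1 z.2 = b z.1 z.2] =
        \bigcap_(i in [set: 'I_d]) [set z | w z.1 z.2 0 i = b z.1 z.2 0 i].
      apply/seteqP; split=> [z zE i _ /=|z zE]; first by rewrite zE.
      by apply/rowP => i; exact: (zE i).
    apply: fin_bigcap_measurable; first exact: finite_finset.
    move=> i _; pose g (z : R * 'rV[R]_d) := w z.1 z.2 0 i - b z.1 z.2 0 i.
    have mg : measurable_fun setT g.
      apply: measurable_funB; first exact: measurable_rV_coord mw.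
      by apply: measurable_continuous_prod; exact: (@continuous_coord _ _ _ (fun z : R * 'rV[R]_d => b z.1 z.2)).
    rewrite (_ : [set z | _] = setT `&` g @^-1` [set 0]); first by apply: mg.
    rewrite setTI; apply/seteqP; split=> z; rewrite /g /=; first by move=> ->; rewrite subrr.
    by move/eqP; rewrite subr_eq0 => /eqP.
  have HS : {ae (@lebesgue_measure R \x @lebesgue_rV R d)%E, forall z, S z}.
    apply: ae_of_sections => //; apply: ae_mono wb => t; apply: ae_mono => x H.
    have [tT|ntT] := boolP (t \in `]0, T[); first by right; exact: H.
    by left=> -[/= tT _]; move: ntT; rewrite tT.
  have F0 := ae_fst (@lebesgue_rV R d) (ae_and wE (ae_and (ae_neq 0) (ae_neq T))).
  apply: ae_mono (ae_and HS (ae_and F0 v_vbar)) => -[t x] /= [Sz [[wt [t0 tT]] vz]].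
  rewrite in_itv/= => /andP[h0 hT].
  have tin : t \in `]0, T[ by rewrite in_itv/= lt_neqAle eq_sym t0 h0 lt_neqAle tT.
  have tTT : 0 <= t <= T by rewrite h0.
  case: Sz => [nS|]; first by exfalso; apply: nS.
  by rewrite /= wt// => ->; rewrite vz// /b clamp_id.
- apply: ae_mono (ae_and y0 mupos) => t [yt mp] tT; apply: (trace0_null (mp tT)).
  apply/eqP; rewrite eq_le (trR_ge0 (mp tT)) andbT.
  by have := yt tT; rewrite /y ge_max => /andP[].
Qed.
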